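(* (I) For every shrinking $C^*$-algebra $A$, $(\mathfrak Z(A),\theta_A)$ is a solid pointed tower and $J_A\colon A\to C^*_0(\mathfrak Z(A),\theta_A)$, $(J_A(a))(\pi)=\pi(a)$, is a well defined $*$-isomorphism. (II) Conversely, if $(S,\kappa)$ is a solid pointed tower, then $C^*_0(S,\kappa)$ is a shrinking $C^*$-algebra and for every finite-dimensional representation $\pi$ of $C^*_0(S,\kappa)$ there exists a unique point $s\in S$ such that $\pi=\pi_s$, where $\pi_s\colon C^*_0(S,\kappa)\ni u\mapsto u(s)\in M_{d(s)}$. Moreover, the assignment $s\mapsto\pi_s$ correctly defines an isomorphism between the pointed towers $(S,\kappa)$ and $(\mathfrak Z(C^*_0(S,\kappa)),\theta_{C^*_0(S,\kappa)})$.
   Context: Conventions. All topological spaces are Hausdorff; $\mathbb N=\{1,2,\ldots\}$. $M_n$ is the $C^*$-algebra of complex $n\times n$ matrices, $\mathcal U_n$ its unitary group, $I_n$ its unit. For $U\in\mathcal U_n$, $X\in M_n$: $U.X=UXU^{-1}$. For $X\in M_n$, $Y\in M_k$, $X\oplus Y\in M_{n+k}$ is the block-diagonal matrix. An $n$-dimensional representation $\pi$ of a $C^*$-algebra $A$ is a (possibly zero or degenerate) $*$-homomorphism $A\to M_n$; $d(\pi)=n$. Shrinking algebras. A $C^*$-algebra $A$ is shrinking if (SH1) finite-dimensional representations of $A$ separate the points of $A$, and (SH2) whenever $\pi_1,\pi_2,\ldots$ are finite-dimensional irreducible representations of $A$ with $\lim_n d(\pi_n)=\infty$, then $\lim_n\|\pi_n(a)\|=0$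 for all $a\in A$. Towers. A tower is a topological space $T$ with a continuous function $d\colon T\to\mathbb N$, an operation $\oplus\colon T\times T\to T$ and functions $\mathcal U_n\times T_n\ni(U,x)\mapsto U.x\in T$ (where $T_n=d^{-1}(\{n\})$), such that: (T1) $\oplus$ is associative and continuous, and for each $n$ the map $T_n\times T\ni(x,y)\mapsto x\oplus y\in T$ is a closed embedding; (T2) $d(x\oplus y)=d(x)+d(y)$ and $d(U.x)=d(x)$; (T3) each $\mathcal U_n\times T_n\to T_n$ is a continuous group action; (T4) $U.x=x$ if $U\in\mathcal U_{d(x)}$ is a scalar multiple of the unit matrix; (T5) $(U\oplus V).(x\oplus y)=(U.x)\oplus(V.y)$ for $x\in T_n$, $y\in T_k$, $U\in\mathcal U_n$, $V\in\mathcal U_k$; (T6) $U_{d(x),d(y)}.(x\oplus y)=y\oplus x$, where $U_{p,q}\in\mathcal U_{p+q}$ is given by $(w_1,\ldots,w_q,z_1,\ldots,z_p)\cdot U_{p,q}=(z_1,\ldots,z_p,w_1,\ldots,w_q)$ (row vectors). The tower is proper if $d$ is a proper map, i.e. each $T_n$ is compact. Let $T$ be a tower. An element $x$ is reducible if $V.x=a\oplus b$ for some $a,b\in T$, $V\in\mathcal U_{d(x)}$; otherwise it is irreducible. $\operatorname{stab}(x)=\{U\in\mathcal U_{d(x)}: U.x=x\}$. $x\equiv y$ means $U.x=y$ for some $U\in\mathcal U_{d(x)}$; $x\preccurlyeq y$ means that $x\equiv y$ or there are $a,b\in T$ with $x\equiv a$, $y\equiv a\oplus b$; $x\perp y$ ($x,y$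 disjoint) means there is no $a\in T$ with $a\preccurlyeq x$ and $a\preccurlyeq y$. $\operatorname{core}(T)$ is the set of irreducible elements and $\overline{\operatorname{core}}(T)$ is its closure in $T$. A topological space $X$ has property $(\sigma)$ if there are sets $K_1\subset K_2\subset\cdots$ with union $X$, each compact Hausdorff in the subspace topology, such that $B\subset X$ is closed iff $B\cap K_n$ is closed for each $n$. An m-tower is a tower $T$ that has property $(\sigma)$ and satisfies for all $x,y,z\in T$: (mT1) if $z\perp x$ and $z\perp y$, then $z\perp x\oplus y$; (mT2) if $z\oplus x\equiv z\oplus y$, then $x\equiv y$; (mT3) if $x\perp y$, then $\operatorname{stab}(x\oplus y)=\{U\oplus V: U\in\operatorname{stab}(x),\ V\in\operatorname{stab}(y)\}$; (mT4) if $x$ is irreducible and $p=d(x)$, then for each $n>0$ the stabilizer of the $n$-fold sum $x\oplus\cdots\oplus x$ is $\{I_p\otimes U: U\in\mathcal U_n\}$, where $I_p\otimes[u_{jk}]$ is the block matrix $[u_{jk}I_p]$. A pointed tower is a pair $(T,\theta)$ with $T$ a tower and $\theta\in T$, $d(\theta)=1$. An isomorphism of pointed towers $(T,\theta)\to(T',\theta')$ is a homeomorphism $v\colon T\to T'$ with $d(v(x))=d(x)$, $v(U.x)=U.v(x)$, $v(x\oplus y)=v(x)\oplus v(y)$ and $v(\theta)=\theta'$. $C^*(T)$ is the unital $C^*$-algebra (pointwise operations, supremum norm) of all functions $f$ on $T$ with $f(x)\in M_{d(x)}$, $f|_{T_n}\colon T_n\to M_n$ continuous for all $n$, $f(U.x)=U.f(x)$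 for $U\in\mathcal U_{d(x)}$, $f(x\oplus y)=f(x)\oplus f(y)$, and $\|f\|=\sup_{x\in T}\|f(x)\|<\infty$. If $T$ is an m-tower with $\overline{\operatorname{core}}(T)$ locally compact (in particular, if $T$ is a proper m-tower), $C^*_0(T)$ is the algebra of all $f\in C^*(T)$ such that for each $\varepsilon>0$ there is a compact $K\subset\overline{\operatorname{core}}(T)$ with $\|f(t)\|\le\varepsilon$ for all $t\in\overline{\operatorname{core}}(T)\setminus K$; and $C^*_0(T,\theta)=\{f\in C^*_0(T): f(\theta)=0\}$. A pointed tower $(T,\theta)$ is solid if $T$ is a proper m-tower and for every $t\in\operatorname{core}(T)$ different from $\theta$ there is $g\in C^*_0(T,\theta)$ with $g(t)\ne0$. Concrete pointed tower. For a $C^*$-algebra $A$, $\mathfrak Z(A)$ is the topological disjoint union over $n\ge1$ of the spaces of all (possibly zero) $n$-dimensional representations of $A$ with the pointwise convergence topology, with degree $d(\pi)$, $(\pi_1\oplus\pi_2)(a)=\pi_1(a)\oplus\pi_2(a)$, $(U.\pi)(a)=U.\pi(a)$; $\theta_A$ is the zero one-dimensional representation of $A$. *)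

(* Defs.v *)
From HB Require Import structures.
From mathcomp Require Import all_boot all_order all_algebra.
From mathcomp Require Import sesquilinear spectral complex.
From mathcomp Require Import all_classical all_reals topology normedtype.
From mathcomp Require Import ring.

Set Implicit Arguments.
Unset Strict Implicit.
Unset Printing Implicit Defensive.

Import Order.TTheory GRing.Theory Num.Theory.
Import numFieldNormedType.Exports ComplexField.Normc.

Local Open Scope classical_set_scope.
Local Open Scope ring_scope.
Local Open Scope sesquilinear_scope.
Local Open Scope complex_scope.

(* The library gives the usual topology to [R[i]^o] only. *)
HB.instance Definition _ (R : rcfType) := NormedModule.copy R[i] (R[i]^o).
HB.instance Definition _ (R : rcfType) :=
  PseudoPointedMetric.copy R[i] (R[i]^o).

Section OperatorNorm.
Variable R : realType.

Definition l2norm n (v : 'cV[R[i]]_n) : R :=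
  Num.sqrt (\sum_i normc (v i 0) ^+ 2).

(* The C*-norm of the matrix algebra: the operator norm on the Hilbert space of
   column vectors. *)
Definition opnorm n (X : 'M[R[i]]_n) : R :=
  sup [set l2norm (X *m v) | v in [set v | l2norm v <= 1]].

Lemma normc_ge0 (z : R[i]) : 0 <= normc z.
Proof. by case: z => a b; exact: sqrtr_ge0. Qed.

Lemma normc_conj (z : R[i]) : normc (Num.conj z) = normc z.
Proof. by case: z => a b /=; rewrite sqrrN. Qed.

Lemma sqr_normcE (z : R[i]) : z * Num.conj z = (normc z ^+ 2)%:C.
Proof. by rewrite -normCK rmorphXn. Qed.

Lemma normc_sum n (F : 'I_n -> R[i]) : normc (\sum_i F i) <= \sum_i normc (F i).
Proof.
elim/big_rec2: _ => [|i x y _ h]; first by rewrite normc0.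
by rewrite (le_trans (le_normcD _ _))// lerD2l.
Qed.

Lemma cauchy_schwarz n (a b : 'I_n -> R) :
  \sum_i a i * b i <=
    Num.sqrt (\sum_i a i ^+ 2) * Num.sqrt (\sum_i b i ^+ 2).
Proof.
set A := \sum_i a i ^+ 2; set B := \sum_i b i ^+ 2; set c := \sum_i _.
have A0 : 0 <= A by rewrite sumr_ge0// => i _; exact: sqr_ge0.
have B0 : 0 <= B by rewrite sumr_ge0// => i _; exact: sqr_ge0.
have key : 0 <= B * (A * B - c ^+ 2).
  have -> : B * (A * B - c ^+ 2) = \sum_i (B * a i - c * b i) ^+ 2.
    rewrite [RHS](eq_bigr (fun i => B ^+ 2 * a i ^+ 2 -
      2 * B * c * (a i * b i) + c ^+ 2 * b i ^+ 2)); last by move=> i _; ring.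
    by rewrite big_split/= sumrB -!mulr_sumr -/A -/B -/c; ring.
  by apply: sumr_ge0 => i _; exact: sqr_ge0.
have [B_eq0|B_neq0] := eqVneq B 0.
  rewrite B_eq0 sqrtr0 mulr0 /c big1// => i _.
  have : B == 0 by rewrite B_eq0.
  rewrite /B psumr_eq0; last by move=> j _; exact: sqr_ge0.
  move=> /allP/(_ i); rewrite mem_index_enum => /(_ isT)/=.
  by rewrite sqrf_eq0 => /eqP ->; rewrite mulr0.
have B_gt0 : 0 < B by rewrite lt0r B_neq0.
rewrite -sqrtrM// (le_trans (ler_norm c))// -sqrtr_sqr ler_sqrt ?mulr_ge0//.
by rewrite -subr_ge0 -(pmulr_rge0 _ B_gt0).
Qed.

Lemma l2norm_ge0 n (v : 'cV[R[i]]_n) : 0 <= l2norm v.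
Proof. exact: sqrtr_ge0. Qed.

Lemma l2norm_sqr n (v : 'cV[R[i]]_n) :
  l2norm v ^+ 2 = \sum_i normc (v i 0) ^+ 2.
Proof. by rewrite sqr_sqrtr// sumr_ge0// => i _; rewrite sqr_ge0. Qed.

Lemma l2norm0 n : l2norm (0 : 'cV[R[i]]_n) = 0.
Proof.
by rewrite /l2norm big1 ?sqrtr0// => i _; rewrite mxE normc0 expr0n.
Qed.

Lemma l2norm_eq0 n (v : 'cV[R[i]]_n) : l2norm v = 0 -> v = 0.
Proof.
move=> v0; apply/colP => i; rewrite mxE.
have /eqP : \sum_i normc (v i 0) ^+ 2 = 0 by rewrite -l2norm_sqr v0 expr0n.
rewrite psumr_eq0; last by move=> j _; exact: sqr_ge0.
move=> /allP/(_ i); rewrite mem_index_enum => /(_ isT)/=.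
by rewrite sqrf_eq0 => /eqP/eq0_normc.
Qed.

Lemma l2normZ n c (v : 'cV[R[i]]_n) : l2norm (c *: v) = normc c * l2norm v.
Proof.
rewrite /l2norm -[in RHS](ger0_norm (normc_ge0 c)) -sqrtr_sqr.
rewrite -sqrtrM ?sqr_ge0// mulr_sumr; congr Num.sqrt.
by apply: eq_bigr => i _; rewrite mxE normcM exprMn.
Qed.

Lemma l2normD n (u v : 'cV[R[i]]_n) : l2norm (u + v) <= l2norm u + l2norm v.
Proof.
rewrite -(@ler_pXn2r _ 2)// ?nnegrE ?addr_ge0 ?l2norm_ge0//.
rewrite sqrrD !l2norm_sqr.
apply: (@le_trans _ _ (\sum_i (normc (u i 0) + normc (v i 0)) ^+ 2)).
  apply: ler_sum => i _; rewrite mxE ler_pXn2r// ?nnegrE ?addr_ge0 ?normc_ge0//.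
  exact: le_normcD.
under eq_bigr do rewrite sqrrD; rewrite !big_split/= lerD2r lerD2l.
by rewrite mulr2n lerD//; exact: cauchy_schwarz.
Qed.

Lemma l2norm_sum n m (F : 'I_m -> 'cV[R[i]]_n) :
  l2norm (\sum_i F i) <= \sum_i l2norm (F i).
Proof.
elim/big_rec2: _ => [|i x y _ h]; first by rewrite l2norm0.
by rewrite (le_trans (l2normD _ _))// lerD2l.
Qed.

Lemma normc_le_l2norm n (v : 'cV[R[i]]_n) i : normc (v i 0) <= l2norm v.
Proof.
rewrite -(@ler_pXn2r _ 2)// ?nnegrE ?normc_ge0 ?l2norm_ge0//.
rewrite l2norm_sqr (bigD1 i)//= lerDl sumr_ge0// => j _; exact: sqr_ge0.
Qed.

Let image_ball n (X : 'M[R[i]]_n) :=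
  [set l2norm (X *m v) | v in [set v | l2norm v <= 1]].

Let image_ball0 n (X : 'M[R[i]]_n) : image_ball X 0.
Proof. by exists 0; rewrite /= ?mulmx0 l2norm0. Qed.

Let image_ball_ubound n (X : 'M[R[i]]_n) : has_ubound (image_ball X).
Proof.
exists (\sum_j l2norm (col j X)) => _ [v v1 <-].
have -> : X *m v = \sum_j v j 0 *: col j X.
  apply/colP => i; rewrite mxE summxE; apply: eq_bigr => j _.
  by rewrite !mxE mulrC.
rewrite (le_trans (l2norm_sum _))// ler_sum// => j _.
by rewrite l2normZ ler_piMl ?l2norm_ge0// (le_trans (normc_le_l2norm _ _)).
Qed.

Lemma opnorm_ge0 n (X : 'M[R[i]]_n) : 0 <= opnorm X.
Proof. exact: ub_le_sup (image_ball_ubound X) _ (image_ball0 X). Qed.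

Lemma opnorm_le n (X : 'M[R[i]]_n) c :
  (forall v, l2norm v <= 1 -> l2norm (X *m v) <= c) -> opnorm X <= c.
Proof.
move=> h; apply: ge_sup; first by exists 0; exact: image_ball0.
by move=> _ [v v1 <-]; exact: h.
Qed.

Lemma l2norm_mulmx n (X : 'M[R[i]]_n) v :
  l2norm (X *m v) <= opnorm X * l2norm v.
Proof.
have [v0|v_neq0] := eqVneq (l2norm v) 0.
  by rewrite (l2norm_eq0 v0) mulmx0 l2norm0 mulr0.
have v_gt0 : 0 < l2norm v by rewrite lt0r v_neq0 l2norm_ge0.
have normv : normc ((l2norm v)^-1)%:C = (l2norm v)^-1.
  by rewrite /= expr0n/= addr0 sqrtr_sqr ger0_norm// invr_ge0 ltW.
rewrite -ler_pdivrMr// mulrC -normv -l2normZ scalemxAr.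
apply: ub_le_sup; first exact: image_ball_ubound.
by exists (((l2norm v)^-1)%:C *: v) => //=; rewrite l2normZ normv mulVf.
Qed.

Lemma opnorm0 n : opnorm (0 : 'M[R[i]]_n) = 0.
Proof.
apply/eqP; rewrite eq_le opnorm_ge0 andbT.
by apply: opnorm_le => v _; rewrite mul0mx l2norm0.
Qed.

Lemma opnormD n (X Y : 'M[R[i]]_n) : opnorm (X + Y) <= opnorm X + opnorm Y.
Proof.
apply: opnorm_le => v v1; rewrite mulmxDl (le_trans (l2normD _ _))// lerD//;
by rewrite (le_trans (l2norm_mulmx _ _))// ler_piMr ?opnorm_ge0.
Qed.

Lemma opnormM n (X Y : 'M[R[i]]_n) : opnorm (X *m Y) <= opnorm X * opnorm Y.
Proof.
apply: opnorm_le => v v1; rewrite -mulmxA (le_trans (l2norm_mulmx _ _))//.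
rewrite ler_wpM2l ?opnorm_ge0// (le_trans (l2norm_mulmx _ _))//.
by rewrite ler_piMr ?opnorm_ge0.
Qed.

Let opnormZ_le n c (X : 'M[R[i]]_n) : opnorm (c *: X) <= normc c * opnorm X.
Proof.
apply: opnorm_le => v v1; rewrite -scalemxAl l2normZ.
rewrite ler_wpM2l ?normc_ge0// (le_trans (l2norm_mulmx _ _))//.
by rewrite ler_piMr ?opnorm_ge0.
Qed.

Lemma opnormZ n c (X : 'M[R[i]]_n) : opnorm (c *: X) = normc c * opnorm X.
Proof.
have [->|c0] := eqVneq c 0; first by rewrite scale0r opnorm0 normc0 mul0r.
have nc : 0 < normc c.
  by rewrite lt0r normc_ge0 andbT; apply: contra_neq c0 => /eq0_normc.
apply/eqP; rewrite eq_le opnormZ_le/= mulrC -ler_pdivlMr//.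
by rewrite -{1}(scalerK c0 X) (le_trans (opnormZ_le _ _))// normcV mulrC.
Qed.

Lemma opnorm_eq0 n (X : 'M[R[i]]_n) : opnorm X = 0 -> X = 0.
Proof.
move=> X0; apply/matrixP => i j; rewrite mxE.
have /l2norm_eq0 : l2norm (X *m delta_mx j 0) = 0.
  apply/eqP; rewrite eq_le l2norm_ge0 andbT.
  by rewrite (le_trans (l2norm_mulmx _ _))// X0 mul0r.
by rewrite -colE => /colP/(_ i); rewrite !mxE.
Qed.

Lemma opnorm_adj_le n (X : 'M[R[i]]_n) : opnorm (X ^t*) <= opnorm X.
Proof.
apply: opnorm_le => v v1; set w := X ^t* *m v.
have [->|w0] := eqVneq (l2norm w) 0; first exact: opnorm_ge0.
have w_gt0 : 0 < l2norm w by rewrite lt0r w0 l2norm_ge0.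
rewrite -(ler_pM2r w_gt0) -expr2.
have -> : l2norm w ^+ 2 = normc (\sum_i (X *m w) i 0 * Num.conj (v i 0)).
  transitivity (normc (\sum_i w i 0 * Num.conj (w i 0))).
    under eq_bigr do rewrite sqr_normcE.
    rewrite -rmorph_sum -l2norm_sqr /= expr0n/= addr0 sqrtr_sqr.
    by rewrite ger0_norm// sqr_ge0.
  congr normc.
  under eq_bigr do rewrite {2}/w mxE rmorph_sum mulr_sumr.
  under [RHS]eq_bigr do rewrite mxE mulr_suml.
  rewrite exchange_big/=; apply: eq_bigr => i _; apply: eq_bigr => j _.
  by rewrite !mxE rmorphM/= conjCK mulrA (mulrC (X i j)).
rewrite (le_trans (normc_sum _))//.
under eq_bigr do rewrite normcM normc_conj.
rewrite (le_trans (cauchy_schwarz _ _))// -/(l2norm _) -/(l2norm _).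
rewrite (le_trans _ (l2norm_mulmx _ _))// ler_piMr ?l2norm_ge0//.
Qed.

End OperatorNorm.

Section NumFieldContinuity.
Variables (K : numClosedFieldType) (X : topologicalType).

Let continuous_add (f g : X -> K) :
  continuous f -> continuous g -> continuous (fun x => f x + g x).
Proof. by move=> cf cg x; apply: cvgD; [exact: cf|exact: cg]. Qed.

Let continuous_mul (f g : X -> K) :
  continuous f -> continuous g -> continuous (fun x => f x * g x).
Proof. by move=> cf cg x; apply: cvgM; [exact: cf|exact: cg]. Qed.

Lemma continuous_linear_entry (c : K) (f g : X -> K) :
  continuous f -> continuous g -> continuous (fun x => c * f x + g x).
Proof.
move=> cf cg; apply: continuous_add => //; apply: continuous_mul => //.
exact: cst_continuous.
Qed.

Lemma continuous_dot n (f g : 'I_n -> X -> K) :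
  (forall i, continuous (f i)) -> (forall i, continuous (g i)) ->
  continuous (fun x => \sum_i f i x * g i x).
Proof.
move=> cf cg; rewrite /index_enum; elim: (Finite.enum _) => [|i s IHs].
  under eq_fun do rewrite big_nil; exact: cst_continuous.
by under eq_fun do rewrite big_cons; apply: continuous_add => //; exact: continuous_mul.
Qed.

Lemma continuous_conj (f : X -> K) :
  continuous f -> continuous (fun x => Num.conj (f x)).
Proof.
move=> cf x; apply/cvgrPdist_lt => e e0.
have /cvgrPdist_lt/(_ e e0) := cf x.
by apply: filterS => y; rewrite -rmorphB norm_conjC.
Qed.

End NumFieldContinuity.

Lemma continuous_mxP (K X : topologicalType) m n (f : X -> 'M[K]_(m, n)) :
  continuous f <-> forall i j, continuous (fun x => f x i j).
Proof.
split=> [cf i j x A fxA|cf x A].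
  apply: (cf x [set M : 'M[K]_(m, n) | A (M i j)]).
  exists (fun i' j' => if (i' == i) && (j' == j) then A else setT).
    move=> i' j'; case: ifPn => [/andP[/eqP-> /eqP->]//|_]; exact: filterT.
  by move=> M /(_ i j); rewrite !eqxx.
move=> [P fxP PA]; rewrite nbhs_simpl/=.
have : \forall y \near x, forall i j, P i j (f y i j).
  apply: filter_forall => i; apply: filter_forall => j.
  exact: (cf i j x _ (fxP i j)).
by apply: filterS => y yP; exact: PA.
Qed.

Section MatrixContinuity.
Variables (R : realType) (X : topologicalType) (n : nat).
Implicit Types f g : X -> 'M[R[i]]_n.

Lemma continuous_mx_linear c f g :
  continuous f -> continuous g -> continuous (fun x => c *: f x + g x).
Proof.
move=> /continuous_mxP cf /continuous_mxP cg; apply/continuous_mxP => i j.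
under eq_fun do rewrite !mxE.
exact: (@continuous_linear_entry R[i] X c).
Qed.

Lemma continuous_mx_mul f g :
  continuous f -> continuous g -> continuous (fun x => f x *m g x).
Proof.
move=> /continuous_mxP cf /continuous_mxP cg; apply/continuous_mxP => i j.
under eq_fun do rewrite mxE.
exact: (@continuous_dot R[i] X n (fun k x => f x i k) (fun k x => g x k j)).
Qed.

Lemma continuous_mx_adj f : continuous f -> continuous (fun x => (f x) ^t*).
Proof.
move=> /continuous_mxP cf; apply/continuous_mxP => i j.
under eq_fun do rewrite !mxE.
exact: (@continuous_conj R[i] X (fun x => f x j i)).
Qed.

End MatrixContinuity.

Section StarAlgebras.
Variable R : realType.

(* A normed space with a product and an involution; the C*-algebra axioms are
   in [is_cstar_algebra].  Algebras need not be unital and may be zero. *)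
Record starAlgData := StarAlgData {
  sa_sort :> normedModType R[i];
  sa_mul : sa_sort -> sa_sort -> sa_sort;
  sa_adj : sa_sort -> sa_sort }.

Record is_cstar_algebra (A : starAlgData) : Prop := IsCstarAlgebra {
  cstar_complete : forall F : set_system A,
    ProperFilter F -> cauchy F -> cvg F;
  cstar_mulA : associative (@sa_mul A);
  cstar_mulDl : left_distributive (@sa_mul A) +%R;
  cstar_mulDr : right_distributive (@sa_mul A) +%R;
  cstar_mulZl : forall (c : R[i]) (a b : A),
    sa_mul (c *: a) b = c *: sa_mul a b;
  cstar_mulZr : forall (c : R[i]) (a b : A),
    sa_mul a (c *: b) = c *: sa_mul a b;
  cstar_adjD : {morph @sa_adj A : a b / a + b};
  cstar_adjZ : forall (c : R[i]) (a : A),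
    sa_adj (c *: a) = Num.conj c *: sa_adj a;
  cstar_adjM : forall a b : A, sa_adj (sa_mul a b) = sa_mul (sa_adj b) (sa_adj a);
  cstar_adjK : involutive (@sa_adj A);
  cstar_normM : forall a b : A, `|sa_mul a b| <= `|a| * `|b|;
  cstar_norm : forall a : A, `|sa_mul (sa_adj a) a| = `|a| ^+ 2 }.

Definition star_isomorphism (A B : starAlgData) (J : A -> B) : Prop :=
  [/\ linear J,
      forall a b, J (sa_mul a b) = sa_mul (J a) (J b),
      forall a, J (sa_adj a) = sa_adj (J a)
    & bijective J].

(* Not required to be nonzero or nondegenerate. *)
Record is_rep (A : starAlgData) n (pi : A -> 'M[R[i]]_n) : Prop := IsRep {
  rep_linear : linear pi;
  rep_mul : forall a b, pi (sa_mul a b) = pi a *m pi b;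
  rep_adj : forall a, pi (sa_adj a) = (pi a) ^t* }.

(* The function type carries the topology of pointwise convergence, and [reps A n]
   used as a type carries the subspace topology. *)
Definition reps (A : starAlgData) n : set {ptws A -> 'M[R[i]]_n} :=
  [set pi | is_rep pi].
Arguments reps : clear implicits.

Definition posnat := {n : nat | (0 < n)%N}.

(* Topologized by the library as a disjoint union. *)
Definition fdrep (A : starAlgData) := {n : posnat & reps A (val n)}.

Definition mk_fdrep (A : starAlgData) n (n_gt0 : (0 < n)%N)
    (pi : A -> 'M[R[i]]_n) (pi_rep : is_rep pi) : fdrep A :=
  existT (fun n : posnat => reps A (val n)) (exist _ n n_gt0)
    (exist _ (pi : {ptws A -> 'M[R[i]]_n}) (mem_set pi_rep)).

Definition rep_deg (A : starAlgData) (p : fdrep A) : nat := val (projT1 p).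

Lemma rep_deg_gt0 (A : starAlgData) (p : fdrep A) : (0 < rep_deg p)%N.
Proof. exact: valP. Qed.

Definition rep_fun (A : starAlgData) (p : fdrep A) : A -> 'M[R[i]]_(rep_deg p) :=
  val (projT2 p).

Lemma rep_funP (A : starAlgData) (p : fdrep A) : is_rep (rep_fun p).
Proof. exact: set_mem (valP (projT2 p)). Qed.

(* The rows of [W] are the transposes of column vectors spanning a subspace, so
   that [stablemx W X^T] means that this subspace is invariant under [X]. *)
Definition irreducible_rep (A : starAlgData) (p : fdrep A) : Prop :=
  (exists a, rep_fun p a != 0) /\
  forall W : 'M[R[i]]_(rep_deg p),
    (forall a, stablemx W (rep_fun p a)^T) -> W = 0 \/ row_full W.

Record is_shrinking (A : starAlgData) : Prop := IsShrinking {
  sh_separates : forall a b : A, a <> b ->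
    exists p : fdrep A, rep_fun p a <> rep_fun p b;
  sh_vanish : forall p : nat -> fdrep A,
    (forall k, irreducible_rep (p k)) ->
    (fun k => rep_deg (p k)) @ \oo --> \oo ->
    forall a : A, (fun k => opnorm (rep_fun (p k) a)) @ \oo --> (0 : R) }.

End StarAlgebras.

Section Towers.
Variable R : realType.

Definition unitary_group n : set 'M[R[i]]_n := [set U | U \is unitarymx].
Arguments unitary_group : clear implicits.

Definition dsum_mx m n (X : 'M[R[i]]_m) (Y : 'M[R[i]]_n) : 'M[R[i]]_(m + n) :=
  block_mx X 0 0 Y.

Definition swap_mx p q : 'M[R[i]]_(p + q) :=
  castmx (addnC q p, erefl) (block_mx 0 1%:M 1%:M 0 : 'M[R[i]]_(q + p, p + q)).

Lemma swap_mxE p q (w : 'rV[R[i]]_q) (z : 'rV[R[i]]_p) :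
  castmx (erefl, addnC q p) (row_mx w z) *m swap_mx p q = row_mx z w.
Proof.
transitivity (row_mx w z *m
  (block_mx 0 1%:M 1%:M 0 : 'M[R[i]]_(q + p, p + q))); last first.
  by rewrite mul_row_block !mulmx0 !mulmx1 add0r addr0.
rewrite /swap_mx; move: (row_mx w z) (block_mx _ _ _ _) => r M.
by move: (addnC q p) r M => e; case: _ / e => r M; rewrite !castmx_id.
Qed.

(* The second clause says that the topology of [X] is induced by [f]; it includes
   the continuity of [f]. *)
Definition closed_embedding (X Y : topologicalType) (f : X -> Y) : Prop :=
  [/\ injective f,
      forall A : set X, open A <-> exists2 B : set Y, open B & A = f @^-1` B
    & closed (range f)].

Definition homeomorphism (X Y : topologicalType) (f : X -> Y) : Prop :=
  continuous f /\ exists g : Y -> X, [/\ continuous g, cancel f g & cancel g f].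

(* [act U x] is the action U.x when the size of [U] is (propositionally) [deg x]
   and [U] is unitary; its other values are irrelevant, and no axiom or notion
   below depends on them. *)
Record towerData := TowerData {
  tw_sort :> topologicalType;
  deg : tw_sort -> nat;
  deg_gt0 : forall x, (0 < deg x)%N;
  oplus : tw_sort -> tw_sort -> tw_sort;
  act : forall n, 'M[R[i]]_n -> tw_sort -> tw_sort }.

Definition layer (T : towerData) n : set T := [set x | deg x = n].
Arguments layer : clear implicits.

Record is_tower (T : towerData) : Prop := IsTower {
  tower_hausdorff : hausdorff_space T;
  deg_continuous : continuous (@deg T);
  oplusA : associative (@oplus T);
  oplus_continuous : continuous (fun p : T * T => oplus p.1 p.2);
  oplus_closed_embedding : forall n,
    closed_embedding (fun p : layer T n * T => oplus (val p.1) p.2);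
  deg_oplus : forall x y : T, deg (oplus x y) = (deg x + deg y)%N;
  deg_act : forall (x : T) (U : 'M[R[i]]_(deg x)),
    U \is unitarymx -> deg (act U x) = deg x;
  act_continuous : forall n, continuous
    (fun p : unitary_group n * layer T n => act (val p.1) (val p.2));
  act1 : forall x : T, act (1%:M : 'M[R[i]]_(deg x)) x = x;
  actM : forall (x : T) (U V : 'M[R[i]]_(deg x)),
    U \is unitarymx -> V \is unitarymx -> act (U *m V) x = act U (act V x);
  act_scalar : forall (x : T) (c : R[i]),
    (c%:M : 'M[R[i]]_(deg x)) \is unitarymx ->
    act (c%:M : 'M[R[i]]_(deg x)) x = x;
  act_oplus : forall (x y : T) (U : 'M[R[i]]_(deg x)) (V : 'M[R[i]]_(deg y)),
    U \is unitarymx -> V \is unitarymx ->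
    act (dsum_mx U V) (oplus x y) = oplus (act U x) (act V y);
  act_swap : forall x y : T,
    act (swap_mx (deg x) (deg y)) (oplus x y) = oplus y x }.

Definition proper_tower (T : towerData) : Prop := forall n, compact (layer T n).

Section TowerNotions.
Variable T : towerData.
Implicit Types x y : T.

Definition reducible x : Prop :=
  exists V : 'M[R[i]]_(deg x), V \is unitarymx /\
  exists a b : T, act V x = oplus a b.

Definition core : set T := [set x | ~ reducible x].

(* To be used with n = deg x only, an equation that need not be definitional. *)
Definition stab n x : set 'M[R[i]]_n :=
  [set U | U \is unitarymx /\ act U x = x].

Definition tequiv x y : Prop :=
  exists U : 'M[R[i]]_(deg x), U \is unitarymx /\ act U x = y.

(* [tsub a x] is the relation a \preccurlyeq x. *)
Definition tsub x y : Prop :=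
  tequiv x y \/ exists a b : T, tequiv x a /\ tequiv y (oplus a b).

Definition tdisjoint x y : Prop := ~ exists a : T, tsub a x /\ tsub a y.

(* The n-fold sum of x, for 0 < n. *)
Definition nfold x n : T := iter n.-1 (oplus x) x.

End TowerNotions.
Arguments core : clear implicits.
Arguments stab {T} n x.

Definition sigma_property (X : topologicalType) : Prop :=
  exists K : nat -> set X,
    [/\ forall n, K n `<=` K n.+1,
        \bigcup_n K n = setT,
        forall n, compact (K n) /\ hausdorff_space (K n)
      & forall B : set X, closed B <-> forall n, closed (B `&` K n)].

Record is_mtower (T : towerData) : Prop := IsMtower {
  mtower_tower : is_tower T;
  mtower_sigma : sigma_property T;
  mtower_disjoint : forall x y z : T,
    tdisjoint z x -> tdisjoint z y -> tdisjoint z (oplus x y);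
  mtower_cancel : forall x y z : T,
    tequiv (oplus z x) (oplus z y) -> tequiv x y;
  mtower_stab : forall x y : T, tdisjoint x y ->
    stab (deg x + deg y) (oplus x y) =
    [set W | exists U V, [/\ stab (deg x) x U, stab (deg y) y V
                           & W = dsum_mx U V]];
  (* the block matrix [u_jk I_p], i.e. I_p \otimes U, with p = deg x *)
  mtower_stab_nfold : forall (x : T) n, core T x -> (0 < n)%N ->
    stab (\sum_(i < n) deg x) (nfold x n) =
    [set \mxblock_(i < n, j < n) ((U i j)%:M : 'M[R[i]]_(deg x))
      | U in unitary_group n] }.

Record pointed_iso (S T : towerData) (s0 : S) (t0 : T) (v : S -> T) : Prop :=
  PointedIso {
  piso_homeo : homeomorphism v;
  piso_deg : forall x, deg (v x) = deg x;
  piso_act : forall x (U : 'M[R[i]]_(deg x)),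
    U \is unitarymx -> v (act U x) = act U (v x);
  piso_oplus : forall x y, v (oplus x y) = oplus (v x) (v y);
  piso_point : v s0 = t0 }.

End Towers.

Arguments unitary_group : clear implicits.
Arguments layer {R} T n.
Arguments core {R} T.
Arguments stab {R} T n x.

Section ConformMx.
Variables (R : realType) (m n : nat).
Implicit Types X Y : 'M[R[i]]_m.

Lemma conform_mx_linear c X Y :
  conform_mx (0 : 'M[R[i]]_n) (c *: X + Y) =
  c *: conform_mx (0 : 'M[R[i]]_n) X + conform_mx (0 : 'M[R[i]]_n) Y.
Proof.
have [e|ne] := eqVneq m n; last by rewrite !nonconform_mx ?ne// scaler0 addr0.
by case: _ / e; rewrite !conform_mx_id.
Qed.

Lemma conform_mx_mul X Y :
  conform_mx (0 : 'M[R[i]]_n) (X *m Y) =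
  conform_mx (0 : 'M[R[i]]_n) X *m conform_mx (0 : 'M[R[i]]_n) Y.
Proof.
have [e|ne] := eqVneq m n; last by rewrite !nonconform_mx ?ne// mulmx0.
by case: _ / e; rewrite !conform_mx_id.
Qed.

Lemma conform_mx_adj X :
  conform_mx (0 : 'M[R[i]]_n) (X ^t*) = (conform_mx (0 : 'M[R[i]]_n) X) ^t*.
Proof.
have [e|ne] := eqVneq m n.
  by case: _ / e; rewrite !conform_mx_id.
by rewrite !nonconform_mx ?ne// trmx0 map_mx0.
Qed.

Lemma dsum_mx_linear c X1 Y1 (X2 Y2 : 'M[R[i]]_n) :
  dsum_mx (c *: X1 + Y1) (c *: X2 + Y2) = c *: dsum_mx X1 X2 + dsum_mx Y1 Y2.
Proof.
by rewrite /dsum_mx scale_block_mx add_block_mx !scaler0 !addr0.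
Qed.

Lemma dsum_mx_mul X1 Y1 (X2 Y2 : 'M[R[i]]_n) :
  dsum_mx (X1 *m Y1) (X2 *m Y2) = dsum_mx X1 X2 *m dsum_mx Y1 Y2.
Proof.
by rewrite /dsum_mx mulmx_block !mulmx0 !mul0mx !addr0 add0r.
Qed.

Lemma dsum_mx_adj X (Y : 'M[R[i]]_n) : dsum_mx (X ^t*) (Y ^t*) = (dsum_mx X Y) ^t*.
Proof. by rewrite /dsum_mx tr_block_mx map_block_mx !trmx0 !map_mx0. Qed.

End ConformMx.

Section FunctionAlgebras.
Variables (R : realType) (T : towerData R).

Definition tfun := forall x : T, 'M[R[i]]_(deg x).

HB.instance Definition _ := gen_eqMixin tfun.
HB.instance Definition _ := gen_choiceMixin tfun.

Definition tfun_zero : tfun := fun=> 0.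
Definition tfun_opp (f : tfun) : tfun := fun x => - f x.
Definition tfun_add (f g : tfun) : tfun := fun x => f x + g x.
Definition tfun_scale (c : R[i]) (f : tfun) : tfun := fun x => c *: f x.
Definition tfun_mul (f g : tfun) : tfun := fun x => f x *m g x.
Definition tfun_adj (f : tfun) : tfun := fun x => (f x) ^t*.

Lemma tfun_addA : associative tfun_add.
Proof. by move=> f g h; apply: functional_extensionality_dep => x; exact: addrA. Qed.
Lemma tfun_addC : commutative tfun_add.
Proof. by move=> f g; apply: functional_extensionality_dep => x; exact: addrC. Qed.
Lemma tfun_add0 : left_id tfun_zero tfun_add.
Proof. by move=> f; apply: functional_extensionality_dep => x; exact: add0r. Qed.
Lemma tfun_addN : left_inverse tfun_zero tfun_opp tfun_add.
Proof. by move=> f; apply: functional_extensionality_dep => x; exact: addNr. Qed.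

HB.instance Definition _ :=
  GRing.isZmodule.Build tfun tfun_addA tfun_addC tfun_add0 tfun_addN.

Lemma tfun_scaleA a b f :
  tfun_scale a (tfun_scale b f) = tfun_scale (a * b) f.
Proof. by apply: functional_extensionality_dep => x; exact: scalerA. Qed.
Lemma tfun_scale1 : left_id 1 tfun_scale.
Proof. by move=> f; apply: functional_extensionality_dep => x; exact: scale1r. Qed.
Lemma tfun_scaleDr : right_distributive tfun_scale +%R.
Proof. by move=> a f g; apply: functional_extensionality_dep => x; exact: scalerDr. Qed.
Lemma tfun_scaleDl f : {morph tfun_scale^~ f : a b / a + b}.
Proof. by move=> a b; apply: functional_extensionality_dep => x; exact: scalerDl. Qed.

HB.instance Definition _ := GRing.Zmodule_isLmodule.Build R[i] tfun
  tfun_scaleA tfun_scale1 tfun_scaleDr tfun_scaleDl.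

Implicit Types f g : tfun.

(* [conform_mx 0 M : 'M_n] is [M : 'M_m] transported along m = n whenever this
   equation holds. In every clause it does hold, by [x \in layer T n], [deg_act]
   and [deg_oplus] respectively. *)
Record in_Cstar f : Prop := InCstar {
  Cstar_continuous : forall n, continuous
    (fun x : layer T n => conform_mx (0 : 'M[R[i]]_n) (f (val x)));
  Cstar_act : forall (x : T) (U : 'M[R[i]]_(deg x)), U \is unitarymx ->
    conform_mx (0 : 'M[R[i]]_(deg x)) (f (act U x)) = U *m f x *m invmx U;
  Cstar_oplus : forall x y : T,
    conform_mx (0 : 'M[R[i]]_(deg x + deg y)) (f (oplus x y)) =
    dsum_mx (f x) (f y);
  Cstar_bounded : has_ubound (range (fun x : T => opnorm (f x))) }.

Definition supnorm f : R := sup (range (fun x : T => opnorm (f x))).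

Definition vanishing f : Prop := forall e : R, 0 < e ->
  exists K : set T, [/\ compact K, K `<=` closure (core T)
    & forall t, (closure (core T) `\` K) t -> opnorm (f t) <= e].

Definition in_C0 (theta : T) f : Prop :=
  [/\ in_Cstar f, vanishing f & f theta = 0].

Lemma in_Cstar0 : in_Cstar 0.
Proof.
have z (m n : nat) : conform_mx (0 : 'M[R[i]]_n) (0 : 'M[R[i]]_m) = 0.
  have [e|ne] := eqVneq m n; last by rewrite nonconform_mx ?ne.
  by case: _ / e; rewrite conform_mx_id.
split=> [n|x U _|x y|].
- by under eq_fun do rewrite z; exact: cst_continuous.
- by rewrite z mulmx0 mul0mx.
- by rewrite z /dsum_mx block_mx0.
- by exists 0 => _ [x _ <-]; rewrite opnorm0.
Qed.

Lemma in_Cstar_linear c f g : in_Cstar f -> in_Cstar g -> in_Cstar (c *: f + g).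
Proof.
move=> [cf af of_ [Mf bf]] [cg ag og [Mg bg]].
have E x : (c *: f + g) x = c *: f x + g x by [].
split=> [n|x U Uu|x y|].
- under eq_fun do rewrite E conform_mx_linear.
  exact: continuous_mx_linear (cf n) (cg n).
- rewrite !E conform_mx_linear af// ag// mulmxDr mulmxDl.
  by rewrite -scalemxAr -scalemxAl.
- by rewrite !E conform_mx_linear of_ og dsum_mx_linear.
- exists (normc c * Mf + Mg) => _ [x _ <-]; rewrite E.
  rewrite (le_trans (opnormD _ _))// opnormZ lerD//; last by apply: bg; exists x.
  by rewrite ler_wpM2l ?normc_ge0//; apply: bf; exists x.
Qed.

Lemma in_Cstar_mul f g : in_Cstar f -> in_Cstar g -> in_Cstar (tfun_mul f g).
Proof.
move=> [cf af of_ [Mf bf]] [cg ag og [Mg bg]].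
split=> [n|x U Uu|x y|].
- under eq_fun do rewrite conform_mx_mul.
  exact: continuous_mx_mul (cf n) (cg n).
- rewrite conform_mx_mul af// ag// !mulmxA mulmxKV//.
  exact: unitarymx_unit.
- by rewrite conform_mx_mul of_ og dsum_mx_mul.
- exists (Mf * Mg) => _ [x _ <-].
  rewrite (le_trans (opnormM _ _))// ler_pM ?opnorm_ge0//.
    by apply: bf; exists x.
  by apply: bg; exists x.
Qed.

Lemma in_Cstar_adj f : in_Cstar f -> in_Cstar (tfun_adj f).
Proof.
move=> [cf af of_ [Mf bf]].
split=> [n|x U Uu|x y|].
- under eq_fun do rewrite conform_mx_adj.
  exact: continuous_mx_adj (cf n).
- rewrite conform_mx_adj af// invmx_unitary// /tfun_adj.
  by rewrite !trmx_mul !map_mxM trmxCK mulmxA.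
- by rewrite conform_mx_adj of_ dsum_mx_adj.
- exists Mf => _ [x _ <-].
  by rewrite (le_trans (opnorm_adj_le _))//; apply: bf; exists x.
Qed.

Lemma vanishing0 : vanishing 0.
Proof.
move=> e e0; exists set0; split=> [||t _]; first exact: compact0.
  exact: sub0set.
by rewrite opnorm0 ltW.
Qed.

Lemma vanishing_linear c f g :
  vanishing f -> vanishing g -> vanishing (c *: f + g).
Proof.
move=> vf vg e e0.
have c1 : 0 < normc c + 1 by rewrite ltr_wpDl ?normc_ge0.
have [|K [Kc Ks Kf]] := vf (e / 2 / (normc c + 1)); first by rewrite !divr_gt0.
have [|L [Lc Ls Lg]] := vg (e / 2); first by rewrite divr_gt0.
exists (K `|` L); split; first exact: compactU.
  by rewrite subUset.
move=> t [tc]; rewrite -[(K `|` L) t]/(K t \/ L t) not_orE => -[nK nL].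
rewrite (le_trans (opnormD _ _))// [leRHS]splitr lerD//; last exact: Lg.
rewrite opnormZ (@le_trans _ _ ((normc c + 1) * (e / 2 / (normc c + 1))))//.
  by rewrite ler_pM ?normc_ge0 ?opnorm_ge0 ?lerDl//; exact: Kf.
by rewrite mulrC divfK ?gt_eqF.
Qed.

Lemma vanishing_mul f g : in_Cstar f -> vanishing g -> vanishing (tfun_mul f g).
Proof.
move=> [_ _ _ [M bf]] vg e e0.
have M1 : 0 < `|M| + 1 by rewrite ltr_wpDl.
have [|K [Kc Ks Kg]] := vg (e / (`|M| + 1)); first by rewrite divr_gt0.
exists K; split=> // t ht; rewrite (le_trans (opnormM _ _))//.
rewrite (@le_trans _ _ ((`|M| + 1) * (e / (`|M| + 1))))//.
  rewrite ler_pM ?opnorm_ge0//; last exact: Kg.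
  rewrite (@le_trans _ _ M)//; first by apply: bf; exists t.
  by rewrite (le_trans (ler_norm _))// lerDl.
by rewrite mulrC divfK ?gt_eqF.
Qed.

Lemma vanishing_adj f : vanishing f -> vanishing (tfun_adj f).
Proof.
move=> vf e e0; have [K [Kc Ks Kf]] := vf e e0.
exists K; split; [exact: Kc|exact: Ks|move=> t ht].
exact: (le_trans (opnorm_adj_le (f t)) (Kf t ht)).
Qed.

Variable theta : T.

Definition C0_pred : {pred tfun} := fun f => `[< in_C0 theta f >].

Lemma C0_submod_closed : submod_closed C0_pred.
Proof.
split; first by apply/asboolP; split=> //; [exact: in_Cstar0|exact: vanishing0].
move=> c f g /asboolP[f1 f2 f3] /asboolP[g1 g2 g3]; apply/asboolP; split.
- exact: in_Cstar_linear.
- exact: vanishing_linear.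
- by rewrite -[LHS]/(c *: f theta + g theta) f3 g3 scaler0 addr0.
Qed.

HB.instance Definition _ :=
  GRing.isSubmodClosed.Build R[i] tfun C0_pred C0_submod_closed.

Definition C0fun := {f : tfun | C0_pred f}.
HB.instance Definition _ := SubChoice.on C0fun.
HB.instance Definition _ := [SubChoice_isSubLmodule of C0fun by <:].

Definition C0val (u : C0fun) : tfun := sval u.

Lemma C0funP (u : C0fun) : in_C0 theta (C0val u).
Proof. by apply/asboolP; exact: (svalP u). Qed.

Definition C0_mul (u v : C0fun) : C0fun.
Proof.
exists (tfun_mul (C0val u) (C0val v)); apply/asboolP.
have [u1 u2 u3] := C0funP u; have [v1 v2 v3] := C0funP v; split.
- exact: in_Cstar_mul.
- exact: vanishing_mul.
- by rewrite /tfun_mul v3 mulmx0.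
Defined.

Definition C0_adj (u : C0fun) : C0fun.
Proof.
exists (tfun_adj (C0val u)); apply/asboolP.
have [u1 u2 u3] := C0funP u; split.
- exact: in_Cstar_adj.
- exact: vanishing_adj.
- by rewrite /tfun_adj u3 trmx0 map_mx0.
Defined.

Definition C0_norm (u : C0fun) : R[i] := (supnorm (C0val u))%:C.

Lemma supnorm_ub (u : C0fun) x : opnorm (C0val u x) <= supnorm (C0val u).
Proof.
have [[_ _ _ ub] _ _] := C0funP u.
by apply: ub_le_sup => //; exists x.
Qed.

Lemma supnorm_ge0 (u : C0fun) : 0 <= supnorm (C0val u).
Proof. exact: (le_trans (opnorm_ge0 (C0val u theta)) (supnorm_ub u theta)). Qed.

Lemma supnorm_le (u : C0fun) c :
  (forall x, opnorm (C0val u x) <= c) -> supnorm (C0val u) <= c.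
Proof.
move=> h; apply: ge_sup; first by exists (opnorm (C0val u theta)); exists theta.
by move=> _ [x _ <-]; exact: h.
Qed.

Lemma supnormD (u v : C0fun) :
  supnorm (C0val (u + v)) <= supnorm (C0val u) + supnorm (C0val v).
Proof.
apply: supnorm_le => x; apply: le_trans (opnormD (C0val u x) (C0val v x)) _.
by rewrite lerD// supnorm_ub.
Qed.

Lemma supnormZ (c : R[i]) (u : C0fun) :
  supnorm (C0val (c *: u)) = normc c * supnorm (C0val u).
Proof.
have le d (w : C0fun) : supnorm (C0val (d *: w)) <= normc d * supnorm (C0val w).
  apply: supnorm_le => x; rewrite -[C0val (d *: w) x]/(d *: C0val w x) opnormZ.
  by rewrite ler_wpM2l ?normc_ge0// supnorm_ub.
apply/eqP; rewrite eq_le le andTb; have [->|c0] := eqVneq c 0.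
  by rewrite normc0 mul0r supnorm_ge0.
have nc : 0 < normc c.
  by rewrite lt0r normc_ge0 andbT; apply: contra_neq c0 => /eq0_normc.
by rewrite mulrC -ler_pdivlMr// -{1}(scalerK c0 u) mulrC -normcV le.
Qed.

Lemma supnorm_eq0 (u : C0fun) : supnorm (C0val u) = 0 -> u = 0.
Proof.
move=> u0; apply/val_inj; apply: functional_extensionality_dep => x.
apply: opnorm_eq0; apply/eqP; rewrite eq_le opnorm_ge0 andbT -u0.
exact: supnorm_ub.
Qed.

Lemma C0_normD (u v : C0fun) : C0_norm (u + v) <= C0_norm u + C0_norm v.
Proof. by rewrite /C0_norm -rmorphD lecR supnormD. Qed.

Lemma C0_normZ (c : R[i]) (u : C0fun) : C0_norm (c *: u) = `|c| * C0_norm u.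
Proof. by rewrite /C0_norm supnormZ rmorphM. Qed.

Lemma C0_norm_eq0 (u : C0fun) : C0_norm u = 0 -> u = 0.
Proof. by move=> /(@complexI _ _ 0)/supnorm_eq0. Qed.

HB.instance Definition _ :=
  Lmodule_isNormed.Build R[i] C0fun C0_normD C0_normZ C0_norm_eq0.

Definition C0 : starAlgData R := @StarAlgData R C0fun C0_mul C0_adj.

Definition C0_eval (s : T) (u : C0) : 'M[R[i]]_(deg s) := C0val u s.

Lemma C0_eval_rep s : is_rep (C0_eval s).
Proof. by split. Qed.

Definition eval_rep (s : T) : fdrep C0 := mk_fdrep (deg_gt0 s) (C0_eval_rep s).

End FunctionAlgebras.

Record is_solid (R : realType) (T : towerData R) (theta : T) : Prop := IsSolid {
  solid_mtower : is_mtower T;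
  solid_proper : proper_tower T;
  solid_point : deg theta = 1%N;
  solid_separates : forall t : T, core T t -> t <> theta ->
    exists g : C0 theta, C0_eval t g <> 0 }.

Section ConcreteTower.
Variables (R : realType) (A : starAlgData R).

Lemma zero_rep_proof : is_rep ((fun _ => 0) : A -> 'M[R[i]]_1).
Proof.
split=> [c a b|a b|a]; first by rewrite scaler0 addr0.
  by rewrite mulmx0.
by rewrite trmx0 map_mx0.
Qed.

Definition zero_rep : fdrep A := mk_fdrep (ltn0Sn 0) zero_rep_proof.

Lemma sum_rep_proof (p q : fdrep A) :
  is_rep (fun a => dsum_mx (rep_fun p a) (rep_fun q a)).
Proof.
have [pl pm pa] := rep_funP p; have [ql qm qa] := rep_funP q.
split=> [c a b|a b|a]; first by rewrite pl ql dsum_mx_linear.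
  by rewrite pm qm dsum_mx_mul.
by rewrite pa qa dsum_mx_adj.
Qed.

Lemma sum_rep_gt0 (p q : fdrep A) : (0 < rep_deg p + rep_deg q)%N.
Proof. by rewrite addn_gt0 rep_deg_gt0. Qed.

Definition sum_rep (p q : fdrep A) : fdrep A :=
  mk_fdrep (sum_rep_gt0 p q) (sum_rep_proof p q).

(* [U] itself if it is unitary of size [m]; otherwise the unit matrix, which makes
   [conj_rep] total. *)
Definition as_unitary m n (U : 'M[R[i]]_n) : 'M[R[i]]_m :=
  let V := conform_mx 1%:M U in if V \is unitarymx then V else 1%:M.

Lemma as_unitary_unitary m n (U : 'M[R[i]]_n) : as_unitary m U \is unitarymx.
Proof.
rewrite /as_unitary; case: ifP => // _.
by apply/unitarymxP; rewrite trmx1 map_mx1 mulmx1.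
Qed.

Lemma as_unitaryE n (U : 'M[R[i]]_n) : U \is unitarymx -> as_unitary n U = U.
Proof. by move=> Uu; rewrite /as_unitary conform_mx_id Uu. Qed.

Lemma conj_rep_proof (p : fdrep A) (U : 'M[R[i]]_(rep_deg p)) :
  U \is unitarymx -> is_rep (fun a => U *m rep_fun p a *m invmx U).
Proof.
move=> Uu; have [pl pm pa] := rep_funP p.
split=> [c a b|a b|a].
- by rewrite pl mulmxDr mulmxDl -scalemxAr -scalemxAl.
- by rewrite pm !mulmxA mulmxKV// unitarymx_unit.
- by rewrite pa invmx_unitary// !trmx_mul !map_mxM trmxCK mulmxA.
Qed.

Definition conj_rep n (U : 'M[R[i]]_n) (p : fdrep A) : fdrep A :=
  mk_fdrep (rep_deg_gt0 p) (conj_rep_proof (as_unitary_unitary (rep_deg p) U)).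

Definition fdrep_tower : towerData R :=
  @TowerData R (fdrep A) (@rep_deg R A) (@rep_deg_gt0 R A) sum_rep conj_rep.

End ConcreteTower.

(* Main.v *)
(* In an m-tower a point is determined, up to equivalence, by its irreducible parts and
   their multiplicities, and the stabilizer axioms say that a value prescribed at an
   irreducible point propagates to sums. Hence each equivariant function on the core
   extends to a unique "algebraic" (equivariant and additive) function. A single value of
   an algebraic function is attained by a continuous one: extend from layer to layer by
   Tietze's theorem and restore equivariance by taking Chebyshev centers of orbits for
   the Hilbert-Schmidt norm.

   Part (I). Order and disjointness in the tower of representations are expressed by
   isometric and by vanishing intertwiners, and the axioms of an m-tower become linear
   algebra. The map J is isometric. By the bicommutant theorem its image takes at each
   point all the values of algebraic functions vanishing at theta, and a
   Stone-Weierstrass argument over the tower shows that it is everything: approximate on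
   representations of degree at most N by induction on N, with partial fractions
   P (1 + Q)^-1 whose weights are almost scalar near an irreducible point.

   Part (II). The kernel of a nonzero representation pi of C*_0 is an ideal; if at each
   irreducible point other than kappa some element of it did not vanish, it would be
   dense. So pi factors over an evaluation at some irreducible t, and matrix units
   embed pi_t in pi; splitting it off and repeating exhibits pi as an evaluation. *)
Require Import Defs.
From HB Require Import structures.
From mathcomp Require Import all_boot all_order all_algebra.
From mathcomp Require Import sesquilinear spectral complex.
From mathcomp Require Import all_classical all_reals topology normedtype numfun sequences.
From mathcomp Require Import ring lra zify.

Set Implicit Arguments.
Unset Strict Implicit.
Unset Printing Implicit Defensive.

Import Order.TTheory GRing.Theory Num.Theory.
Import numFieldNormedType.Exports ComplexField.Normc.

Local Open Scope classical_set_scope.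
Local Open Scope ring_scope.
Local Open Scope sesquilinear_scope.
Local Open Scope complex_scope.

(** * Matrices *)

Section MatrixAlgebra.
Variable R : realType.
Local Notation C := R[i].

(** The function algebra has no unit, and its only scalar-valued element is 0, since a function
    vanishing at theta takes the value f(x) + 0 in block form at a sum with theta. So there are no
    partitions of unity. Their substitute is an average of b* b over functions that resemble matrix
    units near an irreducible point: it is almost the scalar given by the squared Hilbert-Schmidt
    norm of b, and a high power of a bump as b makes it dominate there and negligible at the
    remaining points of comparable degree.

    The induction on the degree says nothing beyond degree N, where an approximant may be large.
    They show that the subalgebra is an ideal, and for ideals the density argument of part (II)
    applies.

    Square roots are taken of operators on A that are symmetric for the A-valued product x* y, and
    inverses come from an iteration that stays in a closed subalgebra; neither step adjoins a unit.
    Degrees agree only propositionally, so most identities are stated between infinite arrays. *)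

Lemma adjmxM m n p (X : 'M[C]_(m, n)) (Y : 'M[C]_(n, p)) :
  (X *m Y) ^t* = Y ^t* *m X ^t*.
Proof. by rewrite trmx_mul map_mxM. Qed.

Lemma adjmxD m n (X Y : 'M[C]_(m, n)) : (X + Y) ^t* = X ^t* + Y ^t*.
Proof. by apply/matrixP => i j; rewrite !mxE rmorphD. Qed.

Lemma adjmxZ m n (c : C) (X : 'M[C]_(m, n)) : (c *: X) ^t* = Num.conj c *: X ^t*.
Proof. by apply/matrixP => i j; rewrite !mxE rmorphM. Qed.

Lemma adjmxN m n (X : 'M[C]_(m, n)) : (- X) ^t* = - X ^t*.
Proof. by apply/matrixP => i j; rewrite !mxE rmorphN. Qed.

Lemma adjmx0 m n : (0 : 'M[C]_(m, n)) ^t* = 0.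
Proof. by apply/matrixP => i j; rewrite !mxE rmorph0. Qed.

Lemma adjmx_scalar n (c : C) : (c%:M : 'M[C]_n) ^t* = (Num.conj c)%:M.
Proof. by apply/matrixP => i j; rewrite !mxE eq_sym rmorphMn. Qed.

Lemma adjmx1 n : (1%:M : 'M[C]_n) ^t* = 1%:M.
Proof. by rewrite adjmx_scalar rmorph1. Qed.

Lemma unitarymx_adjmul n (U : 'M[C]_n) : U \is unitarymx -> U ^t* *m U = 1%:M.
Proof. by move=> Uu; rewrite -(invmx_unitary Uu) mulVmx ?unitarymx_unit. Qed.

Lemma isometry_unitarymx n (U : 'M[C]_n) : U ^t* *m U = 1%:M -> U \is unitarymx.
Proof. by move=> h; rewrite -trmxC_unitary; apply/unitarymxP; rewrite trmxCK. Qed.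

Lemma unitarymx1 n : (1%:M : 'M[C]_n) \is unitarymx.
Proof. by apply/unitarymxP; rewrite adjmx1 mulmx1. Qed.

Lemma unitarymxV n (U : 'M[C]_n) : U \is unitarymx -> invmx U \is unitarymx.
Proof. by move=> Uu; rewrite (invmx_unitary Uu) trmxC_unitary. Qed.

Lemma invmxM n (U V : 'M[C]_n) : U \in unitmx -> V \in unitmx ->
  invmx (U *m V) = invmx V *m invmx U.
Proof.
move=> Uu Vu; have UV : U *m V \in unitmx by rewrite unitmx_mul Uu.
by rewrite -[RHS]mul1mx -(mulVmx UV) -!mulmxA mulKVmx// mulmxV// mulmx1.
Qed.

Lemma invmx_unitaryM n (U V : 'M[C]_n) : U \is unitarymx -> V \is unitarymx ->
  invmx (U *m V) = invmx V *m invmx U.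
Proof. by move=> /unitarymx_unit Uu /unitarymx_unit Vu; exact: invmxM. Qed.

Lemma dsum_mx1 m n : dsum_mx (1%:M : 'M[C]_m) (1%:M : 'M[C]_n) = 1%:M.
Proof. by rewrite /dsum_mx -scalar_mx_block. Qed.

Lemma dsum_mx_inj m n (X1 Y1 : 'M[C]_m) (X2 Y2 : 'M[C]_n) :
  dsum_mx X1 X2 = dsum_mx Y1 Y2 -> X1 = Y1 /\ X2 = Y2.
Proof. by move=> /eq_block_mx[]. Qed.

Lemma unitarymx_dsum m n (U : 'M[C]_m) (V : 'M[C]_n) :
  U \is unitarymx -> V \is unitarymx -> dsum_mx U V \is unitarymx.
Proof.
move=> Uu Vu; apply/unitarymxP; rewrite -dsum_mx_adj -dsum_mx_mul.
by rewrite (unitarymxP Uu) (unitarymxP Vu) dsum_mx1.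
Qed.

Lemma invmx_dsum m n (U : 'M[C]_m) (V : 'M[C]_n) :
  U \is unitarymx -> V \is unitarymx ->
  invmx (dsum_mx U V) = dsum_mx (invmx U) (invmx V).
Proof.
move=> Uu Vu; rewrite (invmx_unitary Uu) (invmx_unitary Vu).
by rewrite (invmx_unitary (unitarymx_dsum Uu Vu)) dsum_mx_adj.
Qed.

Lemma unitarymx_swap p q : swap_mx R p q \is unitarymx.
Proof.
rewrite /swap_mx; set B := block_mx _ _ _ _.
have Bu : B *m B ^t* = 1%:M.
  rewrite /B tr_block_mx map_block_mx !adjmx0 !adjmx1 mulmx_block.
  by rewrite !mulmx0 !mul0mx !mulmx1 !add0r !addr0 -scalar_mx_block.
move: (addnC q p) B Bu => e; case: _ / e => B Bu; rewrite castmx_id.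
exact/unitarymxP.
Qed.

Lemma swap_mx_dsum p q (X : 'M[C]_p) (Y : 'M[C]_q) :
  castmx (addnC q p, addnC q p) (dsum_mx Y X) *m swap_mx R p q =
  swap_mx R p q *m dsum_mx X Y.
Proof.
rewrite /swap_mx /dsum_mx; set B := (block_mx 0 _ _ _ : 'M[C]_(q + p, p + q)).
have E : block_mx Y 0 0 X *m B = B *m block_mx X 0 0 Y.
  by rewrite /B !mulmx_block !mulmx0 !mul0mx !mulmx1 !mul1mx !add0r !addr0.
move: (block_mx Y 0 0 X) B (block_mx X 0 0 Y) E.
by move: (addnC q p) => e; case: _ / e => Y' B X' E; rewrite !castmx_id.
Qed.

Lemma hermitian_spectral n (H : 'M[C]_n) : H ^t* = H ->
  [/\ spectralmx H \is unitarymx,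
      H = (spectralmx H) ^t* *m diag_mx (spectral_diag H) *m spectralmx H
    & forall i, Num.conj (spectral_diag H 0 i) = spectral_diag H 0 i].
Proof.
move=> Hh; have hH : H \is hermsymmx.
  by apply/is_hermitianmxP; rewrite expr0 scale1r Hh.
split; first exact: spectral_unitarymx.
  rewrite -invmx_unitary ?spectral_unitarymx//.
  exact/orthomx_spectralP/hermitian_normalmx.
move=> i; have /mxOverP/(_ 0 i) := hermitian_spectral_diag_real hH.
by move=> /CrealP.
Qed.

(** Functional calculus in the spectral basis. It serves for the inverse square root in polar
    parts. *)
Definition hermfun n (phi : C -> C) (H : 'M[C]_n) : 'M[C]_n :=
  (spectralmx H) ^t* *m diag_mx (map_mx phi (spectral_diag H)) *m spectralmx H.

(** In the eigenbasis the relation XH = HX reads (d_i - d_j) y_ij = 0. So commuting with H is a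
    condition on the support of Y, from which commutation with every function of H follows without
    polynomial approximation. *)
Lemma spectral_coord n (H X : 'M[C]_n) : H ^t* = H -> X *m H = H *m X ->
  forall i j, spectral_diag H 0 i != spectral_diag H 0 j ->
  (spectralmx H *m X *m (spectralmx H) ^t*) i j = 0.
Proof.
move=> Hh; have [Pu HE _] := hermitian_spectral Hh.
have PaP := unitarymx_adjmul Pu; have PPa := unitarymxP Pu.
set P := spectralmx H in PaP PPa Pu HE *; set D := spectral_diag H in HE *.
move=> XH i j nij; set Y := P *m X *m P ^t*.
have YD : Y *m diag_mx D = diag_mx D *m Y.
  have -> : diag_mx D = P *m H *m P ^t*.
    by rewrite {1}HE !mulmxA !PPa mul1mx -!mulmxA PPa mulmx1.
  have -> : Y *m (P *m H *m P ^t*) = P *m X *m (P ^t* *m P) *m H *m P ^t*.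
    by rewrite /Y !mulmxA.
  have -> : P *m H *m P ^t* *m Y = P *m H *m (P ^t* *m P) *m X *m P ^t*.
    by rewrite /Y !mulmxA.
  by rewrite PaP !mulmx1 -(mulmxA P X) XH !mulmxA.
have /matrixP/(_ i j) := YD.
rewrite mul_mx_diag mul_diag_mx !mxE => /eqP; rewrite mulrC -subr_eq0 -mulrBl.
by rewrite mulf_eq0 subr_eq0 eq_sym (negPf nij)/= => /eqP.
Qed.

Lemma hermfun_comm n phi (H X : 'M[C]_n) : H ^t* = H -> X *m H = H *m X ->
  X *m hermfun phi H = hermfun phi H *m X.
Proof.
move=> Hh XH; have [Pu _ _] := hermitian_spectral Hh.
have PaP := unitarymx_adjmul Pu; have PPa := unitarymxP Pu.
have co := spectral_coord Hh XH.
set P := spectralmx H in PaP PPa Pu co *; set D := spectral_diag H in co *.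
set Y := P *m X *m P ^t* in co.
have YD : Y *m diag_mx (map_mx phi D) = diag_mx (map_mx phi D) *m Y.
  apply/matrixP => i j; rewrite mul_mx_diag mul_diag_mx; move: (co i j).
  move=> h; rewrite [LHS]mxE [RHS]mxE [map_mx phi D 0 j]mxE [map_mx phi D 0 i]mxE mulrC; move: h.
  by have [->//|_ ->//] := eqVneq (D 0 i) (D 0 j); rewrite !mulr0.
rewrite /hermfun -/P -/D.
have -> : X = P ^t* *m Y *m P.
  by rewrite /Y !mulmxA PaP mul1mx -mulmxA PaP mulmx1.
set E := diag_mx _ in YD *.
have -> : P ^t* *m Y *m P *m (P ^t* *m E *m P) = P ^t* *m Y *m (P *m P ^t*) *m E *m P.
  by rewrite !mulmxA.
have -> : P ^t* *m E *m P *m (P ^t* *m Y *m P) = P ^t* *m E *m (P *m P ^t*) *m Y *m P.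
  by rewrite !mulmxA.
by rewrite PPa !mulmx1 -(mulmxA _ Y) YD mulmxA.
Qed.

(** The columns of [V] are the spectral basis vectors whose eigenvalue is that of [i0];
    [spectral_coord] makes their span invariant under the commutant of H. The case k = n serves
    Schur's lemma, and the formula for [lam] allows the choice of a nonzero eigenvalue. *)
Lemma eigenspace_isometry n (H : 'M[C]_n) (i0 : 'I_n) : H ^t* = H ->
  exists k (V : 'M[C]_(n, k)) (lam : C),
  [/\ (0 < k)%N, V ^t* *m V = 1%:M, H *m V = lam *: V,
      (forall X : 'M[C]_n, X *m H = H *m X -> X *m V = V *m (V ^t* *m X *m V)) &
      (k = n -> H = lam%:M) /\ lam = spectral_diag H 0 i0].
Proof.
move=> Hh; have [Pu HE _] := hermitian_spectral Hh.
have PaP := unitarymx_adjmul Pu; have PPa := unitarymxP Pu.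
have co := spectral_coord Hh.
set P := spectralmx H in PaP PPa Pu HE co; set D := spectral_diag H in HE co *.
pose A := [pred i | D 0 i == D 0 i0].
pose f := fun j : 'I_#|A| => enum_val j.
pose V : 'M[C]_(n, #|A|) := (rowsub f P) ^t*.
pose S : 'M[C]_(#|A|, n) := rowsub f 1%:M.
have VE : V = P ^t* *m S ^t* by rewrite -adjmxM mul_rowsub_mx mul1mx.
have SE j : S j (f j) = 1 by rewrite !mxE eqxx.
have S0 j k : k != f j -> S j k = 0 by move=> h; rewrite !mxE eq_sym (negPf h).
have VV : V ^t* *m V = 1%:M.
  rewrite VE adjmxM !trmxCK mulmxA -(mulmxA S) PPa mulmx1.
  apply/matrixP => j k; rewrite !mxE (bigD1 (f j))//= big1 => [|l ne].
    rewrite !mxE eqxx mul1r addr0 rmorph_nat.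
    by rewrite (inj_eq enum_val_inj) eq_sym.
  by rewrite [S j l]S0 ?mul0r.
have HV : H *m V = D 0 i0 *: V.
  rewrite VE {1}HE !mulmxA -(mulmxA _ P) PPa mulmx1 -mulmxA.
  rewrite scalemxAr; congr (_ *m _); apply/matrixP => j k.
  rewrite mul_diag_mx !mxE.
  have [<-|ne] := eqVneq (enum_val k) j; last by rewrite !rmorph0 !mulr0.
  by congr (_ * _); have := enum_valP k; rewrite inE => /eqP.
exists #|A|, V, (D 0 i0); split=> //.
- by apply/card_gt0P; exists i0; rewrite inE.
- move=> X XH; pose Y := P *m X *m P ^t*.
  have XE : X = P ^t* *m Y *m P.
    by rewrite /Y !mulmxA PaP mul1mx -mulmxA PaP mulmx1.
  have YS : Y *m S ^t* = S ^t* *m (S *m Y *m S ^t*).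
    apply/matrixP => j k.
    have YSE l : (Y *m S ^t*) l k = Y l (f k).
      rewrite mxE (bigD1 (f k))//= big1 => [|m ne].
        by rewrite !mxE eqxx rmorph1 mulr1 addr0.
      by rewrite [(S ^t*) m k]mxE [S^T m k]mxE S0// rmorph0 mulr0.
    have SYS l : (S *m (Y *m S ^t*)) l k = Y (f l) (f k).
      rewrite mxE (bigD1 (f l))//= big1 => [|m ne]; last by rewrite S0 ?mul0r.
      by rewrite SE mul1r YSE addr0.
    rewrite YSE -(mulmxA S) [RHS]mxE; have coY := co X XH j (f k) : _ -> Y j (f k) = 0.
    have [/eqP dj|dj] := boolP (D 0 j == D 0 i0); last first.
      rewrite coY; last by have := enum_valP k; rewrite inE => /eqP ->.
      rewrite big1// => l _; rewrite [(S ^t*) j l]mxE [S^T j l]mxE S0 ?rmorph0 ?mul0r//.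
      by apply: contra dj => /eqP ->; have := enum_valP l; rewrite inE.
    have jA : j \in A by rewrite inE dj.
    rewrite (bigD1 (enum_rank_in jA j))//= big1 => [|m ne].
      rewrite SYS /f enum_rankK_in// [(S ^t*) _ _]mxE [S^T _ _]mxE.
      have := SE (enum_rank_in jA j); rewrite /f (enum_rankK_in jA jA) => ->.
      by rewrite rmorph1 mul1r addr0.
    rewrite [(S ^t*) _ _]mxE [S^T _ _]mxE S0 ?rmorph0 ?mul0r//.
    apply: contra ne => /eqP E; apply/eqP/enum_val_inj.
    by rewrite (enum_rankK_in jA jA) E.
  rewrite VE adjmxM !trmxCK {1 2}XE.
  have -> : P ^t* *m Y *m P *m (P ^t* *m S ^t*) =
    P ^t* *m ((Y *m (P *m P ^t*)) *m S ^t*) by rewrite !mulmxA.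
  rewrite PPa mulmx1 YS.
  have -> : P ^t* *m S ^t* *m (S *m P *m (P ^t* *m Y *m P) *m (P ^t* *m S ^t*)) =
    P ^t* *m S ^t* *m (S *m (P *m P ^t*) *m Y *m (P *m P ^t*) *m S ^t*).
    by rewrite !mulmxA.
  by rewrite PPa !mulmx1 !mulmxA.
- split=> // An.
  have D1 : D = const_mx (D 0 i0).
    apply/rowP => j; rewrite mxE; apply/eqP.
    have : j \in A.
      have : #|[predC A]| = 0%N.
        by apply/(@addnI #|A|); rewrite cardC addn0 An card_ord.
      by move=> /card0_eq/(_ j); rewrite [j \in [predC A]]/= => /negbFE.
    by rewrite inE.
  rewrite HE {1}D1 diag_const_mx -scalemx1 -scalemxAr mulmx1 -scalemxAl.
  by rewrite PaP scalemx1.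
Qed.

Local Notation "B ^!" :=
  (orthomx (@Num.conj C) (mx_of_hermitian (hermitian1mx _)) B) : matrix_set_scope.
Local Notation "A '_|_ B" := (A%MS <= B^!)%MS : matrix_set_scope.

(** Invariance of W under the adjoint of X makes the orthogonal complement invariant under X. Hence
    PXP = PX and (1 - P)XP = 0, in the row-vector convention. *)
Lemma proj_ortho_comm k n (W : 'M[C]_(k, n)) (X : 'M[C]_n) :
  stablemx W X -> stablemx W (X ^t*) ->
  proj_ortho W *m X = X *m proj_ortho W.
Proof.
move=> WX WXa; set P := proj_ortho W.
have PX : P *m X *m P = P *m X.
  by rewrite proj_ortho_id// (submx_trans _ WX)// submxMr// proj_orthoE.
have sub : (W^!%MS *m X <= W^!)%MS.
  rewrite orthomx_sym; apply/orthomx1P.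
  have /orthomx1P/= := submx_refl (W^!)%MS.
  case/submxP: WXa => Z ZE.
  move=> h; rewrite adjmxM mulmxA -{1}(trmxCK X) -mulmxA.
  have : (W *m X ^t*) *m (W^!%MS) ^t* = 0.
    rewrite ZE -mulmxA.
    have /orthomx1P -> : (W '_|_ W^!)%MS by rewrite orthomx_sym.
    by rewrite mulmx0.
  by rewrite -mulmxA trmxCK.
have h : (1%:M - P) *m X *m P = 0.
  rewrite proj_ortho_0// (submx_trans _ sub)// submxMr//.
  by have := proj_ortho_compl_sub W (1%:M : 'M[C]_n); rewrite mul1mx.
by rewrite -PX; apply/eqP; rewrite eq_sym -subr_eq0 -mulmxA -{1}(mul1mx (X *m P))
  -mulmxBl mulmxA h.
Qed.

End MatrixAlgebra.

(** * Operator and Hilbert-Schmidt norms *)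

Section OperatorNormFacts.
Variable R : realType.
Local Notation C := R[i].

Definition dotc n (v w : 'cV[C]_n) : C := (v ^t* *m w) 0 0.

Lemma dotcE n (v w : 'cV[C]_n) : dotc v w = \sum_i Num.conj (v i 0) * w i 0.
Proof. by rewrite /dotc mxE; apply: eq_bigr => i _; rewrite !mxE. Qed.

Lemma dotcc n (v : 'cV[C]_n) : dotc v v = (l2norm v ^+ 2)%:C.
Proof.
rewrite dotcE l2norm_sqr rmorph_sum; apply: eq_bigr => i _.
by rewrite mulrC sqr_normcE.
Qed.

Lemma dotcDr n (v w1 w2 : 'cV[C]_n) : dotc v (w1 + w2) = dotc v w1 + dotc v w2.
Proof. by rewrite /dotc mulmxDr mxE. Qed.

Lemma dotcDl n (v w1 w2 : 'cV[C]_n) : dotc (w1 + w2) v = dotc w1 v + dotc w2 v.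
Proof. by rewrite /dotc adjmxD mulmxDl mxE. Qed.

Lemma dotcZr n (c : C) (v w : 'cV[C]_n) : dotc v (c *: w) = c * dotc v w.
Proof. by rewrite /dotc -scalemxAr mxE. Qed.

Lemma dotcZl n (c : C) (v w : 'cV[C]_n) : dotc (c *: v) w = Num.conj c * dotc v w.
Proof. by rewrite /dotc adjmxZ -scalemxAl mxE. Qed.

Lemma dotc_adj m n (X : 'M[C]_(m, n)) (v : 'cV[C]_n) (w : 'cV[C]_m) :
  dotc (X *m v) w = dotc v (X ^t* *m w).
Proof. by rewrite /dotc adjmxM -mulmxA. Qed.

Lemma dotc_conj n (v w : 'cV[C]_n) : dotc w v = Num.conj (dotc v w).
Proof.
rewrite !dotcE rmorph_sum; apply: eq_bigr => i _.
by rewrite rmorphM /= conjCK mulrC.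
Qed.

Lemma dotc_le n (v w : 'cV[C]_n) : normc (dotc v w) <= l2norm v * l2norm w.
Proof.
rewrite dotcE (le_trans (normc_sum _))//.
under eq_bigr do rewrite normcM normc_conj.
exact: cauchy_schwarz.
Qed.

Lemma normc_Re (z : C) : `|complex.Re z| <= normc z.
Proof.
case: z => a b /=; rewrite -sqrtr_sqr ler_sqrt ?addr_ge0 ?sqr_ge0//.
by rewrite lerDl sqr_ge0.
Qed.

Lemma normc_Im (z : C) : `|complex.Im z| <= normc z.
Proof.
case: z => a b /=; rewrite -sqrtr_sqr ler_sqrt ?addr_ge0 ?sqr_ge0//.
by rewrite lerDr sqr_ge0.
Qed.

Lemma normc_le_ReIm (z : C) : normc z <= `|complex.Re z| + `|complex.Im z|.
Proof.
case: z => a b /=.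
rewrite -(@ler_pXn2r _ 2)// ?nnegrE ?addr_ge0 ?sqrtr_ge0//.
rewrite sqr_sqrtr ?addr_ge0 ?sqr_ge0// sqrrD !real_normK ?num_real//.
by rewrite lerD2r lerDl mulrn_wge0// mulr_ge0.
Qed.

Lemma normc_real (x : R) : normc x%:C = `|x|.
Proof. by rewrite /= expr0n/= addr0 sqrtr_sqr. Qed.

Lemma l2norm_isometry m n (V : 'M[C]_(m, n)) (v : 'cV[C]_n) :
  V ^t* *m V = 1%:M -> l2norm (V *m v) = l2norm v.
Proof.
move=> VV; have h : (l2norm (V *m v) ^+ 2)%:C = (l2norm v ^+ 2)%:C.
  by rewrite -!dotcc dotc_adj mulmxA VV mul1mx.
move: h => /complexI/eqP; rewrite eqrXn2 ?l2norm_ge0// => /eqP; exact.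
Qed.

Lemma l2norm_unitary n (U : 'M[C]_n) v : U \is unitarymx ->
  l2norm (U *m v) = l2norm v.
Proof. by move=> Uu; apply: l2norm_isometry; exact: unitarymx_adjmul. Qed.

Lemma l2normN n (v : 'cV[C]_n) : l2norm (- v) = l2norm v.
Proof. by rewrite -scaleN1r l2normZ normcN normc1 mul1r. Qed.

Lemma opnorm_le_gen n (X : 'M[C]_n) c : 0 <= c ->
  (forall v, l2norm (X *m v) <= c * l2norm v) -> opnorm X <= c.
Proof.
move=> c0 h; apply: opnorm_le => v v1; rewrite (le_trans (h v))//.
by rewrite ler_piMr.
Qed.

Lemma opnorm1 n : opnorm (1%:M : 'M[C]_n) <= 1.
Proof. by apply: opnorm_le => v; rewrite mul1mx. Qed.

Lemma opnormN n (X : 'M[C]_n) : opnorm (- X) = opnorm X.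
Proof. by rewrite -scaleN1r opnormZ normcN normc1 mul1r. Qed.

Lemma opnorm_conj_le n (U X : 'M[C]_n) : U \is unitarymx ->
  opnorm (U *m X *m invmx U) <= opnorm X.
Proof.
move=> Uu; apply: opnorm_le_gen => [|v]; first exact: opnorm_ge0.
rewrite -!mulmxA (l2norm_unitary _ Uu) (le_trans (l2norm_mulmx _ _))//.
by rewrite (l2norm_unitary _ (unitarymxV Uu)).
Qed.

Lemma opnorm_conj n (U X : 'M[C]_n) : U \is unitarymx ->
  opnorm (U *m X *m invmx U) = opnorm X.
Proof.
move=> Uu; apply/eqP; rewrite eq_le (opnorm_conj_le _ Uu) andTb.
have {1}-> : X = invmx U *m (U *m X *m invmx U) *m invmx (invmx U).
  by rewrite invmxK !mulmxA mulVmx ?unitarymx_unit// mul1mx mulmxKV// unitarymx_unit.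
exact: opnorm_conj_le (unitarymxV Uu).
Qed.

Lemma l2norm_col_mx m n (u : 'cV[C]_m) (v : 'cV[C]_n) :
  l2norm (col_mx u v) ^+ 2 = l2norm u ^+ 2 + l2norm v ^+ 2.
Proof.
rewrite !l2norm_sqr big_split_ord/=; congr (_ + _); apply: eq_bigr => i _.
  by rewrite col_mxEu.
by rewrite col_mxEd.
Qed.

Lemma opnorm_dsum_le m n (X : 'M[C]_m) (Y : 'M[C]_n) c :
  opnorm X <= c -> opnorm Y <= c -> opnorm (dsum_mx X Y) <= c.
Proof.
move=> Xc Yc; have c0 : 0 <= c by rewrite (le_trans (opnorm_ge0 X)).
apply: opnorm_le_gen => // v.
rewrite -(vsubmxK v) /dsum_mx mul_block_col !mul0mx addr0 add0r.
rewrite -(@ler_pXn2r _ 2)// ?nnegrE ?mulr_ge0 ?l2norm_ge0//.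
rewrite exprMn !l2norm_col_mx mulrDr -!exprMn.
have h k (Z : 'M[C]_k) w : opnorm Z <= c ->
    l2norm (Z *m w) ^+ 2 <= (c * l2norm w) ^+ 2.
  move=> Zc; rewrite ler_pXn2r// ?nnegrE ?mulr_ge0 ?l2norm_ge0//.
  by rewrite (le_trans (l2norm_mulmx _ _))// ler_wpM2r ?l2norm_ge0.
by rewrite lerD// h.
Qed.

Lemma opnorm_dsum_gel m n (X : 'M[C]_m) (Y : 'M[C]_n) :
  opnorm X <= opnorm (dsum_mx X Y).
Proof.
apply: opnorm_le_gen => [|v]; first exact: opnorm_ge0.
have := l2norm_mulmx (dsum_mx X Y) (col_mx v 0).
rewrite /dsum_mx mul_block_col !mul0mx !mulmx0 !addr0.
have E k (w : 'cV[C]_k) : l2norm (col_mx w (0 : 'cV_n)) = l2norm w.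
  apply/eqP; rewrite -(@eqrXn2 _ 2) ?l2norm_ge0// l2norm_col_mx l2norm0 expr0n.
  by rewrite addr0.
by rewrite !E.
Qed.

Lemma opnorm_adj n (X : 'M[C]_n) : opnorm (X ^t*) = opnorm X.
Proof.
apply/eqP; rewrite eq_le opnorm_adj_le andTb.
by rewrite -{1}(trmxCK X) opnorm_adj_le.
Qed.

Lemma opnorm_adjM n (X : 'M[C]_n) : opnorm (X ^t* *m X) = opnorm X ^+ 2.
Proof.
apply/eqP; rewrite eq_le; apply/andP; split.
  by rewrite (le_trans (opnormM _ _)) ?opnorm_adj ?expr2.
rewrite -[leRHS]sqr_sqrtr ?opnorm_ge0//.
rewrite ler_pXn2r// ?nnegrE ?opnorm_ge0 ?sqrtr_ge0//.
apply: opnorm_le_gen => [|v]; first exact: sqrtr_ge0.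
rewrite -(@ler_pXn2r _ 2)// ?nnegrE ?mulr_ge0 ?l2norm_ge0 ?sqrtr_ge0//.
rewrite exprMn (sqr_sqrtr (opnorm_ge0 (X ^t* *m X))).
have -> : l2norm (X *m v) ^+ 2 = normc (dotc v (X ^t* *m X *m v)).
  by rewrite -mulmxA -dotc_adj dotcc normc_real ger0_norm ?sqr_ge0.
rewrite (le_trans (dotc_le _ _))// mulrC expr2 mulrA ler_wpM2r ?l2norm_ge0//.
exact: l2norm_mulmx.
Qed.

Lemma l2norm_delta n (i : 'I_n) : l2norm (delta_mx i 0 : 'cV[C]_n) = 1.
Proof.
rewrite /l2norm (bigD1 i)//= big1 => [|j ne].
  by rewrite mxE !eqxx normc1 expr1n addr0 sqrtr1.
by rewrite mxE (negPf ne) normc0 expr0n.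
Qed.

Lemma entry_le_opnorm n (X : 'M[C]_n) i j : normc (X i j) <= opnorm X.
Proof.
have -> : X i j = (X *m delta_mx j (0 : 'I_1)) i 0 by rewrite -colE mxE.
rewrite (le_trans (normc_le_l2norm _ _))// (le_trans (l2norm_mulmx _ _))//.
by rewrite l2norm_delta mulr1.
Qed.

Lemma l2norm_le_sum n (v : 'cV[C]_n) : l2norm v <= \sum_i normc (v i 0).
Proof.
have s0 : 0 <= \sum_i normc (v i 0) by rewrite sumr_ge0// => i _; exact: normc_ge0.
rewrite -(@ler_pXn2r _ 2)// ?nnegrE ?l2norm_ge0// l2norm_sqr expr2 mulr_suml.
apply: ler_sum => i _; rewrite expr2 ler_wpM2l ?normc_ge0//.
by rewrite (bigD1 i)//= lerDl sumr_ge0// => j _; exact: normc_ge0.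
Qed.

Lemma opnorm_le_sum n (X : 'M[C]_n) :
  opnorm X <= \sum_i \sum_j normc (X i j).
Proof.
have s0 i : 0 <= \sum_j normc (X i j) by rewrite sumr_ge0// => j _; exact: normc_ge0.
apply: opnorm_le_gen => [|v]; first by rewrite sumr_ge0.
rewrite (le_trans (l2norm_le_sum _))// mulr_suml ler_sum// => i _.
rewrite mxE (le_trans (normc_sum _))// mulr_suml ler_sum// => j _.
by rewrite normcM ler_wpM2l ?normc_ge0// normc_le_l2norm.
Qed.

Definition hsnorm n (X : 'M[C]_n) : R := l2norm ((mxvec X)^T).

Lemma hsnorm_sqr n (X : 'M[C]_n) :
  hsnorm X ^+ 2 = \sum_i \sum_j normc (X i j) ^+ 2.
Proof.
rewrite /hsnorm l2norm_sqr pair_big/=.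
rewrite (reindex _ (curry_mxvec_bij n n))/=; apply: eq_bigr => -[i j] _ /=.
by rewrite mxE mxvecE.
Qed.

Lemma hsnorm_sqr_col n (X : 'M[C]_n) :
  hsnorm X ^+ 2 = \sum_j l2norm (col j X) ^+ 2.
Proof.
rewrite hsnorm_sqr exchange_big/=; apply: eq_bigr => j _.
by rewrite l2norm_sqr; apply: eq_bigr => i _; rewrite mxE.
Qed.

Lemma hsnorm_ge0 n (X : 'M[C]_n) : 0 <= hsnorm X.
Proof. exact: l2norm_ge0. Qed.

Lemma hsnormD n (X Y : 'M[C]_n) : hsnorm (X + Y) <= hsnorm X + hsnorm Y.
Proof. by rewrite /hsnorm linearD/= linearD/= l2normD. Qed.

Lemma hsnormZ n (c : C) (X : 'M[C]_n) : hsnorm (c *: X) = normc c * hsnorm X.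
Proof. by rewrite /hsnorm linearZ/= linearZ/= l2normZ. Qed.

Lemma hsnormN n (X : 'M[C]_n) : hsnorm (- X) = hsnorm X.
Proof. by rewrite -scaleN1r hsnormZ normcN normc1 mul1r. Qed.

Lemma hsnorm0 n : hsnorm (0 : 'M[C]_n) = 0.
Proof. by rewrite /hsnorm linear0 trmx0 l2norm0. Qed.

Lemma hsnorm_eq0 n (X : 'M[C]_n) : hsnorm X = 0 -> X = 0.
Proof.
move=> /l2norm_eq0 h; apply: (can_inj mxvecK); apply: trmx_inj.
by rewrite h linear0 trmx0.
Qed.

(** The operator norm has no such identity; it is the reason for taking centers in the
    Hilbert-Schmidt norm. *)
Lemma hsnorm_parallelogram n (X Y : 'M[C]_n) :
  hsnorm (X + Y) ^+ 2 + hsnorm (X - Y) ^+ 2 = (hsnorm X ^+ 2 + hsnorm Y ^+ 2) *+ 2.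
Proof.
rewrite !hsnorm_sqr -!big_split/= -sumrMnl; apply: eq_bigr => i _.
rewrite -!big_split/= -sumrMnl; apply: eq_bigr => j _; rewrite !mxE.
case: (X i j) (Y i j) => a b [c d] /=.
by rewrite !sqr_sqrtr ?addr_ge0 ?sqr_ge0//; ring.
Qed.

Lemma opnorm_le_hsnorm n (X : 'M[C]_n) : opnorm X <= hsnorm X.
Proof.
apply: opnorm_le_gen => [|v]; first exact: hsnorm_ge0.
rewrite -(@ler_pXn2r _ 2)// ?nnegrE ?mulr_ge0 ?l2norm_ge0//.
rewrite exprMn hsnorm_sqr l2norm_sqr mulr_suml ler_sum// => i _.
have s0 : 0 <= \sum_j normc (X i j) ^+ 2 by rewrite sumr_ge0// => j _; exact: sqr_ge0.
rewrite mxE -[leRHS](sqr_sqrtr (mulr_ge0 s0 (sqr_ge0 _))).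
rewrite ler_pXn2r// ?nnegrE ?normc_ge0 ?sqrtr_ge0//.
rewrite (le_trans (normc_sum _))//; under eq_bigr do rewrite normcM.
rewrite (le_trans (cauchy_schwarz _ _))// (sqrtrM _ s0).
by rewrite [Num.sqrt (l2norm _ ^+ 2)]sqrtr_sqr ger0_norm ?l2norm_ge0.
Qed.

Lemma hsnorm_le_opnorm n (X : 'M[C]_n) : hsnorm X <= n%:R * opnorm X.
Proof.
rewrite -(@ler_pXn2r _ 2)// ?nnegrE ?mulr_ge0 ?hsnorm_ge0 ?opnorm_ge0//.
rewrite hsnorm_sqr_col exprMn.
apply: (@le_trans _ _ (\sum_(j < n) opnorm X ^+ 2)).
  apply: ler_sum => j _; rewrite ler_pXn2r// ?nnegrE ?l2norm_ge0 ?opnorm_ge0//.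
  rewrite colE (le_trans (l2norm_mulmx _ _))//.
  by rewrite l2norm_delta mulr1.
rewrite sumr_const card_ord -[opnorm X ^+ 2 *+ n]mulr_natl ler_wpM2r ?sqr_ge0//.
by rewrite -natrX ler_nat; case: n {X} => // n; rewrite -mulnn leq_pmulr.
Qed.

Lemma hsnorm_mulUl n (U X : 'M[C]_n) : U \is unitarymx -> hsnorm (U *m X) = hsnorm X.
Proof.
move=> Uu; apply/eqP; rewrite -(@eqrXn2 _ 2) ?hsnorm_ge0// !hsnorm_sqr_col.
by apply/eqP; apply: eq_bigr => j _; rewrite !colE -mulmxA (l2norm_unitary _ Uu).
Qed.

Lemma hsnorm_adj n (X : 'M[C]_n) : hsnorm (X ^t*) = hsnorm X.
Proof.
apply/eqP; rewrite -(@eqrXn2 _ 2) ?hsnorm_ge0// !hsnorm_sqr exchange_big/=.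
apply/eqP; apply: eq_bigr => i _; apply: eq_bigr => j _.
by rewrite !mxE normc_conj.
Qed.

Lemma hsnorm_conj n (U X : 'M[C]_n) : U \is unitarymx ->
  hsnorm (U *m X *m invmx U) = hsnorm X.
Proof.
move=> Uu; rewrite -mulmxA (hsnorm_mulUl _ Uu) -hsnorm_adj adjmxM.
rewrite (invmx_unitary Uu) trmxCK (hsnorm_mulUl _ Uu).
exact: hsnorm_adj.
Qed.

End OperatorNormFacts.

Opaque opnorm l2norm unitarymx.

(** * The topology of matrices *)

Section MatrixTopology.
Variable R : realType.
Local Notation C := R[i].

Lemma normr_normc (z : C) : `|z| = (normc z)%:C.
Proof. by case: z. Qed.

Lemma nbhs_normcP (z : C) (A : set C) :
  nbhs z A <-> exists2 e : R, 0 < e & forall w, normc (w - z) < e -> A w.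
Proof.
split=> [/nbhs_ballP[e /= e0 eA]|[e e0 eA]].
  exists (complex.Re e) => [|w we]; first by move: e0; rewrite ltcE/= => /andP[_].
  apply: eA; rewrite -ball_normE/= distrC normr_normc.
  move: e0; rewrite ltcE/= => /andP[/eqP Ime _]; case: e Ime we => a b /= -> we.
  by rewrite ltcE/= eqxx.
apply/nbhs_ballP; exists e%:C => /=; first by rewrite ltcR.
by move=> w; rewrite -ball_normE/= distrC normr_normc ltcR => /eA.
Qed.

(** The topology of matrices is entrywise; from here on it is handled through the operator norm. *)
Lemma nbhs_opnormP n (X : 'M[C]_n) (A : set 'M[C]_n) :
  nbhs X A <-> exists2 e : R, 0 < e & forall Y, opnorm (Y - X) < e -> A Y.
Proof.
split=> [[P PX PA]|[e e0 eA]].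
  pose e_ (p : 'I_n * 'I_n) : R :=
    projT1 (cid2 (iffLR (nbhs_normcP _ _) (PX p.1 p.2))).
  have e_gt0 p : 0 < e_ p by rewrite /e_; case: cid2.
  exists (\big[Num.min/1]_p e_ p); first by apply: lt_bigmin.
  move=> Y Ye; apply: PA => i j /=.
  have [_ eP] : 0 < e_ (i, j) /\ forall w, normc (w - X i j) < e_ (i, j) -> P i j w.
    by rewrite /e_; case: cid2.
  apply: eP; have -> : Y i j - X i j = (Y - X) i j by rewrite !mxE.
  rewrite (le_lt_trans (entry_le_opnorm _ _ _))// (lt_le_trans Ye)//.
  exact: bigmin_le_cond.
(* The n * n entries, each at most [d], sum to less than [e]; the successor keeps this strict and
   covers n = 0. *)
pose d := e / (n * n).+1%:R.
have d0 : 0 < d by rewrite divr_gt0.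
exists (fun i j => [set w | normc (w - X i j) < d]) => [i j|Y YP].
  by apply/nbhs_normcP; exists d.
apply: eA; rewrite (le_lt_trans (opnorm_le_sum _))//.
apply: (@le_lt_trans _ _ (\sum_(i < n) \sum_(j < n) d)).
  apply: ler_sum => i _; apply: ler_sum => j _.
  by rewrite !mxE; exact/ltW/YP.
rewrite !sumr_const !card_ord -mulrnA -mulr_natr /d mulrAC -mulrA.
by rewrite gtr_pMr// ltr_pdivrMr// mul1r ltr_nat.
Qed.

Lemma cvg_opnormP (T : Type) (F : set_system T) (FF : Filter F) n
    (f : T -> 'M[C]_n) (X : 'M[C]_n) :
  f @ F --> X <-> forall e : R, 0 < e -> \forall x \near F, opnorm (f x - X) < e.
Proof.
split=> [h e e0|h A /nbhs_opnormP[e e0 eA]].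
  have hX : nbhs X [set Y | opnorm (Y - X) < e] by apply/nbhs_opnormP; exists e.
  by have := h _ hX; rewrite nbhs_simpl/=.
rewrite nbhs_simpl/=; apply: filterS (h e e0) => x /=; exact: eA.
Qed.

Lemma cvg_normP (T : Type) (F : set_system T) (FF : Filter F) (f : T -> R) (l : R) :
  (forall e : R, 0 < e -> \forall x \near F, `|f x - l| < e) -> f @ F --> l.
Proof.
move=> h; apply/(@cvgrPdist_lt R R^o T F FF) => e e0.
by apply: filterS (h e e0) => x; rewrite distrC.
Qed.

Lemma opnormBC n (X Y : 'M[C]_n) : opnorm (X - Y) = opnorm (Y - X).
Proof. by rewrite -opnormN opprB. Qed.

Lemma opnormB_triangle n (X Y Z : 'M[C]_n) :
  opnorm (X - Z) <= opnorm (X - Y) + opnorm (Y - Z).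
Proof.
have -> : X - Z = (X - Y) + (Y - Z) by rewrite addrA subrK.
exact: opnormD.
Qed.

Lemma opnorm_dist n (X Y : 'M[C]_n) : `|opnorm Y - opnorm X| <= opnorm (Y - X).
Proof.
have h (Z W : 'M[C]_n) : opnorm Z <= opnorm (Z - W) + opnorm W.
  by rewrite -{1}(subrK W Z); exact: opnormD.
rewrite ler_norml lerBlDr h andbT lerBrDr addrC lerBlDr addrC opnormBC.
exact: h.
Qed.

Lemma opnorm_cts n : continuous (@opnorm R n).
Proof.
move=> X; apply: (@cvg_normP _ (nbhs X) (nbhs_filter X)) => e e0.
have hX : nbhs X [set Y | opnorm (Y - X) < e] by apply/nbhs_opnormP; exists e.
apply: (@filterS _ (nbhs X) (nbhs_filter X) _ _ _ hX) => Y /= YX.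
exact: le_lt_trans (opnorm_dist X Y) YX.
Qed.

Lemma hausdorff_mx n : hausdorff_space 'M[C]_n.
Proof.
move=> X Y XY; apply/eqP; rewrite -subr_eq0; apply/eqP/opnorm_eq0/eqP.
rewrite eq_le opnorm_ge0 andbT; apply/ler_addgt0Pr => e e0; rewrite add0r.
have e20 : 0 < e / 2 by rewrite divr_gt0.
have [] := XY [set Z | opnorm (Z - X) < e / 2] [set Z | opnorm (Z - Y) < e / 2].
- by apply/nbhs_opnormP; exists (e / 2).
- by apply/nbhs_opnormP; exists (e / 2).
move=> Z [/= ZX ZY]; rewrite opnormBC in ZX.
apply: (le_trans (opnormB_triangle X Z Y)); rewrite [leRHS]splitr.
exact: lerD (ltW ZX) (ltW ZY).
Qed.

Lemma compact_normc_disc (M : R) : compact [set z : C | normc z <= M].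
Proof.
pose h (p : R * R) : C := p.1 +i* p.2.
have ch : continuous h.
  move=> [a b] A /nbhs_normcP[e e0 eA].
  have e20 : 0 < e / 2 by rewrite divr_gt0.
  exists ([set x | `|a - x| < e / 2], [set y | `|b - y| < e / 2]) => /=.
    by split; apply/nbhs_ballP; exists (e / 2).
  move=> [x y] [/= xa yb]; apply: eA.
  rewrite (le_lt_trans (normc_le_ReIm _))// [ltRHS]splitr /= ltrD//.
    by rewrite distrC.
  by rewrite distrC.
have c : compact (h @` (`[- M, M] `*` `[- M, M])%classic).
  apply: continuous_compact; first exact: continuous_subspaceT.
  by apply: compact_setX; exact: segment_compact.
apply: (subclosed_compact _ c).
  have -> : [set z : C | normc z <= M] = (@normc R : C -> R) @^-1` [set x | x <= M] by [].
  apply: preimage_closed; last exact: closed_le.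
  move=> z _; apply: (@cvg_normP _ (nbhs z) (nbhs_filter z)) => e e0.
  have hz : nbhs z [set w | normc (w - z) < e] by apply/nbhs_normcP; exists e.
  apply: (@filterS _ (nbhs z) (nbhs_filter z) _ _ _ hz) => w /= we.
  apply: le_lt_trans we; rewrite ler_norml; apply/andP; split.
    rewrite lerBrDr addrC lerBlDr -[normc (w - z)]normcN opprB addrC.
    by rewrite -{1}(subrK w z) le_normcD.
  by rewrite lerBlDr -{1}(subrK z w) le_normcD.
move=> z /= zM; exists (complex.Re z, complex.Im z); last by case: z zM.
by split; rewrite /= in_itv/= -ler_norml (le_trans _ zM)// ?normc_Re ?normc_Im.
Qed.

Lemma compact_opnorm_ball n (M : R) : compact [set X : 'M[C]_n | opnorm X <= M].
Proof.
have c1 := @tychonoff ('I_n * 'I_n)%type (fun=> C) (fun=> [set z | normc z <= M])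
  (fun=> @compact_normc_disc M).
pose h (f : prod_topology (fun _ : 'I_n * 'I_n => C)) : 'M[C]_n :=
  \matrix_(i, j) f (i, j).
have ch : continuous h.
  apply/continuous_mxP => i j.
  have -> : (fun f => h f i j) = (fun f => f (i, j)) by apply/funext => f; rewrite mxE.
  exact: (@proj_continuous _ (fun _ : 'I_n * 'I_n => C) (i, j)).
have c2 := continuous_compact (continuous_subspaceT ch) c1.
apply: (subclosed_compact _ c2).
  apply: (@preimage_closed _ _ (@opnorm R n) [set x | x <= M]); last exact: closed_le.
  by move=> X _; exact: opnorm_cts.
move=> X /= XM; exists (fun p => X p.1 p.2); last first.
  by apply/matrixP => i j; rewrite mxE.
by move=> p; rewrite (le_trans (entry_le_opnorm _ _ _)).
Qed.

Lemma continuous_opnormP (X : topologicalType) n (f : X -> 'M[C]_n) :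
  continuous f <->
  forall x (e : R), 0 < e -> \forall y \near x, opnorm (f y - f x) < e.
Proof. by split=> [cf x|cf x]; apply/cvg_opnormP; exact: cf. Qed.

Lemma compact_unitary_group n : compact (unitary_group R n).
Proof.
apply: (subclosed_compact _ (@compact_opnorm_ball n 1)).
  have -> : unitary_group R n = (fun U : 'M[C]_n => U *m U ^t*) @^-1` [set 1%:M].
    by apply/seteqP; split=> U /unitarymxP.
  apply: preimage_closed => [U _|].
    have ci : continuous (id : 'M[C]_n -> 'M[C]_n) by move=> ?; exact: cvg_id.
    exact: (continuous_mx_mul ci (continuous_mx_adj ci)).
  exact/accessible_closed_set1/hausdorff_accessible/hausdorff_mx.
move=> U Uu /=; apply: opnorm_le => v v1.
by rewrite (l2norm_unitary _ Uu).
Qed.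

Lemma compact_set_type (X : topologicalType) (A : set X) :
  compact A -> compact [set: A].
Proof.
move=> cA F FF _.
have [|p [Ap clp]] := cA (set_val @ F) _.
  change (F (set_val @^-1` A)).
  by apply: (@filterS _ F _ setT) => [a _|]; [exact: set_valP|exact: filterT].
exists (exist _ p (mem_set Ap)); split=> // B N FB [V [[W oW WE] pV VN]].
have Wp : nbhs p W.
  by apply: open_nbhs_nbhs; split=> //; move: pV; rewrite -WE.
have FB' : (set_val @ F) (set_val @` B).
  by apply: (@filterS _ F _ B) FB => b Bb; exists b.
have [q [[b Bb bq] Wq]] := clp _ _ FB' Wp.
by exists b; split=> //; apply: VN; rewrite -WE /preimage/= bq.
Qed.

Lemma hausdorff_set_type (X : topologicalType) (A : set X) :
  hausdorff_space X -> hausdorff_space A.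
Proof.
move=> hX a b ab; apply/val_inj/hX => U V Ua Vb.
have Ua' : nbhs a (set_val @^-1` U) := @initial_continuous A X set_val a U Ua.
have Vb' : nbhs b (set_val @^-1` V) := @initial_continuous A X set_val b V Vb.
by have [c [Uc Vc]] := ab _ _ Ua' Vb'; exists (set_val c).
Qed.

Lemma val_continuous (X : topologicalType) (A : set X) :
  continuous (set_val : A -> X).
Proof. exact: initial_continuous. Qed.

Lemma to_set_type_continuous (Y X : topologicalType) (A : set X) (f : Y -> A) :
  continuous (fun y => set_val (f y)) -> continuous f.
Proof.
move=> cf y N [V [[W oW WE] yV VN]].
have := cf y W; rewrite /nbhs/= => h.
apply: filterS (h _) => [z Wz|].
  by apply: VN; rewrite -WE.
by apply: open_nbhs_nbhs; split=> //; move: yV; rewrite -WE.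
Qed.

(** Completeness by compactness: the image filter lies in a compact ball, so it has a cluster point,
    and the Cauchy condition upgrades clustering to convergence. *)
Lemma mx_cauchy_cvg (T : Type) (F : set_system T) n (f : T -> 'M[C]_n) :
  ProperFilter F ->
  (forall e : R, 0 < e -> exists X : 'M[C]_n, \forall t \near F, opnorm (f t - X) <= e) ->
  exists X : 'M[C]_n, f @ F --> X.
Proof.
move=> FF cf; have [X0 FX0] := cf 1 ltr01.
have bd : (f @ F) [set X : 'M[C]_n | opnorm X <= opnorm X0 + 1].
  apply: filterS FX0 => t ft; rewrite /= -(subrK X0 (f t)).
  apply: (le_trans (opnormD _ _)); rewrite addrC; exact: lerD.
have [X [_ clX]] := compact_opnorm_ball (fmap_proper_filter f FF) bd.
exists X; apply/cvg_opnormP => e e0.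
have e40 : 0 < e / 4 by rewrite divr_gt0.
have e4e : e / 4 + e / 4 + e / 4 <= e by clear -e0; lra.
have [Y FY] := cf _ e40.
have [|Z [/= ZY ZX]] := clX [set Z | opnorm (Z - Y) <= e / 4]
    [set Z | opnorm (Z - X) < e / 4] FY.
  by apply/nbhs_opnormP; exists (e / 4).
apply: filterS FY => t ft.
have -> : f t - X = (f t - Y) - (Z - Y) + (Z - X).
  by apply/matrixP => i j; rewrite !mxE; ring.
apply: (le_lt_trans (opnormD _ _)).
have h : opnorm (f t - Y - (Z - Y)) <= e / 4 + e / 4.
  apply: (le_trans (opnormD _ _)); rewrite opnormN.
  exact: lerD ft ZY.
apply: (lt_le_trans (ler_ltD h ZX)).
exact: e4e.
Qed.

End MatrixTopology.

(** * Towers *)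

Section TowerBasics.
Variables (R : realType) (T : towerData R).
Hypothesis HT : is_tower T.
Local Notation C := R[i].
Implicit Types x y z : T.

(** The axioms speak of matrices of size literally [deg x]. This and the following variants take the
    size up to a propositional equation, so that composites of [act] and [oplus] need no casts. *)
Lemma deg_actE n (U : 'M[C]_n) x : deg x = n -> U \is unitarymx ->
  deg (act U x) = n.
Proof. by move=> e; subst n => Uu; exact: deg_act. Qed.

Lemma act1E n x : deg x = n -> act (1%:M : 'M[C]_n) x = x.
Proof. by move=> <-; exact: act1. Qed.

Lemma actME n (U V : 'M[C]_n) x : deg x = n -> U \is unitarymx ->
  V \is unitarymx -> act (U *m V) x = act U (act V x).
Proof. by move=> e; subst n => Uu Vu; exact: actM. Qed.

Lemma act_oplusE m n (U : 'M[C]_m) (V : 'M[C]_n) x y : deg x = m -> deg y = n ->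
  U \is unitarymx -> V \is unitarymx ->
  act (dsum_mx U V) (oplus x y) = oplus (act U x) (act V y).
Proof. by move=> e1 e2; subst m n => Uu Vu; exact: act_oplus. Qed.

Lemma deg_oplusE m n x y : deg x = m -> deg y = n -> deg (oplus x y) = (m + n)%N.
Proof. by move=> <- <-; exact: deg_oplus. Qed.

Lemma actVK n (U : 'M[C]_n) x : deg x = n -> U \is unitarymx ->
  act (invmx U) (act U x) = x.
Proof.
move=> e Uu; rewrite -(actME e (unitarymxV Uu) Uu).
by rewrite (mulVmx (unitarymx_unit Uu)) act1E.
Qed.

Lemma actKV n (U : 'M[C]_n) x : deg x = n -> U \is unitarymx ->
  act U (act (invmx U) x) = x.
Proof.
move=> e Uu; rewrite -(actME e Uu (unitarymxV Uu)).
by rewrite (mulmxV (unitarymx_unit Uu)) act1E.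
Qed.

Lemma tequivE n x y : deg x = n -> tequiv x y ->
  exists2 U : 'M[C]_n, U \is unitarymx & act U x = y.
Proof. by move=> e; subst n => -[U [Uu Uxy]]; exists U. Qed.

Lemma tequiv_intro n (U : 'M[C]_n) x : deg x = n -> U \is unitarymx ->
  tequiv x (act U x).
Proof. by move=> e; subst n => Uu; exists U. Qed.

Lemma tequiv_refl x : tequiv x x.
Proof. by exists 1%:M; split; [exact: unitarymx1|exact: act1]. Qed.

Lemma tequiv_deg x y : tequiv x y -> deg y = deg x.
Proof. by move=> [U [Uu <-]]; rewrite (deg_actE _ Uu). Qed.

Lemma tequiv_sym x y : tequiv x y -> tequiv y x.
Proof.
move=> [U [Uu <-]]; have d := deg_actE erefl Uu.
by have := tequiv_intro d (unitarymxV Uu); rewrite (actVK erefl Uu).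
Qed.

Lemma tequiv_trans x y z : tequiv x y -> tequiv y z -> tequiv x z.
Proof.
move=> [U [Uu <-]] /(tequivE (deg_actE erefl Uu))[V Vu <-].
rewrite -(actME erefl Vu Uu).
exact: (tequiv_intro erefl (mul_unitarymx Vu Uu)).
Qed.

Lemma tequiv_oplus x x' y y' : tequiv x x' -> tequiv y y' ->
  tequiv (oplus x y) (oplus x' y').
Proof.
move=> [U [Uu <-]] [V [Vu <-]]; rewrite -(act_oplusE erefl erefl Uu Vu).
by apply: tequiv_intro; [exact: deg_oplus|exact: unitarymx_dsum].
Qed.

Lemma tequiv_swap x y : tequiv (oplus x y) (oplus y x).
Proof.
rewrite -(act_swap HT x y); apply: tequiv_intro; first exact: deg_oplus.
exact: unitarymx_swap.
Qed.

Lemma reducibleE n x : deg x = n -> reducible x ->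
  exists2 V : 'M[C]_n, V \is unitarymx & exists a b, act V x = oplus a b.
Proof. by move=> e; subst n => -[V [Vu h]]; exists V. Qed.

Lemma core_tequiv x y : tequiv x y -> core T x -> core T y.
Proof.
move=> [U [Uu <-]] cx; have d := deg_actE erefl Uu.
move=> /(reducibleE d)[V Vu [a [b Vab]]]; apply: cx.
exists (V *m U); split; first exact: (mul_unitarymx Vu Uu).
by exists a, b; rewrite (actME erefl Vu Uu).
Qed.

Lemma not_core_oplus x y : ~ core T (oplus x y).
Proof.
apply; exists 1%:M; split; first exact: unitarymx1.
by exists x, y; rewrite act1E.
Qed.

Lemma not_core_tequiv x y z : tequiv z (oplus x y) -> ~ core T z.
Proof. by move=> zxy /(core_tequiv zxy); exact: not_core_oplus. Qed.

Lemma tsub_tequivl x y z : tequiv x y -> tsub x z -> tsub y z.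
Proof.
move=> xy [xz|[a [b [xa zab]]]]; first by left; exact: tequiv_trans (tequiv_sym xy) xz.
by right; exists a, b; split=> //; exact: tequiv_trans (tequiv_sym xy) xa.
Qed.

Lemma tsub_tequivr x y z : tequiv y z -> tsub x y -> tsub x z.
Proof.
move=> yz [xy|[a [b [xa yab]]]]; first by left; exact: tequiv_trans xy yz.
by right; exists a, b; split=> //; exact: tequiv_trans (tequiv_sym yz) yab.
Qed.

Lemma tsub_refl x : tsub x x.
Proof. by left; exact: tequiv_refl. Qed.

Lemma tsub_oplusl a x y : tsub a x -> tsub a (oplus x y).
Proof.
move=> [ax|[a' [b [aa' xab]]]].
  by right; exists x, y; split=> //; exact: tequiv_refl.
right; exists a', (oplus b y); split=> //; rewrite oplusA//.
exact: tequiv_oplus xab (tequiv_refl y).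
Qed.

Lemma tsub_oplusr a x y : tsub a y -> tsub a (oplus x y).
Proof. by move=> ay; exact: tsub_tequivr (tequiv_swap y x) (tsub_oplusl x ay). Qed.

Lemma tsub_deg x y : tsub x y -> (deg x <= deg y)%N.
Proof.
move=> [/tequiv_deg ->//|[a [b [/tequiv_deg e /tequiv_deg]]]].
by rewrite deg_oplus// e => <-; exact: leq_addr.
Qed.

Lemma tsub_deg_eq x y : tsub x y -> deg x = deg y -> tequiv x y.
Proof.
move=> [//|[a [b [/tequiv_deg e /tequiv_deg]]]].
rewrite deg_oplus// e => <- h; exfalso.
by have := deg_gt0 b; rewrite -(ltn_add2l (deg x)) addn0 -h ltnn.
Qed.

Lemma tsub_core a t : core T t -> tsub a t -> tequiv a t.
Proof. by move=> ct [//|[a' [b [_ /not_core_tequiv]]]]. Qed.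

Lemma tdisjoint_sym x y : tdisjoint x y -> tdisjoint y x.
Proof. by move=> xy [a [ay ax]]; apply: xy; exists a. Qed.

Lemma core_tdisjointN t x : core T t -> ~ tdisjoint t x -> tsub t x.
Proof.
move=> ct /contrapT[a [/(tsub_core ct) at_ ax]].
exact: tsub_tequivl at_ ax.
Qed.

Lemma tsub_tdisjointN t x : tsub t x -> ~ tdisjoint t x.
Proof. by move=> tx; apply; exists t; split=> //; exact: tsub_refl. Qed.

(** Strong induction on the degree: a reducible point is, up to a unitary, a sum of two points of
    smaller degree. *)
Lemma tower_ind (P : T -> Prop) :
  (forall x, core T x -> P x) -> (forall x y, P x -> P y -> P (oplus x y)) ->
  (forall x (U : 'M[C]_(deg x)), U \is unitarymx -> P x -> P (act U x)) ->
  forall x, P x.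
Proof.
move=> Pc Ps Pa x; have [n] := ubnP (deg x); elim: n x => // n IHn x xn.
have [/Pc//|/contrapT[V [Vu [a [b Vab]]]]] := pselect (core T x).
have d := deg_actE erefl Vu.
rewrite -(actVK erefl Vu).
have dV : deg x = deg (act V x) by rewrite d.
have h : P (act V x).
  have dab : (deg a + deg b = deg x)%N by rewrite -d Vab deg_oplus.
  rewrite Vab; apply: Ps; apply: IHn; rewrite (leq_trans _ (_ : deg x <= n)%N)//.
    by rewrite -dab -[X in (X < _)%N]addn0 ltn_add2l deg_gt0.
  by rewrite -dab -[X in (X < _)%N]add0n ltn_add2r deg_gt0.
(* The size is generalized because the inverse unitary has size [deg x], which equals
   [deg (act V x)] only propositionally. *)
suff H (m : nat) (W : 'M[C]_m) : deg (act V x) = m -> W \is unitarymx -> P (act W (act V x)).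
  exact: H (unitarymxV Vu).
by move=> e; subst m => Wu; exact: Pa.
Qed.

Lemma exists_core_tsub x : exists2 t, core T t & tsub t x.
Proof.
elim/tower_ind: x => [x cx|x y [t ct tx] _|x U Uu [t ct tx]].
- by exists x => //; exact: tsub_refl.
- by exists t => //; exact: tsub_oplusl.
- by exists t => //; apply: tsub_tequivr tx; exact: tequiv_intro.
Qed.

End TowerBasics.

(* Matrices of variable size as infinite arrays; this keeps casts along equations
   between degrees out of the arguments below. *)
Section UntypedMatrices.
Variable R : realType.
Local Notation C := R[i].

Definition umx := nat -> nat -> C.

Definition mat n (M : umx) : 'M[C]_n := \matrix_(i, j) M i j.

Definition pad n (X : 'M[C]_n) : umx := fun i j =>
  if insub i is Some i' then if insub j is Some j' then X i' j' else 0 else 0.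

Definition wf n (M : umx) := pad (mat n M) = M.

Definition uconj n (U : 'M[C]_n) (M : umx) : umx := pad (U *m mat n M *m invmx U).

Definition udsum m n (M N : umx) : umx := fun i j =>
  if (i < m)%N && (j < m)%N then M i j else
  if [&& m <= i, m <= j, i < m + n & j < m + n]%N then N (i - m)%N (j - m)%N else 0.

Lemma padE n (X : 'M[C]_n) (i j : 'I_n) : pad X i j = X i j.
Proof. by rewrite /pad !valK. Qed.

Lemma pad_out n (X : 'M[C]_n) i j : ~~ ((i < n) && (j < n))%N -> pad X i j = 0.
Proof.
rewrite /pad; case: insubP => [i' -> _|//]; case: insubP => [j' -> _|//].
by [].
Qed.

Lemma matK n (X : 'M[C]_n) : mat n (pad X) = X.
Proof. by apply/matrixP => i j; rewrite mxE padE. Qed.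

Lemma pad_inj n : injective (@pad n).
Proof. exact: can_inj (@matK n). Qed.

Lemma wf_pad n (X : 'M[C]_n) : wf n (pad X).
Proof. by rewrite /wf matK. Qed.

Lemma wfP n M : (forall i j, ~~ ((i < n) && (j < n))%N -> M i j = 0) -> wf n M.
Proof.
move=> h; apply/funext => i; apply/funext => j.
have [/andP[lin ljn]|nij] := boolP ((i < n) && (j < n))%N; last first.
  by rewrite pad_out// h.
by have := padE (mat n M) (Ordinal lin) (Ordinal ljn); rewrite mxE.
Qed.

Lemma pad_conform m n (X : 'M[C]_m) : m = n -> pad (conform_mx (0 : 'M[C]_n) X) = pad X.
Proof. by move=> e; case: _ / e; rewrite conform_mx_id. Qed.

Lemma mat_pad_conform m n (X : 'M[C]_m) : m = n ->
  mat n (pad X) = conform_mx (0 : 'M[C]_n) X.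
Proof. by move=> e; case: _ / e; rewrite conform_mx_id matK. Qed.

Lemma pad_castmx m n (e : m = n) (X : 'M[C]_m) : pad (castmx (e, e) X) = pad X.
Proof. by case: _ / e; rewrite castmx_id. Qed.

Lemma mat_udsum m n M N : mat (m + n) (udsum m n M N) = dsum_mx (mat m M) (mat n N).
Proof.
apply/matrixP => i j; rewrite mxE /udsum /dsum_mx.
case: (split_ordP i) => i' ->; case: (split_ordP j) => j' ->;
  rewrite ?block_mxEul ?block_mxEur ?block_mxEdl ?block_mxEdr ?mxE/= ?ltn_ord ?[(m + _ < m)%N]ltnNge ?leq_addr ?andbF/=.
- by [].
- by rewrite [(m <= i')%N]leqNgt ltn_ord.
- by rewrite [(m <= j')%N]leqNgt ltn_ord.
- by rewrite ?leq_addr !ltn_add2l !ltn_ord !addKn.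
Qed.

Lemma wf_udsum m n M N : wf (m + n) (udsum m n M N).
Proof.
apply: wfP => i j nij; rewrite /udsum.
case: ifP => [/andP[lim ljm]|_].
  by move: nij; rewrite !ltn_addr.
by case: ifP => // /and4P[_ _ h1 h2]; rewrite h1 h2 in nij.
Qed.

Lemma pad_dsum m n (X : 'M[C]_m) (Y : 'M[C]_n) :
  pad (dsum_mx X Y) = udsum m n (pad X) (pad Y).
Proof.
by rewrite -[RHS](wf_udsum m n) mat_udsum !matK.
Qed.

(** For arrays associativity is a plain equation, whereas block matrices would need a cast along
    associativity of addition. *)
Lemma udsumA m n p L M N : udsum m (n + p) L (udsum n p M N) =
  udsum (m + n) p (udsum m n L M) N.
Proof.
apply/funext => i; apply/funext => j; rewrite /udsum addnA !subnDA.
have [im|im] := ltnP i m; have [jm|jm] := ltnP j m => /=.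
- by rewrite !ltn_addr.
- rewrite [(i < m + n)%N]ltn_addr//=.
  by case: ifP => // _; case: ifP => // /and4P[]; lia.
- rewrite [(j < m + n)%N]ltn_addr//= andbT.
  by case: ifP => // _; case: ifP => // /and4P[]; lia.
have -> : (i - m < n)%N = (i < m + n)%N by lia.
have -> : (j - m < n)%N = (j < m + n)%N by lia.
have -> : (n <= i - m)%N = (m + n <= i)%N by lia.
have -> : (n <= j - m)%N = (m + n <= j)%N by lia.
have -> : (i - m < n + p)%N = (i < m + n + p)%N by lia.
have -> : (j - m < n + p)%N = (j < m + n + p)%N by lia.
have [imn|imn] := ltnP i (m + n)%N; have [jmn|jmn] := ltnP j (m + n)%N => /=.
- by rewrite !(ltn_addr p).
- by case: ifP => //; lia.
- by case: ifP => //; lia.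
- by case: ifP => //; case: ifP.
Qed.

Lemma uconj1 n M : wf n M -> uconj (1%:M : 'M[C]_n) M = M.
Proof. by move=> w; rewrite /uconj mul1mx invmx1 mulmx1. Qed.

Lemma uconjM n (U V : 'M[C]_n) M : U \is unitarymx -> V \is unitarymx ->
  uconj U (uconj V M) = uconj (U *m V) M.
Proof.
by move=> Uu Vu; rewrite /uconj matK (invmx_unitaryM Uu Vu) !mulmxA.
Qed.

Lemma wf_uconj n (U : 'M[C]_n) M : wf n (uconj U M).
Proof. exact: wf_pad. Qed.

Lemma uconjVK n (U : 'M[C]_n) M : U \is unitarymx -> wf n M ->
  uconj (invmx U) (uconj U M) = M.
Proof.
move=> Uu w; rewrite (uconjM _ (unitarymxV Uu) Uu).
by rewrite (mulVmx (unitarymx_unit Uu)) uconj1.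
Qed.

Lemma uconj_dsum m n (U : 'M[C]_m) (V : 'M[C]_n) M N :
  U \is unitarymx -> V \is unitarymx ->
  uconj (dsum_mx U V) (udsum m n M N) = udsum m n (uconj U M) (uconj V N).
Proof.
move=> Uu Vu; rewrite {1}/uconj mat_udsum (invmx_dsum Uu Vu) -!dsum_mx_mul.
exact: pad_dsum.
Qed.

Lemma uconj_swap m n M N : wf m M -> wf n N ->
  uconj (swap_mx R m n) (udsum m n M N) = udsum n m N M.
Proof.
move=> wM wN; rewrite /uconj mat_udsum -swap_mx_dsum.
rewrite mulmxK; last exact/unitarymx_unit/unitarymx_swap.
by rewrite pad_castmx pad_dsum -[in RHS]wM -[in RHS]wN.
Qed.

Lemma mat_uconj n (U : 'M[C]_n) M : mat n (uconj U M) = U *m mat n M *m invmx U.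
Proof. exact: matK. Qed.

Lemma udsum_inj m n L M L' M' : wf m L -> wf n M -> wf m L' -> wf n M' ->
  udsum m n L M = udsum m n L' M' -> L = L' /\ M = M'.
Proof.
move=> wL wM wL' wM' /(congr1 (mat (m + n))); rewrite !mat_udsum.
by move=> /dsum_mx_inj[h1 h2]; rewrite -wL -wM h1 h2.
Qed.

End UntypedMatrices.

(** * Algebraic functions *)

Lemma pad_matE (R : realType) n (M : umx R) i j :
  pad (mat n M) i j = if ((i < n) && (j < n))%N then M i j else 0.
Proof.
case: ifP => [/andP[lin ljn]|/negbT nij]; last by rewrite pad_out.
by have := padE (mat n M) (Ordinal lin) (Ordinal ljn); rewrite mxE.
Qed.

Section Powers.
Variables (R : realType) (T : towerData R).
Hypothesis HT : is_tower T.
Local Notation C := R[i].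
Implicit Types t : T.

(** Indexed by multiplicity minus one: this is the sum of m + 1 copies of t. *)
Definition tpow t m : T := nfold t m.+1.

Lemma tpowS t m : tpow t m.+1 = oplus t (tpow t m). Proof. by []. Qed.

Lemma deg_tpow t m : deg (tpow t m) = (\sum_(i < m.+1) deg t)%N.
Proof.
elim: m => [|m IHm]; first by rewrite big_ord_recl big_ord0 addn0.
by rewrite tpowS (deg_oplus HT)// IHm [RHS]big_ord_recl.
Qed.

Fixpoint upow t (M : umx R) m : umx R :=
  if m is m'.+1 then udsum (deg t) (deg (tpow t m')) M (upow t M m') else M.

Lemma wf_upow t M m : wf (deg t) M -> wf (deg (tpow t m)) (upow t M m).
Proof. by case: m => [//|m] w; rewrite tpowS (deg_oplus HT)//; exact: wf_udsum. Qed.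

(** The block-diagonal form matches the block matrices by which (mT4) describes the stabilizer. *)
Lemma mat_upow t M m :
  mat (\sum_(i < m.+1) deg t) (upow t M m) = \mxdiag_(i < m.+1) mat (deg t) M.
Proof.
elim: m => [|m IHm].
  rewrite mxdiag_recl; apply: pad_inj; rewrite pad_castmx -/(dsum_mx _ _) pad_dsum.
  rewrite [upow t M 0]/=; apply/funext => i; apply/funext => j.
  have E : (\sum_(i0 < 1) deg t = deg t)%N by rewrite big_ord_recl big_ord0 addn0.
  have E0 : (\sum_(i0 < 0) deg t = 0)%N by rewrite big_ord0.
  rewrite /udsum !pad_matE E; case: ifP => // _.
  by case: ifP => // /and4P[h1 _ h2 _]; exfalso; move: h2; rewrite E0; lia.
rewrite mxdiag_recl -IHm; apply: pad_inj; rewrite pad_castmx -/(dsum_mx _ _) pad_dsum.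
rewrite -[RHS]/(udsum _ _ _ _) -(wf_udsum _ _ _ _) mat_udsum !matK -mat_udsum.
rewrite wf_udsum [upow t M m.+1]/= deg_tpow.
have -> : (\sum_(i < m.+2) deg t = deg t + \sum_(i < m.+1) deg t)%N.
  by rewrite big_ord_recl.
exact: wf_udsum.
Qed.

End Powers.

Section AlgebraicExtension.
Variables (R : realType) (T : towerData R).
Hypothesis Hm : is_mtower T.
Let HT := mtower_tower Hm.
Local Notation C := R[i].
Implicit Types x y z t b : T.

(** The contrapositive of (mT1), since an irreducible t that is not disjoint from x lies below x. *)
Lemma core_tsub_oplus t x y : core T t -> tsub t (oplus x y) ->
  tsub t x \/ tsub t y.
Proof.
move=> ct txy; have [tx|ntx] := pselect (tdisjoint t x); last first.
  by left; exact: core_tdisjointN ntx.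
have [ty|nty] := pselect (tdisjoint t y); last by right; exact: core_tdisjointN nty.
exfalso; exact: (tsub_tdisjointN HT txy (mtower_disjoint Hm tx ty)).
Qed.

(** The algebraic half of membership in C*(T), without continuity or boundedness. Padding absorbs
    the equations between the degrees of [act U x], [oplus x y] and their arguments. *)
Definition is_alg (f : tfun T) : Prop :=
  (forall x (U : 'M[C]_(deg x)), U \is unitarymx ->
    pad (f (act U x)) = uconj U (pad (f x))) /\
  (forall x y, pad (f (oplus x y)) = udsum (deg x) (deg y) (pad (f x)) (pad (f y))).

Definition core_equivariant (g : tfun T) : Prop :=
  forall x (U : 'M[C]_(deg x)), core T x -> U \is unitarymx ->
    pad (g (act U x)) = uconj U (pad (g x)).

Lemma is_alg_core f : is_alg f -> core_equivariant f.
Proof. by move=> [fa _] x U _; exact: fa. Qed.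

(* A relation and not a function, since a point arises in several ways; [uval_uniq]
   shows that the value does not depend on them. *)
Inductive uval (g : tfun T) : T -> umx R -> Prop :=
| uval_core x : core T x -> uval g x (pad (g x))
| uval_sum x y M N : uval g x M -> uval g y N ->
    uval g (oplus x y) (udsum (deg x) (deg y) M N)
| uval_act x M (U : 'M[C]_(deg x)) : U \is unitarymx -> uval g x M ->
    uval g (act U x) (uconj U M).

Lemma uval_wf g x M : uval g x M -> wf (deg x) M.
Proof.
elim=> [{}x cx|{}x y {}M N _ _ _ _|{}x {}M U Uu _ _]; first exact: wf_pad.
  by rewrite deg_oplus//; exact: wf_udsum.
by rewrite (deg_actE HT erefl Uu); exact: wf_uconj.
Qed.

Lemma uval_ex g x : exists M, uval g x M.
Proof.
elim/(tower_ind HT): x => [x cx|x y [M xM] [N yN]|x U Uu [M xM]].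
- by exists (pad (g x)); exact: uval_core.
- by eexists; exact: uval_sum xM yN.
- by eexists; exact: uval_act Uu xM.
Qed.

(** Unitary equivalence of pairs consisting of a point and a value at it, both moved by the same
    unitary. *)
Definition peq x (M : umx R) y (N : umx R) : Prop :=
  exists U : 'M[C]_(deg x), [/\ U \is unitarymx, y = act U x & N = uconj U M].

Lemma peq_intro n (U : 'M[C]_n) x M : deg x = n -> U \is unitarymx ->
  peq x M (act U x) (uconj U M).
Proof. by move=> e; subst n => Uu; exists U. Qed.

Lemma peqE n x M y N : deg x = n -> peq x M y N ->
  exists U : 'M[C]_n, [/\ U \is unitarymx, y = act U x & N = uconj U M].
Proof. by move=> e; subst n. Qed.

Lemma peq_refl x M : wf (deg x) M -> peq x M x M.
Proof.
move=> w; exists 1%:M; split; first exact: unitarymx1.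
  by rewrite (act1E HT).
by rewrite uconj1.
Qed.

Lemma peq_trans x M y N z P : peq x M y N -> peq y N z P -> peq x M z P.
Proof.
move=> [U [Uu -> ->]] /(peqE (deg_actE HT erefl Uu))[V [Vu -> ->]].
rewrite -(actME HT erefl Vu Uu) (uconjM _ Vu Uu).
exact: peq_intro erefl (mul_unitarymx Vu Uu).
Qed.

Lemma peq_sum x M x' M' y N y' N' : peq x M x' M' -> peq y N y' N' ->
  peq (oplus x y) (udsum (deg x) (deg y) M N)
      (oplus x' y') (udsum (deg x') (deg y') M' N').
Proof.
move=> [U [Uu -> ->]] [V [Vu -> ->]].
rewrite (deg_actE HT erefl Uu) (deg_actE HT erefl Vu).
rewrite -(act_oplusE HT erefl erefl Uu Vu) -(uconj_dsum _ _ Uu Vu).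
exact: peq_intro (deg_oplus HT _ _) (unitarymx_dsum Uu Vu).
Qed.

Lemma peq_swap x M y N : wf (deg x) M -> wf (deg y) N ->
  peq (oplus x y) (udsum (deg x) (deg y) M N) (oplus y x) (udsum (deg y) (deg x) N M).
Proof.
move=> wM wN; rewrite -(act_swap HT x y) -(uconj_swap wM wN).
exact: peq_intro (deg_oplus HT _ _) (unitarymx_swap _ _ _).
Qed.

Lemma peq_tequiv x M y N : peq x M y N -> tequiv x y.
Proof. by move=> [U [Uu -> _]]; exists U. Qed.

Lemma uval_core_inv g x M : core_equivariant g -> uval g x M -> core T x ->
  M = pad (g x).
Proof.
move=> geq; elim=> [//|{}x y {}M N _ _ _ _ /not_core_oplus|{}x {}M U Uu _ IH cx].
  by move=> /(_ HT).
have cx' : core T x.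
  exact: (core_tequiv HT (tequiv_sym HT (tequiv_intro erefl Uu)) cx).
by rewrite IH// geq.
Qed.

(** By induction on the derivation of the value: the part t is brought to the front by associativity
    and the swap (T6), and it carries its prescribed value [g t] along. *)
Lemma split_one g t x M : core_equivariant g -> core T t -> uval g x M ->
  tsub t x -> peq t (pad (g t)) x M \/
  exists b B, uval g b B /\ peq (oplus t b) (udsum (deg t) (deg b) (pad (g t)) B) x M.
Proof.
move=> geq ct; have wt := @wf_pad _ _ (g t).
elim=> [{}x cx tx|{}x y {}M N xM IHx yN IHy txy|{}x {}M U Uu xM IHx tx].
- have [U [Uu <-]] := tsub_core HT cx tx.
  by left; rewrite geq//; exact: peq_intro.
- have wM := uval_wf xM; have wN := uval_wf yN.
  have tsum z Z w W : uval g z Z -> uval g w W ->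
      (peq t (pad (g t)) z Z \/ exists b B, uval g b B /\
        peq (oplus t b) (udsum (deg t) (deg b) (pad (g t)) B) z Z) ->
      exists b B, uval g b B /\ peq (oplus t b) (udsum (deg t) (deg b) (pad (g t)) B)
        (oplus z w) (udsum (deg z) (deg w) Z W).
    move=> zZ wW [h|[b [B [bB h]]]].
      by exists w, W; split=> //; apply: (peq_sum h (peq_refl (uval_wf wW))).
    exists (oplus b w), (udsum (deg b) (deg w) B W); split; first exact: uval_sum.
    have := peq_sum h (peq_refl (uval_wf wW)).
    by rewrite !(deg_oplus HT) (oplusA HT) -udsumA.
  right; have [tx|ty] := core_tsub_oplus ct txy; first exact: tsum (IHx tx).
  have [b [B [bB h]]] := tsum _ _ _ _ yN xM (IHy ty).
  by exists b, B; split=> //; apply: peq_trans h _; exact: peq_swap.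
- have tx' : tsub t x.
    exact: (tsub_tequivr HT (tequiv_sym HT (tequiv_intro erefl Uu)) tx).
  have pU : peq x M (act U x) (uconj U M) by exact: peq_intro.
  have [h|[b [B [bB h]]]] := IHx tx'; first by left; exact: peq_trans h pU.
  by right; exists b, B; split=> //; exact: peq_trans h pU.
Qed.

(** By (mT4) such a W has scalar blocks, hence commutes with a diagonal of equal blocks M. *)
Lemma stab_tpow_upow t M m (W : 'M[C]_(\sum_(i < m.+1) deg t)) : core T t ->
  stab T _ (tpow t m) W -> W \is unitarymx /\ uconj W (upow t M m) =
    pad (mat (\sum_(i < m.+1) deg t) (upow t M m)).
Proof.
move=> ct sW; have := sW; rewrite (mtower_stab_nfold Hm ct (ltn0Sn m)).
move=> [V _ WE]; have Wu : W \is unitarymx by case: sW.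
split=> //; rewrite /uconj; congr pad.
suff -> : W *m mat (\sum_(i < m.+1) deg t) (upow t M m) =
    mat (\sum_(i < m.+1) deg t) (upow t M m) *m W.
  by rewrite mulmxK// unitarymx_unit.
rewrite (mat_upow HT) -WE mul_mxblock_mxdiag mul_mxdiag_mxblock.
by apply/eq_mxblockP => i j; rewrite scalar_mxC.
Qed.

Lemma tdisjoint_tpow t b m : tdisjoint b t -> tdisjoint b (tpow t m).
Proof. by move=> bt; elim: m => // m IHm; exact: (mtower_disjoint Hm). Qed.

Lemma tpow_add t m k : oplus (tpow t m) (tpow t k) = tpow t (m + k).+1.
Proof. by elim: m => // m IHm; rewrite tpowS -(oplusA HT) IHm. Qed.

(** [split_one] is iterated until the remainder is disjoint from t; the degree of the remainder
    decreases. *)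
Lemma isotypic_split g t x M : core_equivariant g -> core T t -> uval g x M ->
  tsub t x -> (exists m, peq (tpow t m) (upow t (pad (g t)) m) x M) \/
  exists m b B, [/\ uval g b B, tdisjoint t b & peq (oplus (tpow t m) b)
    (udsum (deg (tpow t m)) (deg b) (upow t (pad (g t)) m) B) x M].
Proof.
move=> geq ct; have [n] := ubnP (deg x); elim: n x M => // n IHn x M xn xM tx.
have wt := @wf_pad _ _ (g t).
have [h|[b [B [bB h]]]] := split_one geq ct xM tx; first by left; exists 0%N.
have [tb|ntb] := pselect (tdisjoint t b).
  by right; exists 0%N, b, B.
have tb := core_tdisjointN HT ct ntb.
have dx : deg x = (deg t + deg b)%N.
  by rewrite (tequiv_deg HT (peq_tequiv h)) deg_oplus.
have bn : (deg b < n)%N.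
  by rewrite (leq_trans _ (_ : deg x <= n)%N)// dx -[X in (X < _)%N]add0n ltn_add2r deg_gt0.
have [[m hm]|[m [c [D [cD tc hm]]]]] := IHn b B bn bB tb.
  left; exists m.+1; apply: peq_trans h.
  by apply: peq_sum hm; exact: peq_refl.
right; exists m.+1, c, D; split=> //; apply: peq_trans h.
have := peq_sum (peq_refl wt) hm.
by rewrite (oplusA HT) (deg_oplus HT) udsumA tpowS (deg_oplus HT).
Qed.

(** With unequal multiplicities, cancelling the common copies by (mT2) would exhibit t inside the
    remainder that is disjoint from it. *)
Lemma isotypic_mult t m x m' x' : core T t -> tdisjoint t x ->
  tdisjoint t x' -> tequiv (oplus (tpow t m) x) (oplus (tpow t m') x') -> m = m'.
Proof.
move=> ct.
have H k l y z : tdisjoint t y -> tequiv (oplus (tpow t k) y) (oplus (tpow t l) z) ->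
    ~~ (k < l)%N.
  move=> ty e; apply/negP => kl; move: e.
  have -> : l = (k + (l - k.+1)).+1 by lia.
  rewrite -tpow_add -(oplusA HT) => /(mtower_cancel Hm)/(tequiv_sym HT) e.
  apply: (tsub_tdisjointN HT _ ty); apply: (tsub_tequivr HT e).
  by apply: (tsub_oplusl HT); case: (l - k.+1)%N => [|?]; rewrite ?tpowS;
     [exact: tsub_refl|apply: (tsub_oplusl HT); exact: tsub_refl].
move=> tx tx' e; have := H _ _ _ _ tx e; have := H _ _ _ _ tx' (tequiv_sym HT e).
by lia.
Qed.

(** For m < m' cancellation puts t below x; otherwise the left side has the larger degree. *)
Lemma isotypic_mult0 t m m' x : core T t -> tdisjoint t x ->
  ~ tequiv (oplus (tpow t m) x) (tpow t m').
Proof.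
move=> ct tx e; have d := tequiv_deg HT e.
have [mm'|mm'] := ltnP m m'.
  move: e; have -> : m' = (m + (m' - m.+1)).+1 by lia.
  rewrite -tpow_add => /(mtower_cancel Hm)/(tequiv_sym HT) e.
  apply: (tsub_tdisjointN HT _ tx); apply: (tsub_tequivr HT e).
  by case: (m' - m.+1)%N => [|?]; rewrite ?tpowS;
     [exact: tsub_refl|apply: (tsub_oplusl HT); exact: tsub_refl].
have := deg_gt0 x; move: d; rewrite (deg_oplus HT) !(deg_tpow HT) !sum_nat_const !card_ord.
have : (m'.+1 * deg t <= m.+1 * deg t)%N by rewrite leq_mul2r ltnS mm' orbT.
by lia.
Qed.

Lemma deg_tpow_inj t m m' : deg (tpow t m) = deg (tpow t m') -> m = m'.
Proof.
rewrite !(deg_tpow HT) !sum_nat_const !card_ord => /eqP.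
by rewrite eqn_pmul2r ?deg_gt0// => /eqP[].
Qed.

(* The value at a point is unique: two isotypic decompositions of the same point
   differ by an element of a stabilizer, and (mT3), (mT4) say that it commutes
   with the value. *)
Lemma uval_uniq g x M M' : core_equivariant g -> uval g x M -> uval g x M' -> M = M'.
Proof.
move=> geq; have [n] := ubnP (deg x); elim: n x M M' => // n IHn x M M' xn xM xM'.
have [t ct tx] := exists_core_tsub HT x; have wt := @wf_pad _ _ (g t).
have wu k := wf_upow HT k wt.
have stabE y N z N' : wf (deg y) N -> peq y N z M -> peq y N' z M' ->
  (forall W : 'M[C]_(deg y), stab T _ y W -> uconj W N = N') -> M = M'.
  move=> wN [U [Uu zE ->]] [V [Vu zE' ->]] h.
  have Wu := mul_unitarymx (unitarymxV Vu) Uu.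
  rewrite -(h (invmx V *m U)); last first.
    split=> //; rewrite (actME HT erefl (unitarymxV Vu) Uu) -zE zE'.
    exact: actVK.
  rewrite (uconjM _ Vu Wu) mulmxA (mulmxV (unitarymx_unit Vu)).
  by rewrite mul1mx.
have stabP m (W : 'M[C]_(deg (tpow t m))) : stab T _ (tpow t m) W ->
    uconj W (upow t (pad (g t)) m) = upow t (pad (g t)) m.
  move: W (wu m); rewrite (deg_tpow HT) => W wum /(stab_tpow_upow (pad (g t)) ct)[_ ->].
  exact: wum.
have [[m hm]|[m [b [B [bB tb hm]]]]] := isotypic_split geq ct xM tx;
have [[m' hm']|[m' [b' [B' [bB' tb' hm']]]]] := isotypic_split geq ct xM' tx.
- have dm : m' = m.
    apply: (@deg_tpow_inj t).
    by rewrite -(tequiv_deg HT (peq_tequiv hm)) (tequiv_deg HT (peq_tequiv hm')).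
  subst m'; apply: (stabE _ _ _ _ (wu m) hm hm') => W /stabP; exact.
- exfalso; apply: (isotypic_mult0 ct tb').
  exact: (tequiv_trans HT (peq_tequiv hm') (tequiv_sym HT (peq_tequiv hm))).
- exfalso; apply: (isotypic_mult0 ct tb).
  exact: (tequiv_trans HT (peq_tequiv hm) (tequiv_sym HT (peq_tequiv hm'))).
have e := tequiv_trans HT (peq_tequiv hm) (tequiv_sym HT (peq_tequiv hm')).
have mm' := isotypic_mult ct tb tb' e; subst m'.
(* By (mT2) the two remainders are equivalent. They have smaller degree, so the induction hypothesis
   identifies B' with the conjugate of B by the same unitary. *)
have [W [Wu bE]] := mtower_cancel Hm e; subst b'.
have bn : (deg b < n)%N.
  rewrite (leq_trans _ (_ : deg x <= n)%N)// (tequiv_deg HT (peq_tequiv hm)).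
  by rewrite (deg_oplus HT) -[X in (X < _)%N]add0n ltn_add2r deg_gt0.
have B'E : B' = uconj W B.
  by apply: IHn bB' (uval_act Wu bB); rewrite (deg_actE HT erefl Wu).
have hb : peq (oplus (tpow t m) b)
    (udsum (deg (tpow t m)) (deg b) (upow t (pad (g t)) m) B) x M'.
  apply: peq_trans hm'; rewrite B'E.
  by apply: peq_sum; [exact: peq_refl|exists W].
apply: (stabE _ _ _ _ _ hm hb); first by rewrite (deg_oplus HT); exact: wf_udsum.
have tpb : tdisjoint (tpow t m) b.
  exact/tdisjoint_sym/tdisjoint_tpow/tdisjoint_sym.
rewrite (deg_oplus HT) => Z; rewrite (mtower_stab Hm tpb) => -[U [V [sU sV ->]]].
have [Uu _] := sU; have [Vu Vb] := sV.
rewrite (uconj_dsum _ _ Uu Vu) (stabP m U sU); congr udsum.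
have h := uval_act Vu bB; rewrite Vb in h; exact: IHn bn h bB.
Qed.

Definition alg_ext (g : tfun T) : tfun T :=
  fun x => mat (deg x) (projT1 (cid (uval_ex g x))).

Lemma uval_alg_ext g x : uval g x (pad (alg_ext g x)).
Proof.
rewrite /alg_ext; case: cid => M xM /=.
by have := uval_wf xM; rewrite /wf => ->.
Qed.

Lemma alg_extP g : core_equivariant g -> is_alg (alg_ext g).
Proof.
move=> geq; split=> [x U Uu|x y]; apply: (uval_uniq geq); try exact: uval_alg_ext.
  by apply: uval_act => //; exact: uval_alg_ext.
by apply: uval_sum; exact: uval_alg_ext.
Qed.

Lemma alg_ext_core g x : core_equivariant g -> core T x -> alg_ext g x = g x.
Proof.
move=> geq cx; apply: pad_inj.
exact: uval_core_inv geq (uval_alg_ext g x) cx.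
Qed.

Lemma is_alg_eq f f' x : is_alg f -> is_alg f' ->
  (forall t, core T t -> tsub t x -> f t = f' t) -> f x = f' x.
Proof.
move=> [fa fs] [fa' fs'] h; apply: pad_inj; move: h.
elim/(tower_ind HT): x => [x cx h|x y IHx IHy h|x U Uu IHx h].
- by rewrite h//; exact: tsub_refl.
- rewrite fs fs' IHx ?IHy// => t ct tz; apply: h => //.
    exact: (tsub_oplusr HT).
  exact: (tsub_oplusl HT).
- rewrite (fa _ _ Uu) (fa' _ _ Uu) IHx => [//|t ct tz]; apply: h => //.
  exact: (tsub_tequivr HT (tequiv_intro erefl Uu) tz).
Qed.

(** Conjugation preserves the norm and a block sum has the maximum of the norms. Estimates proved on
    the core therefore hold on the whole tower, which is how vanishing on the closure of the core
    becomes a uniform bound. *)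
Lemma is_alg_opnorm_le f c x : is_alg f ->
  (forall t, core T t -> tsub t x -> opnorm (f t) <= c) -> opnorm (f x) <= c.
Proof.
have opE m n (X : 'M[C]_m) (Y : 'M[C]_n) : m = n -> pad X = pad Y -> opnorm X = opnorm Y.
  by move=> e; subst n => /pad_inj ->.
move=> [fa fs]; elim/(tower_ind HT): x => [x cx h|x y IHx IHy h|x U Uu IHx h].
- by apply: h => //; exact: tsub_refl.
- rewrite (opE _ _ _ (dsum_mx (f x) (f y)) (deg_oplus HT x y)) ?fs ?pad_dsum//.
  apply: opnorm_dsum_le; [apply: IHx|apply: IHy] => t ct tz; apply: h => //.
    exact: (tsub_oplusl HT).
  exact: (tsub_oplusr HT).
- rewrite (opE _ _ _ (U *m f x *m invmx U) (deg_actE HT erefl Uu)); last first.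
    by rewrite (fa _ _ Uu) /uconj matK.
  rewrite (opnorm_conj _ Uu) IHx// => t ct tz; apply: h => //.
  by apply: (tsub_tequivr HT) tz; exact: tequiv_intro.
Qed.

End AlgebraicExtension.

Section AlgebraicFunctions.
Variables (R : realType) (T : towerData R).
Hypothesis Hm : is_mtower T.
Let HT := mtower_tower Hm.
Local Notation C := R[i].
Implicit Types x y z t b : T.

Lemma is_alg_mul (f g : tfun T) : is_alg f -> is_alg g -> is_alg (tfun_mul f g).
Proof.
have padM (x : T) (h k : tfun T) :
  pad (tfun_mul h k x) = pad (mat (deg x) (pad (h x)) *m mat (deg x) (pad (k x))).
  by rewrite !matK.
move=> [fa fs] [ga gs]; split=> [x U Uu|x y]; rewrite padM.
  rewrite (fa _ _ Uu) (ga _ _ Uu) (deg_actE HT erefl Uu) !mat_uconj !matK /uconj matK.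
  by rewrite !mulmxA (mulmxKV (unitarymx_unit Uu)).
by rewrite fs gs (deg_oplus HT) !mat_udsum !matK -dsum_mx_mul pad_dsum.
Qed.

Lemma is_alg_linear (c : C) (f g : tfun T) : is_alg f -> is_alg g -> is_alg (c *: f + g).
Proof.
have padL (x : T) (h k : tfun T) : pad ((c *: h + k) x) =
  pad (c *: mat (deg x) (pad (h x)) + mat (deg x) (pad (k x))).
  by rewrite !matK.
move=> [fa fs] [ga gs]; split=> [x U Uu|x y]; rewrite padL.
  rewrite (fa _ _ Uu) (ga _ _ Uu) (deg_actE HT erefl Uu) !mat_uconj !matK /uconj matK.
  by rewrite mulmxDr mulmxDl -scalemxAr -scalemxAl.
by rewrite fs gs (deg_oplus HT) !mat_udsum !matK -dsum_mx_linear pad_dsum.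
Qed.

Lemma is_alg_adj (f : tfun T) : is_alg f -> is_alg (tfun_adj f).
Proof.
have padA (x : T) (h : tfun T) :
  pad (tfun_adj h x) = pad ((mat (deg x) (pad (h x))) ^t*).
  by rewrite matK.
move=> [fa fs]; split=> [x U Uu|x y]; rewrite padA.
  rewrite (fa _ _ Uu) (deg_actE HT erefl Uu) mat_uconj !matK /uconj matK.
  by rewrite (invmx_unitary Uu) !adjmxM trmxCK mulmxA.
by rewrite fs (deg_oplus HT) mat_udsum !matK -dsum_mx_adj pad_dsum.
Qed.

Definition tfun_scalar (c : C) : tfun T := fun x => c%:M.

Lemma pad_scalar_size m n (c : C) : m = n -> pad (c%:M : 'M[C]_m) = pad (c%:M : 'M[C]_n).
Proof. by move=> ->. Qed.

Lemma is_alg_scalar (c : C) : is_alg (tfun_scalar c).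
Proof.
split=> [x U Uu|x y]; rewrite /tfun_scalar.
  rewrite (pad_scalar_size _ (deg_actE HT erefl Uu)) /uconj matK.
  by rewrite scalar_mxC mulmxK// unitarymx_unit.
rewrite (pad_scalar_size _ (deg_oplus HT x y)) -pad_dsum; congr pad.
by rewrite /dsum_mx -scalar_mx_block.
Qed.

Lemma in_Cstar_alg (f : tfun T) : in_Cstar f -> is_alg f.
Proof.
move=> [_ fa fs _]; split=> [x U Uu|x y].
  rewrite /uconj matK -(fa x U Uu) pad_conform//; exact: (deg_actE HT).
by rewrite -pad_dsum -fs pad_conform//; exact: (deg_oplus HT).
Qed.

Definition core_bump t (X : 'M[C]_(deg t)) : tfun T := fun x =>
  if pselect (tequiv t x) is left e then
    mat (deg x) (uconj (projT1 (cid e)) (pad X)) else 0.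

(** Two unitaries carrying t to the same point differ by an element of the stabilizer of t, which is
    scalar by (mT4) with n = 1. So the unitary chosen in [core_bump] does not affect the value. *)
Lemma core_bumpE t (X : 'M[C]_(deg t)) (U : 'M[C]_(deg t)) : core T t -> U \is unitarymx ->
  pad (core_bump X (act U t)) = uconj U (pad X).
Proof.
move=> ct Uu; rewrite /core_bump; case: pselect => [e|]; last first.
  by case; exact: tequiv_intro.
have d := deg_actE HT erefl Uu; case: cid => V [Vu VUt] /=.
have wV : wf (deg (act U t)) (uconj V (pad X)) by rewrite d; exact: wf_uconj.
rewrite wV; set W := invmx U *m V.
have Wu : W \is unitarymx := mul_unitarymx (unitarymxV Uu) Vu.
have sW : stab T (deg t) t W.
  by split=> //; rewrite (actME HT erefl (unitarymxV Uu) Vu) VUt (actVK HT).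
have VE : V = U *m W by rewrite /W mulmxA (mulmxV (unitarymx_unit Uu)) mul1mx.
have [c Wc] : exists c : C, W = c%:M.
  have e1 : (\sum_(i < 1) deg t = deg t)%N by rewrite big_ord_recl big_ord0 addn0.
  have [V' _] : [set \mxblock_(i < 1, j < 1) ((U0 i j)%:M : 'M[C]_(deg t))
      | U0 in unitary_group R 1] (castmx (esym e1, esym e1) W).
    rewrite -(mtower_stab_nfold Hm ct (ltn0Sn 0)).
    by move: (esym e1) => e'; case: _ / e'; rewrite castmx_id.
  move=> /(congr1 (castmx (e1, e1))); rewrite castmxKV => <-.
  exists (V' 0 0); apply: pad_inj; rewrite pad_castmx.
  have -> : \mxblock_(i < 1, j < 1) ((V' i j)%:M : 'M[C]_(deg t)) =
      \mxdiag_(i < 1) (V' 0 0)%:M.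
    by apply/eq_mxblockP => i j; rewrite !ord1 /= conform_mx_id.
  by rewrite mxdiagZ; exact: pad_scalar_size.
rewrite VE -(uconjM _ Uu Wu); congr uconj; rewrite /uconj matK.
have -> : W *m X = X *m W by rewrite Wc scalar_mxC.
by rewrite mulmxK// unitarymx_unit.
Qed.

Lemma core_bump_at t (X : 'M[C]_(deg t)) : core T t -> core_bump X t = X.
Proof.
move=> ct; apply: pad_inj; have := core_bumpE X ct (unitarymx1 _ _).
by rewrite (act1 HT) uconj1//; exact: wf_pad.
Qed.

Lemma core_bump_out t (X : 'M[C]_(deg t)) x : ~ tequiv t x -> core_bump X x = 0 :> 'M[C]_(deg x).
Proof. by rewrite /core_bump; case: pselect. Qed.

Lemma pad0 n : pad (0 : 'M[C]_n) = fun _ _ => 0.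
Proof.
apply/funext => i; apply/funext => j; rewrite /pad.
by case: insub => // i'; case: insub => // j'; rewrite mxE.
Qed.

Lemma uconj0 n (U : 'M[C]_n) m : uconj U (pad (0 : 'M[C]_m)) = fun _ _ => 0.
Proof.
rewrite /uconj; have -> : mat n (pad (0 : 'M[C]_m)) = 0.
  by apply/matrixP => i j; rewrite pad0 !mxE.
by rewrite mulmx0 mul0mx pad0.
Qed.

Lemma core_bump_equivariant t (X : 'M[C]_(deg t)) : core T t -> core_equivariant (core_bump (t := t) X).
Proof.
move=> ct x U cx Uu; have [[V [Vu tx]]|ntx] := pselect (tequiv t x).
  subst x; have dV := deg_actE HT erefl Vu.
  suff H n (W : 'M[C]_n) : deg (act V t) = n -> W \is unitarymx ->
      pad (core_bump X (act W (act V t))) = uconj W (pad (core_bump X (act V t))).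
    exact: H.
  move=> e Wu; have {}e := etrans (esym dV) e; subst n; rewrite -(actME HT erefl Wu Vu).
  by rewrite (core_bumpE X ct Vu) (core_bumpE X ct (mul_unitarymx Wu Vu)) uconjM.
rewrite !core_bump_out ?uconj0 ?pad0//.
by move=> h; apply: ntx; exact: (tequiv_trans HT h (tequiv_sym HT (tequiv_intro erefl Uu))).
Qed.

Definition alg_bump t (X : 'M[C]_(deg t)) := alg_ext Hm (core_bump (t := t) X).

Lemma alg_bumpP t (X : 'M[C]_(deg t)) : core T t -> is_alg (alg_bump (t := t) X).
Proof. by move=> ct; apply: alg_extP; exact: core_bump_equivariant. Qed.

Lemma alg_bump_at t (X : 'M[C]_(deg t)) : core T t -> alg_bump X t = X.
Proof.
move=> ct; rewrite /alg_bump alg_ext_core//; last exact: core_bump_equivariant.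
exact: core_bump_at.
Qed.

Lemma alg_bump_core t (X : 'M[C]_(deg t)) x : core T t -> core T x -> ~ tequiv t x ->
  alg_bump X x = 0 :> 'M[C]_(deg x).
Proof.
move=> ct cx ntx; rewrite /alg_bump alg_ext_core//; last exact: core_bump_equivariant.
exact: core_bump_out.
Qed.

Lemma is_alg0 : is_alg (0 : tfun T).
Proof.
have -> : (0 : tfun T) = tfun_scalar 0.
  by apply: functional_extensionality_dep => x; rewrite /tfun_scalar raddf0.
exact: is_alg_scalar.
Qed.

Lemma is_alg_eq0 f x : is_alg f -> (forall t, core T t -> tsub t x -> f t = 0) -> f x = 0.
Proof. by move=> fa h; exact: (is_alg_eq Hm fa is_alg0). Qed.

Lemma alg_bump_out t (X : 'M[C]_(deg t)) x : core T t -> tdisjoint t x -> alg_bump X x = 0 :> 'M[C]_(deg x).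
Proof.
move=> ct tx; apply: is_alg_eq0; first exact: alg_bumpP.
move=> s cs sx; apply: alg_bump_core => // ts; apply: tx; exists t.
by split; [exact: tsub_refl|exact: (tsub_tequivl HT (tequiv_sym HT ts) sx)].
Qed.

Lemma pad_tpow (f : tfun T) t m : is_alg f -> pad (f (tpow t m)) = upow t (pad (f t)) m.
Proof. by move=> [_ fs]; elim: m => // m IHm; rewrite tpowS fs IHm. Qed.

Lemma stab_tpowP t m (W : 'M[C]_(deg (tpow t m))) : core T t -> W \is unitarymx ->
  (forall f, is_alg f -> uconj W (pad (f (tpow t m))) = pad (f (tpow t m))) ->
  act W (tpow t m) = tpow t m.
Proof.
move=> ct Wu h.
have {}h (X : 'M[C]_(deg t)) : uconj W (upow t (pad X) m) = upow t (pad X) m.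
  have := h _ (alg_bumpP X ct).
  by rewrite pad_tpow ?alg_bump_at//; exact: alg_bumpP.
have wu X := wf_upow HT m (@wf_pad _ (deg t) X).
move: W Wu h wu; rewrite (deg_tpow HT) => W Wu h wu.
suff : stab T _ (tpow t m) W by case.
have comm (X : 'M[C]_(deg t)) : W *m \mxdiag_(i < m.+1) X = \mxdiag_(i < m.+1) X *m W.
  have := congr1 (mat (\sum_(i < m.+1) deg t)) (h X); rewrite mat_uconj (mat_upow HT).
  under eq_mxdiag do rewrite matK.
  by move=> {2}<-; rewrite mulmxKV// unitarymx_unit.
pose B i j := submxblock W i j.
have WB : W = \mxblock_(i, j) B i j by rewrite /B submxblockK.
have Bc i j (X : 'M[C]_(deg t)) : B i j *m X = X *m B i j.
  have := comm X; rewrite {1 2}WB mul_mxblock_mxdiag mul_mxdiag_mxblock.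
  by move=> /eq_mxblockP.
have i0 : 'I_(deg t) := Ordinal (deg_gt0 t).
pose V : 'M[C]_(m.+1) := \matrix_(i, j) B i j i0 i0.
have BV i j : B i j = (V i j)%:M.
  have off k l : B i j k l = (B i j i0 i0) *+ (k == l).
    have := Bc i j (delta_mx i0 k) => /matrixP/(_ i0 l).
    rewrite -[in RHS](mul_delta_mx (0 : 'I_1)) -mulmxA -rowE -[in LHS](mul_delta_mx (0 : 'I_1)).
    rewrite mulmxA -colE [LHS]mxE [RHS]mxE !big_ord1 !mxE !eqxx/= mul1r => <-.
    by rewrite eq_sym; case: eqP => _; rewrite ?mulr1 ?mulr0.
  by apply/matrixP => k l; rewrite off !mxE.
rewrite (mtower_stab_nfold Hm ct (ltn0Sn m)); exists V; last first.
  by rewrite WB; apply/eq_mxblockP => i j; rewrite BV.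
have Wadj : W ^t* = \mxblock_(i < m.+1, j < m.+1) (B j i) ^t*.
  by rewrite {1}WB; apply/matrixP => k l; rewrite !mxE.
have := unitarymxP Wu; rewrite Wadj {1}WB mul_mxblock -mxdiagZ /mxdiag => /eq_mxblockP WW.
have WW' i j : (\sum_k B i k *m (B j k) ^t*) i0 i0 = (i == j)%:R.
  rewrite WW; case: (eqVneq i j) => _; first by rewrite conform_mx_id mxE eqxx.
  by rewrite mxE.
apply/unitarymxP/matrixP => i j; rewrite [1%:M i j]mxE -WW' summxE mxE.
by apply: eq_bigr => k _; rewrite !BV adjmx_scalar -scalar_mxM !mxE eqxx.
Qed.

Lemma isotypic_decomposition t x : core T t -> tsub t x ->
  (exists m, tequiv (tpow t m) x) \/
  exists m b, tdisjoint t b /\ tequiv (oplus (tpow t m) b) x.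
Proof.
move=> ct tx; have [M xM] := uval_ex Hm (0 : tfun T) x.
have [[m h]|[m [b [B [_ tb h]]]]] := isotypic_split Hm (is_alg_core is_alg0) ct xM tx.
  by left; exists m; exact: peq_tequiv h.
by right; exists m, b; split=> //; exact: peq_tequiv h.
Qed.

Lemma alg_actE n (f : tfun T) x (U : 'M[C]_n) : is_alg f -> deg x = n ->
  U \is unitarymx -> pad (f (act U x)) = uconj U (pad (f x)).
Proof. by move=> [fa _] e; subst n; exact: fa. Qed.

Lemma dsum10_comm m n (W : 'M[C]_(m + n)) : W \is unitarymx ->
  W *m dsum_mx (1%:M : 'M_m) (0 : 'M_n) = dsum_mx (1%:M : 'M_m) (0 : 'M_n) *m W ->
  exists W1 W2, [/\ W1 \is unitarymx, W2 \is unitarymx & W = dsum_mx W1 W2].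
Proof.
move=> Wu; rewrite -(submxK W) /dsum_mx !mulmx_block !mulmx0 !mul0mx !mulmx1 !mul1mx.
rewrite !addr0 => /eq_block_mx[_ E12 E21 _].
have WE : W = dsum_mx (ulsubmx W) (drsubmx W).
  by rewrite -{1}(submxK W) E21 -E12.
exists (ulsubmx W), (drsubmx W); rewrite /dsum_mx E21 -E12.
have := unitarymxP Wu; rewrite {1 2}WE -dsum_mx_adj -dsum_mx_mul -dsum_mx1.
by move=> /dsum_mx_inj[/unitarymxP h1 /unitarymxP h2].
Qed.

(** Both sides are values of algebraic functions that equal 1 at t. As [alg_bump 1] vanishes at
    points disjoint from t, it acts as the projection onto the t-isotypic part. *)
Lemma bump1_tpow t m : core T t ->
  pad (alg_bump (1%:M : 'M[C]_(deg t)) (tpow t m)) = pad (1%:M : 'M[C]_(deg (tpow t m))).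
Proof.
move=> ct; rewrite (pad_tpow _ _ (alg_bumpP _ ct)) (alg_bump_at _ ct).
exact: esym (pad_tpow t m (is_alg_scalar 1)).
Qed.

Lemma bump1_split t m b : core T t -> tdisjoint t b ->
  pad (alg_bump (1%:M : 'M[C]_(deg t)) (oplus (tpow t m) b)) =
  pad (dsum_mx (1%:M : 'M[C]_(deg (tpow t m))) (0 : 'M[C]_(deg b))).
Proof.
move=> ct tb; have [_ ->] := alg_bumpP (1%:M : 'M[C]_(deg t)) ct.
by rewrite bump1_tpow// alg_bump_out// -pad_dsum.
Qed.

Lemma uconj_eq n (U V : 'M[C]_n) M N : U \is unitarymx -> V \is unitarymx ->
  wf n M -> uconj U M = uconj V N -> uconj (invmx U *m V) N = M.
Proof.
move=> Uu Vu wM h; rewrite -(uconjM _ (unitarymxV Uu) Vu) -h.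
exact: uconjVK.
Qed.

(** Induction on the degree. For an irreducible part t of s, the function [alg_bump 1] at t detects
    t in s', its trace gives the multiplicity, and commuting with its value makes the transition
    unitary block diagonal. One block fixes the isotypic part by [stab_tpowP]; the other compares
    the remainders. *)
Lemma alg_separates s s' : deg s = deg s' ->
  (forall f : tfun T, is_alg f -> pad (f s) = pad (f s')) -> s = s'.
Proof.
have [n] := ubnP (deg s); elim: n s s' => // n IHn s s' sn dss' fss'.
have [t ct ts] := exists_core_tsub HT s.
have d1 := alg_bumpP (1%:M : 'M[C]_(deg t)) ct.
have pA x m : tequiv (tpow t m) x ->
    pad (alg_bump (1%:M : 'M[C]_(deg t)) x) = pad (1%:M : 'M[C]_(deg x)).
  move=> [U [Uu <-]]; rewrite (alg_actE d1 erefl Uu) (bump1_tpow _ ct).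
  by rewrite -(alg_actE (is_alg_scalar 1) erefl Uu).
have pB x m b : tdisjoint t b -> tequiv (oplus (tpow t m) b) x ->
    pad (alg_bump (1%:M : 'M[C]_(deg t)) x) <> pad (1%:M : 'M[C]_(deg x)).
  move=> tb /(tequivE (deg_oplus HT _ _))[U Uu <-].
  rewrite (alg_actE d1 (deg_oplus HT _ _) Uu) (bump1_split _ ct tb).
  have := alg_actE (is_alg_scalar 1) (deg_oplus HT (tpow t m) b) Uu.
  rewrite /tfun_scalar => ->; rewrite (pad_scalar_size 1 (deg_oplus HT _ _)) => h.
  have := uconj_eq Uu Uu (@wf_pad _ _ _) h.
  rewrite (mulVmx (unitarymx_unit Uu)) uconj1; last exact: wf_pad.
  rewrite -dsum_mx1 => /pad_inj/dsum_mx_inj[_ /matrixP/(_ (Ordinal (deg_gt0 b)) (Ordinal (deg_gt0 b)))].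
  by rewrite !mxE eqxx => /eqP; rewrite oner_eq0.
have ts' : tsub t s'.
  apply: (core_tdisjointN HT ct) => tns'; have := fss' _ d1.
  rewrite (alg_bump_out _ ct tns').
  have [[m h]|[m [b [tb h]]]] := isotypic_decomposition ct ts.
    rewrite (pA _ _ h) -dss' => /pad_inj/matrixP/(_ (Ordinal (deg_gt0 s)) (Ordinal (deg_gt0 s))).
    by rewrite !mxE eqxx => /eqP; rewrite oner_eq0.
  have [U Uu <-] := tequivE (deg_oplus HT _ _) h.
  rewrite (alg_actE d1 (deg_oplus HT _ _) Uu) (bump1_split _ ct tb) => e.
  have := congr1 (uconj (invmx U)) e.
  rewrite uconjVK//; last exact: wf_pad.
  rewrite uconj0 -(pad0 (deg (tpow t m) + deg b)) => /pad_inj.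
  have i0 := Ordinal (deg_gt0 (tpow t m)).
  move=> /matrixP/(_ (lshift _ i0) (lshift _ i0)).
  by rewrite block_mxEul !mxE eqxx => /eqP; rewrite oner_eq0.
have [[m h]|[m [b [tb h]]]] := isotypic_decomposition ct ts;
have [[m' h']|[m' [b' [tb' h']]]] := isotypic_decomposition ct ts'.
- have mm' : m' = m.
    by apply: (@deg_tpow_inj _ _ Hm t); rewrite -(tequiv_deg HT h) -(tequiv_deg HT h').
  subst m'; case: h fss' => U [Uu <-]; case: h' => V [Vu <-] fss'.
  have Wu := mul_unitarymx (unitarymxV Uu) Vu.
  have := stab_tpowP ct Wu; rewrite (actME HT erefl (unitarymxV Uu) Vu) => e.
  rewrite -(actKV HT (deg_actE HT erefl Vu) Uu) e// => f fa.
  apply: uconj_eq => //; first exact: wf_pad.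
  by rewrite -!(alg_actE fa erefl)// fss'.
- by case: (pB _ _ _ tb' h'); rewrite -fss'// (pA _ _ h) dss'.
- by case: (pB _ _ _ tb h); rewrite fss'// (pA _ _ h') dss'.
have dN : deg s = (deg (tpow t m) + deg b)%N by rewrite (tequiv_deg HT h) (deg_oplus HT).
have dN' : deg s' = (deg (tpow t m') + deg b')%N by rewrite (tequiv_deg HT h') (deg_oplus HT).
have [U Uu sE] := tequivE (deg_oplus HT _ _) h.
have e' : deg (oplus (tpow t m') b') = (deg (tpow t m) + deg b)%N.
  by rewrite -dN dss' dN' (deg_oplus HT).
have [V Vu sE'] := tequivE e' h'.
have mm' : m' = m.
  have := fss' _ d1; rewrite -sE -sE' (alg_actE d1 (deg_oplus HT _ _) Uu) (alg_actE d1 e' Vu).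
  rewrite !bump1_split// /uconj => /pad_inj/(congr1 mxtrace).
  have trC (P Q : 'M[C]_(deg (tpow t m) + deg b)) : P \is unitarymx ->
      \tr (P *m Q *m invmx P) = \tr Q.
    by move=> Pu; rewrite mxtrace_mulC mulmxA (mulVmx (unitarymx_unit Pu)) mul1mx.
  rewrite (trC U _ Uu) (trC V _ Vu) matK.
  have trD p q r (e : (p + q = r)%N) :
      \tr (mat r (pad (dsum_mx (1%:M : 'M[C]_p) (0 : 'M[C]_q)))) = p%:R.
    by subst r; rewrite matK mxtrace_block mxtrace1 mxtrace0 addr0.
  rewrite trD; last by rewrite -(deg_oplus HT).
  rewrite mxtrace_block mxtrace1 mxtrace0 addr0 => /eqP.
  by rewrite eqr_nat => /eqP /(deg_tpow_inj Hm).
subst m'; have db : deg b' = deg b by apply/(@addnI (deg (tpow t m))); rewrite -dN' -dss' dN.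
have us M N : udsum (deg (tpow t m)) (deg b') M N = udsum (R := R) (deg (tpow t m)) (deg b) M N.
  by rewrite db.
pose W := invmx U *m V.
have Wu : W \is unitarymx := mul_unitarymx (unitarymxV Uu) Vu.
have Wf f : is_alg f -> uconj W (udsum (deg (tpow t m)) (deg b) (pad (f (tpow t m))) (pad (f b'))) =
    udsum (deg (tpow t m)) (deg b) (pad (f (tpow t m))) (pad (f b)).
  move=> fa; apply: uconj_eq => //; first exact: wf_udsum.
  have [_ fs] := fa; have := fss' f fa.
  rewrite -sE -sE' (alg_actE fa (deg_oplus HT _ _) Uu) (alg_actE fa e' Vu).
  by rewrite !fs us.
have [W1 [W2 [W1u W2u WE]]] : exists W1 W2, [/\ W1 \is unitarymx, W2 \is unitarymx &
    W = dsum_mx W1 W2].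
  apply: dsum10_comm => //; have := Wf _ d1.
  rewrite (bump1_tpow _ ct) (alg_bump_out _ ct tb) (alg_bump_out _ ct tb').
  rewrite (pad0 (deg b')) -(pad0 (deg b)) -pad_dsum.
  rewrite /uconj matK => /pad_inj {2}<-.
  by rewrite mulmxKV// unitarymx_unit.
have h1 f : is_alg f -> uconj W1 (pad (f (tpow t m))) = pad (f (tpow t m)) /\
    uconj W2 (pad (f b')) = pad (f b).
  move=> fa; have := Wf f fa; rewrite WE uconj_dsum//.
  by apply: udsum_inj; do ?[exact: wf_uconj|exact: wf_pad].
have E1 : act W1 (tpow t m) = tpow t m.
  by apply: stab_tpowP => // f fa; have [] := h1 f fa.
have E2 : b = act W2 b'.
  apply: IHn; first last.
  - by move=> f fa; rewrite (alg_actE fa db W2u); have [_ ->] := h1 f fa.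
  - by rewrite (deg_actE HT db W2u).
  rewrite (leq_trans _ (_ : deg s <= n)%N)// dN -[X in (X < _)%N]add0n ltn_add2r.
  exact: deg_gt0.
rewrite -sE -sE'; have -> : V = U *m W.
  by rewrite /W mulmxA (mulmxV (unitarymx_unit Uu)) mul1mx.
by rewrite (actME HT e' Uu Wu) WE (act_oplusE HT erefl db W1u W2u) E1 -E2.
Qed.

End AlgebraicFunctions.

(** * Continuous algebraic functions *)

Lemma midpoint_le (R : realFieldType) (d r u v w : R) : u <= r -> v <= r ->
  2 ^+ 2 * w + d = (u + v) *+ 2 -> w <= r - d / 4.
Proof. by rewrite mulr2n => h1 h2 h3; lra. Qed.

Lemma sqr_gap_le (R : realFieldType) (m e d : R) : m ^+ 2 <= (m + e) ^+ 2 - d / 4 ->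
  d <= 4 * e * (2 * m + e).
Proof.
have -> : 4 * e * (2 * m + e) = 4 * ((m + e) ^+ 2 - m ^+ 2) by ring.
move: (m ^+ 2) ((m + e) ^+ 2) => u v h; lra.
Qed.

(** * Chebyshev centers for the Hilbert-Schmidt norm *)

Section ChebyshevCenter.
Variables (R : realType) (I : pointedType) (n : nat).
Local Notation C := R[i].
Implicit Types (phi psi : I -> 'M[C]_n) (Z W : 'M[C]_n).

Definition hs_bounded phi : Prop := exists M, forall i, hsnorm (phi i) <= M.

Definition radius phi Z : R := sup (range (fun i => hsnorm (Z - phi i))).

Lemma radius_has_sup phi Z : hs_bounded phi ->
  has_sup (range (fun i => hsnorm (Z - phi i))).
Proof.
move=> [M phiM]; split; first by exists (hsnorm (Z - phi point)), point.
exists (hsnorm Z + M) => _ [i _ <-].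
by apply: le_trans (hsnormD _ _) _; rewrite hsnormN lerD2l.
Qed.

Lemma radius_ge phi Z i : hs_bounded phi -> hsnorm (Z - phi i) <= radius phi Z.
Proof.
by move=> bphi; apply: ub_le_sup; [exact: (radius_has_sup Z bphi).2|exists i].
Qed.

Lemma radius_le phi Z c : (forall i, hsnorm (Z - phi i) <= c) -> radius phi Z <= c.
Proof.
move=> h; apply: ge_sup; first by exists (hsnorm (Z - phi point)), point.
by move=> _ [i _ <-].
Qed.

Lemma radius_ge0 phi Z : hs_bounded phi -> 0 <= radius phi Z.
Proof. by move=> b; exact: le_trans (hsnorm_ge0 _) (radius_ge Z point b). Qed.

Lemma hsnormB_triangle Z W Y : hsnorm (Z - Y) <= hsnorm (Z - W) + hsnorm (W - Y).
Proof.
have -> : Z - Y = (Z - W) + (W - Y) by rewrite addrA subrK.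
exact: hsnormD.
Qed.

Lemma radius_lip phi Z W : hs_bounded phi -> radius phi Z <= radius phi W + hsnorm (Z - W).
Proof.
move=> b; apply: radius_le => i; apply: le_trans (hsnormB_triangle Z W _) _.
by rewrite addrC lerD2r; exact: radius_ge.
Qed.

Lemma radius_perturb phi psi Z c : hs_bounded psi ->
  (forall i, hsnorm (phi i - psi i) <= c) -> radius phi Z <= radius psi Z + c.
Proof.
move=> b h; apply: radius_le => i; apply: le_trans (hsnormB_triangle Z (psi i) _) _.
apply: lerD; first exact: radius_ge.
by rewrite -hsnormN opprB.
Qed.

(* Strong convexity of the squared radius, from the parallelogram law. *)
Lemma radius_convex phi Z W m e : hs_bounded phi -> 0 <= m -> 0 <= e ->
  (forall Y, m <= radius phi Y) -> radius phi Z <= m + e -> radius phi W <= m + e ->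
  hsnorm (Z - W) ^+ 2 <= 4 * e * (2 * m + e).
Proof.
move=> b m0 e0 mY Ze We; have me0 : 0 <= m + e by rewrite addr_ge0.
pose Y := (2^-1)%:C *: (Z + W); pose d := hsnorm (Z - W) ^+ 2.
have d0 : 0 <= d by rewrite sqr_ge0.
pose q := (m + e) ^+ 2 - d / 4.
have key i : hsnorm (Y - phi i) ^+ 2 <= q.
  have := hsnorm_parallelogram (Z - phi i) (W - phi i).
  have c2 : (2%:C * (2^-1)%:C : C) = 1 by rewrite -rmorphM mulfV ?rmorph1// pnatr_eq0.
  have -> : Z - phi i + (W - phi i) = 2%:C *: (Y - phi i).
    rewrite /Y scalerBr scalerA c2 scale1r.
    have -> : (2%:C : C) = 1 + 1 by rewrite -[2]/(1 + 1) rmorphD rmorph1.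
    by rewrite scalerDl scale1r opprD addrACA.
  have -> : Z - phi i - (W - phi i) = Z - W by rewrite opprB addrA subrK.
  rewrite hsnormZ normc_real ger0_norm// exprMn -/d.
  have h1 : hsnorm (Z - phi i) ^+ 2 <= (m + e) ^+ 2.
    rewrite ler_pXn2r// ?nnegrE ?hsnorm_ge0//; exact: le_trans (radius_ge Z i b) Ze.
  have h2 : hsnorm (W - phi i) ^+ 2 <= (m + e) ^+ 2.
    rewrite ler_pXn2r// ?nnegrE ?hsnorm_ge0//; exact: le_trans (radius_ge W i b) We.
  exact: midpoint_le.
have q0 : 0 <= q := le_trans (sqr_ge0 _) (key point).
have : m ^+ 2 <= q.
  rewrite -(sqr_sqrtr q0) ler_pXn2r// ?nnegrE ?sqrtr_ge0//.
  apply: le_trans (mY Y) _; apply: radius_le => i.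
  by rewrite -(@ler_pXn2r _ 2)// ?nnegrE ?hsnorm_ge0 ?sqrtr_ge0// (sqr_sqrtr q0) key.
exact: sqr_gap_le.
Qed.

(** By [radius_convex] a minimizing sequence of the radius is Cauchy. *)
Lemma center_exists phi : hs_bounded phi ->
  exists Z, forall W, radius phi Z <= radius phi W.
Proof.
move=> b; pose S := [set radius phi Z | Z in [set: 'M[C]_n]].
have S0 : S !=set0 by exists (radius phi 0), 0.
have lS : has_lbound S by exists 0 => _ [Z _ <-]; exact: radius_ge0.
pose m := inf S.
have m0 : 0 <= m by apply: lb_le_inf => // _ [Z _ <-]; exact: radius_ge0.
have mY Y : m <= radius phi Y by apply: ge_inf => //; exists Y.
have [z zP] : {z : nat -> 'M[C]_n & forall k, radius phi (z k) <= m + k.+1%:R^-1}.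
  apply: (@choice _ _ (fun k Z => radius phi Z <= m + k.+1%:R^-1)) => k.
  have [_ [Z _ <-] Zk] : exists2 x, S x & x < m + k.+1%:R^-1.
    apply: inf_adherent; last by split.
    by rewrite invr_gt0 ltr0Sn.
  by exists Z; exact: ltW.
have [Z zZ] : exists Z : 'M[C]_n, z @ \oo --> Z.
  apply: mx_cauchy_cvg => e e0.
  (* An excess of 1 / (N + 1), which is at most 1, gives in [radius_convex] the bound 4 (2m + 1) /
     (N + 1) on the squared distance; N + 1 > K brings it below e ^ 2. *)
  pose K := 4 * (2 * m + 1) / e ^+ 2.
  have K0 : 0 <= K by rewrite divr_ge0 ?sqr_ge0// mulr_ge0// addr_ge0// mulr_ge0.
  pose N := Num.truncn K.
  exists (z N); exists N => // k /= Nk.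
  apply: le_trans (opnorm_le_hsnorm _) _.
  rewrite -(@ler_pXn2r _ 2)// ?nnegrE ?hsnorm_ge0 ?(ltW e0)//.
  have N0 : 0 <= N.+1%:R^-1 :> R by rewrite invr_ge0.
  have kN : k.+1%:R^-1 <= N.+1%:R^-1 :> R by rewrite lef_pV2 ?posrE// ler_nat ltnS.
  apply: le_trans (radius_convex b m0 N0 mY _ (zP N)) _.
    by apply: le_trans (zP k) _; rewrite lerD2l.
  have N1 : N.+1%:R^-1 <= 1 :> R by rewrite invf_le1// ler1n.
  have KN : K < N.+1%:R by exact: truncnS_gt.
  apply: (@le_trans _ _ (4 * N.+1%:R^-1 * (2 * m + 1))).
    by rewrite ler_wpM2l ?mulr_ge0// lerD2l.
  have e20 : 0 < e ^+ 2 by rewrite exprn_gt0.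
  move: KN; rewrite /K ltr_pdivrMr// => /ltW KN.
  rewrite [leLHS](_ : _ = (4 * (2 * m + 1)) / N.+1%:R); last by ring.
  by rewrite ler_pdivrMr// [leRHS]mulrC.
exists Z => W; apply: le_trans (mY W); apply/ler_addgt0Pr => e e0.
have e20 : 0 < e / 2 by rewrite divr_gt0.
have n1 : 0 < (n%:R + 1) :> R by rewrite ltr_wpDl.
have := (iffLR (cvg_opnormP _ z Z)) zZ _ (divr_gt0 e20 n1).
move=> [N1 _ h1]; pose k := maxn N1 (Num.truncn (e / 2)^-1).
have zkZ : opnorm (z k - Z) < e / 2 / (n%:R + 1) by apply: h1 => /=; exact: leq_maxl.
apply: le_trans (radius_lip Z (z k) b) _.
have hk : k.+1%:R^-1 <= e / 2.
  rewrite invf_ple ?posrE//; apply: ltW; apply: (lt_le_trans (truncnS_gt _)).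
  by rewrite ler_nat ltnS leq_maxr.
have hZ : hsnorm (Z - z k) <= e / 2.
  apply: le_trans (hsnorm_le_opnorm _) _; rewrite opnormBC.
  apply: (@le_trans _ _ ((n%:R + 1) * (e / 2 / (n%:R + 1)))).
    apply: ler_pM; [by []|exact: opnorm_ge0|by rewrite lerDl|exact: ltW].
  by rewrite mulrC divfK ?gt_eqF.
rewrite [in leRHS](splitr e) addrA; apply: lerD => //.
by apply: le_trans (zP k) _; rewrite lerD2l.
Qed.

(** The center W of the second family is within 2c of optimal for the first; the bound is
    [radius_convex] with excess 2c. *)
Lemma center_stable phi psi Z W c : hs_bounded phi -> hs_bounded psi -> 0 <= c ->
  (forall Y, radius phi Z <= radius phi Y) -> (forall Y, radius psi W <= radius psi Y) ->
  (forall i, hsnorm (phi i - psi i) <= c) ->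
  hsnorm (Z - W) ^+ 2 <= 8 * c * (2 * radius phi Z + 2 * c).
Proof.
move=> bp bs c0 Zc Wc h; set m := radius phi Z.
have c20 : 0 <= 2 * c by rewrite mulr_ge0.
have m0 : 0 <= m := radius_ge0 Z bp.
have W2 : radius phi W <= m + 2 * c.
  apply: le_trans (radius_perturb W bs h) _.
  rewrite mulr2n mulrDl mul1r addrA lerD2r; apply: le_trans (Wc Z) _.
  by apply: radius_perturb => // i; rewrite -hsnormN opprB.
have Z1 : radius phi Z <= m + 2 * c by rewrite lerDl.
have -> : 8 * c = 4 * (2 * c) by rewrite mulrA -natrM.
exact: radius_convex bp m0 c20 Zc Z1 W2.
Qed.

End ChebyshevCenter.

Opaque hsnorm.

Lemma continuous_cst (X Y : topologicalType) (y : Y) : continuous (fun _ : X => y).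
Proof. exact: cst_continuous. Qed.

Lemma continuous_pair (Z A B : topologicalType) (f : Z -> A) (g : Z -> B) :
  continuous f -> continuous g -> continuous (fun z => (f z, g z)).
Proof. by move=> cf cg z; apply: cvg_pair; [exact: cf|exact: cg]. Qed.

Lemma continuous_pairl (A B : topologicalType) (b : B) :
  continuous (fun a : A => (a, b)).
Proof.
apply: continuous_pair; first by move=> a; exact: cvg_id.
by move=> a; exact: cvg_cst.
Qed.

(** * Equivariant averaging over unitary orbits *)

Section EquivariantExtension.
Variables (R : realType) (T : towerData R).
Hypothesis HT : is_tower T.
Variable n : nat.
Hypothesis cn : compact (layer T n).
Local Notation C := R[i].
Local Notation X := (layer T n).
Local Notation G := (unitary_group R n).

Lemma layerP (x : X) : deg (set_val x) = n.
Proof. exact: set_valP x. Qed.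

Lemma ugroupP (U : G) : set_val U \is unitarymx.
Proof. exact: set_valP U. Qed.

Definition lact (U : G) (x : X) : X :=
  exist _ (act (set_val U) (set_val x))
    (mem_set (deg_actE HT (layerP x) (ugroupP U))).

Lemma lact_continuous : continuous (fun p : G * X => lact p.1 p.2).
Proof. by apply: to_set_type_continuous; exact: (act_continuous HT). Qed.

Definition mkG (U : 'M[C]_n) (Uu : U \is unitarymx) : G := exist _ U (mem_set Uu).

Definition G1 : G := mkG (unitarymx1 R n).
Definition Gmul (U V : G) : G := mkG (mul_unitarymx (ugroupP U) (ugroupP V)).
Definition Ginv (U : G) : G := mkG (unitarymxV (ugroupP U)).

Lemma lactM U V x : lact (Gmul U V) x = lact U (lact V x).
Proof. by apply/val_inj; rewrite /= (actME HT (layerP x) (ugroupP U) (ugroupP V)). Qed.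

HB.instance Definition _ := isPointed.Build G G1.

Lemma compact_layer_type : compact [set: X].
Proof. exact: compact_set_type. Qed.

Lemma compact_ugroup_type : compact [set: G].
Proof. exact/compact_set_type/compact_unitary_group. Qed.

Lemma hausdorff_layer : hausdorff_space X.
Proof. exact/hausdorff_set_type/(tower_hausdorff HT). Qed.

(** The value at U.x pulled back to x. F is equivariant along the orbit of x exactly when this
    family is constant in U, so its center is an equivariant replacement for F x. *)
Definition untwist (F : X -> 'M[C]_n) (x : X) (U : G) : 'M[C]_n :=
  invmx (set_val U) *m F (lact U x) *m set_val U.

Section Averaging.
Variable F : X -> 'M[C]_n.
Hypothesis cF : continuous F.

Lemma untwist_continuous : continuous (fun p : G * X => untwist F p.2 p.1).
Proof.
have cU : continuous (fun p : G * X => set_val p.1 : 'M[C]_n).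
  move=> p; apply: (@continuous_comp _ _ _ fst set_val); first exact: cvg_fst.
  exact: val_continuous.
have cFl : continuous (fun p : G * X => F (lact p.1 p.2)).
  move=> p; apply: (@continuous_comp _ _ _ (fun p : G * X => lact p.1 p.2) F).
    exact: lact_continuous.
  exact: cF.
have -> : (fun p : G * X => untwist F p.2 p.1) = fun p =>
    (set_val p.1) ^t* *m F (lact p.1 p.2) *m set_val p.1.
  by apply/funext => p; rewrite /untwist (invmx_unitary (ugroupP _)).
exact: (continuous_mx_mul (continuous_mx_mul (continuous_mx_adj cU) cFl) cU).
Qed.

Lemma untwist_bounded x : hs_bounded (untwist F x).
Proof.
have cx : continuous (untwist F x).
  move=> U; apply: (@continuous_comp _ _ _ (fun U : G => (U, x)) (fun p => untwist F p.2 p.1)).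
    exact: continuous_pairl.
  exact: untwist_continuous.
have copn : continuous (fun U => opnorm (untwist F x U)).
  by move=> U; apply: (@continuous_comp _ _ _ (untwist F x) (@opnorm R n));
    [exact: cx|exact: opnorm_cts].
have := continuous_compact (continuous_subspaceT copn) compact_ugroup_type.
move=> /compact_bounded[M [_ Mh]].
exists (n%:R * (M + 1)) => U; apply: le_trans (hsnorm_le_opnorm _) _.
rewrite ler_wpM2l//; apply: le_trans (ler_norm _) _.
by apply: (Mh (M + 1)); [rewrite ltrDl|exists U].
Qed.

Definition equiv_avg (x : X) : 'M[C]_n :=
  projT1 (cid (center_exists (untwist_bounded x))).

Lemma equiv_avgP x W : radius (untwist F x) (equiv_avg x) <= radius (untwist F x) W.
Proof. by rewrite /equiv_avg; case: cid. Qed.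

Lemma center_unique (phi : G -> 'M[C]_n) Z W : hs_bounded phi ->
  (forall Y, radius phi Z <= radius phi Y) -> (forall Y, radius phi W <= radius phi Y) ->
  Z = W.
Proof.
move=> b Zc Wc; apply/eqP; rewrite -subr_eq0; apply/eqP/hsnorm_eq0/eqP.
rewrite -sqrf_eq0 eq_le sqr_ge0 andbT.
have := center_stable b b (lexx 0) Zc Wc.
rewrite !mulr0 mul0r; apply=> U.
have -> : phi U - phi U = 0 by rewrite subrr.
by rewrite hsnorm0.
Qed.

(** Compactness of the unitary group makes the family at y uniformly close to the family at x for y
    near x; [center_stable] then makes the centers close. *)
Lemma equiv_avg_continuous : continuous equiv_avg.
Proof.
apply/continuous_opnormP => x e e0.
set r := radius (untwist F x) (equiv_avg x).
have r0 : 0 <= r by apply: radius_ge0; exact: untwist_bounded.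
(* With c at most 1 the bound 8c(2r + 2c) of [center_stable] is at most 8c(2r + 2), and the second
   term makes this at most e ^ 2 / 2. *)
pose c := Num.min 1 (e ^+ 2 / (2 * (8 * (2 * r + 2)))).
have d0 : 0 < 2 * (8 * (2 * r + 2)) by rewrite !mulr_gt0// ltr_wpDl// mulr_ge0.
have c0 : 0 < c by rewrite lt_min ltr01/= divr_gt0// exprn_gt0.
have n1 : 0 < (n%:R + 1) :> R by rewrite ltr_wpDl.
have near_c : \forall y \near x, forall U : G,
    opnorm (untwist F x U - untwist F y U) < c / (n%:R + 1).
  have cov := iffLR (compact_near_coveringP _) compact_ugroup_type.
  pose P (y : X) (U : G) := opnorm (untwist F x U - untwist F y U) < c / (n%:R + 1).
  have := cov X (nbhs x) P (nbhs_filter x).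
  rewrite /near_covering => H.
  have {}H : (\forall y \near x, [set: G] `<=` P y).
    apply: H => U _.
    have cp : 0 < c / (n%:R + 1) / 2 by rewrite !divr_gt0.
    have h1 := (iffLR (continuous_opnormP _)) untwist_continuous (U, x) _ cp.
    have h2 : \forall V \near U, opnorm (untwist F x V - untwist F x U) < c / (n%:R + 1) / 2.
      have cx : continuous (untwist F x).
        move=> V; apply: (@continuous_comp _ _ _ (fun U : G => (U, x)) (fun p => untwist F p.2 p.1)).
          exact: continuous_pairl.
        exact: untwist_continuous.
      exact: (iffLR (continuous_opnormP _)) cx U _ cp.
    have h3 : \forall p \near ((U, x) : G * X), opnorm (untwist F x p.1 - untwist F x U) < c / (n%:R + 1) / 2.
      exact: (@cvg_fst _ _ (nbhs U) (nbhs x) _ _ h2).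
    have h4 : \forall p \near ((U, x) : G * X), P p.2 p.1.
      apply: filterS2 h1 h3 => -[V y] /= hV1 hV2; rewrite /P.
      apply: le_lt_trans (opnormB_triangle _ (untwist F x U) _) _.
      rewrite opnormBC in hV1; rewrite [ltRHS]splitr; exact: (ltrD hV2 hV1).
    case: h4 => -[A B] /= [UA xB] AB.
    by exists (A, B).
  by apply: filterS H => y h U; exact: h.
apply: filterS near_c => y yc.
have h U : hsnorm (untwist F x U - untwist F y U) <= c.
  apply: le_trans (hsnorm_le_opnorm _) _.
  apply: (@le_trans _ _ ((n%:R + 1) * (c / (n%:R + 1)))).
    by apply: ler_pM; [|exact: opnorm_ge0|rewrite lerDl|exact: ltW].
  by rewrite mulrC divfK ?gt_eqF.
have := center_stable (untwist_bounded x) (untwist_bounded y) (ltW c0)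
  (equiv_avgP x) (equiv_avgP y) h.
rewrite -/r => hs; rewrite opnormBC; apply: le_lt_trans (opnorm_le_hsnorm _) _.
rewrite -(@ltr_pXn2r _ 2)// ?nnegrE ?hsnorm_ge0 ?(ltW e0)//.
apply: le_lt_trans hs _.
have c1 : c <= 1 by rewrite ge_min lexx.
have ce : c <= e ^+ 2 / (2 * (8 * (2 * r + 2))) by rewrite ge_min lexx orbT.
apply: (@le_lt_trans _ _ (c * (8 * (2 * r + 2)))).
  rewrite (mulrC 8) -mulrA ler_wpM2l ?(ltW c0)// ler_wpM2l// lerD2l.
  by rewrite -[leRHS]mulr1 ler_wpM2l.
apply: (@le_lt_trans _ _ (e ^+ 2 / 2)); last by rewrite gtr_pMr ?exprn_gt0// invf_lt1// ltr1n.
have d1 : 0 < 8 * (2 * r + 2) by rewrite mulr_gt0// ltr_wpDl// mulr_ge0.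
move: ce; rewrite ler_pdivlMr// => ce.
by rewrite ler_pdivlMr// -mulrA (mulrC _ 2).
Qed.

(** The family at U.x is the one at x, reindexed by right translation and conjugated by U. The
    Hilbert-Schmidt norm is invariant, so the radii correspond, and the center is unique. *)
Lemma equiv_avg_act U x :
  equiv_avg (lact U x) = set_val U *m equiv_avg x *m invmx (set_val U).
Proof.
have Uu := ugroupP U; have Uun := unitarymx_unit Uu.
have tw V : untwist F (lact U x) V =
    set_val U *m untwist F x (Gmul V U) *m invmx (set_val U).
  rewrite /untwist lactM /= (invmx_unitaryM (ugroupP V) Uu) !mulmxA.
  by rewrite (mulmxV Uun) mul1mx -!mulmxA (mulmxV Uun) mulmx1.
have rad Z : radius (untwist F (lact U x)) (set_val U *m Z *m invmx (set_val U)) =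
    radius (untwist F x) Z.
  apply: (congr1 (@sup R)); apply/seteqP; split=> _ [V _ <-].
    exists (Gmul V U); first by [].
    by rewrite tw -mulmxBl -mulmxBr (hsnorm_conj _ Uu).
  exists (Gmul V (Ginv U)); first by [].
  rewrite tw -mulmxBl -mulmxBr (hsnorm_conj _ Uu).
  congr (hsnorm (_ - untwist F x _)); apply/val_inj => /=.
  exact: mulmxKV.
apply: (center_unique (untwist_bounded (lact U x))); first exact: equiv_avgP.
move=> Y; rewrite rad.
have -> : Y = set_val U *m (invmx (set_val U) *m Y *m set_val U) *m invmx (set_val U).
  by rewrite !mulmxA (mulmxV Uun) mul1mx (mulmxK Uun).
by rewrite rad; exact: equiv_avgP.
Qed.

Lemma equiv_avg_fixed x :
  (forall U, F (lact U x) = set_val U *m F x *m invmx (set_val U)) -> equiv_avg x = F x.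
Proof.
move=> h; have tw U : untwist F x U = F x.
  have Uun := unitarymx_unit (ugroupP U).
  by rewrite /untwist h !mulmxA (mulVmx Uun) mul1mx (mulmxKV Uun).
have r0 : radius (untwist F x) (F x) = 0.
  apply/eqP; rewrite eq_le; apply/andP; split.
    by apply: radius_le => U; rewrite tw subrr hsnorm0.
  exact: radius_ge0 (untwist_bounded x).
apply: (center_unique (untwist_bounded x)); first exact: equiv_avgP.
by move=> Y; rewrite r0; exact: radius_ge0 (untwist_bounded x).
Qed.

End Averaging.
End EquivariantExtension.

Lemma compact_setTX (A B : topologicalType) : compact [set: A] -> compact [set: B] ->
  compact [set: A * B].
Proof. by move=> cA cB; rewrite -setXTT; exact: compact_setX. Qed.

(** A continuous map from a compact space to a Hausdorff space is closed, so it is a quotient map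
    onto its range and continuity of the composite descends. *)
Lemma range_within (K X Y : topologicalType) (m : K -> X) (h : X -> Y) :
  compact [set: K] -> hausdorff_space X -> continuous m -> continuous (h \o m) ->
  closed (range m) /\ {within range m, continuous h}.
Proof.
move=> cK hX cm chm.
have cl (D : set K) : closed D -> closed (m @` D).
  move=> cD; apply: compact_closed => //; apply: continuous_compact.
    exact: continuous_subspaceT.
  exact: subclosed_compact cD cK (fun _ _ => I).
split; first exact/cl/closedT.
apply/subspace_continuousP => _ [k _ <-] W; rewrite nbhsE => -[V [oV Vk VW]].
have oC : open (~` (m @` ((h \o m) @^-1` (~` V)))).
  apply/closed_openC/cl; apply: preimage_closed => [? _|]; first exact: chm.
  exact: open_closedC.
have nC : nbhs (m k) (~` (m @` ((h \o m) @^-1` (~` V)))).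
  apply: open_nbhs_nbhs; split=> // -[k' /= nV mk]; apply: nV.
  by rewrite /= mk.
rewrite nbhs_simpl /within/=; apply: filterS nC => y ny [k' _ k'y]; apply: VW.
by apply: contrapT => nVy; apply: ny; exists k' => //=; rewrite k'y.
Qed.

Lemma within_seqU (X Y : topologicalType) (I : eqType) (s : seq I) (A : I -> set X)
    (h : X -> Y) :
  (forall i, i \in s -> closed (A i) /\ {within A i, continuous h}) ->
  closed [set x | exists2 i, i \in s & A i x] /\
  {within [set x | exists2 i, i \in s & A i x], continuous h}.
Proof.
elim: s => [|i s IHs] As.
  have -> : [set x | exists2 i, i \in [::] & A i x] = set0.
    by apply/seteqP; split=> x // [].
  by split; [exact: closed0|exact: continuous_subspace0].
have -> : [set x | exists2 j, j \in i :: s & A j x] =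
    A i `|` [set x | exists2 j, j \in s & A j x].
  apply/seteqP; split=> x.
    by move=> [j]; rewrite inE => /predU1P[->|js] Aj; [left|right; exists j].
  by move=> [Ai|[j js Aj]]; [exists i; rewrite ?mem_head|exists j; rewrite ?inE ?js ?orbT].
have [|cs ws] := IHs; first by move=> j js; apply: As; rewrite inE js orbT.
have [ci wi] := As i (mem_head i s).
by split; [exact: closedU|exact: withinU_continuous].
Qed.

Section MatrixTietze.
Variables (R : realType) (X : topologicalType) (n : nat).
Hypotheses (cX : compact [set: X]) (hX : hausdorff_space X).
Local Notation C := R[i].

Lemma entry_part_continuous (p : C -> R) i j :
  (forall z, `|p z| <= normc z) -> (forall z w, p z - p w = p (z - w)) ->
  continuous (fun Z : 'M[C]_n => p (Z i j)).
Proof.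
move=> pn pB Z; apply: (@cvg_normP _ _ (nbhs Z) (nbhs_filter Z)) => e e0.
have hZ : nbhs Z [set Y | opnorm (Y - Z) < e] by apply/nbhs_opnormP; exists e.
apply: (@filterS _ (nbhs Z) (nbhs_filter Z) _ _ _ hZ) => Y /= YZ.
apply: le_lt_trans YZ; rewrite pB; apply: le_trans (pn _) _.
have -> : Y i j - Z i j = (Y - Z) i j by rewrite !mxE.
exact: entry_le_opnorm.
Qed.

Lemma continuous_complex (f g : X -> R) : continuous f -> continuous g ->
  continuous (fun x => f x +i* g x : C).
Proof.
move=> cf cg x W /nbhs_normcP[e e0 eW].
have e20 : 0 < e / 2 by rewrite divr_gt0.
have h1 : nbhs x [set y | `|f y - f x| < e / 2].
  have /(@cvgrPdist_lt R R^o) := cf x => /(_ _ e20).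
  by apply: filterS => y; rewrite distrC.
have h2 : nbhs x [set y | `|g y - g x| < e / 2].
  have /(@cvgrPdist_lt R R^o) := cg x => /(_ _ e20).
  by apply: filterS => y; rewrite distrC.
apply: filterS2 h1 h2 => y /= fy gy; apply: eW.
apply: le_lt_trans (normc_le_ReIm _) _; rewrite [ltRHS]splitr /=; exact: ltrD.
Qed.

(** The scalar theorem is applied to real and imaginary parts of entries. The operator-norm bound is
    lost on the way and is restored later by [truncmx]. *)
Lemma mx_tietze (A : set X) (f : X -> 'M[C]_n) (M : R) : closed A ->
  {within A, continuous f} -> (forall x, A x -> opnorm (f x) <= M) ->
  exists F : X -> 'M[C]_n, continuous F /\ forall x, A x -> F x = f x.
Proof.
move=> cA wf fM; have nX := compact_normal hX cX.
have M0 : 0 < `|M| + 1 by rewrite ltr_wpDl.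
have part (p : C -> R) i j : (forall z, `|p z| <= normc z) ->
    (forall z w, p z - p w = p (z - w)) ->
    exists F : X -> R, continuous F /\ forall x, A x -> F x = p (f x i j).
  move=> pn pB.
  have [|x Ax|F [fF cF _]] := @continuous_bounded_extension X R nX A cA
      (fun x => p (f x i j)) (`|M| + 1) M0.
  - move=> x; apply: (@continuous_comp (subspace A) _ _ f (fun Z : 'M[C]_n => p (Z i j))).
      exact: wf.
    exact: entry_part_continuous.
  - apply: le_trans (pn _) _; apply: le_trans (entry_le_opnorm _ _ _) _.
    by apply: le_trans (fM x Ax) _; apply: le_trans (ler_norm M) _; rewrite lerDl.
  by exists F; split=> // x Ax; rewrite -fF ?inE.
have ReP i j := part (@complex.Re R) i j (@normc_Re R)
  (fun z w => esym (raddfB (@complex.Re R) z w)).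
have ImP i j := part (@complex.Im R) i j (@normc_Im R)
  (fun z w => esym (raddfB (@complex.Im R) z w)).
pose FR i j := projT1 (cid (ReP i j)); pose FI i j := projT1 (cid (ImP i j)).
exists (fun x => \matrix_(i, j) (FR i j x +i* FI i j x)); split.
  apply/continuous_mxP => i j; under eq_fun do rewrite mxE.
  apply: continuous_complex; rewrite /FR /FI.
    by case: (cid (ReP i j)) => F [].
  by case: (cid (ImP i j)) => F [].
move=> x Ax; apply/matrixP => i j; rewrite mxE /FR /FI.
case: (cid (ReP i j)) => F [_ /(_ x Ax) /= ->].
case: (cid (ImP i j)) => G [_ /(_ x Ax) /= ->].
by case: (f x i j).
Qed.

End MatrixTietze.

Section Truncation.
Variables (R : realType) (n : nat).
Local Notation C := R[i].

(** The radial retraction onto the ball of radius M. It depends on Z through the operator norm only,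
    hence commutes with unitary conjugation. *)
Definition truncmx (M : R) (Z : 'M[C]_n) : 'M[C]_n :=
  (M / Num.max M (opnorm Z))%:C *: Z.

Lemma truncmx_id M Z : 0 < M -> opnorm Z <= M -> truncmx M Z = Z.
Proof. by move=> M0 ZM; rewrite /truncmx max_l// divff ?gt_eqF// scale1r. Qed.

Lemma truncmx_le M Z : 0 < M -> opnorm (truncmx M Z) <= M.
Proof.
move=> M0; have m0 : 0 < Num.max M (opnorm Z) by rewrite lt_max M0.
rewrite /truncmx opnormZ normc_real ger0_norm ?divr_ge0 ?(ltW M0) ?(ltW m0)//.
rewrite -[leRHS]mulr1 -mulrA ler_wpM2l ?(ltW M0)//.
by rewrite mulrC ler_pdivrMr// mul1r le_max lexx orbT.
Qed.

Lemma truncmx_conj M U Z : U \is unitarymx ->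
  truncmx M (U *m Z *m invmx U) = U *m truncmx M Z *m invmx U.
Proof.
by move=> Uu; rewrite /truncmx (opnorm_conj _ Uu) -scalemxAr -scalemxAl.
Qed.

Lemma truncmx_continuous M : 0 < M -> continuous (truncmx M).
Proof.
move=> M0.
pose q (Z : 'M[C]_n) := M / Num.max M (opnorm Z).
have cq : continuous q.
  move=> Z; apply: (@cvgM R 'M[C]_n (nbhs Z)); first exact: cvg_cst.
  apply: cvgV; first by rewrite gt_eqF// lt_max M0.
  have -> : (fun Y : 'M[C]_n => Num.max M (opnorm Y)) =
      (fun Y => (M + opnorm Y + `|M - opnorm Y|) / 2%:R) :> ('M[C]_n -> R).
    by apply/funext => Y; rewrite maxr_absE.
  have cO : (@opnorm R n) @ nbhs Z --> opnorm Z := @opnorm_cts R n Z.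
  have cM : (fun _ : 'M[C]_n => M) @ nbhs Z --> M by exact: cvg_cst.
  rewrite maxr_absE; apply: cvgM; last exact: cvg_cst.
  apply: (@cvgD R R^o); first exact: (@cvgD R R^o).
  by apply: (@cvg_norm R R^o); exact: (@cvgB R R^o).
apply/continuous_mxP => i j; under eq_fun do rewrite mxE.
have cc : continuous (fun Z : 'M[C]_n => q Z +i* 0 : C).
  apply: continuous_complex; [exact: cq|exact: continuous_cst].
have ce : continuous (fun Z : 'M[C]_n => Z i j).
  case: (@continuous_mxP C 'M[C]_n n n id) => h _.
  by apply: h => Z; exact: cvg_id.
move=> Z; exact: (@cvgM C 'M[C]_n (nbhs Z) (nbhs_filter Z)
  (fun Y => q Y +i* 0 : C) (fun Y => Y i j) _ _ (cc Z) (ce Z)).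
Qed.

End Truncation.

Section TopologicalExtension.
Variables (R : realType) (T : towerData R).
Hypotheses (Hm : is_mtower T) (Hp : proper_tower T).
Let HT := mtower_tower Hm.
Local Notation C := R[i].
Implicit Types (x y t : T) (f g : tfun T).

Definition ev n f (x : layer T n) : 'M[C]_n := conform_mx 0 (f (set_val x)).

Lemma pad_ev n f (x : layer T n) : pad (ev f x) = pad (f (set_val x)).
Proof. by rewrite pad_conform// layerP. Qed.

Lemma evE n f (x : layer T n) : ev f x = mat n (pad (f (set_val x))).
Proof. by rewrite -pad_ev matK. Qed.

Definition mk_layer n x (e : deg x = n) : layer T n := exist _ x (mem_set e).

Lemma ev_act n f (U : unitary_group R n) (x : layer T n) : is_alg f ->
  ev f (lact HT U x) = set_val U *m ev f x *m invmx (set_val U).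
Proof.
move=> fa; rewrite !evE (alg_actE fa (layerP x) (ugroupP U)).
exact: mat_uconj.
Qed.

Lemma opnorm_pad m n (A : 'M[C]_m) (B : 'M[C]_n) : m = n -> pad A = pad B ->
  opnorm A = opnorm B.
Proof. by move=> e; subst n => /pad_inj ->. Qed.

Lemma opnorm_ev n f (x : layer T n) : opnorm (ev f x) = opnorm (f (set_val x)).
Proof. by apply: opnorm_pad; rewrite ?layerP// pad_ev. Qed.

(* The orbit of a direct sum is the image of a compact space. *)
Lemma within_sums n k l f : (k + l = n)%N -> is_alg f ->
  continuous (@ev k f) -> continuous (@ev l f) ->
  closed [set x : layer T n | exists (U : unitary_group R n) (a : layer T k) (b : layer T l),
    set_val x = act (set_val U) (oplus (set_val a) (set_val b))] /\
  {within [set x : layer T n | exists (U : unitary_group R n) (a : layer T k) (b : layer T l),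
    set_val x = act (set_val U) (oplus (set_val a) (set_val b))], continuous (@ev n f)}.
Proof.
move=> kl fa ck cl.
pose s (p : layer T k * layer T l) : layer T n :=
  mk_layer (etrans (deg_oplusE HT (layerP p.1) (layerP p.2)) kl).
pose m (p : unitary_group R n * (layer T k * layer T l)) : layer T n :=
  lact HT p.1 (s p.2).
have cs : continuous s.
  apply: to_set_type_continuous.
  have c2 : continuous (fun p : layer T k * layer T l => (set_val p.1, set_val p.2) : T * T).
    apply: continuous_pair => p.
      by apply: (@continuous_comp _ _ _ fst set_val); [exact: cvg_fst|exact: val_continuous].
    by apply: (@continuous_comp _ _ _ snd set_val); [exact: cvg_snd|exact: val_continuous].
  move=> p; apply: (@continuous_comp _ _ _
    (fun p : layer T k * layer T l => (set_val p.1, set_val p.2) : T * T)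
    (fun q : T * T => oplus q.1 q.2)); first exact: c2.
  exact: (oplus_continuous HT).
have cm : continuous m.
  have c2 : continuous (fun p : unitary_group R n * (layer T k * layer T l) => (p.1, s p.2)).
    apply: continuous_pair => p; first exact: cvg_fst.
    by apply: (@continuous_comp _ _ _ snd s); [exact: cvg_snd|exact: cs].
  move=> p; apply: (@continuous_comp _ _ _
    (fun p : unitary_group R n * (layer T k * layer T l) => (p.1, s p.2))
    (fun q => lact HT q.1 q.2)); first exact: c2.
  exact: lact_continuous.
have cev : continuous (fun p : layer T k * layer T l =>
    mat n (udsum k l (pad (ev f p.1)) (pad (ev f p.2)))).
  have c1 : continuous (fun p : layer T k * layer T l => ev f p.1).
    by move=> p; apply: (@continuous_comp _ _ _ fst (@ev k f)); [exact: cvg_fst|exact: ck].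
  have c2 : continuous (fun p : layer T k * layer T l => ev f p.2).
    by move=> p; apply: (@continuous_comp _ _ _ snd (@ev l f)); [exact: cvg_snd|exact: cl].
  have cpad q (h : layer T k * layer T l -> 'M[C]_q) i j : continuous h ->
      continuous (fun p => pad (h p) i j).
    move=> /continuous_mxP ch; rewrite /pad.
    case: insub => [i'|]; last exact: continuous_cst.
    by case: insub => [j'|]; [exact: ch|exact: continuous_cst].
  apply/continuous_mxP => i j; under eq_fun do rewrite mxE.
  rewrite /udsum; case: ((i < k) && (j < k))%N; first exact: cpad.
  case: [&& _, _, _ & _]; [exact: cpad|exact: continuous_cst].
have evm : @ev n f \o m = fun p : unitary_group R n * (layer T k * layer T l) =>
    set_val p.1 *m mat n (udsum k l (pad (ev f p.2.1)) (pad (ev f p.2.2))) *m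
    (set_val p.1) ^t*.
  apply/funext => -[U [a b]] /=; rewrite (ev_act _ _ fa) (invmx_unitary (ugroupP U)).
  congr (_ *m _ *m _); rewrite evE /=; congr mat.
  have ud x y : deg x = k -> deg y = l ->
      pad (f (oplus x y)) = udsum k l (pad (f x)) (pad (f y)).
    by have [_ fo] := fa; move=> <- <-; exact: fo.
  by rewrite !pad_ev; exact: ud (layerP a) (layerP b).
have cem : continuous (@ev n f \o m).
  rewrite evm.
  have cU : continuous (fun p : unitary_group R n * (layer T k * layer T l) => set_val p.1 : 'M[C]_n).
    by move=> p; apply: (@continuous_comp _ _ _ fst set_val); [exact: cvg_fst|exact: val_continuous].
  apply: (continuous_mx_mul (continuous_mx_mul cU _) (continuous_mx_adj cU)).
  move=> p; apply: (@continuous_comp _ _ _ snd (fun p : layer T k * layer T l =>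
    mat n (udsum k l (pad (ev f p.1)) (pad (ev f p.2))))); first exact: cvg_snd.
  exact: cev.
have cK : compact [set: unitary_group R n * (layer T k * layer T l)].
  apply: compact_setTX; first exact: compact_ugroup_type.
  by apply: compact_setTX; apply: compact_layer_type; exact: Hp.
have := range_within cK (hausdorff_layer (n := n) HT) cm cem.
have <- : range m = [set x : layer T n | exists (U : unitary_group R n) (a : layer T k)
    (b : layer T l), set_val x = act (set_val U) (oplus (set_val a) (set_val b))]; last by [].
apply/seteqP; split=> x.
  by move=> [[U [a b]] _ <-]; exists U, a, b.
by move=> [U [a [b xE]]]; exists (U, (a, b)) => //; apply/val_inj; rewrite /= -xE.
Qed.

Lemma within_orbit n f t : deg t = n -> is_alg f ->
  closed [set x : layer T n | tequiv t (set_val x)] /\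
  {within [set x : layer T n | tequiv t (set_val x)], continuous (@ev n f)}.
Proof.
move=> dt fa; pose t' := mk_layer dt.
pose m (U : unitary_group R n) : layer T n := lact HT U t'.
have cm : continuous m.
  move=> U; apply: (@continuous_comp _ _ _ (fun U : unitary_group R n => (U, t'))
    (fun p => lact HT p.1 p.2)); first exact: continuous_pairl.
  exact: lact_continuous.
have evm : @ev n f \o m = fun U => set_val U *m ev f t' *m (set_val U) ^t*.
  by apply/funext => U /=; rewrite (ev_act _ _ fa) (invmx_unitary (ugroupP U)).
have cem : continuous (@ev n f \o m).
  rewrite evm; have cU : continuous (fun U : unitary_group R n => set_val U : 'M[C]_n).
    exact: val_continuous.
  apply: (continuous_mx_mul (continuous_mx_mul cU _) (continuous_mx_adj cU)).
  exact: continuous_cst.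
have := range_within (@compact_ugroup_type R n) (hausdorff_layer (n := n) HT) cm cem.
have <- : range m = [set x : layer T n | tequiv t (set_val x)]; last by [].
apply/seteqP; split=> x.
  by move=> [U _ <-]; exact: tequiv_intro dt (ugroupP U).
move=> /(tequivE dt)[U Uu Ux]; exists (mkG Uu) => //.
by apply/val_inj.
Qed.

(** The points of degree n where the value is already prescribed: reducible ones, determined by
    lower layers, and the orbits of the list L, where the original value is to be kept. *)
Definition fixed_locus n (L : seq T) : set (layer T n) :=
  [set x | reducible (set_val x) \/ exists2 t, t \in L & tequiv t (set_val x)].

End TopologicalExtension.

(** * Extension from layer to layer *)

Section LayerInduction.
Variables (R : realType) (T : towerData R).
Hypotheses (Hm : is_mtower T) (Hp : proper_tower T).
Let HT := mtower_tower Hm.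
Local Notation C := R[i].
Implicit Types (x y t : T) (f g : tfun T).

Lemma within_locus n (L : seq T) f : is_alg f -> (forall k, (k < n)%N -> continuous (@ev R T k f)) ->
  closed (@fixed_locus R T n L) /\ {within @fixed_locus R T n L, continuous (@ev R T n f)}.
Proof.
move=> fa fc.
pose A (i : nat + T) : set (layer T n) := match i with
  | inl k => [set x : layer T n | exists (U : unitary_group R n) (a : layer T k)
      (b : layer T (n - k)), set_val x = act (set_val U) (oplus (set_val a) (set_val b))]
  | inr t => [set x : layer T n | tequiv t (set_val x)] end.
(* Finitely many closed pieces: sums of degrees k and n - k for 0 < k < n, and the orbits of those
   points of L that have degree n. *)
pose s : seq (nat + T) := [seq inl k | k <- iota 1 n.-1] ++ [seq inr t | t <- L & deg t == n].
have As i : i \in s -> closed (A i) /\ {within A i, continuous (@ev R T n f)}.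
  rewrite mem_cat => /orP[/mapP[k]|/mapP[t]].
    rewrite mem_iota => /andP[k0 kn] ->; have lt : (k < n)%N by lia.
    apply: within_sums => //; [by lia|exact: fc|apply: fc; lia].
  by rewrite mem_filter => /andP[/eqP dt _] ->; exact: within_orbit.
have := within_seqU As.
suff -> : [set x | exists2 i, i \in s & A i x] = @fixed_locus R T n L by [].
apply/seteqP; split=> x.
  move=> [j]; rewrite mem_cat => /orP[/mapP[k]|/mapP[t]].
    rewrite mem_iota => /andP[k0 kn] -> [U [a [b xE]]]; left; apply: contrapT.
    have Uu := ugroupP U => xc; apply: (@not_core_oplus _ _ HT (set_val a) (set_val b)).
    apply: core_tequiv HT _ _ _ xc; apply: (tequiv_sym HT); rewrite xE.
    apply: (tequiv_intro (n := n) _ Uu).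
    by rewrite (deg_oplusE HT (layerP a) (layerP b)); lia.
  by rewrite mem_filter => /andP[/eqP dt tL] -> /= tx; right; exists t.
move=> [/(reducibleE (layerP x))[V Vu [a [b xE]]]|[t tL tx]].
  have dab : (deg a + deg b)%N = n.
    by rewrite -(deg_oplus HT) -xE (deg_actE HT (layerP x) Vu).
  have db : deg b = (n - deg a)%N by lia.
  exists (inl (deg a)).
    rewrite mem_cat map_f // mem_iota (deg_gt0 a).
    by have := deg_gt0 a; have := deg_gt0 b; lia.
  exists (mkG (unitarymxV Vu)), (mk_layer (erefl (deg a))), (mk_layer db).
  by rewrite -[RHS]/(act (invmx V) (oplus a b)) -xE (actVK HT (layerP x) Vu).
exists (inr t) => //; rewrite mem_cat; apply/orP; right; apply: map_f.
by rewrite mem_filter tL andbT -(tequiv_deg HT tx); apply/eqP/layerP.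
Qed.

Lemma fixed_locus_act n (L : seq T) (U : unitary_group R n) (x : layer T n) :
  @fixed_locus R T n L x -> @fixed_locus R T n L (lact HT U x).
Proof.
have e := tequiv_intro (layerP x) (ugroupP U).
move=> [xr|[t tL tx]]; [left|right; exists t => //].
  apply: contrapT => xc; have := core_tequiv HT (tequiv_sym HT e) xc.
  by apply.
exact: tequiv_trans HT _ _ _ tx e.
Qed.

Definition layer_patch n (E : layer T n -> 'M[C]_n) f : tfun T := fun x =>
  if @eqP _ (deg x) n is ReflectT e then conform_mx 0 (E (mk_layer e)) else f x.

Lemma layer_patch_in n (E : layer T n -> 'M[C]_n) f (x : layer T n) :
  pad (layer_patch E f (set_val x)) = pad (E x).
Proof.
rewrite /layer_patch; case: eqP => [e|]; last by have := layerP x.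
rewrite pad_conform ?layerP//; congr (pad (E _)); exact: val_inj.
Qed.

Lemma layer_patch_out n (E : layer T n -> 'M[C]_n) f x : deg x <> n ->
  layer_patch E f x = f x.
Proof. by rewrite /layer_patch; case: eqP. Qed.

(** Tietze, averaging and truncation each leave the values on [fixed_locus] alone, where
    equivariance and the bound hold already. Only core values of degree n are changed, so the
    algebraic re-extension agrees with f below degree n and at reducible points of degree n. *)
Lemma layer_step n (M : R) f (L : seq T) : 0 < M -> is_alg f ->
  (forall x, opnorm (f x) <= M) ->
  (forall k, (k < n)%N -> continuous (@ev R T k f)) ->
  exists f', [/\ is_alg f', (forall x, opnorm (f' x) <= M),
    (forall k, (k < n.+1)%N -> continuous (@ev R T k f')),
    (forall x, (deg x < n)%N -> f' x = f x) &
    (forall t, t \in L -> core T t -> f' t = f t)].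
Proof.
move=> M0 fa fM fc.
have [cD wD] := within_locus L fa fc.
have cX := compact_layer_type (@Hp n).
have hX := hausdorff_layer (n := n) HT.
have [|F [cF Ff]] := mx_tietze cX hX cD wD (M := M).
  by move=> x _; rewrite opnorm_ev.
pose E (x : layer T n) := truncmx M (equiv_avg HT cF x).
have cE : continuous E.
  move=> x; apply: (@continuous_comp _ _ _ (equiv_avg HT cF) (truncmx M)).
    exact: equiv_avg_continuous.
  exact: truncmx_continuous.
have Eact (U : unitary_group R n) (x : layer T n) :
    E (lact HT U x) = set_val U *m E x *m invmx (set_val U).
  by rewrite /E equiv_avg_act (truncmx_conj _ _ (ugroupP U)).
have ED (x : layer T n) : @fixed_locus R T n L x -> E x = ev f x.
  move=> Dx; rewrite /E equiv_avg_fixed.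
    by rewrite (Ff _ Dx); apply: truncmx_id => //; rewrite opnorm_ev.
  move=> U; rewrite (Ff _ (fixed_locus_act U Dx)) (Ff _ Dx).
  exact: ev_act.
pose g := layer_patch E f.
have ge : core_equivariant g.
  move=> x U xc Uu; have [e|ne] := eqVneq (deg x) n.
    have gx := layer_patch_in E f (mk_layer e).
    rewrite [pad (g x)]gx; subst n.
    have := layer_patch_in E f (lact HT (mkG Uu) (mk_layer (erefl (deg x)))).
    by move=> /= ->; rewrite Eact /uconj matK.
  rewrite /g !layer_patch_out; last 2 first.
  - exact/eqP.
  - by rewrite (deg_act HT Uu); exact/eqP.
  by have [fa1 _] := fa; exact: fa1.
have fga := alg_extP Hm ge.
pose f' := alg_ext Hm g.
have flow x : (forall t, core T t -> tsub t x -> (deg t) <> n) -> f' x = f x.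
  move=> xn; apply: (is_alg_eq Hm fga fa) => t tc tx.
  by rewrite (alg_ext_core Hm ge tc) /g layer_patch_out//; exact: xn.
have fE (x : layer T n) : ev f' x = E x.
  have [xc|/contrapT xr] := pselect (core T (set_val x)).
    by rewrite evE /f' (alg_ext_core Hm ge xc) /g layer_patch_in matK.
  rewrite ED; last by left.
  rewrite evE [RHS]evE; congr (mat n (pad _)); apply: flow => t tc tx dt.
  have e := tsub_deg_eq HT tx (etrans dt (esym (layerP x))).
  exact: (core_tequiv HT e tc).
have flow' x : (deg x < n)%N -> f' x = f x.
  move=> xn; apply: flow => t tc tx dt.
  by have := tsub_deg HT tx; rewrite dt leqNgt xn.
exists f'; split; [exact: fga|..|exact: flow'|].
- move=> x; apply: (is_alg_opnorm_le Hm fga) => t tc _.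
  rewrite (alg_ext_core Hm ge tc); have [e|ne] := eqVneq (deg t) n.
    rewrite (opnorm_pad e (layer_patch_in E f (mk_layer e))).
    exact: truncmx_le.
  by rewrite /g layer_patch_out//; exact/eqP.
- move=> k; rewrite ltnS leq_eqVlt => /predU1P[->|kn].
    by have -> : @ev R T n f' = E by apply/funext.
  have -> : @ev R T k f' = @ev R T k f; last exact: fc.
  by apply/funext => x; rewrite !evE flow'// (layerP x).
- move=> t tL tc; have [e|ne] := eqVneq (deg t) n.
    have h := fE (mk_layer e); rewrite ED in h; last first.
      by right; exists t => //; exact: tequiv_refl.
    apply: (@pad_inj R); rewrite -[LHS](pad_ev f' (mk_layer e)) h.
    exact: pad_ev.
  by rewrite /f' (alg_ext_core Hm ge tc) /g layer_patch_out//; exact/eqP.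
Qed.

End LayerInduction.

Section TopologicalExtension2.
Variables (R : realType) (T : towerData R).
Hypotheses (Hm : is_mtower T) (Hp : proper_tower T).
Let HT := mtower_tower Hm.
Local Notation C := R[i].
Implicit Types (x y t : T) (f g : tfun T).

Lemma opnorm_tequiv f x y : is_alg f -> tequiv x y -> opnorm (f y) = opnorm (f x).
Proof.
move=> [fa _] [U [Uu <-]]; rewrite -(opnorm_conj (f x) Uu).
apply: opnorm_pad; first exact: (deg_act HT Uu).
by rewrite (fa _ _ Uu) /uconj matK.
Qed.

Lemma opnorm_tsub f x y : is_alg f -> tsub x y -> opnorm (f x) <= opnorm (f y).
Proof.
move=> fa [e|[a [b [e1 e2]]]]; first by rewrite (opnorm_tequiv fa e).
rewrite -(opnorm_tequiv fa e1) -(opnorm_tequiv fa e2).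
have [_ fo] := fa; have := fo a b; rewrite -pad_dsum => h.
by rewrite (opnorm_pad (deg_oplus HT a b) h); exact: opnorm_dsum_gel.
Qed.

Lemma finite_cores x : exists2 L : seq T, (forall t, t \in L -> core T t /\ tsub t x) &
  forall t, core T t -> tsub t x -> exists2 t', t' \in L & tequiv t' t.
Proof.
elim/(tower_ind HT): x => [x xc|x y [L Lc LP] [L' Lc' LP']|x U Uu [L Lc LP]].
- exists [:: x] => [t|t tc tx]; first by rewrite inE => /eqP ->; split=> //; exact: tsub_refl.
  exists x; rewrite ?mem_head//; apply: (tequiv_sym HT); exact: tsub_core tx.
- exists (L ++ L') => [t|t tc /(core_tsub_oplus Hm tc)[tx|ty]].
  + rewrite mem_cat => /orP[/Lc|/Lc'] [tc tx]; split=> //.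
      exact: tsub_oplusl.
    exact: tsub_oplusr.
  + by have [t' t'L e] := LP t tc tx; exists t'; rewrite ?mem_cat ?t'L.
  + by have [t' t'L e] := LP' t tc ty; exists t'; rewrite ?mem_cat ?t'L ?orbT.
- have e : tequiv x (act U x) by exact: tequiv_intro Uu.
  exists L => [t /Lc[tc tx]|t tc tx]; first by split=> //; exact: tsub_tequivr HT _ _ _ e tx.
  apply: LP => //; apply: tsub_tequivr HT _ _ _ _ tx; exact: tequiv_sym.
Qed.

Lemma in_Cstar_intro f (M : R) : is_alg f -> (forall x, opnorm (f x) <= M) ->
  (forall n, continuous (@ev R T n f)) -> in_Cstar f.
Proof.
move=> [fa fo] fM fc; split; first exact: fc.
- move=> x U Uu; rewrite -(mat_pad_conform _ (deg_act HT Uu)) fa//.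
  by rewrite /uconj !matK.
- by move=> x y; rewrite -(mat_pad_conform _ (deg_oplus HT x y)) fo -pad_dsum matK.
- by exists M => _ [x _ <-].
Qed.

Lemma in_Cstar_approx f s : is_alg f -> exists2 f', in_Cstar f' & f' s = f s.
Proof.
(* An algebraic f may be unbounded. Keeping its core values only below s bounds them by the norm of
   f s without changing f s; the added 1 makes M positive. *)
move=> fa; pose g : tfun T := fun x => if pselect (tsub x s) then f x else 0.
have ge : core_equivariant g.
  move=> x U xc Uu; rewrite /g; have e := tequiv_intro (erefl (deg x)) Uu.
  case: pselect => h; case: pselect => h'.
  - by have [fa1 _] := fa; exact: fa1.
  - by case: h'; apply: tsub_tequivl HT _ _ _ _ h; exact: tequiv_sym.
  - by case: h; exact: tsub_tequivl HT _ _ _ e h'.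
  - by rewrite uconj0 pad0.
pose f0 := alg_ext Hm g; have f0a : is_alg f0 := alg_extP Hm ge.
have f0s : f0 s = f s.
  apply: (is_alg_eq Hm f0a fa) => t tc ts.
  by rewrite /f0 (alg_ext_core Hm ge tc) /g; case: pselect.
pose M := opnorm (f s) + 1.
have M0 : 0 < M by rewrite ltr_wpDl ?opnorm_ge0.
have f0M x : opnorm (f0 x) <= M.
  apply: (is_alg_opnorm_le Hm f0a) => t tc _.
  rewrite /f0 (alg_ext_core Hm ge tc) /g; case: pselect => [ts|nts] /=.
    by rewrite (le_trans (opnorm_tsub fa ts))// lerDl.
  by rewrite opnorm0 (ltW M0).
have [L Lc LP] := finite_cores s.
pose P n f := [/\ is_alg f, (forall x, opnorm (f x) <= M),
  (forall k, (k < n)%N -> continuous (@ev R T k f)) &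
  (forall t, t \in L -> f t = f0 t)].
have step n f1 : P n f1 -> exists f', P n.+1 f' /\ forall x, (deg x < n)%N -> f' x = f1 x.
  move=> [a1 b1 c1 d1].
  have [f' [a2 b2 c2 e2 d2]] := layer_step Hm Hp L M0 a1 b1 c1.
  exists f'; split=> //; split=> // t tL; rewrite d2 ?d1//.
  by have [] := Lc t tL.
have st (p : nat * tfun T) : exists f', P p.1 p.2 ->
    P p.1.+1 f' /\ forall x, (deg x < p.1)%N -> f' x = p.2 x.
  have [h|h] := pselect (P p.1 p.2); last by exists 0.
  by have [f' h'] := step p.1 p.2 h; exists f'.
have [next nextP'] := choice st.
have nextP n f1 : P n f1 ->
    P n.+1 (next (n, f1)) /\ forall x, (deg x < n)%N -> next (n, f1) x = f1 x.
  exact: nextP' (n, f1).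
(* Stage n is settled in degrees below n and later stages do not change it there, so the limit [h]
   may read each point at the stage following its degree. *)
pose F := fix F n := if n is m.+1 then next (m, F m) else f0.
have FP n : P n (F n).
  elim: n => [|n IHn]; first by split.
  by have [] := nextP n (F n) IHn.
have Fst n x : (deg x < n)%N -> F n x = F (deg x).+1 x.
  elim: n => // n IHn; rewrite ltnS leq_eqVlt => /predU1P[e|xn].
    by rewrite -e.
  have [_ h] := nextP n (F n) (FP n).
  by rewrite -(IHn xn) -(h x xn).
pose h : tfun T := fun x => F (deg x).+1 x.
have hF n x : (deg x < n)%N -> h x = F n x by move=> /Fst.
have ha : is_alg h.
  split=> [x U Uu|x y].
    have [[a1 _] _ _ _] := FP (deg x).+1.
    rewrite (hF (deg x).+1 x (ltnSn _)) (hF (deg x).+1 (act U x)); first exact: a1.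
    by rewrite (deg_act HT Uu).
  have [[_ a2] _ _ _] := FP (deg x + deg y).+1.
  rewrite (hF (deg x + deg y).+1 x) ?ltnS ?leq_addr//.
  rewrite (hF (deg x + deg y).+1 y) ?ltnS ?leq_addl//.
  rewrite (hF (deg x + deg y).+1 (oplus x y)) ?(deg_oplus HT)//; exact: a2.
exists h.
  apply: (in_Cstar_intro (M := M) ha).
    by move=> x; have [_ b _ _] := FP (deg x).+1; exact: b.
  move=> n; have [_ _ c _] := FP n.+1; have cn := c n (ltnSn n).
  have -> : @ev R T n h = @ev R T n (F n.+1); last exact: cn.
  apply/funext => x; rewrite !evE; congr (mat n (pad _)).
  by apply: hF; rewrite (layerP x).
rewrite -f0s; apply: (is_alg_eq Hm ha f0a) => t tc ts.
have [t' t'L [U [Uu <-]]] := LP t tc ts.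
apply: (@pad_inj R); rewrite (proj1 ha _ _ Uu) (proj1 f0a _ _ Uu).
by have [_ _ _ d] := FP (deg t').+1; rewrite /h d.
Qed.

End TopologicalExtension2.

(** * Interpolation by elements of an ideal *)

Section IdealInterpolation.
Variables (R : realType) (T : towerData R).
Hypotheses (Hm : is_mtower T) (Hp : proper_tower T).
Local Notation C := R[i].
Implicit Types (x y t s : T) (f g u : tfun T).

Lemma is_alg_tequiv_eq f g t x : is_alg f -> is_alg g -> tequiv t x ->
  f t = g t -> f x = g x.
Proof.
move=> [fa _] [ga _] [U [Uu <-]] e; apply: (@pad_inj R).
by rewrite (fa _ _ Uu) (ga _ _ Uu) e.
Qed.

Lemma tfun_sumE (I : Type) (r : seq I) (F : I -> tfun T) x :
  (\sum_(j <- r) F j) x = \sum_(j <- r) F j x.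
Proof.
elim: r => [|j r IHr]; first by rewrite !big_nil.
by rewrite !big_cons -IHr.
Qed.

Lemma is_alg_sum (I : Type) (r : seq I) (F : I -> tfun T) :
  (forall j, is_alg (F j)) -> is_alg (\sum_(j <- r) F j).
Proof.
move=> Fa; elim: r => [|j r IHr]; first by rewrite big_nil; exact: is_alg0.
by rewrite big_cons -[F j]scale1r; exact: is_alg_linear.
Qed.

(** Simplicity of the matrix algebra made explicit: one nonzero entry of W generates every X. *)
Lemma mx_sandwich n (X W : 'M[C]_n) (a b : 'I_n) : W a b != 0 ->
  X = \sum_i \sum_j ((X i j / W a b) *: delta_mx i a) *m W *m delta_mx b j.
Proof.
move=> wab; rewrite [LHS]matrix_sum_delta.
apply: eq_bigr => i _; apply: eq_bigr => j _.
rewrite -!scalemxAl; have -> : delta_mx i a *m W *m delta_mx b j = W a b *: delta_mx i j.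
  apply/matrixP => p q; rewrite mxE (bigD1 b)//= big1 ?addr0; last first.
    by move=> c cb; rewrite [delta_mx b j c q]mxE (negbTE cb) mulr0.
  rewrite [delta_mx b j b q]mxE eqxx/= mxE (bigD1 a)//= big1 ?addr0; last first.
    by move=> c ca; rewrite mxE (negbTE ca) andbF mul0r.
  rewrite !mxE eqxx andbT; case: (p == i); case: (q == j); rewrite ?mulr1 ?mulr0 ?mul1r ?mul0r //.
by rewrite scalerA divfK.
Qed.

Variable I : tfun T -> Prop.
Hypotheses (Ia : forall u, I u -> is_alg u) (I0 : I 0)
  (IL : forall c u v, I u -> I v -> I (c *: u + v))
  (IM : forall g u h, in_Cstar g -> I u -> in_Cstar h -> I (tfun_mul (tfun_mul g u) h)).

Lemma ideal_sum (J : Type) (r : seq J) (F : J -> tfun T) :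
  (forall j, I (F j)) -> I (\sum_(j <- r) F j).
Proof.
move=> FI; elim: r => [|j r IHr]; first by rewrite big_nil.
by rewrite big_cons -[F j]scale1r; exact: IL.
Qed.

(** The value f t is generated from w t by [mx_sandwich], with bumps carrying the matrix units. The
    bumps are replaced by elements of C*(T) with the same values at s, as only the value at s is
    claimed. *)
Lemma ideal_bump f s t : is_alg f -> core T t ->
  (f t <> 0 -> exists2 w, I w & w t <> 0) ->
  exists2 u, I u & u s = tfun_mul f (alg_bump Hm (1%:M : 'M[C]_(deg t))) s.
Proof.
move=> fa tc fw; set e := alg_bump _ _.
have ea : is_alg e by exact: alg_bumpP.
have fea : is_alg (tfun_mul f e) by exact: is_alg_mul.
have [ft0|/eqP/fw[w Iw wt0]] := eqVneq (f t) 0.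
  exists 0 => //; apply/esym; apply: (is_alg_eq0 Hm fea) => x xc xs.
  have [tx|ntx] := pselect (tequiv t x).
    apply: (is_alg_tequiv_eq fea (is_alg0 Hm) tx).
    by rewrite /tfun_mul ft0 mul0mx.
  by rewrite /tfun_mul /e (alg_bump_core Hm _ tc xc ntx) mulmx0.
have [a [b wab]] : exists a b, w t a b != 0.
  apply: contrapT => h; apply: wt0; apply/matrixP => a b; rewrite mxE.
  by apply/eqP; apply: contrapT => /negP hab; apply: h; exists a, b.
pose A i j := (f t i j / w t a b) *: (delta_mx i a : 'M[C]_(deg t)).
pose B j := (delta_mx b j : 'M[C]_(deg t)).
pose gA i j := alg_bump Hm (A i j); pose gB j := alg_bump Hm (B j).
have gAa i j : is_alg (gA i j) by exact: alg_bumpP.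
have gBa j : is_alg (gB j) by exact: alg_bumpP.
have hA (p : 'I_(deg t) * 'I_(deg t)) : exists u, in_Cstar u /\ u s = gA p.1 p.2 s.
  by have [u uc us] := in_Cstar_approx Hm Hp s (gAa p.1 p.2); exists u.
have hB j : exists u, in_Cstar u /\ u s = gB j s.
  by have [u uc us] := in_Cstar_approx Hm Hp s (gBa j); exists u.
have [GA GAP] := choice hA; have [GB GBP] := choice hB.
pose h i j := tfun_mul (tfun_mul (gA i j) w) (gB j).
have ha i j : is_alg (h i j).
  exact: (is_alg_mul Hm (is_alg_mul Hm (gAa i j) (Ia Iw)) (gBa j)).
exists (\sum_i \sum_j tfun_mul (tfun_mul (GA (i, j)) w) (GB j)).
  apply: ideal_sum => i; apply: ideal_sum => j.
  by have [GAc _] := GAP (i, j); have [GBc _] := GBP j; exact: IM.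
have -> : (\sum_i \sum_j tfun_mul (tfun_mul (GA (i, j)) w) (GB j)) s =
    (\sum_i \sum_j h i j) s.
  rewrite !tfun_sumE; apply: eq_bigr => i _; rewrite !tfun_sumE; apply: eq_bigr => j _.
  have [_ eA] := GAP (i, j); have [_ eB] := GBP j.
  by rewrite /h -[LHS]/(GA (i, j) s *m w s *m GB j s) eA eB.
have sa : is_alg (\sum_i \sum_j h i j).
  apply: is_alg_sum => i; apply: is_alg_sum => j; exact: ha.
apply: (is_alg_eq Hm sa fea) => x xc xs.
have [tx|ntx] := pselect (tequiv t x).
  apply: (is_alg_tequiv_eq sa fea tx); rewrite /tfun_mul /e (alg_bump_at Hm _ tc) mulmx1.
  rewrite [RHS](mx_sandwich (f t) wab) tfun_sumE; apply: eq_bigr => i _.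
  rewrite tfun_sumE; apply: eq_bigr => j _.
  by rewrite /h /tfun_mul /gA /gB !(alg_bump_at Hm _ tc).
rewrite /tfun_mul /e (alg_bump_core Hm _ tc xc ntx) mulmx0.
rewrite tfun_sumE big1// => i _; rewrite tfun_sumE big1// => j _.
by rewrite /h /tfun_mul /gB (alg_bump_core Hm _ tc xc ntx) mulmx0.
Qed.

(** The irreducible parts of s are removed one at a time: f = f e + (f - f e), where e is the bump 1
    at the part t. The first term is [ideal_bump] and the second vanishes at t. *)
Lemma ideal_interpolation f s : is_alg f ->
  (forall t, core T t -> f t <> 0 -> exists2 w, I w & w t <> 0) ->
  exists2 u, I u & u s = f s.
Proof.
move=> fa fw; have [L Lc LP] := finite_cores Hm s.
have {LP} : forall t, core T t -> tsub t s -> f t <> 0 ->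
    exists2 t', t' \in L & tequiv t' t by move=> t tc ts _; exact: LP.
elim: L Lc f fa fw => [|t L IHL] Lc f fa fw LP.
  exists 0 => //; apply/esym; apply: (is_alg_eq0 Hm fa) => t tc ts.
  by apply/eqP; apply: contrapT => /negP/eqP/(LP _ tc ts)[].
have [tc ts] := Lc t (mem_head _ _).
set e := alg_bump Hm (1%:M : 'M[C]_(deg t)).
have ea : is_alg e by exact: alg_bumpP.
have fea : is_alg (tfun_mul f e) by exact: is_alg_mul.
have f'a : is_alg (-1 *: tfun_mul f e + f) by exact: is_alg_linear.
have f'E x : (-1 *: tfun_mul f e + f) x = f x - f x *m e x.
  by rewrite -[LHS]/(-1 *: (f x *m e x) + f x) scaleN1r addrC.
have f'w x : f x = 0 -> (-1 *: tfun_mul f e + f) x = 0.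
  by move=> fx0; rewrite f'E fx0 mul0mx subr0.
have [||x xc|u2 Iu2 u2s] := IHL _ _ f'a.
- by move=> x xL; apply: Lc; rewrite inE xL orbT.
- by move=> x xc f'x; apply: fw => // /f'w.
- move=> xs f'x; have [|t'] := LP x xc xs; first by move=> /f'w.
  rewrite inE => /predU1P[->|t'L] e't; last by exists t'.
  exfalso; apply: f'x; apply: (is_alg_tequiv_eq f'a (is_alg0 Hm) e't).
  by rewrite f'E /e (alg_bump_at Hm _ tc) mulmx1 subrr.
have [u1 Iu1 u1s] := ideal_bump s fa tc (fw t tc).
exists (1 *: u1 + u2); first exact: IL.
rewrite scale1r -[LHS]/(u1 s + u2 s) u1s u2s f'E addrC subrK //.
Qed.

End IdealInterpolation.

(** * Function algebras of pointed towers *)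

Section C0CstarAlgebra.
Variables (R : realType) (T : towerData R) (theta : T).
Local Notation C := R[i].
Implicit Types (x y t s : T) (f g : tfun T) (u v : C0 theta).

Lemma C0_normE u : `|u| = (supnorm (C0val u))%:C.
Proof. by []. Qed.

Lemma C0valB u v x : C0val (u - v) x = C0val u x - C0val v x.
Proof. by []. Qed.

Lemma C0_ext u v : (forall x, C0val u x = C0val v x) -> u = v.
Proof. by move=> h; apply/val_inj; apply: functional_extensionality_dep. Qed.

Lemma opnorm_conform m n (X : 'M[C]_m) : opnorm (conform_mx (0 : 'M[C]_n) X) <= opnorm X.
Proof.
have [e|ne] := eqVneq m n; first by subst n; rewrite conform_mx_id.
by rewrite nonconform_mx ?ne// opnorm0 opnorm_ge0.
Qed.

Lemma conform_mxB m n (X Y : 'M[C]_m) : conform_mx (0 : 'M[C]_n) (X - Y) =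
  conform_mx (0 : 'M[C]_n) X - conform_mx (0 : 'M[C]_n) Y.
Proof.
by rewrite addrC -scaleN1r conform_mx_linear scaleN1r addrC.
Qed.

Lemma opnorm_small n (X : 'M[C]_n) :
  (forall e : R, 0 < e -> opnorm X <= e) -> X = 0.
Proof.
move=> h; apply: opnorm_eq0; apply/eqP; rewrite eq_le opnorm_ge0 andbT.
apply/ler_addgt0Pl => e e0; rewrite addr0; exact: h.
Qed.

Lemma opnorm_triangle n (X Y : 'M[C]_n) (a b : R) :
  opnorm X <= a -> opnorm (Y - X) <= b -> opnorm Y <= a + b.
Proof.
move=> Xa Yb; rewrite -[Y](subrK X) addrC.
by apply: le_trans (opnormD _ _) _; apply: lerD.
Qed.

Lemma uniform_limit_C0 f :
  (forall e : R, 0 < e -> exists u, forall x, opnorm (C0val u x - f x) <= e) ->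
  in_C0 theta f.
Proof.
move=> fu; split; first split.
- move=> n; apply/continuous_opnormP => x e e0.
  have e3 : 0 < e / 3 by rewrite divr_gt0.
  have [u uf] := fu _ e3; have [[uc _ _ _] _ _] := C0funP u.
  have := uc n; move/continuous_opnormP => /(_ x _ e3).
  apply: filterS => y uyx.
  have h z : opnorm (conform_mx (0 : 'M[C]_n) (C0val u z) - conform_mx (0 : 'M[C]_n) (f z)) <= e / 3.
    by rewrite -conform_mxB; apply: le_trans (opnorm_conform _ _) (uf z).
  have -> : e = (e / 3 + e / 3) + e / 3 by field.
  apply: le_lt_trans (opnormB_triangle _ (conform_mx 0 (C0val u (val x))) _) _.
  apply: ltr_leD; last exact: h.
  apply: le_lt_trans (opnormB_triangle _ (conform_mx 0 (C0val u (val y))) _) _.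
  by apply: ler_ltD uyx; rewrite opnormBC.
- move=> x U Uu; apply/eqP; rewrite -subr_eq0; apply/eqP; apply: opnorm_small => e e0.
  have e2 : 0 < e / 2 by rewrite divr_gt0.
  have [u uf] := fu _ e2; have [[_ ua _ _] _ _] := C0funP u.
  rewrite [leRHS]splitr; apply: le_trans (opnormB_triangle _ (U *m C0val u x *m invmx U) _) _.
  apply: lerD.
    rewrite -(ua _ _ Uu) -conform_mxB; apply: le_trans (opnorm_conform _ _) _.
    by rewrite opnormBC.
  by rewrite -mulmxBl -mulmxBr (opnorm_conj _ Uu).
- move=> x y; apply/eqP; rewrite -subr_eq0; apply/eqP; apply: opnorm_small => e e0.
  have e2 : 0 < e / 2 by rewrite divr_gt0.
  have [u uf] := fu _ e2; have [[_ _ uo _] _ _] := C0funP u.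
  rewrite [leRHS]splitr; apply: le_trans (opnormB_triangle _ (dsum_mx (C0val u x) (C0val u y)) _) _.
  apply: lerD.
    rewrite -uo -conform_mxB; apply: le_trans (opnorm_conform _ _) _.
    by rewrite opnormBC.
  have -> : dsum_mx (C0val u x) (C0val u y) - dsum_mx (f x) (f y) =
      dsum_mx (C0val u x - f x) (C0val u y - f y).
    rewrite addrC -scaleN1r -dsum_mx_linear !scaleN1r.
    by congr dsum_mx; rewrite addrC.
  exact: opnorm_dsum_le.
- have [u uf] := fu 1 ltr01; exists (supnorm (C0val u) + 1) => _ [x _ <-].
  apply: opnorm_triangle (supnorm_ub u x) _.
  by rewrite opnormBC.
- move=> e e0; have e2 : 0 < e / 2 by rewrite divr_gt0.
  have [u uf] := fu _ e2; have [_ uv _] := C0funP u.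
  have [K [Kc Ks Ku]] := uv _ e2; exists K; split=> // t tK.
  rewrite [leRHS]splitr; apply: opnorm_triangle (Ku t tK) _.
  by rewrite opnormBC.
- apply: opnorm_small => e e0; have [u uf] := fu _ e0.
  have [_ _ u0] := C0funP u; have := uf theta.
  by rewrite u0 sub0r opnormN.
Qed.

Lemma C0_complete (F : set_system (C0 theta)) : ProperFilter F -> cauchy F -> cvg F.
Proof.
move=> PF /cauchyP cF.
have cF' (e : R) : 0 < e -> exists u, F [set v | supnorm (C0val (u - v)) < e].
  move=> e0; have [|u Fu] := cF e%:C; first by rewrite ltcR.
  exists u; apply: filterS Fu => v; rewrite -ball_normE /= C0_normE ltcR.
  by [].
have lim x : exists X : 'M[C]_(deg x), (fun u => C0val u x) @ F --> X.
  apply: mx_cauchy_cvg => e e0; have [u Fu] := cF' e e0.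
  exists (C0val u x); apply: filterS Fu => v /= uv.
  rewrite opnormBC; apply: le_trans (ltW uv); exact: (supnorm_ub (u - v)).
pose f : tfun T := fun x => projT1 (cid (lim x)).
have fl x : (fun u => C0val u x) @ F --> f x by rewrite /f; case: cid.
have near (e : R) u : 0 < e -> F [set v | supnorm (C0val (u - v)) < e] ->
    forall x, opnorm (C0val u x - f x) <= e.
  move=> e0 Fu x; apply/ler_addgt0Pr => d d0.
  have /cvg_opnormP := fl x => /(_ d d0) Fd.
  have [v [/= v1 v2]] := filter_ex (filterI Fu Fd).
  apply: le_trans (opnormB_triangle _ (C0val v x) _) _; apply: lerD.
    by apply: le_trans (ltW v1); exact: (supnorm_ub (u - v)).
  exact: ltW.
have f0 : in_C0 theta f.
  apply: uniform_limit_C0 => e e0; have [u Fu] := cF' e e0.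
  by exists u; exact: near.
pose fu : C0 theta := exist _ f (asboolT f0).
apply/cvg_ex; exists fu.
apply/cvg_ballP => e e0.
have [e' e'0 e'e] : exists2 e' : R, 0 < e' & e'%:C < e.
  have er : (complex.Re e)%:C = e.
    by move: e0; case: (e) => a b; rewrite ltcE /= => /andP[/eqP -> _].
  exists (complex.Re e / 2).
    by rewrite divr_gt0// -ltcR er.
  by rewrite -er ltcR ltr_pdivrMr// mulr_natr mulr2n ltrDr -ltcR er.
have e2 : 0 < e' / 2 by rewrite divr_gt0.
have [u Fu] := cF' _ e2.
have Fu0 := Fu; apply: filterS Fu => v /= Fv; rewrite -ball_normE /=; apply: le_lt_trans e'e.
rewrite C0_normE lecR; apply: supnorm_le => x.
rewrite [leRHS]splitr; apply: le_trans (opnormB_triangle _ (C0val u x) _) _.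
apply: lerD; first by rewrite opnormBC; exact: (near _ _ e2 Fu0).
by apply: le_trans (ltW Fv); exact: (supnorm_ub (u - v)).
Qed.

Lemma C0_cstar_algebra : is_cstar_algebra (C0 theta).
Proof.
split.
- exact: C0_complete.
- by move=> u v w; apply: C0_ext => x; exact: mulmxA.
- by move=> u v w; apply: C0_ext => x; exact: mulmxDl.
- by move=> u v w; apply: C0_ext => x; exact: mulmxDr.
- by move=> c u v; apply: C0_ext => x; rewrite [LHS]/= /C0val /= /tfun_mul; exact: (esym (scalemxAl _ _ _)).
- by move=> c u v; apply: C0_ext => x; rewrite [LHS]/= /C0val /= /tfun_mul; exact: (esym (scalemxAr _ _ _)).
- by move=> u v; apply: C0_ext => x; exact: (adjmxD (C0val u x) (C0val v x)).
- by move=> c u; apply: C0_ext => x; exact: (adjmxZ c (C0val u x)).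
- by move=> u v; apply: C0_ext => x; exact: (adjmxM (C0val u x) (C0val v x)).
- by move=> u; apply: C0_ext => x; exact: (trmxCK (C0val u x)).
- move=> u v; rewrite !C0_normE -rmorphM lecR; apply: supnorm_le => x.
  apply: le_trans (opnormM (C0val u x) (C0val v x)) _.
  by apply: ler_pM; rewrite ?opnorm_ge0 ?supnorm_ub.
- move=> u; rewrite !C0_normE -rmorphXn; congr (_%:C); apply/eqP; rewrite eq_le.
  apply/andP; split.
    apply: supnorm_le => x; rewrite -[C0val _ x]/((C0val u x)^t* *m C0val u x) opnorm_adjM.
    by rewrite ler_pXn2r ?nnegrE ?opnorm_ge0 ?supnorm_ge0 ?supnorm_ub.
  have s0 := supnorm_ge0 (sa_mul (sa_adj u) u).
  rewrite -[leRHS](sqr_sqrtr s0) ler_pXn2r ?nnegrE ?supnorm_ge0 ?sqrtr_ge0//.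
  apply: supnorm_le => x; rewrite -(ger0_norm (opnorm_ge0 _)) -sqrtr_sqr ler_sqrt//.
  by rewrite -opnorm_adjM; exact: (supnorm_ub (sa_mul (sa_adj u) u)).
Qed.

End C0CstarAlgebra.

(** * Resolvents in closed subalgebras *)

Section LowerBounds.
Variable R : realType.
Local Notation C := R[i].

(** Only the real part of the quadratic form is bounded below, so that the notion covers
    skew-adjoint matrices with t = 0. *)
Definition lowb n (t : R) (H : 'M[C]_n) : Prop :=
  forall v : 'cV[C]_n, t * l2norm v ^+ 2 <= complex.Re (dotc v (H *m v)).

Lemma Re_dotcc n (v : 'cV[C]_n) : complex.Re (dotc v v) = l2norm v ^+ 2.
Proof. by rewrite dotcc. Qed.

Lemma Re_dotc_le n (v w : 'cV[C]_n) : complex.Re (dotc v w) <= l2norm v * l2norm w.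
Proof.
apply: le_trans (dotc_le v w); apply: le_trans (normc_Re _); exact: ler_norm.
Qed.

Lemma lowb_gram n (W : 'M[C]_n) : lowb 0 (W ^t* *m W).
Proof.
move=> v; rewrite mul0r -mulmxA -dotc_adj.
by rewrite Re_dotcc sqr_ge0.
Qed.

Lemma lowbD n s t (G H : 'M[C]_n) : lowb s G -> lowb t H -> lowb (s + t) (G + H).
Proof.
move=> Gs Ht v; rewrite mulmxDl dotcDr raddfD mulrDl; apply: lerD; [exact: Gs|exact: Ht].
Qed.

Lemma lowbZ n (c : R) t (H : 'M[C]_n) : 0 <= c -> lowb t H -> lowb (c * t) (c%:C *: H).
Proof.
move=> c0 Ht v; rewrite -scalemxAl dotcZr.
have -> : complex.Re (c%:C * dotc v (H *m v)) = c * complex.Re (dotc v (H *m v)).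
  by case: (dotc v _) => x y /=; rewrite mul0r subr0.
by rewrite -mulrA ler_wpM2l// Ht.
Qed.

Lemma lowb0 n : lowb 0 (0 : 'M[C]_n).
Proof. by move=> v; rewrite mul0mx -[0 : 'cV__](scale0r v) dotcZr mul0r mul0r. Qed.

Lemma lowb_sum n (I : Type) (r : seq I) (P : pred I) (F : I -> 'M[C]_n) :
  (forall j, P j -> lowb 0 (F j)) -> lowb 0 (\sum_(j <- r | P j) F j).
Proof.
move=> h; elim/big_rec: _ => [|j X Pj HX]; first exact: lowb0.
by rewrite -[0]addr0; apply: lowbD; [exact: h|].
Qed.

(** Cauchy-Schwarz: the product of the norms of v and (1 + H)v is at least the real part of their
    inner product. *)
Lemma lowb_expand n t (H : 'M[C]_n) v : 0 <= t -> lowb t H ->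
  (1 + t) * l2norm v <= l2norm ((1%:M + H) *m v).
Proof.
move=> t0 Ht; have [v0|v0] := eqVneq (l2norm v) 0.
  by rewrite v0 mulr0 l2norm_ge0.
have vp : 0 < l2norm v by rewrite lt0r v0 l2norm_ge0.
rewrite -(ler_pM2l vp); apply: le_trans (Re_dotc_le _ _).
rewrite mulmxDl mul1mx dotcDr raddfD /= Re_dotcc.
have -> : l2norm v * ((1 + t) * l2norm v) = l2norm v ^+ 2 + t * l2norm v ^+ 2 by ring.
by rewrite lerD2l.
Qed.

Lemma expanding_unitmx n (M : 'M[C]_n) : (forall v, l2norm v <= l2norm (M *m v)) ->
  M \in unitmx.
Proof.
move=> h; rewrite -unitmx_tr unitmxE unitfE; apply/negP => /det0P[v v0 vM].
case/negP: v0; have e : M *m v^T = 0 by rewrite -[M]trmxK -trmx_mul vM trmx0.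
have /eqP : l2norm v^T = 0.
  by apply/eqP; rewrite eq_le l2norm_ge0 andbT; have := h v^T; rewrite e l2norm0.
by move=> /eqP/l2norm_eq0 /(congr1 trmx); rewrite trmxK trmx0 => ->.
Qed.

Lemma lowb_unitmx n (H : 'M[C]_n) : lowb 0 H -> 1%:M + H \in unitmx.
Proof.
move=> h; apply: expanding_unitmx => v.
by have := lowb_expand v (lexx 0) h; rewrite addr0 mul1r.
Qed.

Lemma lowb_solve_le n t (H X Y : 'M[C]_n) : 0 <= t -> lowb t H ->
  X + H *m X = Y -> (1 + t) * opnorm X <= opnorm Y.
Proof.
move=> t0 Ht e; have t1 : 0 < 1 + t by rewrite ltr_wpDr.
rewrite mulrC -ler_pdivlMr//; apply: opnorm_le_gen => [|v].
  by rewrite divr_ge0 ?opnorm_ge0// ltW.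
rewrite mulrAC ler_pdivlMr// mulrC; apply: le_trans (l2norm_mulmx Y v).
have -> : Y *m v = (1%:M + H) *m (X *m v).
  by rewrite [RHS]mulmxDl -e mulmxDl mul1mx mulmxA.
exact: lowb_expand.
Qed.

Lemma lowb_solve_le_r n t (H X Y : 'M[C]_n) : 0 <= t -> lowb t H -> H ^t* = H ->
  X + X *m H = Y -> (1 + t) * opnorm X <= opnorm Y.
Proof.
move=> t0 Ht Hh e; rewrite -opnorm_adj -(opnorm_adj Y).
by apply: lowb_solve_le Ht _ => //; rewrite -e adjmxD adjmxM Hh.
Qed.

(** With al = (1 + L)^-2, expanding the square gives at most 1 - 2 al + al times the square of the
    norm of v: the inner product of v and w has real part at least that square, and w is at most 1 +
    L times as long as v. *)
Lemma lowb_contract n (L : R) (H : 'M[C]_n) v : 0 <= L -> opnorm H <= L -> lowb 0 H ->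
  l2norm (v - ((1 + L) ^- 2)%:C *: ((1%:M + H) *m v)) ^+ 2 <=
    (1 - (1 + L) ^- 2) * l2norm v ^+ 2.
Proof.
move=> L0 HL Hp; set al := (1 + L) ^- 2; set w := (1%:M + H) *m v.
have L1 : 0 < 1 + L by rewrite ltr_wpDr.
have al0 : 0 < al by rewrite invr_gt0 exprn_gt0.
have wv : l2norm v ^+ 2 <= complex.Re (dotc v w).
  rewrite /w mulmxDl mul1mx dotcDr raddfD /= Re_dotcc lerDl.
  by have := Hp v; rewrite mul0r.
have wL : l2norm w <= (1 + L) * l2norm v.
  rewrite /w mulmxDl mul1mx; apply: le_trans (l2normD _ _) _.
  rewrite mulrDl mul1r lerD2l; apply: le_trans (l2norm_mulmx _ _) _.
  by rewrite ler_wpM2r ?l2norm_ge0.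
have -> : l2norm (v - al%:C *: w) ^+ 2 =
    l2norm v ^+ 2 - 2 * al * complex.Re (dotc v w) + al ^+ 2 * l2norm w ^+ 2.
  rewrite -!Re_dotcc -scaleNr dotcDl !dotcDr !dotcZl !dotcZr.
  have -> : dotc w v = Num.conj (dotc v w) by rewrite dotc_conj.
  case: (dotc v v) => x1 y1; case: (dotc v w) => x2 y2; case: (dotc w w) => x3 y3.
  by rewrite /=; ring.
have alL : al * (1 + L) ^+ 2 = 1 by rewrite /al mulVf// expf_neq0// gt_eqF.
have : al ^+ 2 * l2norm w ^+ 2 <= al * l2norm v ^+ 2.
  rewrite expr2 -mulrA ler_pM2l// -[leRHS]mul1r -alL -mulrA ler_pM2l// -exprMn.
  by rewrite ler_pXn2r ?nnegrE ?l2norm_ge0 ?mulr_ge0 ?l2norm_ge0 ?(ltW L1).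
have : al * l2norm v ^+ 2 <= al * complex.Re (dotc v w) by rewrite ler_pM2l.
move: (l2norm v ^+ 2) (complex.Re _) (al ^+ 2 * _) => a b c h1 h2.
clear -h1 h2; lra.
Qed.

End LowerBounds.

Section ClosedSubalgebra.
Variables (R : realType) (T : towerData R) (theta : T).
Hypotheses (Hm : is_mtower T) (Hp : proper_tower T).
Local Notation C := R[i].
Implicit Types (x y t s z : T) (f g u w m a : tfun T).

Record closed_subalgebra (B : tfun T -> Prop) : Prop := ClosedSubalgebra {
  csub_C0 : forall u, B u -> in_C0 theta u;
  csub0 : B 0;
  csub_linear : forall (c : C) u w, B u -> B w -> B (c *: u + w);
  csub_mul : forall u w, B u -> B w -> B (tfun_mul u w);
  csub_adj : forall u, B u -> B (tfun_adj u);
  csub_closed : forall f, (forall e : R, 0 < e ->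
    exists2 u, B u & forall x, opnorm (u x - f x) <= e) -> B f }.

Variable B : tfun T -> Prop.
Hypothesis HB : closed_subalgebra B.

Lemma csub_alg u : B u -> is_alg u.
Proof. by move=> /(csub_C0 HB)[uc _ _]; exact: in_Cstar_alg. Qed.

Lemma csub_bounded u : B u -> exists2 M : R, 0 < M & forall x, opnorm (u x) <= M.
Proof.
move=> /(csub_C0 HB)[[_ _ _ [M uM]] _ _]; exists (`|M| + 1); first by rewrite ltr_wpDl.
move=> x; apply: le_trans (_ : M <= _); first by apply: uM; exists x.
by apply: le_trans (ler_norm _) _; rewrite lerDl.
Qed.

Lemma csub_sum (I : Type) (r : seq I) (F : I -> tfun T) :
  (forall j, B (F j)) -> B (\sum_(j <- r) F j).
Proof.
move=> FB; elim: r => [|j r IHr]; first by rewrite big_nil; exact: csub0.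
by rewrite big_cons -[F j]scale1r; exact: csub_linear.
Qed.

Lemma geometric_small (r c e : R) : 0 <= r < 1 -> 0 < e -> exists k, r ^+ k * c <= e.
Proof.
move=> /andP[r0 r1] e0; have c1 : 0 < `|c| + 1 by rewrite ltr_wpDl.
have r1' : `|r| < 1 by rewrite ger0_norm.
have /(@cvgrPdist_lt R R^o) := cvg_expr r1'.
move=> /(_ (e / (`|c| + 1))); rewrite divr_gt0// => /(_ isT)[k _ /(_ k (leqnn k))].
rewrite /= sub0r normrN ger0_norm ?exprn_ge0// ltr_pdivlMr// => h; exists k.
apply: le_trans (ltW h); rewrite ler_wpM2l ?exprn_ge0//.
by apply: le_trans (ler_norm c) _; rewrite lerDl.
Qed.

(** The function (1 + h)^-1 a is a uniform limit of iterates built from a and h by sums and products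
    only, so it lies in B although B has no unit. *)
Lemma csub_resolvent a h : B a -> B h -> (forall x, lowb 0 (h x)) ->
  exists2 m, B m & forall x, m x + h x *m m x = a x.
Proof.
move=> Ba Bh hp; pose m : tfun T := fun x => invmx (1%:M + h x) *m a x.
have mE x : m x + h x *m m x = a x.
  rewrite -[X in X + _]mul1mx -mulmxDl /m mulmxA (mulmxV (lowb_unitmx (hp x))).
  exact: mul1mx.
exists m => //; have [L L0 hL] := csub_bounded Bh; have [M M0 aM] := csub_bounded Ba.
have mM x : opnorm (m x) <= M.
  apply: le_trans (aM x); have := lowb_solve_le (lexx 0) (hp x) (mE x).
  by rewrite addr0 mul1r.
pose al : R := (1 + L) ^- 2.
have L1 : 1 <= (1 + L) ^+ 2 by rewrite exprn_ege1// lerDl ltW.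
have al01 : 0 < al <= 1.
  by rewrite invr_gt0 (lt_le_trans ltr01 L1)/= invf_le1// (lt_le_trans ltr01 L1).
(* One correction by al times the residual a - (1 + h)u. As h is bounded, a single al works at all
   points and [lowb_contract] gives a uniform rate r < 1. *)
pose step u : tfun T := al%:C *: (a + -1 *: (u + tfun_mul h u)) + u.
have Bstep u : B u -> B (step u).
  move=> Bu; apply: csub_linear => //.
  have -> : a + -1 *: (u + tfun_mul h u) = -1 *: (1 *: u + tfun_mul h u) + a.
    by rewrite scale1r addrC.
  apply: csub_linear => //; apply: csub_linear => //; exact: csub_mul.
pose mk k := iter k step (0 : tfun T).
have Bmk k : B (mk k) by elim: k => [|k IHk]; [exact: csub0|exact: Bstep].
pose r := Num.sqrt (1 - al).
have r0 : 0 <= r by exact: sqrtr_ge0.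
have r2 : r ^+ 2 = 1 - al by rewrite sqr_sqrtr// subr_ge0; case/andP: al01.
have r1 : r < 1.
  rewrite -[ltRHS]sqrtr1 ltr_sqrt ?ltr01// gtrBl.
  by case/andP: al01.
have stepE u x : m x - step u x =
    (m x - u x) - al%:C *: ((1%:M + h x) *m (m x - u x)).
  have -> : step u x = al%:C *: (a x - (u x + h x *m u x)) + u x.
    by rewrite -[LHS]/(al%:C *: (a x + -1 *: (u x + h x *m u x)) + u x) scaleN1r.
  rewrite -mE mulmxDl mul1mx mulmxBr.
  have -> : m x + h x *m m x - (u x + h x *m u x) = m x - u x + (h x *m m x - h x *m u x).
    by rewrite opprD addrACA.
  by rewrite opprD addrA addrAC.
have conv k x : opnorm (m x - mk k x) <= r ^+ k * M.
  elim: k => [|k IHk].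
    by rewrite expr0 mul1r -[mk 0%N x]/(0 : 'M__) subr0; exact: mM.
  rewrite exprS -mulrA; apply: le_trans (ler_wpM2l r0 IHk).
  apply: opnorm_le_gen => [|v]; first by rewrite mulr_ge0 ?opnorm_ge0.
  rewrite -mulrA; apply: le_trans (ler_wpM2l r0 (l2norm_mulmx _ v)).
  rewrite -[mk k.+1 x]/(step (mk k) x) stepE mulmxBl -scalemxAl -mulmxA.
  rewrite -(@ler_pXn2r _ 2)// ?nnegrE ?mulr_ge0 ?l2norm_ge0// exprMn r2.
  exact: lowb_contract (ltW L0) (hL x) (hp x).
apply: (csub_closed HB) => e e0; have [|k ke] := @geometric_small r M e _ e0.
  by rewrite r0 r1.
by exists (mk k) => // x; rewrite opnormBC; exact: le_trans (conv k x) ke.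
Qed.

End ClosedSubalgebra.

Lemma compact_finite_cover (X : topologicalType) (J : choiceType) (K : set X)
    (P : J -> Prop) (O : J -> set X) : compact K ->
  (forall x, K x -> exists2 j, P j & nbhs x (O j)) ->
  exists2 s : seq J, (forall j, j \in s -> P j) &
    forall x, K x -> exists2 j, j \in s & O j x.
Proof.
move=> cK h; have [[x0 Kx0]|K0] := pselect (exists x, K x); last first.
  by exists [::] => // x Kx; case: K0; exists x.
pose X' : ptopologicalType := HB.pack_for ptopologicalType X (isPointed.Build X x0).
have cK' : @cover_compact X' K by rewrite -(@compact_cover X').
have [||s sP sK] := cK' J [set j | P j] (fun j => (O j)°).
- by move=> j _; exact: open_interior.
- by move=> x /h[j Pj xO]; exists j.
exists (finmap.enum_fset s) => [j js|x /sK[j js xO]].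
  by have := sP j js; rewrite inE.
by exists j => //; exact: interior_subset xO.
Qed.

(** * Bump functions *)

Section BumpMatrix.
Variable R : realType.
Local Notation C := R[i].

(** Pairing the equation, applied to v, with M v expresses the squared norm of M v plus c times
    those of all F w M v as one inner product of A v and M v, which is at most the norm of A* M
    times the squared norm of v. *)
Lemma bump_mx n (I : eqType) (s : seq I) (F : I -> 'M[C]_n) (A M : 'M[C]_n) (c : R) :
  0 <= c -> M + (c%:C *: \sum_(w <- s) (F w)^t* *m F w) *m M = A ->
  opnorm M ^+ 2 <= opnorm (A^t* *m M) /\
  forall w, w \in s -> c * opnorm (F w *m M) ^+ 2 <= opnorm (A^t* *m M).
Proof.
move=> c0 e; set q := opnorm (A^t* *m M); have q0 : 0 <= q by exact: opnorm_ge0.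
have key v : l2norm (M *m v) ^+ 2 + c * (\sum_(w <- s) l2norm (F w *m M *m v) ^+ 2)
    <= q * l2norm v ^+ 2.
  have -> : l2norm (M *m v) ^+ 2 + c * (\sum_(w <- s) l2norm (F w *m M *m v) ^+ 2) =
      complex.Re (dotc (A *m v) (M *m v)).
    rewrite -e mulmxDl dotcDl raddfD /= Re_dotcc; congr (_ + _).
    rewrite -!scalemxAl dotcZl.
    have sE : complex.Re (dotc ((\sum_(w <- s) (F w)^t* *m F w) *m M *m v) (M *m v)) =
        \sum_(w <- s) l2norm (F w *m M *m v) ^+ 2.
      clear e; elim: s => [|w r IHr].
        by rewrite !big_nil !mul0mx -[0 : 'cV__](scale0r (M *m v)) dotcZl conjC0 mul0r.
      rewrite !big_cons -IHr !mulmxDl dotcDl raddfD; congr (_ + _).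
      rewrite -!mulmxA dotc_adj; have -> : ((F w)^t*)^t* = F w by exact: trmxCK.
      exact: Re_dotcc.
    by rewrite -sE; case: (dotc _ _) => x y /=; rewrite oppr0 mul0r subr0.
  rewrite dotc_conj.
  have -> : complex.Re (Num.conj (dotc (M *m v) (A *m v))) =
      complex.Re (dotc (M *m v) (A *m v)) by case: (dotc _ _).
  have -> : dotc (M *m v) (A *m v) = Num.conj (dotc v (A^t* *m M *m v)).
    by rewrite -mulmxA -[in RHS]dotc_adj dotc_conj.
  have -> : complex.Re (Num.conj (dotc v (A^t* *m M *m v))) =
      complex.Re (dotc v (A^t* *m M *m v)) by case: (dotc _ _).
  apply: le_trans (Re_dotc_le _ _) _.
  apply: le_trans (ler_wpM2l (l2norm_ge0 v) (l2norm_mulmx _ v)) _.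
  by rewrite -/q expr2 mulrCA.
have bound (N : 'M[C]_n) (d : R) : 0 <= d ->
    (forall v, d * l2norm (N *m v) ^+ 2 <= q * l2norm v ^+ 2) -> d * opnorm N ^+ 2 <= q.
  rewrite le_eqVlt => /predU1P[<- _|d0 h]; first by rewrite mul0r.
  rewrite mulrC -ler_pdivlMr//; have qd : 0 <= q / d by rewrite divr_ge0// ltW.
  rewrite -(sqr_sqrtr qd) ler_pXn2r ?nnegrE ?opnorm_ge0 ?sqrtr_ge0//.
  apply: opnorm_le_gen => [|v]; first exact: sqrtr_ge0.
  rewrite -(@ler_pXn2r _ 2)// ?nnegrE ?mulr_ge0 ?l2norm_ge0 ?sqrtr_ge0//.
  have -> : (Num.sqrt (q / d) * l2norm v) ^+ 2 = (q * l2norm v ^+ 2) / d.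
    by rewrite exprMn (sqr_sqrtr qd) mulrAC.
  by rewrite ler_pdivlMr// mulrC.
split.
  rewrite -[X in X <= _]mul1r; apply: bound => // v; apply: le_trans (key v).
  by rewrite mul1r lerDl mulr_ge0// sumr_ge0// => w _; exact: sqr_ge0.
move=> w ws; apply: bound => // v; apply: le_trans (key v).
apply: le_trans (_ : c * (\sum_(w <- s) l2norm (F w *m M *m v) ^+ 2) <= _).
  rewrite ler_wpM2l// (big_rem w ws)/= lerDl sumr_ge0// => j _; exact: sqr_ge0.
by rewrite lerDr sqr_ge0.
Qed.

Lemma bump_arith (K d e w q m : R) : 0 < K -> 0 < d -> 0 < e -> 0 <= w -> 0 <= m ->
  (K / d) ^+ 2 * w ^+ 2 <= q -> m ^+ 2 <= q -> q <= K * m -> m <= K ->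
  q <= K * w + d * K -> e ^+ 2 = K * d + d * K -> m <= e.
Proof.
move=> K0 d0 e0 w0 m0 wq mq qm mK q1 eE.
have wd : w <= d.
  rewrite -(@ler_pXn2r _ 2)// ?nnegrE ?(ltW d0)//.
  have c0 : 0 < (K / d) ^+ 2 by rewrite exprn_gt0// divr_gt0.
  rewrite -(ler_pM2l c0); apply: le_trans wq _; apply: le_trans qm _.
  by rewrite -exprMn divfK ?gt_eqF// expr2 ler_pM2l.
rewrite -(@ler_pXn2r _ 2)// ?nnegrE ?(ltW e0)// eE.
apply: le_trans mq _; apply: le_trans q1 _.
by rewrite lerD2r ler_pM2l.
Qed.

(** Up to d K one may replace A* M by A* W M, and the factor (K / d) ^ 2 forces W M to have norm at
    most d. So the square of the norm of M is at most K d + d K = e ^ 2. *)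
Lemma bump_small n (A W M : 'M[C]_n) (K d e : R) : 0 < K -> 0 < d -> 0 < e ->
  (K / d) ^+ 2 * opnorm (W *m M) ^+ 2 <= opnorm (A^t* *m M) ->
  opnorm M ^+ 2 <= opnorm (A^t* *m M) -> opnorm M <= opnorm A -> opnorm A <= K ->
  opnorm (A^t* *m W - A^t*) <= d -> e ^+ 2 = K * d + d * K -> opnorm M <= e.
Proof.
move=> K0 d0 e0 h1 h2 MA AK AW eE.
have MK : opnorm M <= K := le_trans MA AK.
have h3 : opnorm (A^t* *m M) <= K * opnorm M.
  apply: le_trans (opnormM _ _) _; rewrite opnorm_adj.
  exact: (ler_wpM2r (opnorm_ge0 _) AK).
have h4 : opnorm (A^t* *m M) <= K * opnorm (W *m M) + d * K.
  have -> : A^t* *m M = A^t* *m (W *m M) - (A^t* *m W - A^t*) *m M.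
    by rewrite mulmxBl mulmxA opprB addrC subrK.
  apply: le_trans (opnormD _ _) _; rewrite opnormN; apply: lerD.
    apply: le_trans (opnormM _ _) _; rewrite opnorm_adj.
    exact: (ler_wpM2r (opnorm_ge0 _) AK).
  apply: le_trans (opnormM _ _) _.
  by apply: ler_pM; rewrite ?opnorm_ge0.
have w0 := opnorm_ge0 (W *m M); have m0 := opnorm_ge0 M.
exact: bump_arith K0 d0 e0 w0 m0 h1 h2 h3 MK h4 eE.
Qed.

End BumpMatrix.

Section Bump.
Variables (R : realType) (T : towerData R) (theta : T).
Hypotheses (Hm : is_mtower T) (Hp : proper_tower T).
Let HT := mtower_tower Hm.
Local Notation C := R[i].
Implicit Types (x y t s z : T) (f g u w m a : tfun T).

Lemma open_layer n : open (layer T n).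
Proof.
have -> : layer T n = (@deg R T) @^-1` [set n] by [].
by apply: open_comp => [? _|]; [exact: (deg_continuous HT)|exact: discrete_open].
Qed.

Lemma opnorm_continuous g : in_Cstar g -> continuous (fun x => opnorm (g x)).
Proof.
move=> gc x; have [gc' _ _ _] := gc; set n := deg x.
pose x' : layer T n := mk_layer (erefl n).
have cx : continuous (fun y : layer T n => opnorm (ev g y)).
  move=> y; apply: (@continuous_comp _ _ _ (@ev R T n g) (@opnorm R n)).
    exact: gc'.
  exact: opnorm_cts.
apply: (@cvg_normP _ _ (nbhs x) (nbhs_filter x)) => e e0.
have /(@cvgrPdist_lt R R^o) := cx x' => /(_ e e0).
move=> [V [[O oO OV] x'V VE]].
have xO : O x by move: x'V; rewrite -OV.
have : nbhs x (O `&` layer T n).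
  by apply: open_nbhs_nbhs; split; [exact: openI (open_layer n)|].
apply: filterS => y [yO yn].
have := VE (mk_layer yn); rewrite -OV => /(_ yO).
by rewrite /= !opnorm_ev distrC.
Qed.

Variable B : tfun T -> Prop.
Hypothesis HB : closed_subalgebra theta B.

(** With h the weighted sum of the w* w, the function m = (1 + h)^-1 a is damped wherever some w is
    almost a right unit for a*, and equals a wherever all the chosen w vanish. Moreover a - m = h m,
    which lies in any ideal containing W. *)
Lemma csub_bump (W : tfun T -> Prop) a (K : set T) (e : R) : B a ->
  (forall w, W w -> B w) -> compact K ->
  (forall z, K z -> exists2 w, W w & (a z)^t* *m w z = (a z)^t*) -> 0 < e ->
  exists m (s : seq (tfun T)) (c : R), [/\ B m, (forall w, w \in s -> W w),
    (forall x, m x + (c%:C *: \sum_(w <- s) (w x)^t* *m w x) *m m x = a x),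
    (forall x, opnorm (m x) <= opnorm (a x)) & forall z, K z -> opnorm (m z) <= e].
Proof.
move=> Ba WB cK aK e0; have [M M0 aM] := csub_bounded HB Ba.
(* Chosen so that M d + d M = e ^ 2, as [bump_small] requires. *)
pose d := e ^+ 2 / (2 * M); have M20 : 0 < 2 * M by rewrite mulr_gt0.
have d0 : 0 < d by rewrite divr_gt0// exprn_gt0.
pose O w := [set x | opnorm ((a x)^t* *m w x - (a x)^t*) < d].
have [|s sW sK] := @compact_finite_cover T (tfun T) K W O cK.
  move=> z Kz; have [w Ww aw] := aK z Kz; exists w => //.
  pose g : tfun T := -1 *: tfun_adj a + tfun_mul (tfun_adj a) w.
  have gE x : g x = (a x)^t* *m w x - (a x)^t*.
    by rewrite -[LHS]/(-1 *: (a x)^t* + (a x)^t* *m w x) scaleN1r addrC.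
  have Bg : B g.
    apply: (csub_linear HB); first exact: (csub_adj HB).
    by apply: (csub_mul HB); [exact: (csub_adj HB)|exact: WB].
  have [gc _ _] := csub_C0 HB Bg.
  have /(@cvgrPdist_lt R R^o) := @opnorm_continuous g gc z => /(_ d d0).
  apply: filterS => x; rewrite !gE aw subrr opnorm0 sub0r normrN.
  by rewrite ger0_norm ?opnorm_ge0.
pose c := (M / d) ^+ 2; have c0 : 0 < c by rewrite exprn_gt0// divr_gt0.
pose h : tfun T := c%:C *: \sum_(w <- s) tfun_mul (tfun_adj w) w.
have hE x : h x = c%:C *: \sum_(w <- s) (w x)^t* *m w x.
  by rewrite -[LHS]/(c%:C *: (\sum_(w <- s) tfun_mul (tfun_adj w) w) x) tfun_sumE.
have Bh : B h.
  rewrite -[h]addr0; apply: (csub_linear HB); last exact: (csub0 HB).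
  rewrite big_seq; elim/big_ind: _ => [|u v Bu Bv|w ws]; first exact: (csub0 HB).
    by rewrite -[u]scale1r; exact: (csub_linear HB).
  by have Bw := WB _ (sW _ ws); apply: (csub_mul HB) => //; exact: (csub_adj HB).
have hp x : lowb 0 (h x).
  rewrite hE -[0](mulr0 c); apply: lowbZ; first exact: ltW.
  by apply: lowb_sum => w _; exact: lowb_gram.
have [m Bm mE] := csub_resolvent HB Ba Bh hp.
have mEx x : m x + (c%:C *: \sum_(w <- s) (w x)^t* *m w x) *m m x = a x.
  by rewrite -hE.
have ma x : opnorm (m x) <= opnorm (a x).
  by have := lowb_solve_le (lexx 0) (hp x) (mE x); rewrite addr0 mul1r.
exists m, s, c; split=> // z Kz.
have [w ws wz] := sK z Kz.
have [m2 /(_ w ws) wm] := bump_mx (ltW c0) (mEx z).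
have eE : e ^+ 2 = M * d + d * M.
  by rewrite /d; field; rewrite gt_eqF.
exact: (bump_small M0 d0 e0 wm m2 (ma z) (aM z) (ltW wz) eE).
Qed.

End Bump.

(** * Approximation modulo an ideal *)

Section IdealDensity.
Variables (R : realType) (T : towerData R) (theta : T).
Hypotheses (Hm : is_mtower T) (Hp : proper_tower T).
Local Notation C := R[i].
Implicit Types (x y t s z : T) (f g u w m a : tfun T).

Lemma in_C0_csub : closed_subalgebra theta (in_C0 theta).
Proof.
split=> //.
- by split; [exact: in_Cstar0|exact: vanishing0|].
- move=> c u w [u1 u2 u3] [w1 w2 w3]; split.
  + exact: in_Cstar_linear.
  + exact: vanishing_linear.
  + by rewrite -[LHS]/(c *: u theta + w theta) u3 w3 scaler0 addr0.
- move=> u w [u1 u2 u3] [w1 w2 w3]; split.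
  + exact: in_Cstar_mul.
  + exact: vanishing_mul.
  + by rewrite /tfun_mul w3 mulmx0.
- move=> u [u1 u2 u3]; split.
  + exact: in_Cstar_adj.
  + exact: vanishing_adj.
  + by rewrite /tfun_adj u3 trmx0 map_mx0.
- move=> f fu; apply: uniform_limit_C0 => e e0; have [u uc uf] := fu e e0.
  by exists (exist _ u (asboolT uc)).
Qed.

(* The elements [m] approximate 0 uniformly, and [a - m] lies in the ideal. *)
Lemma ideal_approx (I : tfun T -> Prop) a (e : R) :
  (forall w, I w -> in_C0 theta w) -> I 0 -> (forall c u w, I u -> I w -> I (c *: u + w)) ->
  (forall u w, in_C0 theta u -> I w -> I (tfun_mul u w)) ->
  (forall u w, I u -> in_C0 theta w -> I (tfun_mul u w)) ->
  in_C0 theta a -> (forall s, exists2 w, I w & (a s)^t* *m w s = (a s)^t*) -> 0 < e ->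
  exists2 m, in_C0 theta m /\ (forall x, opnorm (m x) <= e) & I (a - m).
Proof.
move=> IC I0 IL IMl IMr ac aI e0; have [_ av _] := ac.
have [K [cK Ksub aK]] := av e e0.
have [m [s [c [mc sI mE ma mK]]]] := csub_bump Hm in_C0_csub ac IC cK (fun z _ => aI z) e0.
exists m; first split=> //.
  (* The bound is checked at irreducible points: on K it comes from the bump, and off K from the
     decay of a, which dominates m. *)
  have [mC _ _] := mc; move=> x; apply: (is_alg_opnorm_le Hm (in_Cstar_alg Hm mC)) => t tc _.
  have [tK|ntK] := pselect (K t); first exact: mK.
  by apply: le_trans (ma t) _; apply: aK; split=> //; exact: subset_closure.
pose h : tfun T := c%:C *: (\sum_(w <- s) tfun_mul (tfun_adj w) w) + 0.
have Ih : I h.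
  apply: (IL) => //; rewrite big_seq; elim/big_ind: _ => [//|u v Iu Iv|w ws].
    by rewrite -[u]scale1r; exact: IL.
  by apply: IMl (sI _ ws); exact: (csub_adj in_C0_csub (IC _ (sI _ ws))).
have -> : a - m = tfun_mul h m; last exact: IMr.
apply: functional_extensionality_dep => x.
rewrite -[LHS]/(a x - m x) -mE addrC addKr /tfun_mul /h addr0; congr (_ *m _).
by rewrite -[RHS]/(c%:C *: (\sum_(w <- s) tfun_mul (tfun_adj w) w) x) tfun_sumE.
Qed.

End IdealDensity.

(** * Representations of C*-algebras are contractive *)

Section CstarOperators.
Variables (R : realType) (A : starAlgData R).
Hypothesis HA : is_cstar_algebra A.
Local Notation C := R[i].
Local Notation "a ** b" := (sa_mul a b) (at level 40, left associativity).
Local Notation "a ^#" := (sa_adj a) (at level 2, format "a ^#").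
Implicit Types (a b x y z : A) (V W S : A -> A).

Lemma conj_realC (r : R) : Num.conj r%:C = r%:C :> C.
Proof. by apply/eqP; rewrite eq_complex /= oppr0 !eqxx. Qed.

Lemma halfD (x : A) : (2^-1)%:C *: x + (2^-1)%:C *: x = x.
Proof.
rewrite -scalerDl -rmorphD /=.
have -> : (2^-1 + 2^-1 : R) = 1 by field.
exact: scale1r.
Qed.

Definition nrm a : R := complex.Re `|a|.

Lemma nrmE a : `|a| = (nrm a)%:C.
Proof.
have := normr_ge0 a; rewrite /nrm; case: `|a| => r s.
by rewrite lecE /= => /andP[/eqP -> _].
Qed.

Lemma nrm_ge0 a : 0 <= nrm a.
Proof. by rewrite -lecR -nrmE normr_ge0. Qed.

Lemma nrm0 : nrm 0 = 0.
Proof. by rewrite /nrm normr0. Qed.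

Lemma nrm_eq0 a : nrm a = 0 -> a = 0.
Proof. by move=> h; apply/eqP; rewrite -normr_eq0 nrmE h. Qed.

Lemma nrmD a b : nrm (a + b) <= nrm a + nrm b.
Proof. by rewrite -lecR rmorphD /= -!nrmE ler_normD. Qed.

Lemma nrmN a : nrm (- a) = nrm a.
Proof. by rewrite /nrm normrN. Qed.

Lemma nrmBC a b : nrm (a - b) = nrm (b - a).
Proof. by rewrite /nrm distrC. Qed.

Lemma nrmB_triangle a b c : nrm (a - c) <= nrm (a - b) + nrm (b - c).
Proof. by rewrite -[a - c](subrKA b) nrmD. Qed.

Lemma nrmZ (c : C) a : nrm (c *: a) = normc c * nrm a.
Proof.
rewrite {1}/nrm normrZ nrmE normr_normc.
by rewrite -rmorphM.
Qed.

Lemma nrmM a b : nrm (a ** b) <= nrm a * nrm b.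
Proof. by rewrite -lecR rmorphM /= -!nrmE (cstar_normM HA). Qed.

Lemma nrm_cstar a : nrm (a^# ** a) = nrm a ^+ 2.
Proof. by rewrite {1}/nrm (cstar_norm HA) nrmE -rmorphXn. Qed.

Lemma nrm_adj a : nrm (a^#) = nrm a.
Proof.
have le b : nrm b <= nrm (b^#).
  have [->|b0] := eqVneq (nrm b) 0; first exact: nrm_ge0.
  have bp : 0 < nrm b by rewrite lt0r b0 nrm_ge0.
  by rewrite -(ler_pM2r bp) -expr2 -nrm_cstar; exact: nrmM.
apply/eqP; rewrite eq_le le andbT.
by have := le (a^#); rewrite (cstar_adjK HA).
Qed.

Lemma nrm_small a : (forall e : R, 0 < e -> nrm a <= e) -> a = 0.
Proof.
move=> h; apply: nrm_eq0; apply/eqP; rewrite eq_le nrm_ge0 andbT.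
by apply/ler_addgt0Pl => e e0; rewrite addr0; exact: h.
Qed.

Definition converges (u : nat -> A) (l : A) : Prop := forall e : R, 0 < e ->
  exists N, forall n, (N <= n)%N -> nrm (u n - l) <= e.

Lemma cauchy_converges (u : nat -> A) :
  (forall e : R, 0 < e -> exists N, forall n, (N <= n)%N -> nrm (u n - u N) <= e) ->
  exists l, converges u l.
Proof.
move=> cu.
have cF : cauchy (u @ \oo).
  apply: cauchy_exP => e e0.
  have er : (complex.Re e)%:C = e.
    by move: e0; case: (e) => p q; rewrite ltcE /= => /andP[/eqP -> _].
  have er0 : 0 < complex.Re e by rewrite -ltcR er.
  have [|N uN] := cu (complex.Re e / 2); first by rewrite divr_gt0.
  exists (u N); exists N => // n /= Nn; rewrite -ball_normE /=.
  rewrite nrmE nrmBC -er ltcR; apply: le_lt_trans (uN n Nn) _.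
  by rewrite ltr_pdivrMr// mulr_natr mulr2n ltrDr.
have /cvg_ex[l ul] : cvg (u @ \oo) by exact: (cstar_complete HA) cF.
exists l => e e0; have eC : 0 < e%:C :> C by rewrite ltcR.
have /cvgrPdist_lt/(_ _ eC)[N _ uN] := ul.
exists N => n Nn; have := uN n Nn; rewrite /= nrmE nrmBC ltcR; exact: ltW.
Qed.

Lemma converges_unique u l l' : converges u l -> converges u l' -> l = l'.
Proof.
move=> ul ul'; apply/eqP; rewrite -subr_eq0; apply/eqP; apply: nrm_small => e e0.
have e2 : 0 < e / 2 by rewrite divr_gt0.
have [N uN] := ul _ e2; have [N' uN'] := ul' _ e2.
rewrite [leRHS]splitr; apply: le_trans (nrmB_triangle _ (u (maxn N N')) _) _.
apply: lerD; first by rewrite nrmBC; apply: uN; rewrite leq_maxl.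
by apply: uN'; rewrite leq_maxr.
Qed.

Lemma converges_lip (F : A -> A) (K : R) u l :
  (forall x y, nrm (F x - F y) <= K * nrm (x - y)) ->
  converges u l -> converges (fun n => F (u n)) (F l).
Proof.
move=> FK ul e e0; have K1 : 0 < `|K| + 1 by rewrite ltr_wpDl.
have [|N uN] := ul (e / (`|K| + 1)); first by rewrite divr_gt0.
exists N => n Nn; apply: le_trans (FK _ _) _.
apply: le_trans (_ : (`|K| + 1) * nrm (u n - l) <= _).
  by rewrite ler_wpM2r ?nrm_ge0// (le_trans (ler_norm _))// lerDl.
by rewrite mulrC -ler_pdivlMr// uN.
Qed.

Lemma convergesD u v l k : converges u l -> converges v k ->
  converges (fun n => u n + v n) (l + k).
Proof.
move=> ul vk e e0; have e2 : 0 < e / 2 by rewrite divr_gt0.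
have [N uN] := ul _ e2; have [N' vN'] := vk _ e2.
exists (maxn N N') => n; rewrite geq_max => /andP[Nn Nn'].
by rewrite opprD addrACA [leRHS]splitr (le_trans (nrmD _ _))// lerD ?uN ?vN'.
Qed.

Lemma converges_ext u v l : u =1 v -> converges u l -> converges v l.
Proof. by move=> uv ul e /ul[N uN]; exists N => n /uN; rewrite uv. Qed.

Lemma convergesS u l : converges u l -> converges (fun n => u n.+1) l.
Proof. by move=> ul e /ul[N uN]; exists N => n Nn; apply: uN; exact: leqW. Qed.

Lemma convergesZ (c : C) u l : converges u l -> converges (fun n => c *: u n) (c *: l).
Proof.
apply: (@converges_lip _ (normc c)) => x y.
by rewrite -scalerBr nrmZ.
Qed.

Lemma converges_nrm_le u l (K : R) : (forall n, nrm (u n) <= K) -> converges u l -> nrm l <= K.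
Proof.
move=> uK ul; apply/ler_addgt0Pr => e e0; have [N uN] := ul e e0.
rewrite -[l](subrK (u N)) addrC; apply: le_trans (nrmD _ _) _.
by apply: lerD; [exact: uK|rewrite nrmBC; exact: uN].
Qed.

Lemma lin_sub V x y : linear V -> V (x - y) = V x - V y.
Proof. by move=> Vl; rewrite addrC -scaleN1r Vl scaleN1r addrC. Qed.

Lemma lin_add V x y : linear V -> V (x + y) = V x + V y.
Proof. by move=> Vl; have := Vl 1 x y; rewrite !scale1r. Qed.

Lemma lin0 V : linear V -> V 0 = 0.
Proof. by move=> Vl; rewrite -[X in V X](subrr 0) (lin_sub _ _ Vl) subrr. Qed.

Lemma lin_scale V c x : linear V -> V (c *: x) = c *: V x.
Proof. by move=> Vl; rewrite -[c *: x]addr0 Vl (lin0 Vl) addr0. Qed.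

(** Self-adjointness for the A-valued inner product that makes A a module over itself. *)
Definition symmetric_op V : Prop := forall x y, (V x)^# ** y = x^# ** V y.

Lemma lin_lip V (K : R) : linear V -> (forall x, nrm (V x) <= K * nrm x) ->
  forall x y, nrm (V x - V y) <= K * nrm (x - y).
Proof. by move=> Vl VK x y; rewrite -(lin_sub _ _ Vl). Qed.

Lemma mul_subl a b x : (a - b) ** x = a ** x - b ** x.
Proof.
rewrite -scaleN1r (cstar_mulDl HA) (cstar_mulZl HA); by rewrite scaleN1r.
Qed.

Lemma mul_subr a b x : x ** (a - b) = x ** a - x ** b.
Proof.
rewrite -scaleN1r (cstar_mulDr HA) (cstar_mulZr HA); by rewrite scaleN1r.
Qed.

Lemma adj_sub a b : (a - b)^# = a^# - b^#.
Proof.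
rewrite -scaleN1r (cstar_adjD HA) (cstar_adjZ HA) rmorphN rmorph1.
by rewrite scaleN1r.
Qed.

(** * Square roots of symmetric operators on the algebra *)

Section SquareRoot.
Variable W : A -> A.
Hypotheses (Wl : linear W) (W1 : forall x, nrm (W x) <= nrm x).

(** Iteration for 1 - sqrt (1 - W), whose limit Q satisfies 2Q = W + Q ^ 2. The sequence
    [sqrt_bound] is the same iteration on the scalar 1; it majorizes the iterates and their
    increments. *)
Fixpoint sqrt_iter n : A -> A :=
  if n is m.+1 then fun x => (2^-1)%:C *: (W x + sqrt_iter m (sqrt_iter m x))
  else fun=> 0.

Fixpoint sqrt_bound n : R := if n is m.+1 then (1 + sqrt_bound m ^+ 2) / 2 else 0.

Lemma sqrt_iterS n x :
  sqrt_iter n.+1 x = (2^-1)%:C *: (W x + sqrt_iter n (sqrt_iter n x)).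
Proof. by []. Qed.

Lemma sqrt_bound01 n : 0 <= sqrt_bound n <= 1.
Proof.
elim: n => [|n /andP[t0 t1]] /=; first by rewrite lexx ler01.
rewrite divr_ge0 ?addr_ge0 ?sqr_ge0//= ler_pdivrMr// mul1r.
by rewrite (_ : 2 = 1 + 1)// lerD2l exprn_ile1.
Qed.

Lemma sqrt_bound_le n : sqrt_bound n <= sqrt_bound n.+1.
Proof.
rewrite -subr_ge0 /=; move: (sqrt_bound n) => t.
have -> : (1 + t ^+ 2) / 2 - t = (1 - t) ^+ 2 / 2 by field.
by rewrite divr_ge0// sqr_ge0.
Qed.

Lemma sqrt_bound_mono m n : (m <= n)%N -> sqrt_bound m <= sqrt_bound n.
Proof.
move=> mn; rewrite -(subnKC mn); elim: (n - m)%N => [|k IHk]; first by rewrite addn0.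
by rewrite addnS (le_trans IHk)// sqrt_bound_le.
Qed.

Lemma sqrt_iter_linear n : linear (sqrt_iter n).
Proof.
elim: n => [|n IHn] c x y /=; first by rewrite scaler0 addr0.
rewrite Wl !IHn scalerA mulrC -scalerA -scalerDr; congr (_ *: _).
by rewrite scalerDr addrACA.
Qed.

Lemma sqrt_iter_comm V : linear V -> (forall x, V (W x) = W (V x)) ->
  forall n x, V (sqrt_iter n x) = sqrt_iter n (V x).
Proof.
move=> Vl VW; elim=> [|n IHn] x /=; first exact: lin0.
by rewrite (lin_scale _ _ Vl) (lin_add _ _ Vl) VW !IHn.
Qed.

Lemma sqrt_iter_commute m n x : sqrt_iter m (sqrt_iter n x) = sqrt_iter n (sqrt_iter m x).
Proof.
apply: sqrt_iter_comm (sqrt_iter_linear m) _ n x => y.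
by apply/esym; apply: sqrt_iter_comm Wl _ m y.
Qed.

Lemma nrm_half x : nrm ((2^-1)%:C *: x) = nrm x / 2.
Proof. by rewrite nrmZ normc_real ger0_norm ?invr_ge0// mulrC. Qed.

Lemma sqrt_iter_le n x : nrm (sqrt_iter n x) <= sqrt_bound n * nrm x.
Proof.
elim: n x => [|n IHn] x /=; first by rewrite nrm0 mul0r.
rewrite nrm_half mulrAC ler_wpM2r ?invr_ge0// mulrDl mul1r.
apply: le_trans (nrmD _ _) _; apply: lerD => //.
apply: le_trans (IHn _) _; rewrite expr2 -mulrA ler_wpM2l//.
by case/andP: (sqrt_bound01 n).
Qed.

(** Iterates commute, so the difference of squares factors into a difference and a sum; the scalar
    majorants satisfy the same recursion with equality. *)
Lemma sqrt_iter_step n x : nrm (sqrt_iter n.+1 x - sqrt_iter n x) <=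
  (sqrt_bound n.+1 - sqrt_bound n) * nrm x.
Proof.
elim: n x => [|n IHn] x.
  by rewrite subr0 [sqrt_bound 0]/(0) subr0; exact: sqrt_iter_le.
rewrite (sqrt_iterS n.+1 x) {2}(sqrt_iterS n x).
set q := sqrt_iter n.+1; set q' := sqrt_iter n.
have -> : (2^-1)%:C *: (W x + q (q x)) - (2^-1)%:C *: (W x + q' (q' x)) =
    (2^-1)%:C *: (q (q x + q' x) - q' (q x + q' x)).
  rewrite -scalerBr; congr (_ *: _).
  have ql : linear q := sqrt_iter_linear n.+1.
  have ql' : linear q' := sqrt_iter_linear n.
  rewrite (lin_add _ _ ql) (lin_add _ _ ql').
  have -> : q' (q x) = q (q' x) by exact: sqrt_iter_commute.
  by rewrite !opprD !addrA; congr (_ - _); rewrite addrK addrC addKr.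
rewrite nrm_half; apply: le_trans (ler_wpM2r _ (IHn _)) _; first by rewrite invr_ge0.
have h : nrm (q x + q' x) <= (sqrt_bound n.+1 + sqrt_bound n) * nrm x.
  by rewrite mulrDl; apply: le_trans (nrmD _ _) _; apply: lerD; exact: sqrt_iter_le.
have d0 : 0 <= sqrt_bound n.+1 - sqrt_bound n by rewrite subr_ge0 sqrt_bound_le.
apply: le_trans (ler_wpM2r _ (ler_wpM2l d0 h)) _; first by rewrite invr_ge0.
have -> : sqrt_bound n.+2 = (1 + sqrt_bound n.+1 ^+ 2) / 2 by [].
have -> : sqrt_bound n.+1 = (1 + sqrt_bound n ^+ 2) / 2 by [].
move: (sqrt_bound n) (nrm x) => t r; rewrite le_eqVlt; apply/orP; left; apply/eqP; by field.
Qed.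

(** Monotone and bounded by 1, which gives the Cauchy property with no rate. *)
Lemma sqrt_bound_cauchy (e : R) : 0 < e ->
  exists N, forall n, (N <= n)%N -> sqrt_bound n - sqrt_bound N <= e.
Proof.
move=> e0; have hs : has_sup (range sqrt_bound).
  split; first by exists (sqrt_bound 0); exists 0%N.
  by exists 1 => _ [n _ <-]; case/andP: (sqrt_bound01 n).
have [_ [N _ <-] h] := sup_adherent e0 hs.
exists N => n Nn; rewrite lerBlDr -lerBlDl; apply: ltW; apply: le_lt_trans h.
rewrite lerB// ; apply: ub_le_sup; [exact: hs.2|by exists n].
Qed.

Lemma sqrt_iter_gap m k x : nrm (sqrt_iter (m + k) x - sqrt_iter m x) <=
  (sqrt_bound (m + k) - sqrt_bound m) * nrm x.
Proof.
elim: k => [|k IHk]; first by rewrite addn0 !subrr nrm0 mul0r.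
rewrite addnS; apply: le_trans (nrmB_triangle _ (sqrt_iter (m + k) x) _) _.
apply: le_trans (lerD (sqrt_iter_step _ _) IHk) _.
by rewrite -mulrDl subrKA.
Qed.

Lemma sqrt_iter_cvg x : exists l, converges (fun n => sqrt_iter n x) l.
Proof.
apply: cauchy_converges => e e0; have x1 : 0 < nrm x + 1 by rewrite ltr_wpDl ?nrm_ge0.
have [|N tN] := @sqrt_bound_cauchy (e / (nrm x + 1)); first by rewrite divr_gt0.
exists N => n Nn; have := sqrt_iter_gap N (n - N) x; rewrite subnKC// => h.
apply: le_trans h _; apply: le_trans (_ : e / (nrm x + 1) * (nrm x + 1) <= _).
  apply: ler_pM; rewrite ?nrm_ge0 ?subr_ge0 ?sqrt_bound_mono ?tN ?lerDl//.
by rewrite divfK ?gt_eqF.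
Qed.

Definition sqrt_op x : A := projT1 (cid (sqrt_iter_cvg x)).

Lemma sqrt_opP x : converges (fun n => sqrt_iter n x) (sqrt_op x).
Proof. by rewrite /sqrt_op; case: cid. Qed.

Lemma sqrt_op_linear : linear sqrt_op.
Proof.
move=> c x y; apply: converges_unique (sqrt_opP _) _.
apply: converges_ext (convergesD (convergesZ c (sqrt_opP x)) (sqrt_opP y)) => n.
by rewrite (sqrt_iter_linear n).
Qed.

Lemma sqrt_op_le x : nrm (sqrt_op x) <= nrm x.
Proof.
apply: converges_nrm_le (sqrt_opP x) => n; apply: le_trans (sqrt_iter_le n x) _.
by rewrite ler_piMl ?nrm_ge0//; case/andP: (sqrt_bound01 n).
Qed.

Lemma sqrt_op_comm V (K : R) : linear V -> (forall x, nrm (V x) <= K * nrm x) ->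
  (forall x, V (W x) = W (V x)) -> forall x, V (sqrt_op x) = sqrt_op (V x).
Proof.
move=> Vl VK VW x; apply: converges_unique (sqrt_opP _).
apply: converges_ext (converges_lip (lin_lip Vl VK) (sqrt_opP x)) => n.
exact: sqrt_iter_comm.
Qed.

Lemma sqrt_op_eq x : sqrt_op x + sqrt_op x = W x + sqrt_op (sqrt_op x).
Proof.
have e : sqrt_op x = (2^-1)%:C *: (W x + sqrt_op (sqrt_op x)).
  apply: converges_unique (convergesS (sqrt_opP x)) _.
  apply: convergesZ; apply: convergesD.
    by move=> e e0; exists 0%N => n _; rewrite subrr nrm0 ltW.
  move=> e e0; have e2 : 0 < e / 2 by rewrite divr_gt0.
  have [N uN] := sqrt_opP x e2; have [N' uN'] := sqrt_opP (sqrt_op x) e2.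
  exists (maxn N N') => n; rewrite geq_max => /andP[Nn Nn'].
  rewrite [leRHS]splitr; apply: le_trans (nrmB_triangle _ (sqrt_iter n (sqrt_op x)) _) _.
  apply: lerD; last exact: uN'.
  rewrite -(lin_sub _ _ (sqrt_iter_linear n)); apply: le_trans (sqrt_iter_le _ _) _.
  apply: le_trans (uN n Nn); rewrite ler_piMl ?nrm_ge0//.
  by case/andP: (sqrt_bound01 n).
by rewrite {1 2}e halfD.
Qed.

Lemma sqrt_op_symmetric : symmetric_op W -> symmetric_op sqrt_op.
Proof.
move=> Ws.
have qs n : symmetric_op (sqrt_iter n).
  elim: n => [|n IHn] x y.
    by rewrite /= -(subrr x) adj_sub mul_subl mul_subr !subrr.
  rewrite !sqrt_iterS (cstar_adjZ HA) (cstar_mulZl HA) (cstar_mulZr HA).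
  rewrite conj_realC.
  by rewrite (cstar_adjD HA) (cstar_mulDl HA) (cstar_mulDr HA) Ws !IHn.
move=> x y.
have l1 : converges (fun n => (sqrt_iter n x)^# ** y) ((sqrt_op x)^# ** y).
  apply: (converges_lip (F := fun z => z^# ** y) (K := nrm y)) (sqrt_opP x) => u v.
  by rewrite -mul_subl -adj_sub (le_trans (nrmM _ _))// nrm_adj mulrC.
have l2 : converges (fun n => x^# ** sqrt_iter n y) (x^# ** sqrt_op y).
  apply: (converges_lip (F := fun z => x^# ** z) (K := nrm x)) (sqrt_opP y) => u v.
  by rewrite -mul_subr (le_trans (nrmM _ _))// nrm_adj.
by apply: converges_unique l1 (converges_ext _ l2) => n; rewrite qs.
Qed.

End SquareRoot.

(** S = 1 - Q, so S ^ 2 = 1 - W. Commutation passes through the limit for bounded operators, which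
    lets several roots be combined below. *)
Lemma op_root W : linear W -> (forall x, nrm (W x) <= nrm x) -> symmetric_op W ->
  exists S, [/\ linear S, symmetric_op S, forall x, S (S x) = x - W x,
    forall V (K : R), linear V -> (forall x, nrm (V x) <= K * nrm x) ->
      (forall x, V (W x) = W (V x)) -> forall x, V (S x) = S (V x) &
    forall x, nrm (x - S x) <= nrm x].
Proof.
move=> Wl W1 Ws; pose Q := sqrt_op Wl W1; have Ql : linear Q by exact: sqrt_op_linear.
have Qs : symmetric_op Q by exact: sqrt_op_symmetric.
exists (fun x => x - Q x); split.
- by move=> c x y; rewrite Ql opprD addrACA -scalerBr.
- by move=> x y; rewrite adj_sub mul_subl mul_subr Qs.
- move=> x; rewrite (lin_sub _ _ Ql) opprB addrA addrAC.
  have := sqrt_op_eq Wl W1 x; rewrite -/Q => h.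
  rewrite -[RHS]addr0 -(subrr (Q (Q x))) addrACA -opprD -h opprD !addrA.
  by rewrite [LHS]addrAC; congr (_ - _); rewrite addrAC.
- move=> V K Vl VK VW x; rewrite (lin_sub _ _ Vl); congr (_ - _).
  exact: sqrt_op_comm.
- by move=> x; rewrite opprB addrC subrK; exact: sqrt_op_le.
Qed.

(** For c = 'i and c = - 'i the cross terms of (S x + c V x)* (S x + c V x) cancel, because S and V
    commute, leaving x* (S ^ 2 + V ^ 2) x; and S x is the mean of the two vectors. This replaces the
    order on positive elements of A. *)
Lemma symmetric_pair_le S V x : linear S -> linear V -> symmetric_op S -> symmetric_op V ->
  (forall x, S (V x) = V (S x)) -> nrm (S x) ^+ 2 <= nrm x * nrm (S (S x) + V (V x)).
Proof.
move=> Sl Vl Ss Vs SV.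
have key (c : C) : Num.conj c * c = 1 -> Num.conj c = - c ->
    nrm (S x + c *: V x) ^+ 2 <= nrm x * nrm (S (S x) + V (V x)).
  move=> c1 cN; rewrite -nrm_cstar (cstar_adjD HA) (cstar_adjZ HA).
  rewrite (cstar_mulDl HA) !(cstar_mulDr HA) !(cstar_mulZl HA) !(cstar_mulZr HA).
  rewrite !Ss !Vs scalerA c1 scale1r SV cN scaleNr.
  have -> (p q r : A) : p + q + (- q + r) = p + r by rewrite addrA addrK.
  rewrite -(cstar_mulDr HA); apply: le_trans (nrmM _ _) _; by rewrite nrm_adj.
have := key 'i; rewrite -normCKC normCi expr1n conjCi => /(_ erefl erefl) h1.
have k1 : Num.conj (- 'i%C) * (- 'i%C) = 1 :> C.
  by apply/eqP; rewrite eq_complex /=; apply/andP; split; apply/eqP; ring.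
have k2 : Num.conj (- 'i%C) = - - 'i%C :> C.
  by apply/eqP; rewrite eq_complex /=; apply/andP; split; apply/eqP; ring.
have h2 := key _ k1 k2.
have n0 := nrm_ge0 x; have n1 := nrm_ge0 (S (S x) + V (V x)).
have s0 : 0 <= nrm x * nrm (S (S x) + V (V x)) by exact: mulr_ge0.
rewrite -(sqr_sqrtr s0) ler_pXn2r ?nnegrE ?nrm_ge0 ?sqrtr_ge0//.
have r1 c : nrm (S x + c *: V x) ^+ 2 <= nrm x * nrm (S (S x) + V (V x)) ->
    nrm (S x + c *: V x) <= Num.sqrt (nrm x * nrm (S (S x) + V (V x))).
  by move=> h; rewrite -(ger0_norm (nrm_ge0 _)) -sqrtr_sqr ler_sqrt.
have e : S x = (2^-1)%:C *: ((S x + 'i *: V x) + (S x + (- 'i) *: V x)).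
  by rewrite scaleNr addrACA subrr addr0 scalerDr halfD.
rewrite {1}e nrm_half.
rewrite ler_pdivrMr// mulr_natr mulr2n; apply: le_trans (nrmD _ _) _.
by apply: lerD; exact: r1.
Qed.

End CstarOperators.

Section RepresentationNorms.
Variables (R : realType) (A : starAlgData R).
Hypothesis HA : is_cstar_algebra A.
Local Notation C := R[i].
Local Notation "a ** b" := (sa_mul a b) (at level 40, left associativity).
Local Notation "a ^#" := (sa_adj a) (at level 2, format "a ^#").
Implicit Types (a b e x y z : A).

Lemma rep0 n (pi : A -> 'M[C]_n) : is_rep pi -> pi 0 = 0.
Proof.
move=> [pl _ _]; have := pl (-1) 0 0.
by rewrite scaler0 addr0 scaleN1r addNr.
Qed.

Lemma repZ n (pi : A -> 'M[C]_n) c a : is_rep pi -> pi (c *: a) = c *: pi a.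
Proof.
by move=> pr; have [pl _ _] := pr; rewrite -[c *: a]addr0 pl (rep0 pr) addr0.
Qed.

Lemma repB n (pi : A -> 'M[C]_n) a b : is_rep pi -> pi (a - b) = pi a - pi b.
Proof.
by move=> [pl _ _]; rewrite addrC -scaleN1r pl scaleN1r addrC.
Qed.

Lemma mul_linear a : linear (fun x => a ** x).
Proof. by move=> c x y; rewrite (cstar_mulDr HA) (cstar_mulZr HA). Qed.

Lemma sub_id_linear (V : A -> A) : linear V -> linear (fun x => x - V x).
Proof. by move=> Vl c x y; rewrite Vl opprD addrACA scalerBr. Qed.

Lemma adj_mul_symmetric a : symmetric_op (fun x => a^# ** (a ** x)).
Proof.
move=> x y; rewrite !(cstar_adjM HA) (cstar_adjK HA).
by rewrite !(cstar_mulA HA).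
Qed.

Lemma rep_l2norm_gram n (pi : A -> 'M[C]_n) a v : is_rep pi ->
  dotc v (pi (a^# ** a) *m v) = (l2norm (pi a *m v) ^+ 2)%:C.
Proof.
move=> [_ pm pa]; rewrite pm pa -mulmxA -dotc_adj; exact: dotcc.
Qed.

(** With S = sqrt (1 - W), W being left multiplication by a* a, the identity (S x)* S x = x* x - (a
    x)* (a x) is carried by [pi] to a comparison of vector norms. Taking x = a* gives that the
    squared norm of [pi a] is at most its norm. *)
Lemma rep_contractive1 n (pi : A -> 'M[C]_n) a : is_rep pi -> nrm a <= 1 ->
  opnorm (pi a) <= 1.
Proof.
move=> pr a1; pose W x := a^# ** (a ** x).
have Wl : linear W by move=> c x y; rewrite /W (mul_linear a) (mul_linear (a^#)).
have aM x : nrm (a ** x) <= nrm x.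
  by apply: le_trans (nrmM HA _ _) _; rewrite ler_piMl ?nrm_ge0.
have asM x : nrm (a^# ** x) <= nrm x.
  apply: le_trans (nrmM HA _ _) _; rewrite ler_piMl ?nrm_ge0//.
  by rewrite (nrm_adj HA).
have W1 x : nrm (W x) <= nrm x by exact: le_trans (asM _) (aM x).
have [S [Sl Ss SS _ _]] := op_root HA Wl W1 (adj_mul_symmetric a).
have key x v : l2norm (pi a *m (pi x *m v)) <= l2norm (pi x *m v).
  have e : (S x)^# ** S x = x^# ** x - (a ** x)^# ** (a ** x).
    rewrite Ss SS (mul_subr HA); congr (_ - _).
    by rewrite /W (cstar_adjM HA) !(cstar_mulA HA).
  have := rep_l2norm_gram (S x) v pr; rewrite e (repB _ _ pr) mulmxBl.
  rewrite -[_ - _ *m v]scale1r -scaleN1r scalerDr scale1r scale1r dotcDr dotcZr.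
  rewrite !(rep_l2norm_gram _ v pr) => /(congr1 (@complex.Re R)) /= h.
  have [_ pm _] := pr; rewrite pm in h.
  rewrite -(@ler_pXn2r _ 2)// ?nnegrE ?l2norm_ge0// -subr_ge0 mulmxA.
  have := sqr_ge0 (l2norm (pi (S x) *m v)); rewrite -h.
  by rewrite mulN1r oppr0 mul0r subr0.
have PP : opnorm (pi a *m (pi a)^t*) <= opnorm (pi a).
  apply: opnorm_le_gen => [|v]; first exact: opnorm_ge0.
  rewrite -mulmxA; have [_ _ pa] := pr; rewrite -pa.
  apply: le_trans (key _ v) _; apply: le_trans (l2norm_mulmx _ _) _.
  by rewrite pa opnorm_adj.
have := opnorm_adjM ((pi a)^t*); have -> : ((pi a)^t*)^t* = pi a by exact: trmxCK.
rewrite opnorm_adj => e; rewrite e in PP.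
have [->|p0] := eqVneq (opnorm (pi a)) 0; first exact: ler01.
have pp : 0 < opnorm (pi a) by rewrite lt0r p0 opnorm_ge0.
by rewrite -(ler_pM2l pp) mulr1 -expr2.
Qed.

Lemma rep_contractive n (pi : A -> 'M[C]_n) a : is_rep pi -> opnorm (pi a) <= nrm a.
Proof.
move=> pr; have [a0|a0] := eqVneq (nrm a) 0.
  by rewrite (nrm_eq0 a0) (rep0 pr) opnorm0 nrm_ge0.
have ap : 0 < nrm a by rewrite lt0r a0 nrm_ge0.
have := @rep_contractive1 n pi ((nrm a)^-1%:C *: a) pr.
rewrite nrmZ (repZ _ _ pr) opnormZ normc_real ger0_norm ?invr_ge0 ?nrm_ge0//.
by rewrite mulVf// => /(_ (lexx _)); rewrite mulrC ler_pdivrMr// mul1r.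
Qed.

Hypothesis Hsep : forall a b : A, a <> b ->
  exists p : fdrep A, rep_fun p a <> rep_fun p b.

(* Put [D = kap - e^2], [Q = |D|] and [Z = (Q - D) x], so that [(Q + D) Z = 0]. With [S] a
   square root of [Q], this gives [p(SZ)^* p(SZ) + p(Z)^* (kap - p(e)^2) p(Z) = 0] for each
   representation [p]; hence [Z = 0] and [D = S^2]. The square roots are taken of operators
   on [A], which need not have a unit. *)
Lemma rep_isometric_sa e (k' kap : R) : e^# = e -> nrm e ^+ 2 <= 2^-1 ->
  0 <= k' < kap -> kap <= 2^-1 ->
  (forall p : fdrep A, opnorm (rep_fun p e) ^+ 2 <= k') -> nrm e ^+ 2 <= kap.
Proof.
move=> es e1 /andP[k0 kk] kap1 pe; have kap0 : 0 < kap by exact: le_lt_trans kk.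
pose E x := e ** x; have El : linear E by exact: mul_linear.
have Es : symmetric_op E.
  by move=> x y; rewrite /E (cstar_adjM HA) es (cstar_mulA HA).
have Ek x : nrm (E x) <= nrm e * nrm x by exact: nrmM.
pose D x := kap%:C *: x - E (E x).
have Dl : linear D.
  move=> c x y; rewrite /D !El scalerDr opprD addrACA scalerBr !scalerA.
  by rewrite mulrC.
have Ds : symmetric_op D.
  move=> x y; rewrite /D (adj_sub HA) (mul_subl HA) (mul_subr HA) (cstar_adjZ HA).
  by rewrite conj_realC (cstar_mulZl HA) (cstar_mulZr HA) !Es.
have D1 x : nrm (D x) <= nrm x.
  apply: le_trans (nrmD _ _) _; rewrite nrmN nrmZ normc_real gtr0_norm//.
  have h : nrm (E (E x)) <= nrm e ^+ 2 * nrm x.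
    apply: le_trans (Ek _) _; rewrite expr2 -mulrA ler_wpM2l ?nrm_ge0//.
  apply: le_trans (lerD (lexx _) h) _; rewrite -mulrDl ler_piMl ?nrm_ge0//.
  have -> : 1 = 2^-1 + 2^-1 :> R by field.
  exact: lerD.
have Dk x : nrm (D x) <= 1 * nrm x by rewrite mul1r.
have DE x : D (E x) = E (D x).
  by rewrite /D (lin_sub _ _ El) (lin_scale _ _ El).
have DDl : linear (fun x => D (D x)) by move=> c x y; rewrite !Dl.
have DDs : symmetric_op (fun x => D (D x)) by move=> x y; rewrite !Ds.
have DD1 x : nrm (D (D x)) <= nrm x by exact: le_trans (D1 _) (D1 x).
have [s [sl ss sE sD _]] := op_root HA DDl DD1 DDs.
have sDx x : D (s x) = s (D x) by exact: (sD _ _ Dl Dk).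
have s1 x : nrm (s x) <= nrm x.
  rewrite -(@ler_pXn2r _ 2)// ?nnegrE ?nrm_ge0//.
  have sDx' y : s (D y) = D (s y) by rewrite sDx.
  by have := symmetric_pair_le HA x sl Dl ss Ds sDx'; rewrite sE subrK expr2.
pose W2 x := x - D (D x).
have W2l : linear W2 by exact: (sub_id_linear DDl).
have W2s : symmetric_op W2.
  by move=> x y; rewrite /W2 (adj_sub HA) (mul_subl HA) (mul_subr HA) !Ds.
have W21 x : nrm (W2 x) <= nrm x.
  by rewrite /W2 -sE; exact: le_trans (s1 _) (s1 x).
have [Q [Ql Qs QQ Qc Q1]] := op_root HA W2l W21 W2s.
have QQE x : Q (Q x) = D (D x) by rewrite QQ /W2 opprB addrC subrK.
have QD x : D (Q x) = Q (D x).
  by apply: (Qc _ _ Dl Dk) => y; rewrite /W2 (lin_sub _ _ Dl).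
have QE x : E (Q x) = Q (E x).
  by apply: (Qc _ _ El Ek) => y; rewrite /W2 (lin_sub _ _ El) -!DE.
pose W3 x := x - Q x.
have W3l : linear W3 by move=> c x y; rewrite /W3 Ql opprD addrACA scalerBr.
have W3s : symmetric_op W3.
  by move=> x y; rewrite /W3 (adj_sub HA) (mul_subl HA) (mul_subr HA) Qs.
have [S [Sl Ss SS Sc _]] := op_root HA W3l Q1 W3s.
have SSE x : S (S x) = Q x by rewrite SS /W3 opprB addrC subrK.
have SE x : E (S x) = S (E x).
  by apply: (Sc _ _ El Ek) => y; rewrite /W3 (lin_sub _ _ El) QE.
have QD0 x : Q x = D x.
  set Z := Q x - D x; apply/eqP; rewrite -subr_eq0 -/Z; apply/eqP.
  have SZ : S (S Z) = - D Z.
    apply/eqP; rewrite -subr_eq0 opprK SSE /Z (lin_sub _ _ Ql) (lin_sub _ _ Dl).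
    by rewrite QQE QD addrA subrK subrr.
  have eZ : (S Z)^# ** S Z + kap%:C *: (Z^# ** Z) = (E Z)^# ** E Z.
    rewrite Ss SZ Es /D -[- _]scaleN1r (cstar_mulZr HA) (mul_subr HA).
    by rewrite (cstar_mulZr HA) scaleN1r opprB subrK.
  apply: contrapT => /Hsep[p]; rewrite (rep0 (rep_funP p)); apply.
  have pr := rep_funP p; apply: opnorm_eq0; apply/eqP; rewrite eq_le opnorm_ge0 andbT.
  apply: opnorm_le_gen => // v; rewrite mul0r.
  have h : l2norm (rep_fun p (S Z) *m v) ^+ 2 + kap * l2norm (rep_fun p Z *m v) ^+ 2 =
      l2norm (rep_fun p (E Z) *m v) ^+ 2.
    have [pl _ _] := pr.
    have ps : rep_fun p ((S Z)^# ** S Z + kap%:C *: (Z^# ** Z)) =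
        rep_fun p ((S Z)^# ** S Z) + kap%:C *: rep_fun p (Z^# ** Z).
      by rewrite addrC pl addrC.
    apply: (@complexI R); rewrite -[RHS](rep_l2norm_gram (E Z) v pr) -eZ ps.
    rewrite mulmxDl dotcDr -scalemxAl dotcZr !(rep_l2norm_gram _ v pr).
    by rewrite -rmorphM -rmorphD.
  have h2 : l2norm (rep_fun p (E Z) *m v) ^+ 2 <= k' * l2norm (rep_fun p Z *m v) ^+ 2.
    have [_ pm _] := pr; rewrite /E pm -mulmxA.
    apply: le_trans (_ : (opnorm (rep_fun p e) * l2norm (rep_fun p Z *m v)) ^+ 2 <= _).
      by rewrite ler_pXn2r ?nnegrE ?l2norm_ge0 ?mulr_ge0 ?opnorm_ge0 ?l2norm_ge0 ?l2norm_mulmx.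
    by rewrite exprMn ler_wpM2r ?sqr_ge0.
  have h3 : (kap - k') * l2norm (rep_fun p Z *m v) ^+ 2 <= 0.
    rewrite mulrBl subr_le0; apply: le_trans h2; rewrite -h lerDr; exact: sqr_ge0.
  rewrite pmulr_rle0 ?subr_gt0// in h3.
  have h4 : l2norm (rep_fun p Z *m v) ^+ 2 == 0 by rewrite eq_le h3 sqr_ge0.
  by rewrite sqrf_eq0 in h4; rewrite (eqP h4).
(* Now E ^ 2 + S ^ 2 is multiplication by [kap], so the inequality at x = e bounds the fourth power
   of the norm of e by [kap] times its square. *)
have := symmetric_pair_le HA e El Sl Es Ss SE; rewrite SSE QD0 /D addrC subrK nrmZ.
rewrite normc_real gtr0_norm// /E -{1}es (nrm_cstar HA) mulrCA -expr2 => h.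
have [->|n0] := eqVneq (nrm e) 0; first by rewrite expr0n ltW.
have np : 0 < nrm e ^+ 2 by rewrite exprn_gt0// lt0r n0 nrm_ge0.
by rewrite -(ler_pM2r np) -expr2.
Qed.

Lemma rep_isometric a (c : R) : 0 <= c ->
  (forall p : fdrep A, opnorm (rep_fun p a) <= c) -> nrm a <= c.
Proof.
move=> c0 pa; set b := a^# ** a; have bE : nrm b = nrm a ^+ 2 by exact: nrm_cstar.
have b1 : 0 < 2 * (nrm b + 1) by rewrite mulr_gt0// ltr_wpDl ?nrm_ge0.
(* Scaling brings e = l a* a below norm 1/2, as [rep_isometric_sa] requires; letting [kap] decrease
   to the bound and taking roots undoes the scaling. *)
pose l : R := (2 * (nrm b + 1))^-1; have l0 : 0 < l by rewrite invr_gt0.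
pose e := l%:C *: b.
have eE : nrm e = l * nrm a ^+ 2 by rewrite nrmZ normc_real gtr0_norm// bE.
have es : e^# = e.
  by rewrite /e (cstar_adjZ HA) conj_realC /b (cstar_adjM HA) (cstar_adjK HA).
have e1 : nrm e ^+ 2 <= 2^-1.
  have h : nrm e <= 2^-1.
    rewrite nrmZ normc_real gtr0_norm// /l invfM -mulrA ler_piMr ?invr_ge0//.
    by rewrite mulrC ler_pdivrMr ?mul1r ?lerDl// ltr_wpDl ?nrm_ge0.
  apply: le_trans (_ : (2^-1) ^+ 2 <= _).
    by rewrite ler_pXn2r ?nnegrE ?nrm_ge0 ?invr_ge0.
  by rewrite expr2 ler_piMl ?invr_ge0// invf_le1// (_ : 2 = 1 + 1)// lerDl.
have pe (p : fdrep A) : opnorm (rep_fun p e) ^+ 2 <= (l * c ^+ 2) ^+ 2.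
  have pr := rep_funP p; have [_ pm ps] := pr.
  rewrite ler_pXn2r ?nnegrE ?opnorm_ge0 ?mulr_ge0 ?sqr_ge0 ?(ltW l0)//.
  rewrite /e (repZ _ _ pr) opnormZ normc_real gtr0_norm// ler_pM2l// /b pm ps.
  by rewrite opnorm_adjM ler_pXn2r ?nnegrE ?opnorm_ge0.
have : nrm e ^+ 2 <= (l * c ^+ 2) ^+ 2.
  apply/ler_addgt0Pr => d d0; set kap := _ + d.
  have [k2|/ltW k2] := leP kap 2^-1; last exact: le_trans e1 k2.
  by apply: (@rep_isometric_sa e ((l * c ^+ 2) ^+ 2) kap) => //; rewrite sqr_ge0/= ltrDl.
have lc0 : 0 <= l * c ^+ 2 by rewrite mulr_ge0 ?sqr_ge0 ?(ltW l0).
rewrite (@ler_pXn2r _ 2)// ?nnegrE ?nrm_ge0// eE ler_pM2l//.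
by rewrite ler_pXn2r ?nnegrE ?nrm_ge0.
Qed.

End RepresentationNorms.

(** * Finite-dimensional algebras of matrices *)

Section MatrixStarAlgebras.
Variable R : realType.
Local Notation C := R[i].

(** A matrix of maximal rank among those whose row space satisfies S; maximality forces every vector
    of S into it. *)
Lemma subspace_mx N (S : 'rV[C]_N -> Prop) : S 0 ->
  (forall c u v, S u -> S v -> S (c *: u + v)) ->
  exists W : 'M[C]_N, forall v : 'rV_N, (v <= W)%MS <-> S v.
Proof.
move=> S0 SL.
pose P r := `[< exists W : 'M[C]_N, \rank W = r /\ forall v : 'rV_N, (v <= W)%MS -> S v >].
have P0 : exists r, P r.
  exists 0%N; apply/asboolP; exists 0; split; first exact: mxrank0.
  by move=> v; rewrite submx0 => /eqP ->.
have PN r : P r -> (r <= N)%N.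
  by move=> /asboolP[W [<- _]]; exact: rank_leq_row.
have [r /asboolP[W [Wr WS]] rmax] := ex_maxnP P0 PN.
exists W => v; split; first exact: WS.
move=> Sv; apply: contrapT => /negP vW.
have /rmax : P (\rank (W + v)%MS).
  apply/asboolP; exists (W + v)%MS; split=> // u /sub_addsmxP[[a b] /= ->].
  rewrite (mx11_scalar b) mul_scalar_mx addrC; apply: SL => //.
  by apply: WS; exact: submxMl.
rewrite leqNgt -Wr => /negP; apply; apply: rank_ltmx.
by rewrite ltmxE addsmxSl /= addsmx_sub negb_and vW orbT.
Qed.

Lemma lin_mulmx_adj n (X : 'M[C]_n) :
  (lin_mulmx X : 'M_(n * n, n * n)) ^t* = lin_mulmx (X ^t*).
Proof.
have E (Y : 'M[C]_n) (i j k l : 'I_n) :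
    (lin_mulmx Y : 'M_(n * n, n * n)) (mxvec_index i j) (mxvec_index k l) = Y k i *+ (l == j).
  rewrite mxE /= mxvecE vec_mx_delta.
  rewrite mxE (bigD1 i)//= big1 => [|m mi]; last by rewrite mxE (negPf mi) mulr0.
  by rewrite mxE eqxx/= addr0; case: (l == j); rewrite ?mulr1 ?mulr0.
apply/matrixP => a b; rewrite 2!mxE.
case/mxvec_indexP: a => i j; case/mxvec_indexP: b => k l.
rewrite E (E (X ^t*)) [j == l]eq_sym.
have -> : (X ^t*) k i = Num.conj (X i k) by rewrite !mxE.
by case: (l == j); rewrite /= ?rmorph0.
Qed.

Section OrthogonalProjection.
Variables (n : nat) (S : 'M[C]_n -> Prop).
Hypotheses (S0 : S 0) (SL : forall c X Y, S X -> S Y -> S (c *: X + Y)).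

(* The orthogonal projection onto [S] for the Hilbert-Schmidt inner product is linear
   over the multipliers of [S]. *)
Lemma module_projection : exists P : {linear 'M[C]_n -> 'M[C]_n},
  [/\ forall Y, S (P Y), forall Y, S Y -> P Y = Y &
      forall X, (forall Y, S Y -> S (X *m Y)) -> (forall Y, S Y -> S (X ^t* *m Y)) ->
        forall Y, P (X *m Y) = X *m P Y].
Proof.
have [||W WP] := @subspace_mx (n * n) (fun v => S (vec_mx v)).
- by rewrite linear0.
- by move=> c u v Su Sv; rewrite linearP; exact: SL.
pose P := (vec_mx \o (mulmxr (proj_ortho W) \o mxvec)) : {linear 'M[C]_n -> 'M[C]_n}.
exists P; split=> [Y|Y SY|X XS XSt Y].
- by rewrite /P /=; apply/WP; exact: proj_ortho_sub.
- by rewrite /P /= proj_ortho_id ?mxvecK//; apply/WP; rewrite mxvecK.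
have st Z : (forall Y, S Y -> S (Z *m Y)) -> stablemx W (lin_mulmx Z).
  move=> ZS; apply/row_subP => j; rewrite row_mul; apply/WP.
  rewrite -(vec_mxK (row j W)) mul_vec_lin mxvecK; apply: ZS; apply/WP; exact: row_sub.
have c := @proj_ortho_comm R _ _ W (lin_mulmx X) (st X XS).
rewrite /P /=.
have e : mxvec Y *m proj_ortho W *m lin_mulmx X = mxvec (X *m Y) *m proj_ortho W.
  rewrite -mulmxA c; first by rewrite mulmxA mul_vec_lin.
  by rewrite lin_mulmx_adj; exact: st.
rewrite -e; move: (mxvec Y *m proj_ortho W) => v.
by rewrite -{1}(vec_mxK v) mul_vec_lin mxvecK.
Qed.

End OrthogonalProjection.

Record star_closed n (S : 'M[C]_n -> Prop) : Prop := StarClosed {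
  scl0 : S 0;
  scl_linear : forall c X Y, S X -> S Y -> S (c *: X + Y);
  scl_mul : forall X Y, S X -> S Y -> S (X *m Y);
  scl_adj : forall X, S X -> S (X ^t*) }.

(* [e] is the projection of [1%:M] onto [S]; this projection is also linear over the
   bicommutant of [S]. *)
Lemma star_closed_unit n (S : 'M[C]_n -> Prop) : star_closed S ->
  exists e, [/\ S e, e ^t* = e, (forall X, S X -> X *m e = X /\ e *m X = X) &
    forall X, (forall Z, (forall Y, S Y -> Z *m Y = Y *m Z) -> X *m Z = Z *m X) ->
      S (X *m e)].
Proof.
move=> [S0 SL SM SA]; have [P [PS Pid Pmod]] := module_projection S0 SL.
have PX X Y : S X -> P (X *m Y) = X *m P Y.
  by move=> SX; apply: Pmod => Z SZ; apply: SM => //; exact: SA.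
pose e := P 1%:M; have Se : S e := PS _.
have Xe X : S X -> X *m e = X.
  by move=> SX; rewrite /e -PX// mulmx1 Pid.
have eX X : S X -> e ^t* *m X = X.
  move=> SX; have := Xe _ (SA _ SX) => /(congr1 (fun M => M ^t*)).
  rewrite adjmxM; have -> : (X ^t*) ^t* = X by exact: trmxCK.
  by [].
have es : e ^t* = e.
  by rewrite -[LHS](Xe _ (SA _ Se)); exact: eX.
exists e; split=> //.
  by move=> X SX; split; [exact: Xe|rewrite -es; exact: eX].
move=> X XZ.
(* The coefficient matrices of P: column l of P Z is the sum over k of [Q k l] times column k of Z.
   Since P is linear over S on the left, each [Q k l] commutes with S. An X in the bicommutant then
   commutes with all of them, so P (X Y) = X P Y, and Y = 1 gives X e = P X in S. *)
pose Q (k l : 'I_n) : 'M[C]_n := \matrix_(a, b) P (delta_mx b k) a l.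
have QE k l (v : 'cV[C]_n) : Q k l *m v = col l (P (v *m delta_mx 0 k)).
  have -> : v *m (delta_mx 0 k : 'rV[C]_n) = \sum_b v b 0 *: delta_mx b k.
    apply/matrixP => a c; rewrite mxE big_ord1 mxE eqxx/= summxE (bigD1 a)//= big1.
      by rewrite addr0 !mxE eqxx.
    by move=> b ba; rewrite !mxE eq_sym (negPf ba) mulr0.
  rewrite linear_sum; apply/matrixP => a c; rewrite [RHS]mxE summxE mxE.
  by apply: eq_bigr => b _; rewrite linearZ !mxE (ord1 c) mulrC.
have Qc k l Y : S Y -> Q k l *m Y = Y *m Q k l.
  move=> SY; apply/matrixP => a b.
  have -> : (Q k l *m Y) a b = (Q k l *m (Y *m delta_mx b (0 : 'I_1))) a 0.
    by rewrite mulmxA -colE [RHS]mxE.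
  rewrite QE -mulmxA mul_delta_mx PX// [LHS]mxE [RHS]mxE.
  have -> : (Y *m P (delta_mx b k)) a l = \sum_j Y a j * P (delta_mx b k) j l by rewrite mxE.
  by apply: eq_bigr => j _; rewrite mxE.
have XQ k l : X *m Q k l = Q k l *m X by apply: XZ => Y SY; exact: Qc.
have XP Y : P (X *m Y) = X *m P Y.
  have PE Z l : col l (P Z) = \sum_k Q k l *m col k Z.
    have {1}-> : Z = \sum_k col k Z *m delta_mx 0 k.
      apply/matrixP => a c; rewrite summxE (bigD1 c)//= big1 => [|b bc].
        by rewrite mxE big_ord1 !mxE !eqxx mulr1 addr0.
      by rewrite mxE big_ord1 [delta_mx 0 b 0 c]mxE eqxx /= eq_sym (negPf bc) mulr0.
    rewrite linear_sum linear_sum; apply: eq_bigr => k _; exact/esym/QE.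
  have cM (M N : 'M[C]_n) k : col k (M *m N) = M *m col k N by rewrite !colE mulmxA.
  apply/matrixP => a l.
  have -> : P (X *m Y) a l = (col l (P (X *m Y))) a 0 by rewrite mxE.
  have -> : (X *m P Y) a l = (col l (X *m P Y)) a 0 by rewrite [RHS]mxE.
  congr (fun_of_matrix _ a 0); rewrite PE cM PE mulmx_sumr.
  by apply: eq_bigr => k _; rewrite cM !mulmxA XQ.
by rewrite /e -XP mulmx1; exact: PS.
Qed.

Lemma isometry_complete n d (V : 'M[C]_(n, d)) : V ^t* *m V = 1%:M ->
  exists k (V2 : 'M[C]_(n, k)), [/\ (d + k = n)%N, V2 ^t* *m V2 = 1%:M,
    V2 ^t* *m V = 0 & V *m V ^t* + V2 *m V2 ^t* = 1%:M].
Proof.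
move=> VV.
have [k [W [dk WW W2]]] : exists k (W : 'M[C]_(k, n)),
    [/\ (d + k = n)%N, W *m W ^t* = 1%:M & W *m V = 0].
  pose A := V ^t*; have At : A ^t* = V by exact: trmxCK.
  pose B := row_base (orthomx (@Num.conj C) (mx_of_hermitian (hermitian1mx _)) A).
  have Au : A \is unitarymx by apply/unitarymxP; rewrite At.
  pose k := \rank (orthomx (@Num.conj C) (mx_of_hermitian (hermitian1mx _)) A).
  have kn : (k <= n)%N by exact: rank_leq_col.
  exists k, (schmidt B); split.
  - by rewrite -(add_rank_ortho A) /k (mxrank_unitary Au).
  - by apply/unitarymxP; exact: schmidt_unitarymx.
  - rewrite -At; apply/orthomx1P; apply: submx_trans (_ : (B <= _)%MS).
      by rewrite eqmx_schmidt_free ?row_base_free.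
    by rewrite eq_row_base.
exists k, (W ^t*); have Wt : (W ^t*) ^t* = W by exact: trmxCK.
rewrite Wt; split=> //; subst n.
have full : col_mx (V ^t*) W *m row_mx V (W ^t*) = 1%:M.
  rewrite mul_col_row VV WW W2.
  have -> : V ^t* *m W ^t* = 0 by rewrite -adjmxM W2 adjmx0.
  by rewrite -scalar_mx_block.
by have := mulmx1C full; rewrite mul_row_col.
Qed.

End MatrixStarAlgebras.

Section Subrepresentations.
Variables (R : realType) (A : starAlgData R).
Local Notation C := R[i].

Lemma fdrep_eq (p q : fdrep A) : rep_deg p = rep_deg q ->
  (forall a, pad (rep_fun p a) = pad (rep_fun q a)) -> p = q.
Proof.
case: p => [[m m0] [f fr]]; case: q => [[n n0] [g gr]] /= e.
rewrite /rep_deg /= in e; subst n => h.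
have -> : n0 = m0 by exact: eq_irrelevance.
have fg : f = g by apply/funext => a; exact: pad_inj (h a).
by subst g; have -> : fr = gr by exact: eq_irrelevance.
Qed.

Lemma rep_fun_mk n (n0 : (0 < n)%N) (pi : A -> 'M[C]_n) (pr : is_rep pi) :
  rep_fun (mk_fdrep n0 pr) = pi.
Proof. by []. Qed.

(** Taking adjoints, invariance of the range of V becomes invariance of its orthogonal complement,
    on which q' is the compression of p. *)
Lemma subrep_split n d (p : A -> 'M[C]_n) (q : A -> 'M[C]_d) (V : 'M[C]_(n, d)) :
  is_rep p -> is_rep q -> V ^t* *m V = 1%:M -> (forall a, p a *m V = V *m q a) ->
  exists k (q' : A -> 'M[C]_k) (U : 'M[C]_(d + k)), [/\ (d + k = n)%N, is_rep q',
    U \is unitarymx & forall a, pad (p a) = pad (U *m dsum_mx (q a) (q' a) *m invmx U)].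
Proof.
move=> pr qr VV pV; have [k [V2 [dk V22 V2V full]]] := isometry_complete VV.
have [pl pm pa] := pr; have [ql qm qa] := qr.
have Vp a : V ^t* *m p a = q a *m V ^t*.
  have h := congr1 (fun M => M ^t*) (pV (sa_adj a)).
  rewrite !adjmxM pa qa in h.
  by rewrite !trmxCK in h.
have VV2 : V ^t* *m V2 = 0.
  by rewrite -[V2]trmxCK -adjmxM V2V adjmx0.
pose q' a := V2 ^t* *m p a *m V2.
have pV2 a : p a *m V2 = V2 *m q' a.
  rewrite -[LHS]mul1mx -full mulmxDl -!mulmxA (mulmxA (V ^t*)) Vp -mulmxA VV2.
  by rewrite !mulmx0 add0r /q' !mulmxA.
exists k, q'; subst n; pose U := row_mx V V2; exists U.
have Uu : U \is unitarymx.
  by apply/unitarymxP; rewrite /U tr_row_mx map_col_mx mul_row_col.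
have UE : invmx U = U ^t* by rewrite (invmx_unitary Uu).
split=> //.
  split=> [c a b|a b|a].
  - by rewrite /q' pl mulmxDr mulmxDl -scalemxAr -scalemxAl.
  - by rewrite /q' pm mulmxA -(mulmxA _ (p b)) pV2 mulmxA -(mulmxA _ V2) -/(q' b) mulmxA.
  - by rewrite /q' pa !adjmxM trmxCK mulmxA.
move=> a; congr pad; rewrite -[LHS]mulmx1 -(unitarymxP Uu) mulmxA UE; congr (_ *m _).
by rewrite /U /dsum_mx mul_mx_row pV pV2 mul_row_block !mulmx0 addr0 add0r.
Qed.

End Subrepresentations.

(** * Representations of the algebra of a solid tower *)

Section MatrixStarMorphisms.
Variable R : realType.
Local Notation C := R[i].

Lemma mx_eq_cv m n (M N : 'M[C]_(m, n)) : (forall v : 'cV_n, M *m v = N *m v) -> M = N.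
Proof.
move=> h; apply/matrixP => i j.
have -> : M i j = (M *m delta_mx j (0 : 'I_1)) i 0 by rewrite -colE mxE.
by rewrite h -colE mxE.
Qed.

Lemma mul_cv_delta d (x : 'cV[C]_d) (i0 : 'I_d) :
  x *m (delta_mx 0 i0 : 'rV_d) = \sum_j x j 0 *: delta_mx j i0.
Proof.
apply/matrixP => a c; rewrite mxE big_ord1 mxE eqxx/= summxE (bigD1 a)//= big1.
  by rewrite addr0 !mxE eqxx.
by move=> b ba; rewrite !mxE eq_sym (negPf ba) mulr0.
Qed.

(* The columns of [V] are the vectors [G (delta_mx i i0) *m xi], for a unit vector [xi]
   in the range of [G (delta_mx i0 i0)]. *)
Lemma mx_star_morphism d n (G : 'M[C]_d -> 'M[C]_n) : linear G ->
  (forall X Y, G (X *m Y) = G X *m G Y) -> (forall X, G (X ^t*) = (G X) ^t*) ->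
  G 1%:M <> 0 ->
  exists V : 'M[C]_(n, d), V ^t* *m V = 1%:M /\ forall X, G X *m V = V *m X.
Proof.
move=> Gl GM GA G1; pose L : {linear 'M[C]_d -> 'M[C]_n} := HB.pack G
  (GRing.isLinear.Build _ _ _ _ G Gl).
have Gsum (I : Type) (r : seq I) (F : I -> 'M[C]_d) :
    G (\sum_(j <- r) F j) = \sum_(j <- r) G (F j) by exact: (linear_sum L).
have GZ c X : G (c *: X) = c *: G X by exact: (linearZ_LR L).
have [i0 Gi0] : exists i0, G (delta_mx i0 i0) <> 0.
  apply: contrapT => h; apply: G1; rewrite mx1_sum_delta Gsum big1// => j _.
  by apply: contrapT => hj; apply: h; exists j.
pose E := delta_mx i0 i0 : 'M[C]_d.
have [eta w0] : exists eta : 'cV[C]_n, G E *m eta <> 0.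
  apply: contrapT => h; apply: Gi0; apply: mx_eq_cv => v; rewrite mul0mx.
  by apply: contrapT => hv; apply: h; exists v.
pose w := G E *m eta; have wp : 0 < l2norm w.
  by rewrite lt0r l2norm_ge0 andbT; apply/eqP => /l2norm_eq0.
pose xi := ((l2norm w)^-1)%:C *: w.
have xi1 : dotc xi xi = 1.
  rewrite /xi dotcZl dotcZr dotcc conj_realC -!rmorphM.
  have -> : (l2norm w)^-1 * ((l2norm w)^-1 * l2norm w ^+ 2) = 1 by field; rewrite gt_eqF.
  by [].
have EE : E *m E = E by rewrite mul_delta_mx.
have Exi : G E *m xi = xi.
  by rewrite /xi -scalemxAr /w mulmxA -GM EE.
pose r0 := delta_mx 0 i0 : 'rV[C]_d.
pose V : 'M[C]_(n, d) := \matrix_(a, j) (G (delta_mx j i0) *m xi) a 0.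
have VE (x : 'cV[C]_d) : V *m x = G (x *m r0) *m xi.
  rewrite mul_cv_delta Gsum mulmx_suml; apply/colP => a; rewrite mxE summxE.
  apply: eq_bigr => j _; have -> : V a j = (G (delta_mx j i0) *m xi) a 0 by rewrite mxE.
  by rewrite GZ -scalemxAl [RHS]mxE mulrC.
exists V; split.
  apply: mx_eq_cv => y; apply/colP => a.
  have e (z : 'cV[C]_d) : z a 0 = dotc (delta_mx a 0) z.
    rewrite dotcE (bigD1 a)//= big1 ?addr0 ?mxE ?eqxx ?rmorph1 ?mul1r// => b ba.
    by rewrite mxE (negPf ba) rmorph0 mul0r.
  rewrite e [RHS]e mul1mx -mulmxA -dotc_adj !VE.
  move: (delta_mx a 0 : 'cV_d) => x.
  rewrite dotc_adj -GA mulmxA -GM adjmxM mulmxA -(mulmxA (r0 ^t*)).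
  have -> : r0 ^t* *m (x ^t* *m y) *m r0 = dotc x y *: E.
    rewrite [x ^t* *m y]mx11_scalar mul_mx_scalar -scalemxAl /r0.
    have -> : (delta_mx 0 i0 : 'rV[C]_d) ^t* = delta_mx i0 0.
      by apply/matrixP => b c; rewrite !mxE andbC; case: (_ && _); rewrite ?rmorph1 ?rmorph0.
    by rewrite mul_delta_mx.
  by rewrite GZ -scalemxAl Exi dotcZr xi1 mulr1.
move=> X; apply: mx_eq_cv => y; rewrite -!mulmxA !VE.
by rewrite mulmxA -GM mulmxA.
Qed.

End MatrixStarMorphisms.

Section SolidRepresentations.
Variables (R : realType) (T : towerData R) (kappa : T).
Hypothesis HS : is_solid kappa.
Let Hm := solid_mtower HS.
Let Hp := solid_proper HS.
Let HT := mtower_tower Hm.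
Local Notation C := R[i].
Local Notation D := (C0 kappa).
Implicit Types (x y t s : T) (f g w : tfun T) (u v : D).

Lemma kappa_core : core T kappa.
Proof.
move=> [V [Vu [a [b e]]]]; have := deg_act HT Vu; rewrite e (deg_oplus HT) (solid_point HS).
by have := deg_gt0 a; have := deg_gt0 b; lia.
Qed.

(** A unitary of size one is scalar and acts trivially by (T4). *)
Lemma tequiv_point x y : deg x = 1%N -> tequiv x y -> y = x.
Proof.
move=> dx [U [Uu <-]].
have Us : U = (U (cast_ord (esym dx) 0) (cast_ord (esym dx) 0))%:M.
  apply/matrixP => i j; have e (k : 'I_(deg x)) : k = cast_ord (esym dx) 0.
    by apply/val_inj; case: k => k /=; rewrite dx; case: k.
  by rewrite (e i) (e j) mxE eqxx.
move: Uu; rewrite Us => Uu; exact: act_scalar HT _ _ Uu.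
Qed.

Lemma in_C0_alg w : in_C0 kappa w -> is_alg w.
Proof. by move=> [wc _ _]; exact: in_Cstar_alg. Qed.

Lemma in_C0_linear c f g : in_C0 kappa f -> in_C0 kappa g -> in_C0 kappa (c *: f + g).
Proof. exact: (csub_linear (in_C0_csub kappa)). Qed.

Lemma in_C0_mulr w g : in_C0 kappa w -> in_Cstar g -> in_C0 kappa (tfun_mul g w).
Proof.
move=> [wc wv w0] gc; split; [exact: in_Cstar_mul|exact: vanishing_mul|].
by rewrite /tfun_mul w0 mulmx0.
Qed.

Lemma tfun_mul_adj f g : tfun_adj (tfun_mul f g) = tfun_mul (tfun_adj g) (tfun_adj f).
Proof. by apply: functional_extensionality_dep => x; exact: adjmxM. Qed.

Lemma tfun_adjK f : tfun_adj (tfun_adj f) = f.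
Proof. by apply: functional_extensionality_dep => x; exact: trmxCK. Qed.

Lemma in_C0_adj w : in_C0 kappa w -> in_C0 kappa (tfun_adj w).
Proof. exact: (csub_adj (in_C0_csub kappa)). Qed.

Lemma in_C0_mull w g : in_C0 kappa w -> in_Cstar g -> in_C0 kappa (tfun_mul w g).
Proof.
move=> wc gc; rewrite -[tfun_mul w g]tfun_adjK tfun_mul_adj.
by apply: in_C0_adj; apply: in_C0_mulr (in_C0_adj wc) (in_Cstar_adj gc).
Qed.

Definition mkC0 w (wc : in_C0 kappa w) : D :=
  exist (fun f => C0_pred kappa f) w (asboolT wc).

(** Solidity enters here: it provides the nonzero values that [ideal_interpolation] needs for the
    ideal C*_0(T, kappa) of C*(T). *)
Lemma C0_rich f s : is_alg f -> f kappa = 0 -> exists u, C0val u s = f s.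
Proof.
move=> fa f0.
have [|||||u uc us] := @ideal_interpolation R T Hm Hp (in_C0 kappa) _ _ _ _ f s fa.
- exact: in_C0_alg.
- by split; [exact: in_Cstar0|exact: vanishing0|].
- exact: in_C0_linear.
- by move=> g u h gc uc hc; apply: in_C0_mull hc; exact: in_C0_mulr.
- move=> t tc ft; have [|g gt] := solid_separates HS tc.
    by move=> tk; apply: ft; rewrite tk f0.
  by exists (C0val g); [exact: C0funP|].
by exists (mkC0 uc).
Qed.

(** A unit for the algebraic functions vanishing at kappa: it equals 0 at kappa and 1 at all other
    irreducible points. *)
Definition alg_unit0 : tfun T :=
  -1 *: alg_bump Hm (1%:M : 'M[C]_(deg kappa)) + @tfun_scalar R T 1.

Lemma alg_unit0P : is_alg alg_unit0.
Proof.
by apply: is_alg_linear; [exact: Hm|exact: (alg_bumpP Hm _ kappa_core)|exact: is_alg_scalar].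
Qed.

Lemma alg_unit0_kappa : alg_unit0 kappa = 0.
Proof.
rewrite -[LHS]/(-1 *: alg_bump Hm _ kappa + 1%:M) (alg_bump_at Hm _ kappa_core).
by rewrite scaleN1r addNr.
Qed.

Lemma alg_unit0_core t : core T t -> t <> kappa -> alg_unit0 t = 1%:M.
Proof.
move=> tc tk; rewrite -[LHS]/(-1 *: alg_bump Hm _ t + 1%:M).
rewrite (alg_bump_core Hm _ kappa_core tc) ?scaler0 ?add0r//.
by move=> /(tequiv_point (solid_point HS)).
Qed.

Lemma alg_unit0_mul f s : is_alg f -> f kappa = 0 -> f s *m alg_unit0 s = f s.
Proof.
move=> fa f0; have ua := alg_unit0P.
apply: (is_alg_eq Hm (is_alg_mul Hm fa ua) fa) => t tc _.
have [->|tk] := pselect (t = kappa); first by rewrite /tfun_mul f0 mul0mx.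
by rewrite /tfun_mul alg_unit0_core// mulmx1.
Qed.

Lemma rep_kernel_core n (p : D -> 'M[C]_n) : is_rep p -> (exists a, p a <> 0) ->
  exists t, [/\ core T t, t <> kappa & forall u, p u = 0 -> C0val u t = 0].
Proof.
move=> pr [a pa]; apply: contrapT => noT.
have HA := C0_cstar_algebra kappa.
pose I w := exists u, C0val u = w /\ p u = 0.
have IC w : I w -> in_C0 kappa w by move=> [u [<- _]]; exact: C0funP.
have I0 : I 0 by exists 0; split=> //; exact: rep0.
have IL c g w : I g -> I w -> I (c *: g + w).
  move=> [u' [<- pu]] [w' [<- pw]]; exists (c *: u' + w'); split=> //.
  by have [pl _ _] := pr; rewrite pl pu pw scaler0 addr0.
have IA w : I w -> I (tfun_adj w).
  move=> [u [<- pu]]; exists (sa_adj u : D); split=> //.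
  by have [_ _ ps] := pr; rewrite ps pu adjmx0.
(* The multiplier g itself need not lie in the domain of p. But (g u)* (g u) = u* (g* g u) is a
   product inside it that p kills, and the C*-identity gives p (g u) = 0. *)
have IM g w : I w -> in_Cstar g -> I (tfun_mul g w).
  move=> [u [<- pu]] gc.
  pose gu : D := mkC0 (in_C0_mulr (C0funP u) gc).
  pose ggu : D := mkC0 (in_C0_mulr (C0funP gu) (in_Cstar_adj gc)).
  have [_ pm ps] := pr.
  exists gu; split=> //; apply: opnorm_eq0; apply/eqP; rewrite -sqrf_eq0 -opnorm_adjM -ps -pm.
  have -> : sa_mul (sa_adj gu) gu = sa_mul (sa_adj u : D) ggu.
    apply: C0_ext => x.
    rewrite -[LHS]/((tfun_mul g (C0val u) x) ^t* *m (tfun_mul g (C0val u) x)).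
    by rewrite /tfun_mul adjmxM -mulmxA.
  by rewrite pm ps pu adjmx0 mul0mx opnorm0.
have IMr g w : I w -> in_Cstar g -> I (tfun_mul w g).
  move=> Iw gc; rewrite -[tfun_mul w g]tfun_adjK tfun_mul_adj.
  exact: IA (IM _ _ (IA _ Iw) (in_Cstar_adj gc)).
apply: pa; apply: opnorm_small => e e0.
have [|||||m [mC me] [u [uE pu]]] := @ideal_approx R T kappa Hm I (C0val a) e IC I0 IL.
- by move=> g w [gc _ _] Iw; exact: IM.
- by move=> g w Ig [wc _ _]; exact: IMr.
- exact: C0funP.
(* If the claim failed, the kernel would interpolate [alg_unit0] at each s, and that value is a
   right unit for the adjoint of a at s. *)
- move=> s; have ua := alg_unit0P.
  have [|||w Iw ws] := @ideal_interpolation R T Hm Hp I _ I0 IL _ alg_unit0 s ua.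
  + by move=> w /IC/in_C0_alg.
  + by move=> g w h gc Iw hc; apply: IMr => //; exact: IM.
  + move=> t tc ut; apply: contrapT => h; apply: noT; exists t; split=> //.
      by move=> tk; apply: ut; rewrite tk alg_unit0_kappa.
    move=> u pu; apply: contrapT => ut0; apply: h; exists (C0val u) => //.
    by exists u.
  exists w => //; rewrite ws; have ac := C0funP a; have aa := in_C0_adj ac.
  apply: (alg_unit0_mul s (in_C0_alg aa)).
  by have [_ _] := aa.
- exact: e0.
pose m' : D := mkC0 mC.
have -> : p a = p m'.
  have : p (a - m') = 0.
    have -> : a - m' = u by apply: C0_ext => x; rewrite uE.
    exact: pu.
  by rewrite (repB _ _ pr) => /eqP; rewrite subr_eq0 => /eqP.
apply: le_trans (rep_contractive HA m' pr) _.
by rewrite /nrm C0_normE; exact: supnorm_le.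
Qed.

End SolidRepresentations.

(** * Representations as evaluations *)

Section SolidDuality.
Variables (R : realType) (T : towerData R) (kappa : T).
Hypothesis HS : is_solid kappa.
Let Hm := solid_mtower HS.
Let HT := mtower_tower Hm.
Local Notation C := R[i].
Local Notation D := (C0 kappa).
Implicit Types (x y t s : T) (f g w : tfun T) (u v : D).

Lemma C0val_alg u : is_alg (C0val u).
Proof. exact: (in_C0_alg HS (C0funP u)). Qed.

Lemma alg_oplusE m n f x y : is_alg f -> deg x = m -> deg y = n ->
  pad (f (oplus x y)) = udsum m n (pad (f x)) (pad (f y)).
Proof. by move=> [_ fo] <- <-; exact: fo. Qed.

Lemma rep_embed n (p : D -> 'M[C]_n) t : is_rep p -> core T t -> t <> kappa ->
  (forall u, p u = 0 -> C0val u t = 0) ->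
  exists V : 'M[C]_(n, deg t), V ^t* *m V = 1%:M /\
    forall u, p u *m V = V *m C0val u t.
Proof.
move=> pr tc tk ker; have [pl pm ps] := pr; have HA := C0_cstar_algebra kappa.
pose S1 X := exists u, p u = X.
pose S2 X := exists u, p u = X /\ C0val u t = 0.
have S1c : star_closed S1.
  split.
  - by exists 0; exact: (rep0 pr).
  - by move=> c X Y [u <-] [v <-]; exists (c *: u + v); exact: pl.
  - by move=> X Y [u <-] [v <-]; exists (sa_mul u v); exact: pm.
  - by move=> X [u <-]; exists (sa_adj u); exact: ps.
have S2c : star_closed S2.
  split.
  - by exists 0; split; [exact: (rep0 pr)|].
  - move=> c X Y [u [<- u0]] [v [<- v0]]; exists (c *: u + v); split; first exact: pl.
    by rewrite -[LHS]/(c *: C0val u t + C0val v t) u0 v0 scaler0 addr0.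
  - move=> X Y [u [<- u0]] [v [<- v0]]; exists (sa_mul u v); split; first exact: pm.
    by rewrite -[LHS]/(C0val u t *m C0val v t) u0 mul0mx.
  - move=> X [u [<- u0]]; exists (sa_adj u); split; first exact: ps.
    by rewrite -[LHS]/((C0val u t)^t*) u0 adjmx0.
have [e1 [[u1 pu1] e1s e1P _]] := star_closed_unit S1c.
have [e2 [[u2 [pu2 u20]] e2s e2P _]] := star_closed_unit S2c.
have p1 u : p u *m e1 = p u /\ e1 *m p u = p u by apply: e1P; exists u.
have p2 u : C0val u t = 0 -> p u *m e2 = p u /\ e2 *m p u = p u.
  by move=> ut; apply: e2P; exists u.
(* The unit of the image of p minus the unit of the image of the ideal of functions vanishing at t.
   It is a projection commuting with the image that kills this ideal, so p u f depends on u t only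
   and defines a star morphism G on matrices; [ker] makes G nonzero. *)
pose f := e1 - e2.
have fs : f ^t* = f by rewrite /f adjmxD adjmxN e1s e2s.
have fc u : p u *m f = f *m p u.
  rewrite /f mulmxBr mulmxBl; have [-> ->] := p1 u; congr (_ - _).
  have h1 : C0val (sa_mul u u2) t = 0.
    by rewrite -[LHS]/(C0val u t *m C0val u2 t) u20 mulmx0.
  have h2 : C0val (sa_mul u2 u) t = 0.
    by rewrite -[LHS]/(C0val u2 t *m C0val u t) u20 mul0mx.
  have [_] := p2 _ h1; rewrite pm pu2 => a1.
  have [a2 _] := p2 _ h2; rewrite pm pu2 in a2.
  by rewrite -a1 -[RHS]a2 mulmxA.
have e21 : e2 *m e1 = e2 by have [] := p1 u2; rewrite pu2.
have e12 : e1 *m e2 = e2 by have [] := p1 u2; rewrite pu2.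
have e22 : e2 *m e2 = e2 by have [] := p2 _ u20; rewrite pu2.
have e11 : e1 *m e1 = e1 by have [] := p1 u1; rewrite pu1.
have ff : f *m f = f.
  by rewrite /f mulmxBr !mulmxBl e11 e21 e12 e22 subrr subr0.
have f0 u : C0val u t = 0 -> p u *m f = 0.
  by move=> ut; rewrite /f mulmxBr; have [-> _] := p1 u; have [-> _] := p2 u ut; rewrite subrr.
have fE u v : C0val u t = C0val v t -> p u *m f = p v *m f.
  move=> uv; apply/eqP; rewrite -subr_eq0 -mulmxBl -(repB _ _ pr); apply/eqP; apply: f0.
  by rewrite C0valB uv subrr.
have rP (X : 'M[C]_(deg t)) : exists u, C0val u t = X.
  have ba := alg_bumpP Hm X tc.
  have [|u ut] := C0_rich HS t ba.
    apply: (alg_bump_core Hm _ tc (kappa_core HS)) => /(tequiv_sym HT).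
    by move=> /(tequiv_point HS (solid_point HS)).
  by exists u; rewrite ut (alg_bump_at Hm _ tc).
have [r rE] := choice rP.
pose G X := p (r X) *m f.
have Gu u X : C0val u t = X -> G X = p u *m f.
  by move=> ut; apply: fE; rewrite rE ut.
have GM X Y : G (X *m Y) = G X *m G Y.
  rewrite (Gu (sa_mul (r X) (r Y))); last by rewrite -[LHS]/(C0val _ t *m C0val _ t) !rE.
  by rewrite pm /G -[RHS]mulmxA (mulmxA f) -fc -(mulmxA _ f f) ff mulmxA.
have [||||V [VV GV]] := @mx_star_morphism R _ _ G.
- move=> c X Y; rewrite (Gu (c *: r X + r Y)); last first.
    by rewrite -[LHS]/(c *: C0val _ t + C0val _ t) !rE.
  by rewrite pl mulmxDl -scalemxAl.
- exact: GM.
- move=> X; rewrite (Gu (sa_adj (r X))); last by rewrite -[LHS]/((C0val _ t)^t*) rE.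
  by rewrite /G adjmxM fs -ps fc.
- move=> G1; have : C0val (r 1%:M - sa_mul (r 1%:M) u2) t = 0.
    apply: ker; rewrite (repB _ _ pr) pm pu2.
    by move: G1; rewrite /G /f mulmxBr; have [-> _] := p1 (r 1%:M).
  rewrite C0valB -[X in _ - X]/(C0val _ t *m C0val _ t) u20 mulmx0 subr0 rE.
  move=> /matrixP/(_ (Ordinal (deg_gt0 t)) (Ordinal (deg_gt0 t))).
  by rewrite !mxE eqxx => /eqP; rewrite oner_eq0.
exists V; split=> // u.
have V1 : V = G 1%:M *m V by rewrite GV mulmx1.
rewrite {1}V1 mulmxA /G mulmxA -pm.
have -> : p (sa_mul u (r 1%:M)) *m f = G (C0val u t).
  apply/esym; apply: Gu; rewrite -[LHS]/(C0val u t *m C0val _ t) rE.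
  exact: mulmx1.
exact: GV.
Qed.

Lemma zero_point n : (0 < n)%N -> exists2 s, deg s = n & forall u, C0val u s = 0.
Proof.
have k0 u : C0val u kappa = 0 by have [_ _] := C0funP u.
case: n => // n _; elim: n => [|n [s ds s0]].
  by exists kappa; [exact: solid_point|].
exists (oplus kappa s); first by rewrite (deg_oplus HT) ds (solid_point HS).
move=> u; apply: (@pad_inj R); rewrite (proj2 (C0val_alg u)) k0 s0 -pad_dsum.
by rewrite /dsum_mx block_mx0 !pad0.
Qed.

Lemma rep_eval n (p : D -> 'M[C]_n) : (0 < n)%N -> is_rep p ->
  exists2 s, deg s = n & forall u, pad (p u) = pad (C0val u s).
Proof.
elim/ltn_ind: n p => n IHn p n0 pr.
have [pa|p0] := pselect (exists a, p a <> 0); last first.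
  have [s ds s0] := zero_point n0; exists s => // u.
  have -> : p u = 0 by apply: contrapT => h; apply: p0; exists u.
  by rewrite s0 !pad0.
have [t [tc tk ker]] := rep_kernel_core HS pr pa.
have [V [VV pV]] := rep_embed pr tc tk ker.
have [k [q [U [dk qr Uu pE]]]] := subrep_split pr (C0_eval_rep kappa t) VV pV.
have [k0|k0] := posnP k.
  have e : deg t = n by rewrite -dk k0 addn0.
  clear pE Uu qr U q dk k0 k; subst n.
  have Vu : V \is unitarymx by exact: isometry_unitarymx.
  exists (act V t); first exact: (deg_act HT Vu).
  move=> u; rewrite (proj1 (C0val_alg u) _ _ Vu) /uconj matK; congr pad.
  by rewrite -pV -mulmxA (mulmxV (unitarymx_unit Vu)) mulmx1.
have [|s ds sE] := IHn k _ q k0 qr; first by rewrite -dk -addn1 addnC leq_add2r (deg_gt0 t).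
have dts : deg (oplus t s) = (deg t + k)%N by rewrite (deg_oplus HT) ds.
exists (act U (oplus t s)); first by rewrite (deg_actE HT dts Uu).
move=> u; rewrite pE (alg_actE (C0val_alg u) dts Uu) (alg_oplusE (C0val_alg u) (erefl (deg t)) ds) -sE -pad_dsum.
by rewrite /uconj matK.
Qed.

Lemma point_scalar x (X : 'M[C]_(deg x)) : deg x = 1%N -> exists c, X = c%:M.
Proof.
move=> dx; exists (X (cast_ord (esym dx) 0) (cast_ord (esym dx) 0)).
apply/matrixP => i j; have e (k : 'I_(deg x)) : k = cast_ord (esym dx) 0.
  by apply/val_inj; case: k => k /=; rewrite dx; case: k.
by rewrite (e i) (e j) mxE eqxx.
Qed.

(** An algebraic function becomes one vanishing at kappa after subtracting a scalar. Interpolating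
    at the sum of s and s' reproduces both values by a single element, and [alg_separates]
    applies. *)
Lemma C0_separates s s' : deg s = deg s' ->
  (forall u, pad (C0val u s) = pad (C0val u s')) -> s = s'.
Proof.
move=> ds us; apply: (alg_separates Hm ds) => f fa.
have [c fk] := point_scalar (f kappa) (solid_point HS).
have ca : is_alg (@tfun_scalar R T c) by exact: is_alg_scalar.
pose g : tfun T := -1 *: @tfun_scalar R T c + f.
have ga : is_alg g by exact: is_alg_linear.
have gk : g kappa = 0.
  by rewrite -[LHS]/(-1 *: c%:M + f kappa) fk scaleN1r addNr.
have fE x : f x = g x + c%:M.
  by rewrite -[g x]/(-1 *: c%:M + f x) scaleN1r addrAC addNr add0r.
have [u uE] := C0_rich HS (oplus s s') ga gk.
have := congr1 (@pad R _) uE; rewrite (proj2 (C0val_alg u)) (proj2 ga).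
move=> /(udsum_inj (wf_pad _) (wf_pad _) (wf_pad _) (wf_pad _))[e e'].
have h := us u; rewrite e e' in h.
rewrite !fE; move: (g s) (g s') h; rewrite ds => X Y /(@pad_inj R) ->.
by [].
Qed.

Lemma eval_rep_inj s s' : eval_rep kappa s = eval_rep kappa s' -> s = s'.
Proof.
move=> e; apply: C0_separates; first exact: (congr1 (@rep_deg R _) e).
by move=> u; exact: (congr1 (fun p => pad (rep_fun p u)) e).
Qed.

Lemma eval_rep_surj (p : fdrep D) : exists s, p = eval_rep kappa s.
Proof.
have [s ds sE] := rep_eval (rep_deg_gt0 p) (rep_funP p).
by exists s; apply: fdrep_eq => // u; exact: sE.
Qed.

End SolidDuality.

(** * The tower of representations *)

Lemma closed_eq_mx (R : realType) (X : topologicalType) n (f g : X -> 'M[R[i]]_n) :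
  continuous f -> continuous g -> closed [set x | f x = g x].
Proof.
move=> cf cg; have ch : continuous (fun x => opnorm (f x - g x)).
  have cd : continuous (fun x => -1 *: g x + f x) by exact: continuous_mx_linear.
  have -> : (fun x => opnorm (f x - g x)) = (@opnorm R n) \o (fun x => -1 *: g x + f x).
    by apply/funext => x /=; rewrite scaleN1r addrC.
  by move=> x; apply: (@continuous_comp _ _ _ (fun x => -1 *: g x + f x) (@opnorm R n));
    [exact: cd|exact: opnorm_cts].
have -> : [set x | f x = g x] = (fun x => opnorm (f x - g x)) @^-1` [set 0].
  apply/seteqP; split=> x /=; first by move=> ->; rewrite subrr opnorm0.
  by move=> /opnorm_eq0/eqP; rewrite subr_eq0 => /eqP.
by apply: preimage_closed => [? _|]; [exact: ch|exact: closed_eq].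
Qed.

Section RepresentationSpace.
Variables (R : realType) (A : starAlgData R).
Local Notation C := R[i].
Local Notation Z := (fdrep A).
Implicit Types (p q : Z) (a b : A).

Definition rep_ev n a p : 'M[C]_n := conform_mx 0 (rep_fun p a).

Lemma pad_rep_ev n a p : rep_deg p = n -> pad (rep_ev n a p) = pad (rep_fun p a).
Proof. by move=> e; rewrite pad_conform. Qed.

Lemma rep_nbhs n (n0 : (0 < n)%N) (P : @reps R A n) (U : set Z) :
  nbhs (existT (fun n : posnat => @reps R A (val n)) (exist _ n n0) P : Z) U <->
  nbhs P [set Q | U (existT (fun n : posnat => @reps R A (val n)) (exist _ n n0) Q)].
Proof. by []. Qed.

Lemma eval_continuous n a : continuous (fun P : @reps R A n => (val P : A -> 'M[C]_n) a).
Proof.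
move=> P; apply: (@continuous_comp _ _ _ (set_val : @reps R A n -> {ptws A -> 'M[C]_n})
  (fun f : {ptws A -> 'M[C]_n} => f a)); first exact: val_continuous.
exact: (@proj_continuous A (fun _ => 'M[C]_n) a).
Qed.

Lemma rep_ev_continuous n a : continuous (rep_ev n a).
Proof.
case=> [[m m0] P] U; rewrite /rep_ev /= => hU; apply/rep_nbhs.
have [e|ne] := eqVneq m n; last first.
  have {}hU : U 0.
    by apply: nbhs_singleton; rewrite nonconform_mx ?ne// in hU.
  by apply: filterE => Q /=; rewrite nonconform_mx ?ne.
subst n; rewrite conform_mx_id in hU.
have h := @eval_continuous m a P _ hU.
apply: (@filterS _ (nbhs P) (nbhs_filter P) _ _ _ h) => Q /=.
by rewrite conform_mx_id.
Qed.

Lemma rep_deg_near p : \forall q \near p, rep_deg q = rep_deg p.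
Proof. by case: p => [[m m0] P]; apply/rep_nbhs; exact: filterE. Qed.

Lemma rep_deg_continuous : continuous (@rep_deg R A).
Proof.
move=> p U hU; have Up : U (rep_deg p) by exact: nbhs_singleton hU.
by apply: filterS (rep_deg_near p) => q /= ->.
Qed.

Lemma rep_cvg (Y : Type) (F : set_system Y) (FF : Filter F) (f : Y -> Z) p :
  (\forall y \near F, rep_deg (f y) = rep_deg p) ->
  (forall a, (fun y => rep_ev (rep_deg p) a (f y)) @ F --> rep_fun p a) ->
  f @ F --> p.
Proof.
case: p => [[n n0] [P Pr]] fd fe U /rep_nbhs[V [[W oW WV] VP VU]].
pose g y : {ptws A -> 'M[C]_n} := fun a => rep_ev n a (f y).
have gP : g @ F --> (P : {ptws A -> 'M[C]_n}).
  apply/(@pointwise_cvgP A 'M[C]_n (g @ F) P) => a; exact: fe.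
have WP : nbhs (P : {ptws A -> 'M[C]_n}) W.
  by apply: open_nbhs_nbhs; split=> //; move: VP; rewrite -WV.
have hW := gP _ WP; apply: filterS2 fd hW => y dy Wy.
have ge a : pad (g y a) = pad (rep_fun (f y) a) by rewrite /g pad_rep_ev.
have gr : is_rep (g y).
  have [pl pm ps] := rep_funP (f y); rewrite /rep_deg /= in dy.
  split=> [c a b|a b|a]; rewrite /g /rep_ev.
  - by rewrite pl conform_mx_linear.
  - by rewrite pm conform_mx_mul.
  - by rewrite ps conform_mx_adj.
pose Q : @reps R A n := exist _ (g y) (mem_set gr).
have e : f y = existT (fun n : posnat => @reps R A (val n)) (exist _ n n0) Q.
  by apply: fdrep_eq => // a; rewrite -ge.
by change (U (f y)); rewrite e; apply: VU; rewrite -WV.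
Qed.

Lemma rep_hausdorff : hausdorff_space Z.
Proof.
move=> p q pq.
have dpq : rep_deg p = rep_deg q.
  have [r [/= rp rq]] := pq _ _ (rep_deg_near p) (rep_deg_near q).
  by rewrite -rp -rq.
apply: fdrep_eq => // a.
have h : rep_ev (rep_deg p) a p = rep_ev (rep_deg p) a q.
  apply: (@hausdorff_mx R (rep_deg p)) => B B' hB hB'.
  have [r [rB rB']] := pq _ _ (rep_ev_continuous hB) (rep_ev_continuous hB').
  by exists (rep_ev (rep_deg p) a r).
by have := congr1 (@pad _ _) h; rewrite !pad_rep_ev.
Qed.

Lemma is_rep_closed n : closed (@reps R A n).
Proof.
have ce a : continuous (fun f : {ptws A -> 'M[C]_n} => f a).
  exact: (@proj_continuous A (fun _ => 'M[C]_n) a).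
have -> : @reps R A n =
    (\bigcap_(t in [set: C * A * A])
      [set f : {ptws A -> 'M[C]_n} | f (t.1.1 *: t.1.2 + t.2) = t.1.1 *: f t.1.2 + f t.2]) `&`
    ((\bigcap_(t in [set: A * A])
      [set f : {ptws A -> 'M[C]_n} | f (sa_mul t.1 t.2) = f t.1 *m f t.2]) `&`
    (\bigcap_(t in [set: A]) [set f : {ptws A -> 'M[C]_n} | f (sa_adj t) = (f t) ^t*])).
  apply/seteqP; split=> f.
    move=> [fl fm fs]; split; [|split].
    - by move=> [[c a] b] _; exact: fl.
    - by move=> [a b] _; exact: fm.
    - by move=> a _; exact: fs.
  move=> [h1 [h2 h3]]; split=> [c a b|a b|a].
  - exact: (h1 (c, a, b) I).
  - exact: (h2 (a, b) I).
  - exact: (h3 a I).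
apply: closedI; last apply: closedI; apply: closed_bigI => t _; apply: closed_eq_mx.
- exact: ce.
- by apply: continuous_mx_linear; exact: ce.
- exact: ce.
- by apply: continuous_mx_mul; exact: ce.
- exact: ce.
- by apply: continuous_mx_adj; exact: ce.
Qed.

Hypothesis HA : is_cstar_algebra A.

(** By contractivity the representations form a closed subset of a product of compact balls, one for
    each element of A. *)
Lemma reps_compact n : compact (@reps R A n : set {ptws A -> 'M[C]_n}).
Proof.
have cB : compact ([set f | forall a, [set X : 'M[C]_n | opnorm X <= nrm a] (f a)]
    : set {ptws A -> 'M[C]_n}).
  exact: (@tychonoff A (fun _ => 'M[C]_n) (fun a => [set X | opnorm X <= nrm a])
    (fun a => @compact_opnorm_ball R n (nrm a))).
apply: (subclosed_compact _ cB); first exact: is_rep_closed.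
by move=> f fr a /=; exact: rep_contractive.
Qed.

Lemma rep_layer_compact n : compact [set p : Z | rep_deg p = n].
Proof.
have [n0|n0] := posnP n.
  have -> : [set p : Z | rep_deg p = n] = set0; last exact: compact0.
  by apply/seteqP; split=> // p /= dp; have := rep_deg_gt0 p; rewrite dp n0.
have -> : [set p : Z | rep_deg p = n] =
    (existT (fun n : posnat => @reps R A (val n)) (exist _ n n0)) @` [set: @reps R A n].
  apply/seteqP; split=> [[[m m0] P] /= dp|p [P _ <-] //].
  rewrite /rep_deg /= in dp; subst m.
  have -> : n0 = m0 by exact: eq_irrelevance.
  by exists P.
apply: continuous_compact; last exact/compact_set_type/reps_compact.
apply: continuous_subspaceT.
exact: (@existT_continuous _ (fun n : posnat => @reps R A (val n)) (exist _ n n0)).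
Qed.

End RepresentationSpace.

Lemma closed_embedding_intro (X Y : topologicalType) (f : X -> Y) :
  injective f -> continuous f -> (forall B, closed B -> closed (f @` B)) ->
  closed_embedding f.
Proof.
move=> fi fc fcl; split=> //; last by exact: fcl closedT.
move=> B; split=> [oB|[V oV ->]]; last by apply: open_comp => // x _; exact: fc.
exists (~` (f @` (~` B))).
  by apply: closed_openC; apply: fcl; exact: open_closedC.
apply/seteqP; split=> x /=.
  by move=> Bx [y nBy /fi yx]; apply: nBy; rewrite yx.
by move=> h; apply: contrapT => nBx; apply: h; exists x.
Qed.

Lemma near_fst (X Y : topologicalType) (x : X) (y : Y) (P : set X) :
  nbhs x P -> nbhs (x, y) [set t | P t.1].
Proof.
move=> h; exists (P, setT) => /=; first by split=> //; exact: filterT.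
by move=> [a b] [].
Qed.

Lemma near_snd (X Y : topologicalType) (x : X) (y : Y) (P : set Y) :
  nbhs y P -> nbhs (x, y) [set t | P t.2].
Proof.
move=> h; exists (setT, P) => /=; first by split=> //; exact: filterT.
by move=> [a b] [].
Qed.

Lemma continuous_dsum (R : realType) (X : topologicalType) m n
    (f : X -> 'M[R[i]]_m) (g : X -> 'M[R[i]]_n) :
  continuous f -> continuous g -> continuous (fun x => dsum_mx (f x) (g x)).
Proof.
move=> /continuous_mxP cf /continuous_mxP cg; apply/continuous_mxP => i j.
rewrite /dsum_mx /block_mx.
have -> : (fun x => col_mx (row_mx (f x) 0) (row_mx 0 (g x)) i j) = fun x =>
    match fintype.split i, fintype.split j with
    | inl i', inl j' => f x i' j' | inr i', inr j' => g x i' j' | _, _ => 0 end.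
  apply/funext => x; rewrite mxE; case: fintype.split => i'; rewrite mxE;
  by case: fintype.split => j' //; rewrite mxE.
case: (fintype.split i) => i'; case: (fintype.split j) => j';
  [exact: cf|exact: continuous_cst|exact: continuous_cst|exact: cg].
Qed.

Section ConcreteTowerAxioms.
Variables (R : realType) (A : starAlgData R).
Local Notation C := R[i].
Local Notation Z := (fdrep A).
Local Notation ZT := (fdrep_tower A).
Implicit Types (p q r : Z) (a b : A).

Lemma pad_conj_rep n (U : 'M[C]_n) p a : rep_deg p = n -> U \is unitarymx ->
  pad (rep_fun (conj_rep U p) a) = uconj U (pad (rep_fun p a)).
Proof.
move=> e Uu; subst n; rewrite /uconj matK.
by rewrite -[rep_fun (conj_rep U p) a]/(as_unitary (rep_deg p) U *m rep_fun p a *m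
  invmx (as_unitary (rep_deg p) U)) (as_unitaryE Uu).
Qed.

Lemma pad_sum_rep p q a : pad (rep_fun (sum_rep p q) a) =
  udsum (rep_deg p) (rep_deg q) (pad (rep_fun p a)) (pad (rep_fun q a)).
Proof. exact: pad_dsum. Qed.

Lemma pad_sum_repE k l p q a : rep_deg p = k -> rep_deg q = l ->
  pad (rep_fun (sum_rep p q) a) = udsum k l (pad (rep_fun p a)) (pad (rep_fun q a)).
Proof. by move=> <- <-; exact: pad_sum_rep. Qed.

Lemma rep_layer_closed n : closed [set p : Z | rep_deg p = n].
Proof.
have -> : [set p : Z | rep_deg p = n] = (@rep_deg R A) @^-1` [set n] by [].
by apply: preimage_closed => [? _|]; [exact: rep_deg_continuous|exact: discrete_closed].
Qed.

(** The degree is locally constant, so adherence to B at p is decided within the layer of p. *)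
Lemma closed_layers (B : set Z) :
  (forall n, closed (B `&` [set p : Z | rep_deg p = n])) -> closed B.
Proof.
move=> h p clp; have /h : closure (B `&` [set q : Z | rep_deg q = rep_deg p]) p; last by case.
move=> V Vp; have [q [Bq [Vq dq]]] := clp _ (filterI Vp (rep_deg_near p)).
by exists q.
Qed.

Lemma wf_rep n p a : rep_deg p = n -> wf n (pad (rep_fun p a)).
Proof. by move=> <-; exact: wf_pad. Qed.

Lemma rep_cvgE n (Y : Type) (F : set_system Y) (FF : Filter F) (f : Y -> Z) p :
  rep_deg p = n -> (\forall y \near F, rep_deg (f y) = n) ->
  (forall a, (fun y => rep_ev n a (f y)) @ F --> rep_ev n a p) -> f @ F --> p.
Proof.
move=> e h1 h2; subst n; apply: (@rep_cvg R A Y F FF f p h1) => a.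
have <- : rep_ev (rep_deg p) a p = rep_fun p a by exact: conform_mx_id.
exact: h2.
Qed.

Lemma rep_deg_sum p q : rep_deg (sum_rep p q) = (rep_deg p + rep_deg q)%N.
Proof. by []. Qed.

Lemma rep_deg_conj n (U : 'M[C]_n) p : rep_deg (conj_rep U p) = rep_deg p.
Proof. by []. Qed.

Lemma rep_ev_sum k l p q a : rep_deg p = k -> rep_deg q = l ->
  rep_ev (k + l) a (sum_rep p q) = dsum_mx (rep_ev k a p) (rep_ev l a q).
Proof.
move=> e1 e2; apply: (@pad_inj R).
rewrite pad_rep_ev; last by rewrite rep_deg_sum e1 e2.
by rewrite pad_dsum !pad_rep_ev// (pad_sum_repE _ e1 e2).
Qed.

Lemma rep_ev_conj n (U : 'M[C]_n) p a : rep_deg p = n -> U \is unitarymx ->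
  rep_ev n a (conj_rep U p) = U *m rep_ev n a p *m invmx U.
Proof.
move=> e Uu; apply: (@pad_inj R); rewrite pad_rep_ev// (pad_conj_rep _ e Uu).
by rewrite /uconj -(pad_rep_ev a e) matK.
Qed.

Lemma sum_rep_continuous : continuous (fun t : Z * Z => sum_rep t.1 t.2 : Z).
Proof.
move=> [p q]; set k := rep_deg p; set l := rep_deg q.
have h1 : \forall t \near (p, q), rep_deg t.1 = k by exact: near_fst (rep_deg_near p).
have h2 : \forall t \near (p, q), rep_deg t.2 = l by exact: near_snd (rep_deg_near q).
apply: (@rep_cvgE (k + l) _ (nbhs (p, q)) (nbhs_filter (p, q))) => [//||a].
  by apply: filterS2 h1 h2 => -[p' q'] /= e1 e2; rewrite rep_deg_sum e1 e2.
have c1 : continuous (fun t : Z * Z => rep_ev k a t.1).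
  by move=> t; apply: (@continuous_comp _ _ _ fst (@rep_ev R A k a)); [exact: cvg_fst|exact: rep_ev_continuous].
have c2 : continuous (fun t : Z * Z => rep_ev l a t.2).
  by move=> t; apply: (@continuous_comp _ _ _ snd (@rep_ev R A l a)); [exact: cvg_snd|exact: rep_ev_continuous].
have cd := continuous_dsum c1 c2.
rewrite (@rep_ev_sum k l p q)//; apply: cvg_trans (cd (p, q)); apply: near_eq_cvg.
by apply: filterS2 h1 h2 => -[p' q'] /= e1 e2; rewrite (@rep_ev_sum k l).
Qed.

Lemma conj_rep_continuous n : continuous
  (fun t : unitary_group R n * layer ZT n => conj_rep (val t.1) (val t.2 : Z) : Z).
Proof.
have dp (p : layer ZT n) : rep_deg (val p : Z) = n by exact: (layerP p).
move=> [U p]; apply: (@rep_cvgE n _ (nbhs (U, p)) (nbhs_filter (U, p))) => [||a].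
- exact: dp.
- by apply: filterE => -[U' p']; exact: dp.
have cU : continuous (fun t : unitary_group R n * layer ZT n => set_val t.1 : 'M[C]_n).
  by move=> t; apply: (@continuous_comp _ _ _ fst set_val); [exact: cvg_fst|exact: val_continuous].
have cv : continuous (fun t : unitary_group R n * layer ZT n => set_val t.2 : Z).
  by move=> t; apply: (@continuous_comp _ _ _ snd set_val); [exact: cvg_snd|exact: val_continuous].
have cp : continuous (fun t : unitary_group R n * layer ZT n => rep_ev n a (set_val t.2 : Z)).
  move=> t; exact: (@continuous_comp _ Z _ (fun t : unitary_group R n * layer ZT n => set_val t.2 : Z)
    (@rep_ev R A n a) t (cv t) (@rep_ev_continuous R A n a _)).
have cc := continuous_mx_mul (continuous_mx_mul cU cp) (continuous_mx_adj cU).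
have E : (fun t : unitary_group R n * layer ZT n => rep_ev n a (conj_rep (val t.1) (val t.2 : Z))) =
    fun t => set_val t.1 *m rep_ev n a (set_val t.2 : Z) *m (set_val t.1) ^t*.
  apply/funext => -[U' p']; rewrite (rep_ev_conj _ (dp p') (ugroupP U')).
  by rewrite (invmx_unitary (ugroupP U')).
have -> : rep_ev n a (conj_rep (val (U, p).1) (val (U, p).2 : Z)) =
   set_val (U, p).1 *m rep_ev n a (set_val (U, p).2 : Z) *m (set_val (U, p).1) ^t*.
  by have := congr1 (fun h => h (U, p)) E.
rewrite E; exact: cc.
Qed.

Lemma sum_rep_inj p q p' q' : rep_deg p = rep_deg p' -> sum_rep p q = sum_rep p' q' ->
  p = p' /\ q = q'.
Proof.
move=> dp e; have dq : rep_deg q = rep_deg q'.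
  have := congr1 (@rep_deg R A) e; rewrite !rep_deg_sum dp => /eqP.
  by rewrite eqn_add2l => /eqP.
have h a := congr1 (fun r => pad (rep_fun r a)) e.
have {h} h a : pad (rep_fun p a) = pad (rep_fun p' a) /\ pad (rep_fun q a) = pad (rep_fun q' a).
  have := h a; rewrite (pad_sum_repE _ dp dq) pad_sum_rep.
  by apply: udsum_inj; apply: wf_rep.
by split; apply: fdrep_eq => // a; have [] := h a.
Qed.

Lemma conj_rep_sum p q (U : 'M[C]_(rep_deg p)) (V : 'M[C]_(rep_deg q)) :
  U \is unitarymx -> V \is unitarymx ->
  conj_rep (dsum_mx U V) (sum_rep p q) = sum_rep (conj_rep U p) (conj_rep V q).
Proof.
move=> Uu Vu; apply: fdrep_eq => [|a]; first by [].
rewrite (@pad_conj_rep _ _ (sum_rep p q) a (erefl _) (unitarymx_dsum Uu Vu)).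
rewrite (@pad_sum_rep p q) (uconj_dsum _ _ Uu Vu) (@pad_sum_rep (conj_rep U p)).
rewrite (@pad_conj_rep _ _ p a (erefl _) Uu) (@pad_conj_rep _ _ q a (erefl _) Vu).
by rewrite !rep_deg_conj.
Qed.

Lemma conj_rep_swap p q :
  conj_rep (swap_mx R (rep_deg p) (rep_deg q)) (sum_rep p q) = sum_rep q p.
Proof.
apply: fdrep_eq => [|a]; first by rewrite rep_deg_conj !rep_deg_sum addnC.
rewrite (@pad_conj_rep _ _ (sum_rep p q) a (erefl _) (unitarymx_swap _ _ _)).
rewrite (@pad_sum_rep p q) (@pad_sum_rep q p).
by apply: uconj_swap; exact: wf_rep (erefl _).
Qed.

Hypothesis HA : is_cstar_algebra A.

(** A fixed total degree m restricts the domain to a product of two compact layers, whose image is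
    compact and hence closed. *)
Lemma sum_rep_closed_embedding n :
  closed_embedding (fun t : layer ZT n * ZT => oplus (val t.1) t.2).
Proof.
have dp (p : layer ZT n) : rep_deg (val p : Z) = n by exact: (layerP p).
have cont : continuous (fun t : layer ZT n * ZT => oplus (val t.1) t.2).
  have c2 : continuous (fun t : layer ZT n * ZT => (set_val t.1, t.2) : Z * Z).
    apply: continuous_pair => t; last exact: cvg_snd.
    by apply: (@continuous_comp _ _ _ fst set_val); [exact: cvg_fst|exact: val_continuous].
  move=> t; apply: (@continuous_comp _ _ _ (fun t : layer ZT n * ZT => (set_val t.1, t.2) : Z * Z)
    (fun q : Z * Z => sum_rep q.1 q.2 : Z)); [exact: c2|exact: sum_rep_continuous].
apply: closed_embedding_intro => //.
  move=> [p q] [p' q'] /= /sum_rep_inj[|e ->]; first by rewrite !dp.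
  by congr (_, _); exact: val_inj.
move=> B cB; apply: closed_layers => m.
pose K := B `&` ([set: layer ZT n] `*` [set q : ZT | rep_deg q = (m - n)%N]).
have cK : compact K.
  apply: (@subclosed_compact _ _ ([set: layer ZT n] `*` [set q : ZT | rep_deg q = (m - n)%N])).
  - apply: closedI => //.
    have -> : [set: layer ZT n] `*` [set q : ZT | rep_deg q = (m - n)%N] =
        snd @^-1` [set q : ZT | rep_deg q = (m - n)%N].
      by apply/seteqP; split=> t // [].
    by apply: preimage_closed => [? _|]; [exact: cvg_snd|exact: rep_layer_closed].
  - apply: compact_setX; last exact: rep_layer_compact.
    by apply: compact_set_type; exact: rep_layer_compact.
  - by move=> t [].
have cf : compact ((fun t : layer ZT n * ZT => oplus (val t.1) t.2) @` K).
  by apply: continuous_compact => //; exact: continuous_subspaceT.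
have [nm|mn] := leqP n m.
  have -> : (fun t : layer ZT n * ZT => oplus (val t.1) t.2) @` B `&`
      [set p : Z | rep_deg p = m] = (fun t : layer ZT n * ZT => oplus (val t.1) t.2) @` K.
    apply/seteqP; split=> r.
      move=> [[[p q] Bpq <-] /= dr]; exists (p, q) => //; split=> //; split=> //=.
      by rewrite -dr rep_deg_sum dp addnC addnK.
    move=> [[p q] [Bpq [_ /= dq]] <-]; split; first by exists (p, q).
    by rewrite /= rep_deg_sum dp dq subnKC.
  by apply: compact_closed => //; exact: rep_hausdorff.
have -> : (fun t : layer ZT n * ZT => oplus (val t.1) t.2) @` B `&`
    [set p : Z | rep_deg p = m] = set0; last exact: closed0.
apply/seteqP; split=> // r [[[p q] Bpq <-] /= dr].
by move: dr mn; rewrite rep_deg_sum dp => <-; rewrite ltnNge leq_addr.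
Qed.

Lemma fdrep_is_tower : is_tower ZT.
Proof.
split.
- exact: rep_hausdorff.
- exact: rep_deg_continuous.
- move=> p q r; apply: fdrep_eq => [|a]; first by rewrite /= !rep_deg_sum addnA.
  by rewrite /= !pad_sum_rep !rep_deg_sum udsumA.
- exact: sum_rep_continuous.
- exact: sum_rep_closed_embedding.
- by [].
- by [].
- exact: conj_rep_continuous.
- move=> p; apply: fdrep_eq => // a.
  by rewrite (pad_conj_rep _ (erefl _) (unitarymx1 _ _)) uconj1//; exact: wf_rep (erefl _).
- move=> p U V Uu Vu; apply: fdrep_eq => // a.
  rewrite (pad_conj_rep _ (erefl _) (mul_unitarymx Uu Vu)).
  by rewrite (pad_conj_rep _ (rep_deg_conj V p) Uu) (pad_conj_rep _ (erefl _) Vu) uconjM.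
- move=> p c cu; apply: fdrep_eq => // a; rewrite (pad_conj_rep _ (erefl _) cu).
  rewrite /uconj matK; congr pad; rewrite -scalar_mxC -mulmxA.
  by rewrite (mulmxV (unitarymx_unit cu)) mulmx1.
- by move=> p q U V Uu Vu; exact: conj_rep_sum.
- by move=> p q; exact: conj_rep_swap.
Qed.

Lemma fdrep_proper : proper_tower ZT.
Proof. by move=> n; exact: rep_layer_compact. Qed.

Lemma fdrep_sigma : sigma_property ZT.
Proof.
pose K n : set Z := [set p | (rep_deg p <= n)%N].
have cK n : compact (K n).
  elim: n => [|n IHn].
    have -> : K 0%N = set0; last exact: compact0.
    by apply/seteqP; split=> // p; rewrite /K /= leqNgt rep_deg_gt0.
  have -> : K n.+1 = K n `|` [set p : Z | rep_deg p = n.+1].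
    apply/seteqP; split=> p; rewrite /K /=.
      by rewrite leq_eqVlt ltnS => /predU1P[->|pn]; [right|left].
    by move=> [pn|->//]; exact: leqW.
  by apply: compactU => //; exact: rep_layer_compact.
exists K; split.
- by move=> n p; rewrite /K /=; exact: leqW.
- by apply/seteqP; split=> // p _; exists (rep_deg p) => //; rewrite /K /=.
- move=> n; split; first exact: cK.
  exact: (@hausdorff_set_type Z (K n) (@rep_hausdorff R A)).
- move=> B; split=> [cB n|h].
    by apply: closedI => //; apply: compact_closed (cK n); exact: rep_hausdorff.
  apply: closed_layers => n.
  have -> : B `&` [set p : Z | rep_deg p = n] = (B `&` K n) `&` [set p : Z | rep_deg p = n].
    apply/seteqP; split=> p; first by move=> [Bp /= e]; split=> //; split=> //; rewrite /K /= e.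
    by move=> [[Bp _] e].
  by apply: closedI; [exact: h|exact: rep_layer_closed].
Qed.

End ConcreteTowerAxioms.

(** * Order and disjointness through intertwiners *)

Section Intertwiners.
Variables (R : realType) (A : starAlgData R).
Hypothesis HA : is_cstar_algebra A.
Local Notation C := R[i].
Local Notation Z := (fdrep A).
Local Notation ZT := (fdrep_tower A).
Let HT : is_tower ZT := fdrep_is_tower HA.
Implicit Types (p q r x y z : ZT) (a b : A).

Lemma rep_linearE p : linear (rep_fun (p : Z)). Proof. by have [] := rep_funP (p : Z). Qed.
Lemma rep_mulE p a b : rep_fun (p : Z) (sa_mul a b) = rep_fun (p : Z) a *m rep_fun (p : Z) b.
Proof. by have [] := rep_funP (p : Z). Qed.
Lemma rep_adjE p a : rep_fun (p : Z) (sa_adj a) = (rep_fun (p : Z) a) ^t*.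
Proof. by have [] := rep_funP (p : Z). Qed.

Definition intertwines m n (p : A -> 'M[C]_m) (q : A -> 'M[C]_n) (X : 'M[C]_(n, m)) : Prop :=
  forall a, q a *m X = X *m p a.

Lemma intertwines_adj m n (p : A -> 'M[C]_m) (q : A -> 'M[C]_n) (X : 'M[C]_(n, m)) :
  is_rep p -> is_rep q -> intertwines p q X -> intertwines q p (X ^t*).
Proof.
move=> [_ _ ps] [_ _ qs] h a; have := congr1 (fun M => M ^t*) (h (sa_adj a)).
by rewrite !adjmxM ps qs !trmxCK.
Qed.

Lemma intertwines_comp k m n (p : A -> 'M[C]_k) (q : A -> 'M[C]_m) (r : A -> 'M[C]_n)
    (X : 'M[C]_(m, k)) (Y : 'M[C]_(n, m)) :
  intertwines p q X -> intertwines q r Y -> intertwines p r (Y *m X).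
Proof. by move=> hX hY a; rewrite mulmxA hY -mulmxA hX mulmxA. Qed.

Lemma compress_rep n k (p : A -> 'M[C]_n) (V : 'M[C]_(n, k)) : is_rep p ->
  (forall a, p a *m V = V *m (V ^t* *m p a *m V)) -> is_rep (fun a => V ^t* *m p a *m V).
Proof.
move=> [pl pm ps] pV; split=> [c a b|a b|a].
- by rewrite pl mulmxDr mulmxDl -scalemxAr -scalemxAl.
- by rewrite pm -[RHS]mulmxA -pV !mulmxA.
- by rewrite ps !adjmxM trmxCK mulmxA.
Qed.

Definition isometric m n (X : 'M[C]_(n, m)) : Prop := X ^t* *m X = 1%:M.

Lemma isometric_comp k m n (X : 'M[C]_(m, k)) (Y : 'M[C]_(n, m)) :
  isometric X -> isometric Y -> isometric (Y *m X).
Proof.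
rewrite /isometric => hX hY; rewrite adjmxM mulmxA -(mulmxA (X ^t*)) hY mulmx1.
exact: hX.
Qed.

Lemma rep_act_intertwines p (U : 'M[C]_(deg p)) : U \is unitarymx ->
  intertwines (rep_fun (p : Z)) (rep_fun (act U p : Z)) U.
Proof.
move=> Uu a; apply: (@pad_inj R).
have -> : rep_fun (act U p : Z) a = U *m rep_fun (p : Z) a *m invmx U.
  by apply: (@pad_inj R); rewrite (pad_conj_rep _ (erefl _) Uu) /uconj matK.
by rewrite -!mulmxA (mulVmx (unitarymx_unit Uu)) mulmx1.
Qed.

Lemma tequiv_intertwines p q : tequiv p q <->
  deg p = deg q /\ exists X : 'M[C]_(deg q, deg p),
    isometric X /\ intertwines (rep_fun (p : Z)) (rep_fun (q : Z)) X.
Proof.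
split.
  move=> [U [Uu <-]]; split; first by [].
  exists U; split; last exact: rep_act_intertwines.
  exact: unitarymx_adjmul.
move=> [dpq [X [X1 hX]]].
have [Y [Yu hY]] : exists Y : 'M[C]_(deg p), Y \is unitarymx /\
    forall a, pad (rep_fun (q : Z) a) = pad (Y *m rep_fun (p : Z) a *m invmx Y).
  case: q dpq X X1 hX => [[n n0] Q]; rewrite /= /rep_deg /= => e; subst n => X X1 hX.
  have Xu : X \is unitarymx by exact: isometry_unitarymx.
  exists X; split=> // a; congr pad.
  by rewrite -hX -mulmxA (mulmxV (unitarymx_unit Xu)) mulmx1.
exists Y; split=> //; apply: fdrep_eq => // a.
by rewrite hY (pad_conj_rep _ (erefl _) Yu) /uconj matK.
Qed.

Lemma tequiv_isometric p q : tequiv p q -> exists X : 'M[C]_(deg q, deg p),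
  isometric X /\ intertwines (rep_fun (p : Z)) (rep_fun (q : Z)) X.
Proof. by move=> /tequiv_intertwines[]. Qed.

Lemma oplus_intertwinesl p q : exists X : 'M[C]_(deg (oplus p q), deg p),
  isometric X /\ intertwines (rep_fun (p : Z)) (rep_fun (oplus p q : Z)) X.
Proof.
exists (col_mx 1%:M 0); split.
  rewrite /isometric tr_col_mx map_row_mx mul_row_col adjmx1 mulmx1.
  by rewrite mulmx0 addr0.
move=> a; rewrite -[rep_fun (oplus p q : Z) a]/(dsum_mx (rep_fun (p : Z) a) (rep_fun (q : Z) a)).
by rewrite /dsum_mx mul_block_col !mulmx0 !mul0mx mulmx1 !addr0 mul_col_mx mul1mx mul0mx.
Qed.

Lemma tsub_intertwines p q : tsub p q <-> exists X : 'M[C]_(deg q, deg p),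
  isometric X /\ intertwines (rep_fun (p : Z)) (rep_fun (q : Z)) X.
Proof.
split.
  move=> [/tequiv_isometric//|[r [s [/tequiv_isometric[X [X1 hX]] /(tequiv_sym HT)]]]].
  move=> /tequiv_isometric[Y [Y1 hY]]; have [E [E1 hE]] := oplus_intertwinesl r s.
  exists (Y *m (E *m X)); split.
    exact: isometric_comp (isometric_comp X1 E1) Y1.
  exact: intertwines_comp (intertwines_comp hX hE) hY.
move=> [X [X1 hX]].
have [k [q' [U [dk q'r Uu qE]]]] := subrep_split (rep_funP (q : Z)) (rep_funP (p : Z)) X1 hX.
have [k0|k0] := posnP k.
  left; apply/tequiv_intertwines; split; last by exists X.
  by rewrite /= -dk k0 addn0.
right; exists p, (mk_fdrep k0 q'r : ZT); split; first exact: tequiv_refl.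
apply: (tequiv_sym HT).
have e : q = act U (oplus p (mk_fdrep k0 q'r : ZT)).
  apply: fdrep_eq => [|a]; first by rewrite /= -dk.
  rewrite qE (@pad_conj_rep R A _ _ (sum_rep (p : Z) (mk_fdrep k0 q'r)) a (erefl _) Uu).
  by rewrite pad_sum_rep /uconj -pad_dsum matK.
by rewrite e; exact: (tequiv_intro (n := (rep_deg (p : Z) + k)%N)).
Qed.

Lemma isometric_neq0 m n (X : 'M[C]_(n, m)) : (0 < m)%N -> isometric X -> X <> 0.
Proof.
move=> m0 X1 X0; have := X1; rewrite /isometric X0 mulmx0.
move=> /matrixP/(_ (Ordinal m0) (Ordinal m0)); rewrite !mxE eqxx => /eqP.
by rewrite eq_sym oner_eq0.
Qed.

(* The polar part of a nonzero intertwiner on an eigenspace is an equivalence of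
   subrepresentations. *)
Lemma tdisjoint_intertwines p q : tdisjoint p q <->
  forall X : 'M[C]_(deg q, deg p), intertwines (rep_fun (p : Z)) (rep_fun (q : Z)) X -> X = 0.
Proof.
have pr := rep_funP (p : Z); have qr := rep_funP (q : Z).
split; last first.
  move=> h [r [/tsub_intertwines[X [X1 hX]] /tsub_intertwines[Y [Y1 hY]]]].
  have /h YX0 : intertwines (rep_fun (p : Z)) (rep_fun (q : Z)) (Y *m X ^t*).
    exact: intertwines_comp (intertwines_adj (rep_funP _) pr hX) hY.
  apply: (isometric_neq0 (deg_gt0 r) Y1).
  by rewrite -[Y]mulmx1 -X1 mulmxA YX0 mul0mx.
move=> pq W hW; apply: contrapT => W0; apply: pq.
set H := W ^t* *m W; have Hh : H ^t* = H by rewrite /H adjmxM trmxCK.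
have Hc a : rep_fun (p : Z) a *m H = H *m rep_fun (p : Z) a.
  exact: (intertwines_comp hW (intertwines_adj pr qr hW)).
have [Su HE Dr] := hermitian_spectral Hh.
have [i0 Di0] : exists i0, spectral_diag H 0 i0 <> 0.
  apply: contrapT => h; have H0 : H = 0.
    rewrite HE (_ : spectral_diag H = 0) ?linear0 ?mulmx0 ?mul0mx//.
    by apply/rowP => i; rewrite mxE; apply: contrapT => hi; apply: h; exists i.
  apply: W0; apply: mx_eq_cv => v; rewrite mul0mx; apply: l2norm_eq0.
  have := Re_dotcc (W *m v); rewrite dotc_adj mulmxA -/H H0 mul0mx.
  rewrite -[0 : 'cV__](scale0r v) dotcZr mul0r /= => /esym/eqP.
  by rewrite sqrf_eq0 => /eqP.
have [k [V [lam [k0 V1 HV Vc [_ lamE]]]]] := eigenspace_isometry i0 Hh.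
have pV a : rep_fun (p : Z) a *m V = V *m (V ^t* *m rep_fun (p : Z) a *m V) by exact: Vc.
have rr := compress_rep pr pV.
have WV : (W *m V) ^t* *m (W *m V) = lam%:M.
  by rewrite adjmxM mulmxA -(mulmxA (V ^t*)) -/H -mulmxA HV -scalemxAr V1 scalemx1.
have lam0 : lam <> 0 by rewrite lamE.
pose j0 := Ordinal k0.
have lamP : lam = (l2norm (W *m V *m delta_mx j0 (0 : 'I_1)) ^+ 2)%:C.
  rewrite -dotcc dotc_adj mulmxA WV mul_scalar_mx dotcZr dotcc l2norm_delta expr1n.
  by rewrite mulr1.
set mu := l2norm _ in lamP; have mu0 : 0 < mu.
  rewrite lt0r l2norm_ge0 andbT; apply/eqP => h; apply: lam0.
  by rewrite lamP h expr0n.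
exists (mk_fdrep k0 rr : ZT); split; apply/tsub_intertwines; first by exists V.
exists ((mu^-1)%:C *: (W *m V)); split.
  rewrite /isometric adjmxZ conj_realC -scalemxAl -scalemxAr scalerA WV lamP.
  rewrite scale_scalar_mx -!rmorphM.
  have -> : mu^-1 * mu^-1 * mu ^+ 2 = 1 by field; rewrite gt_eqF.
  by [].
move=> a; rewrite -scalemxAr -scalemxAl; congr (_ *: _).
rewrite -[rep_fun (mk_fdrep k0 rr) a]/(V ^t* *m rep_fun (p : Z) a *m V).
transitivity (W *m (rep_fun (p : Z) a *m V)); first by rewrite mulmxA hW mulmxA.
by rewrite (pV a) !mulmxA.
Qed.

Lemma tdisjoint_sum x y z : tdisjoint z x -> tdisjoint z y -> tdisjoint z (oplus x y).
Proof.
move=> /tdisjoint_intertwines hx /tdisjoint_intertwines hy; apply/tdisjoint_intertwines => X hX.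
have hE a : dsum_mx (rep_fun (x : Z) a) (rep_fun (y : Z) a) *m X = X *m rep_fun (z : Z) a by exact: hX.
have h a : rep_fun (x : Z) a *m usubmx X = usubmx X *m rep_fun (z : Z) a /\
    rep_fun (y : Z) a *m dsubmx X = dsubmx X *m rep_fun (z : Z) a.
  have := hE a; rewrite -(vsubmxK X) /dsum_mx mul_block_col !mul0mx addr0 add0r mul_col_mx.
  by rewrite col_mxKu col_mxKd => /eq_col_mx.
have hx0 : usubmx X = 0 by apply: hx => a; case: (h a).
have hy0 : dsubmx X = 0 by apply: hy => a; case: (h a).
rewrite -(vsubmxK X) hx0 hy0; exact: col_mx0.
Qed.

End Intertwiners.

(** * Cancellation of a common summand *)

Section Cancellation.
Variable R : realType.
Local Notation C := R[i].

Lemma poly_nonroot (p : {poly C}) : p != 0 -> exists c : C, p.[c] != 0.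
Proof.
move=> p0; apply: contrapT => h.
pose s : seq C := [seq j%:R | j <- iota 0 (size p)].
have := @max_poly_roots _ p s p0; rewrite size_map size_iota ltnn => hs.
suff : false by []. apply: hs.
  apply/allP => c _; apply/rootP; apply/eqP; apply: contrapT => /negP hc.
  by apply: h; exists c.
rewrite map_inj_uniq ?iota_uniq// => j k /eqP; rewrite eqr_nat => /eqP; exact.
Qed.

Lemma horner_det n (M : 'M[{poly C}]_n) c : (\det M).[c] = \det (map_mx (horner_eval c) M).
Proof. by rewrite det_map_mx. Qed.

(** Both determinants are nonzero polynomials in c: the first is a characteristic polynomial, and
    the second is nonzero at c = 0 because M is invertible. Their product has a non-root. *)
Lemma shift_invertible m n (M : 'M[C]_(m + n)) : M \in unitmx ->
  exists c : C, ulsubmx M + c%:M \in unitmx /\ M + dsum_mx c%:M (0 : 'M_n) \in unitmx.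
Proof.
move=> Mu; pose P1 := char_poly (- ulsubmx M).
pose P2 := \det (map_mx polyC M + 'X *: map_mx polyC (dsum_mx (1%:M : 'M[C]_m) (0 : 'M_n))).
have P1E c : P1.[c] = \det (ulsubmx M + c%:M).
  rewrite /P1 /char_poly horner_det; congr (\det _); apply/matrixP => i j.
  rewrite !mxE /horner_eval hornerD hornerN !hornerE addrC opprK; congr (_ + _).
  by case: (i == j); rewrite ?hornerX ?hornerC.
have P2E c : P2.[c] = \det (M + dsum_mx c%:M (0 : 'M_n)).
  rewrite /P2 horner_det; congr (\det _).
  have -> : dsum_mx (c%:M : 'M[C]_m) (0 : 'M_n) = c *: dsum_mx (1%:M : 'M[C]_m) (0 : 'M_n).
    by rewrite /dsum_mx scale_block_mx !scaler0 scalemx1.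
  apply/matrixP => i j.
  by rewrite !mxE /horner_eval hornerD hornerM hornerX !hornerC.
have P10 : P1 != 0 by rewrite monic_neq0// char_poly_monic.
have P20 : P2 != 0.
  apply/eqP => h; have := P2E 0; rewrite h horner0 /dsum_mx.
  have -> : (0%:M : 'M[C]_m) = 0 by rewrite raddf0.
  rewrite block_mx0 addr0 => /esym/eqP; move: Mu.
  by rewrite unitmxE unitfE => /negPf ->.
have [c] := poly_nonroot (mulf_neq0 P10 P20); rewrite hornerM mulf_eq0 negb_or => /andP[h1 h2].
by exists c; rewrite !unitmxE !unitfE -P1E -P2E.
Qed.

Lemma schur_complement m n (A : 'M[C]_m) B D (E : 'M[C]_n) : A \in unitmx ->
  block_mx A B D E \in unitmx -> E - D *m invmx A *m B \in unitmx.
Proof.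
move=> Au Mu.
have e : block_mx A B D E *m block_mx 1%:M (- (invmx A *m B)) 0 1%:M =
    block_mx A 0 D (E - D *m invmx A *m B).
  rewrite mulmx_block !mulmx1 !mulmx0 !addr0 !mulmxN (mulmxA A) (mulmxV Au) mul1mx.
  by rewrite addNr mulmxA addrC.
have := congr1 determinant e; rewrite det_mulmx det_ublock !det1 !mulr1 det_lblock => h.
move: Mu; rewrite !unitmxE !unitfE h mulf_eq0 negb_or => /andP[_].
by [].
Qed.

Lemma sandwich n (S D E : 'M[C]_n) : S *m S ^t* = 1%:M -> S ^t* *m S = 1%:M ->
  E *m (D *m E) = 1%:M ->
  (S ^t* *m E *m S) *m (S ^t* *m D *m S) *m (S ^t* *m E *m S) = 1%:M.
Proof.
move: (S ^t*) => S' SS SS' h.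
have e (X Y : 'M[C]_n) : (S' *m X *m S) *m (S' *m Y *m S) = S' *m (X *m Y) *m S.
  by rewrite !mulmxA -(mulmxA _ S) SS mulmx1.
by rewrite e e -(mulmxA E) h mulmx1.
Qed.

End Cancellation.

Section MtowerAxioms.
Variables (R : realType) (A : starAlgData R).
Hypothesis HA : is_cstar_algebra A.
Local Notation C := R[i].
Local Notation Z := (fdrep A).
Local Notation ZT := (fdrep_tower A).
Let HT : is_tower ZT := fdrep_is_tower HA.
Implicit Types (p q r x y z : ZT) (a b : A).

Lemma proper_isometry_not_core x k (V : 'M[C]_(deg x, k)) : isometric V ->
  (0 < k < deg x)%N ->
  (forall a, rep_fun (x : Z) a *m V = V *m (V ^t* *m rep_fun (x : Z) a *m V)) ->
  ~ core ZT x.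
Proof.
move=> V1 /andP[k0 kx] xV xc.
have rr := compress_rep (rep_funP (x : Z)) xV.
have : tsub (mk_fdrep k0 rr : ZT) x by apply/(tsub_intertwines HA); exists V.
move=> /(tsub_core HT xc) /(tequiv_deg HT) e.
by move: kx; rewrite e ltnn.
Qed.

(** For a Hermitian element of the commutant an eigenspace of smaller dimension would be a proper
    subrepresentation. The general case follows from the two Hermitian combinations of X and its
    adjoint. *)
Lemma rep_schur x (X : 'M[C]_(deg x)) : core ZT x ->
  (forall a, X *m rep_fun (x : Z) a = rep_fun (x : Z) a *m X) -> exists c, X = c%:M.
Proof.
move=> xc Xc.
have herm (H : 'M[C]_(deg x)) : H ^t* = H ->
    (forall a, rep_fun (x : Z) a *m H = H *m rep_fun (x : Z) a) -> exists c, H = c%:M.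
  move=> Hh Hc.
  have [k [V [lam [k0 V1 _ Vc [kn _]]]]] := eigenspace_isometry (Ordinal (deg_gt0 x)) Hh.
  have [kx|kx|kx] := ltngtP k (deg x).
  - exfalso; apply: (@proper_isometry_not_core x k V V1) xc; first by rewrite k0.
    by move=> a; exact: Vc.
  - have := mxrankM_maxl (V ^t*) V; rewrite V1 mxrank1 => h.
    by have := leq_trans h (rank_leq_col _); rewrite leqNgt kx.
  - by exists lam; exact: kn.
have Xt a : X ^t* *m rep_fun (x : Z) a = rep_fun (x : Z) a *m X ^t*.
  have := congr1 (fun M => M ^t*) (Xc (sa_adj a)); rewrite !adjmxM rep_adjE.
  by rewrite !trmxCK => ->.
pose H1 := X + X ^t*; pose H2 := 'i%C *: (X - X ^t*).
have h1 : H1 ^t* = H1 by rewrite /H1 adjmxD trmxCK addrC.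
have h2 : H2 ^t* = H2.
  rewrite /H2 adjmxZ adjmxD adjmxN trmxCK.
  have -> : Num.conj 'i%C = - 'i%C :> C by apply/eqP; rewrite eq_complex /= oppr0 !eqxx.
  by rewrite scaleNr -scalerN opprB.
have [c1 e1] := herm H1 h1 (fun a => etrans (mulmxDr _ _ _) (etrans (congr2 +%R (esym (Xc a)) (esym (Xt a))) (esym (mulmxDl _ _ _)))).
have [|c2 e2] := herm H2 h2.
  by move=> a; rewrite /H2 -scalemxAr -scalemxAl mulmxBr mulmxBl Xc Xt.
exists (2^-1 * (c1 - 'i%C * c2)).
have -> : X = 2^-1 *: (H1 - 'i%C *: H2).
  rewrite /H1 /H2 scalerA.
  have -> : 'i%C * 'i%C = -1 :> C by apply/eqP; rewrite eq_complex /=; apply/andP; split; apply/eqP; ring.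
  rewrite scaleN1r opprK addrACA subrr addr0 -mulr2n -[X *+ 2]scaler_nat scalerA mulVf ?scale1r//.
  by rewrite pnatr_eq0.
rewrite e1 e2; apply/matrixP => i j; rewrite !mxE.
by case: (i == j); rewrite ?mulr1n// !mulr0n mulr0 subrr mulr0.
Qed.

Lemma stab_commutes n p (U : 'M[C]_n) : rep_deg (p : Z) = n -> U \is unitarymx ->
  (act U p = p <-> forall a, U *m mat n (pad (rep_fun (p : Z) a)) =
    mat n (pad (rep_fun (p : Z) a)) *m U).
Proof.
move=> e Uu; split=> [pU a|h].
  have := congr1 (fun q : Z => mat n (pad (rep_fun q a))) pU.
  rewrite (pad_conj_rep a e Uu) mat_uconj => {2}<-.
  by rewrite mulmxKV// unitarymx_unit.
apply: fdrep_eq => // a; rewrite (pad_conj_rep a e Uu) /uconj h.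
rewrite -mulmxA (mulmxV (unitarymx_unit Uu)) mulmx1.
exact: wf_rep.
Qed.

(** The unitary part X H^(-1/2) with H = X* X: H commutes with x, hence so does its inverse square
    root. *)
Lemma polar_intertwiner n (x y : A -> 'M[C]_n) (X : 'M[C]_n) : is_rep x -> is_rep y ->
  X \in unitmx -> intertwines x y X ->
  exists U : 'M[C]_n, U \is unitarymx /\ intertwines x y U.
Proof.
move=> xr yr Xu hX; set H := X ^t* *m X; have Hh : H ^t* = H by rewrite /H adjmxM trmxCK.
have Hc a : x a *m H = H *m x a.
  exact: (intertwines_comp hX (intertwines_adj xr yr hX)).
have [Su HE _] := hermitian_spectral Hh.
set S := spectralmx H in Su HE; set d := spectral_diag H in HE.
have SS := unitarymxP Su; have SS' := unitarymx_adjmul Su.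
pose w i := X *m (S ^t* *m delta_mx i (0 : 'I_1)).
have dE i : d 0 i = (l2norm (w i) ^+ 2)%:C.
  rewrite -dotcc /w dotc_adj mulmxA -/H HE dotc_adj trmxCK !mulmxA.
  rewrite SS mul1mx -(mulmxA _ S) SS mulmx1 dotcE (bigD1 i)//= big1 => [|j ji].
    rewrite addr0 mul_diag_mx !mxE !eqxx rmorph1 mul1r mulr1.
    by [].
  by rewrite mxE (negPf ji) rmorph0 mul0r.
have w0 i : 0 < l2norm (w i).
  rewrite lt0r l2norm_ge0 andbT; apply/eqP => /l2norm_eq0 h.
  have : delta_mx i (0 : 'I_1) = 0 :> 'cV[C]_n.
    rewrite -[LHS]mul1mx -SS -mulmxA -[S ^t* *m _]mul1mx -(mulVmx Xu) -(mulmxA (invmx X)).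
    by rewrite -/(w i) h !mulmx0.
  by move=> /matrixP/(_ i 0); rewrite !mxE !eqxx => /eqP; rewrite oner_eq0.
pose phi (z : C) : C := ((Num.sqrt (complex.Re z))^-1)%:C.
have phiE i : phi (d 0 i) = ((l2norm (w i))^-1)%:C.
  by rewrite /phi dE /= sqrtr_sqr gtr0_norm.
pose P := hermfun phi H.
have PE : P = S ^t* *m diag_mx (map_mx phi d) *m S by [].
have Pt : P ^t* = P.
  rewrite PE !adjmxM trmxCK -mulmxA; congr (_ *m (_ *m _)).
  apply/matrixP => i j; rewrite !mxE eq_sym; have [->|ij] := eqVneq j i.
    by rewrite !mulr1n phiE conj_realC.
  by rewrite !mulr0n rmorph0.
have Pc a : x a *m P = P *m x a by exact: hermfun_comm Hh (Hc a).
exists (X *m P); split; last first.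
  by move=> a; rewrite mulmxA hX -mulmxA Pc mulmxA.
apply: isometry_unitarymx; rewrite adjmxM Pt mulmxA -(mulmxA P) -/H HE PE.
apply: (sandwich SS SS').
apply/matrixP => i j; rewrite !mulmx_diag !mxE; case: (eqVneq i j) => [_|_]; last by rewrite !mulr0n.
rewrite !mulr1n phiE dE -!rmorphM.
have -> : (l2norm (w i))^-1 * (l2norm (w i) ^+ 2 * (l2norm (w i))^-1) = 1.
  by field; rewrite gt_eqF.
by [].
Qed.

(** Block elimination replaces a count of multiplicities. Adding a scalar c on the z-block keeps M
    an intertwiner and makes that block invertible; the Schur complement is then an invertible
    intertwiner from x to y. *)
Lemma cancel_intertwiner k n (z : A -> 'M[C]_k) (x y : A -> 'M[C]_n) (M : 'M[C]_(k + n)) :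
  is_rep x -> is_rep y -> M \in unitmx ->
  (forall a, dsum_mx (z a) (y a) *m M = M *m dsum_mx (z a) (x a)) ->
  exists U : 'M[C]_n, U \is unitarymx /\ intertwines x y U.
Proof.
move=> xr yr Mu hM; have [c [Au Nu]] := shift_invertible Mu.
set a1 := ulsubmx M + c%:M in Au.
have NE : M + dsum_mx c%:M (0 : 'M_n) = block_mx a1 (ursubmx M) (dlsubmx M) (drsubmx M).
  by rewrite -{1}(submxK M) /dsum_mx add_block_mx !addr0.
have hN a : dsum_mx (z a) (y a) *m block_mx a1 (ursubmx M) (dlsubmx M) (drsubmx M) =
    block_mx a1 (ursubmx M) (dlsubmx M) (drsubmx M) *m dsum_mx (z a) (x a).
  rewrite -NE mulmxDr mulmxDl hM; congr (_ + _).
  by rewrite -!dsum_mx_mul !mulmx0 !mul0mx scalar_mxC.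
rewrite NE in Nu; have Su := schur_complement Au Nu.
apply: polar_intertwiner xr yr Su _ => a.
have := hN a; rewrite /dsum_mx !mulmx_block !mulmx0 !mul0mx !addr0 !add0r.
move=> /eq_block_mx[h1 h2 h3 h4].
have h1' : invmx a1 *m z a = z a *m invmx a1.
  rewrite -[LHS]mulmx1 -(mulmxV Au) mulmxA -(mulmxA _ (z a)) h1.
  by rewrite mulmxA (mulVmx Au) mul1mx.
rewrite mulmxBr mulmxBl h4; congr (_ - _).
by rewrite !mulmxA h3 -(mulmxA _ (z a)) -h1' !mulmxA -(mulmxA _ (z a)) h2 !mulmxA.
Qed.

Lemma rep_cancel x y z : tequiv (oplus z x) (oplus z y) -> tequiv x y.
Proof.
move=> e; have dxy : deg x = deg y.
  have := tequiv_deg HT e; rewrite !(deg_oplus HT) => /eqP.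
  by rewrite eqn_add2l => /eqP.
have /tequiv_intertwines[_ [X [X1 hX]]] := e.
apply/tequiv_intertwines; split=> //; move: X X1 hX; clear e.
case: y dxy => [[n n0] Q] /= e; rewrite /rep_deg /= in e; subst n => X X1 hX.
have Xu : X \is unitarymx by exact: isometry_unitarymx.
have [|U [Uu hU]] := @cancel_intertwiner _ _ (rep_fun (z : Z)) _ _ X (rep_funP (x : Z))
    (rep_funP (existT (fun n : posnat => @reps R A (val n))
      (exist (fun n : nat => (0 < n)%N) (val (projT1 x)) n0) Q : Z)) (unitarymx_unit Xu).
  exact: hX.
by exists U; split=> //; exact: unitarymx_adjmul.
Qed.

Lemma rep_stab_sum x y : tdisjoint x y ->
  stab ZT (deg x + deg y) (oplus x y) =
  [set W | exists U V, [/\ stab ZT (deg x) x U, stab ZT (deg y) y V & W = dsum_mx U V]].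
Proof.
move=> xy; apply/seteqP; split=> W; last first.
  move=> [U [V [[Uu xU] [Vu yV] ->]]]; split; first exact: unitarymx_dsum.
  by rewrite (act_oplusE HT erefl erefl Uu Vu) xU yV.
move=> [Wu hW].
have hW' a : W *m dsum_mx (rep_fun (x : Z) a) (rep_fun (y : Z) a) =
    dsum_mx (rep_fun (x : Z) a) (rep_fun (y : Z) a) *m W.
  have := (iffLR (@stab_commutes _ (oplus x y) W erefl Wu)) hW a.
  by rewrite matK.
have hb a : [/\ ulsubmx W *m rep_fun (x : Z) a = rep_fun (x : Z) a *m ulsubmx W,
    rep_fun (x : Z) a *m ursubmx W = ursubmx W *m rep_fun (y : Z) a,
    rep_fun (y : Z) a *m dlsubmx W = dlsubmx W *m rep_fun (x : Z) a &
    drsubmx W *m rep_fun (y : Z) a = rep_fun (y : Z) a *m drsubmx W].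
  have := hW' a; rewrite -{1 2}(submxK W) /dsum_mx !mulmx_block !mulmx0 !mul0mx !addr0 !add0r.
  by move=> /eq_block_mx[-> h2 h3 ->]; split.
have ur0 : ursubmx W = 0.
  apply: (iffLR (tdisjoint_intertwines HA y x) (tdisjoint_sym xy)) => a.
  by have [] := hb a.
have dl0 : dlsubmx W = 0.
  apply: (iffLR (tdisjoint_intertwines HA x y) xy) => a.
  by have [] := hb a.
have WE : W = dsum_mx (ulsubmx W) (drsubmx W).
  by rewrite -{1}(submxK W) ur0 dl0.
have [Uu Vu] : ulsubmx W \is unitarymx /\ drsubmx W \is unitarymx.
  have := unitarymxP Wu; rewrite [in X in X -> _]WE -dsum_mx_adj -dsum_mx_mul -dsum_mx1.
  by move=> /dsum_mx_inj[/unitarymxP h1 /unitarymxP h2].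
exists (ulsubmx W), (drsubmx W); split=> //; split=> //.
  by apply/(@stab_commutes _ x _ erefl Uu) => a; rewrite matK; have [] := hb a.
by apply/(@stab_commutes _ y _ erefl Vu) => a; rewrite matK; have [] := hb a.
Qed.

Lemma rep_fun_alg a : is_alg (T := ZT) (fun p => rep_fun (p : Z) a).
Proof.
split=> [p U Uu|p q]; first exact: (pad_conj_rep a (erefl _) Uu).
exact: pad_sum_rep.
Qed.

(** The blocks of a stabilizing unitary commute with x, so Schur's lemma makes them scalar;
    multiplication and adjoint of such block matrices are those of the scalar matrices. *)
Lemma rep_stab_nfold x n : core ZT x -> (0 < n)%N ->
  stab ZT (\sum_(i < n) deg x) (nfold x n) =
  [set \mxblock_(i < n, j < n) ((U i j)%:M : 'M[C]_(deg x)) | U in unitary_group R n].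
Proof.
move=> xc; case: n => // m _; rewrite -/(tpow x m).
have dN : rep_deg (tpow x m : Z) = (\sum_(i < m.+1) deg x)%N by exact: (deg_tpow HT).
have matE a : mat (\sum_(i < m.+1) deg x) (pad (rep_fun (tpow x m : Z) a)) =
    \mxdiag_(i < m.+1) rep_fun (x : Z) a.
  rewrite (pad_tpow x m (rep_fun_alg a)) (mat_upow HT).
  by apply: eq_mxdiag => i; rewrite matK.
have i0 : 'I_(deg x) := Ordinal (deg_gt0 x).
have blockM (U V : 'M[C]_m.+1) : \mxblock_(i < m.+1, j < m.+1) ((U i j)%:M : 'M[C]_(deg x)) *m
    \mxblock_(i < m.+1, j < m.+1) ((V i j)%:M : 'M[C]_(deg x)) =
    \mxblock_(i < m.+1, j < m.+1) (((U *m V) i j)%:M : 'M[C]_(deg x)).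
  rewrite mul_mxblock; apply/eq_mxblockP => i j; rewrite [(U *m V) i j]mxE raddf_sum.
  by apply: eq_bigr => k _; rewrite -scalar_mxM.
have blockA (U : 'M[C]_m.+1) : (\mxblock_(i < m.+1, j < m.+1) ((U i j)%:M : 'M[C]_(deg x))) ^t* =
    \mxblock_(i < m.+1, j < m.+1) (((U ^t*) i j)%:M : 'M[C]_(deg x)).
  by apply/matrixP => k l; rewrite !mxE rmorphMn /= eq_sym.
have block1 : \mxblock_(i < m.+1, j < m.+1) (((1%:M : 'M[C]_m.+1) i j)%:M : 'M[C]_(deg x)) = 1%:M.
  rewrite -mxdiagZ /mxdiag; apply/eq_mxblockP => i j; rewrite mxE.
  by case: (eqVneq i j) => _; rewrite ?conform_mx_id ?raddf0.
have blockI (U V : 'M[C]_m.+1) : \mxblock_(i < m.+1, j < m.+1) ((U i j)%:M : 'M[C]_(deg x)) =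
    \mxblock_(i < m.+1, j < m.+1) ((V i j)%:M : 'M[C]_(deg x)) -> U = V.
  move=> /eq_mxblockP h; apply/matrixP => i j; have /matrixP/(_ i0 i0) := h i j.
  by rewrite !mxE eqxx !mulr1n.
apply/seteqP; split=> W.
  move=> [Wu hW].
  have comm a : W *m \mxdiag_(i < m.+1) rep_fun (x : Z) a =
      \mxdiag_(i < m.+1) rep_fun (x : Z) a *m W.
    by rewrite -matE; exact: (iffLR (stab_commutes dN Wu) hW a).
  pose B i j := submxblock W i j.
  have WB : W = \mxblock_(i, j) B i j by rewrite /B submxblockK.
  have Bc i j a : B i j *m rep_fun (x : Z) a = rep_fun (x : Z) a *m B i j.
    have := comm a; rewrite {1 2}WB mul_mxblock_mxdiag mul_mxdiag_mxblock.
    by move=> /eq_mxblockP.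
  have Bs (t : 'I_m.+1 * 'I_m.+1) : exists c, B t.1 t.2 = c%:M.
    by apply: rep_schur => // a; exact: Bc.
  have [c cE] := choice Bs; pose U : 'M[C]_m.+1 := \matrix_(i, j) c (i, j).
  have WU : W = \mxblock_(i < m.+1, j < m.+1) ((U i j)%:M : 'M[C]_(deg x)).
    by rewrite WB; apply/eq_mxblockP => i j; rewrite mxE -cE.
  exists U => //; apply/unitarymxP; apply: blockI.
  by rewrite -blockM -blockA -WU block1; exact/unitarymxP.
move=> [U Uu <-].
have Wu : \mxblock_(i < m.+1, j < m.+1) ((U i j)%:M : 'M[C]_(deg x)) \is unitarymx.
  by apply/unitarymxP; rewrite blockA blockM (unitarymxP Uu) block1.
split=> //; apply/(stab_commutes dN Wu) => a; rewrite matE.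
rewrite mul_mxblock_mxdiag mul_mxdiag_mxblock; apply/eq_mxblockP => i j.
by rewrite scalar_mxC.
Qed.

Lemma fdrep_is_mtower : is_mtower ZT.
Proof.
split.
- exact: HT.
- exact: fdrep_sigma.
- by move=> x y z; exact: tdisjoint_sum.
- exact: rep_cancel.
- exact: rep_stab_sum.
- exact: rep_stab_nfold.
Qed.

End MtowerAxioms.

(** * Irreducible representations *)

Lemma row_space_isometry (R : realType) m n (W : 'M[R[i]]_(m, n)) :
  exists k (V : 'M[R[i]]_(n, k)), isometric V /\ (V^T :=: W)%MS.
Proof.
exists (\rank W), (schmidt (row_base W))^T; split.
  have := congr1 trmx (unitarymxP (schmidt_unitarymx (row_base W) (rank_leq_col W))).
  by rewrite trmx_mul trmx1 map_trmx /isometric.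
by rewrite trmxK; apply: eqmx_trans (eqmx_schmidt_free (row_base_free W)) (eq_row_base W).
Qed.

Lemma layers_compact (R : realType) (T : towerData R) N : proper_tower T ->
  compact [set x : T | (deg x <= N)%N].
Proof.
move=> Hp; elim: N => [|N IH].
  have -> : [set x : T | (deg x <= 0)%N] = set0.
    by apply/seteqP; split=> // x /=; rewrite leqNgt (deg_gt0 x).
  exact: compact0.
have -> : [set x : T | (deg x <= N.+1)%N] = [set x : T | (deg x <= N)%N] `|` layer T N.+1.
  apply/seteqP; split=> x.
    by rewrite /= leq_eqVlt ltnS => /orP[/eqP|]; [right|left].
  by case=> h; [exact: leqW h|exact: eq_leq h].
exact: compactU.
Qed.

Section Irreducibility.
Variables (R : realType) (A : starAlgData R).
Hypothesis HA : is_cstar_algebra A.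
Local Notation C := R[i].
Local Notation Z := (fdrep A).
Local Notation ZT := (fdrep_tower A).
Let HT : is_tower ZT := fdrep_is_tower HA.
Implicit Types (p q t : ZT) (a b : A).

Lemma irreducible_core p : irreducible_rep (p : Z) -> core ZT p.
Proof.
move=> [_ pI] [U [Uu [a [b e]]]].
have da := tequiv_deg HT (ex_intro _ U (conj Uu e) : tequiv p (oplus a b)).
have : tsub a p.
  right; exists a, b; split; first exact: tequiv_refl.
  by exists U.
move=> /(tsub_intertwines HA)[X [X1 hX]].
have [c|h|h] := pI <<X^T>>%MS.
- rewrite (eqmxMr _ (genmxE _)) genmxE -trmx_mul hX trmx_mul.
  exact: submxMl.
- apply: (isometric_neq0 (deg_gt0 a) X1).
  by rewrite -[X]trmxK; apply/eqP; rewrite trmx_eq0 -submx0 -h genmxE.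
move: h; rewrite /row_full genmxE mxrank_tr => /eqP h.
have := rank_leq_col X; rewrite h; move: da; rewrite (deg_oplus HT) => da.
have := deg_gt0 b; change (rep_deg (p : Z)) with (deg p); lia.
Qed.

Lemma core_irreducible p : core ZT p -> p <> zero_rep A -> irreducible_rep (p : Z).
Proof.
move=> pc p0; split.
  apply: contrapT => h.
  have pz a : rep_fun (p : Z) a = 0.
    by apply/eqP; apply: contrapT => ha; apply: h; exists a; exact/negP.
  (* A zero representation of degree at least 2 has proper subrepresentations, so in degree 1 lies
     the only point of the core that is not irreducible as a representation. *)
  have [n1|n1] := eqVneq (deg p) 1%N.
    apply: p0; apply: fdrep_eq => // a; rewrite pz rep_fun_mk.
    by rewrite !pad0.
  apply: (@proper_isometry_not_core _ _ HA p 1%N (delta_mx (Ordinal (deg_gt0 p)) 0) _ _ _ pc).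
  - apply/matrixP => i j; rewrite !mxE (bigD1 (Ordinal (deg_gt0 p)))//= big1 => [|k kp].
      by rewrite !mxE !eqxx !ord1 /= conjC1 mulr1 addr0.
    by rewrite !mxE (negPf kp) /= mulr0.
  - by have := deg_gt0 p; move: n1; case: (deg p) => [|[|]].
  - by move=> a; rewrite pz !(mulmx0, mul0mx).
move=> W Ws; have [k [V [V1 VW]]] := row_space_isometry W.
have pV a : rep_fun (p : Z) a *m V = V *m (V ^t* *m rep_fun (p : Z) a *m V).
  have : (V^T *m (rep_fun (p : Z) a)^T <= V^T)%MS by rewrite VW (eqmxMr _ VW); exact: Ws.
  move=> /submxP[D]; rewrite -trmx_mul => /(congr1 trmx).
  rewrite trmxK trmx_mul trmxK => e.
  by rewrite -(mulmxA (V ^t*)) e (mulmxA (V ^t*)) V1 mul1mx.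
have rV : \rank V = k.
  apply/eqP; rewrite eqn_leq rank_leq_col /=.
  by have := mxrankM_maxr (V ^t*) V; rewrite V1 mxrank1.
have rW : \rank W = k by rewrite -VW mxrank_tr.
have [k0|k0] := posnP k.
  by left; apply/eqP; rewrite -mxrank_eq0 rW k0.
right; rewrite /row_full rW; apply/eqP; apply: contrapT => kn.
apply: (@proper_isometry_not_core _ _ HA p k V V1 _ pV pc); rewrite k0 /=.
have := rank_leq_row V; rewrite rV leq_eqVlt => /orP[/eqP//|].
by [].
Qed.

End Irreducibility.

(** * Solidity of the tower of a shrinking algebra *)

Section ShrinkingSolid.
Variables (R : realType) (A : starAlgData R).
Hypotheses (HA : is_cstar_algebra A) (Hs : is_shrinking A).
Local Notation C := R[i].
Local Notation Z := (fdrep A).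
Local Notation ZT := (fdrep_tower A).
Let Hm : is_mtower ZT := fdrep_is_mtower HA.
Implicit Types (p q t : ZT) (a b : A).

Definition gelfand a : tfun ZT := fun p => rep_fun (p : Z) a.

(** Otherwise there would be irreducible representations of degrees tending to infinity with norms
    above e at a, against (SH2). *)
Lemma large_core_bounded a (e : R) : 0 < e -> exists N, forall t, core ZT t ->
  e < opnorm (gelfand a t) -> (deg t <= N)%N.
Proof.
move=> e0; apply: contrapT => h.
have hp N : exists t : Z, [/\ core ZT t, e < opnorm (gelfand a t) & (N < rep_deg t)%N].
  apply: contrapT => hN; apply: h; exists N => t tc te; rewrite leqNgt.
  by apply/negP => tN; apply: hN; exists t.
have [t tP] := choice hp.
have ti k : irreducible_rep (t k).
  have [tc te _] := tP k; apply: core_irreducible => // t0.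
  by move: te; rewrite t0 /gelfand rep_fun_mk opnorm0 ltNge ltW.
have td : (fun k => rep_deg (t k)) @ \oo --> \oo.
  apply/cvgnyPge => N; exists N => // k /= Nk.
  by have [_ _ tk] := tP k; exact: leq_trans Nk (ltnW tk).
have /cvgrPdist_lt/(_ e e0) [N _ /(_ N (leqnn N))] := sh_vanish Hs ti td a.
have [_ te _] := tP N.
rewrite /= sub0r normrN ger0_norm ?opnorm_ge0// => h2.
by have := lt_trans te h2; rewrite ltxx.
Qed.

Lemma gelfand_Cstar a : in_Cstar (gelfand a).
Proof.
apply: (@in_Cstar_intro _ _ Hm _ (nrm a)).
- exact: rep_fun_alg.
- by move=> x; exact: (rep_contractive HA a (rep_funP (x : Z))).
move=> n x; apply: (@continuous_comp (layer ZT n) Z 'M[C]_n set_val (@rep_ev R A n a)).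
  exact: val_continuous.
exact: rep_ev_continuous.
Qed.

Lemma gelfand_C0 a : in_C0 (zero_rep A : ZT) (gelfand a).
Proof.
split; [exact: gelfand_Cstar| |by rewrite /gelfand rep_fun_mk].
move=> e e0; have [N hN] := large_core_bounded a e0.
exists ([set p : ZT | (deg p <= N)%N] `&` closure (core ZT)); split.
- by apply: compact_closedI; [exact: (layers_compact (fdrep_proper HA))|exact: closed_closure].
- by move=> t [].
move=> t [tc tN]; rewrite leNgt; apply/negP => te; apply: tN; split=> //=.
(* A large value at t in the closure of the core persists nearby, and nearby points have the same
   degree; so some core point in this neighborhood bounds the degree of t. *)
have nt : nbhs t ([set p : ZT | deg p = deg t] `&` [set p : ZT | e < opnorm (gelfand a p)]).
  apply: filterI; first exact: rep_deg_near.
  have := opnorm_continuous Hm (gelfand_Cstar a) (x := t).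
  by move=> /(_ [set r | e < r]); apply; exact: (open_nbhs_nbhs (conj (@open_gt R e) te)).
have [p [pc [pt pe]]] := tc _ nt.
by rewrite -[rep_deg t]/(deg t) -pt; exact: hN.
Qed.

Lemma fdrep_solid : is_solid (zero_rep A : ZT).
Proof.
split; [exact: Hm|exact: fdrep_proper|by []|].
move=> t tc t0; have [[a ha] _] := core_irreducible HA tc t0.
exists (mkC0 (gelfand_C0 a)); rewrite /C0_eval /=.
by apply/eqP.
Qed.

End ShrinkingSolid.

(** * The Stone-Weierstrass theorem over a tower *)

Section ScalarWeights.
Variable R : realType.
Local Notation C := R[i].

Lemma delta_sandwich n (M : 'M[C]_n) (j l : 'I_n) :
  delta_mx j l *m M *m (delta_mx j l) ^t* = M l l *: delta_mx j j.
Proof.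
have -> : (delta_mx j l : 'M[C]_n) ^t* = delta_mx l j.
  by rewrite trmx_delta map_delta_mx.
apply/matrixP => p q; rewrite !mxE (bigD1 l)//= big1 => [|r rl].
  rewrite !mxE eqxx /= (bigD1 l)//= big1 => [|s sl].
    rewrite !mxE eqxx andbT addr0 addr0.
    by case: (p == j); case: (q == j); rewrite ?mul1r ?mul0r ?mulr1 ?mulr0.
  by rewrite !mxE (negPf sl) andbF mul0r.
by rewrite !mxE (negPf rl) /= mulr0.
Qed.

(** The averaging principle behind the weights: matrix units turn any matrix into a scalar, here its
    trace. *)
Lemma delta_sandwich_sum n (M : 'M[C]_n) :
  \sum_(j < n) \sum_(l < n) delta_mx j l *m M *m (delta_mx j l) ^t* = (\tr M)%:M.
Proof.
rewrite -[RHS]scalemx1 mx1_sum_delta scaler_sumr; apply: eq_bigr => j _.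
rewrite /mxtrace scaler_suml; apply: eq_bigr => l _; exact: delta_sandwich.
Qed.

Lemma mulmx_regroup n (U D M D' V : 'M[C]_n) :
  U *m D *m V *m M *m (U *m (D' *m V)) = U *m (D *m (V *m M *m U) *m D') *m V.
Proof. by rewrite !mulmxA. Qed.

Lemma unit_sandwich_sum n (U M : 'M[C]_n) : U \is unitarymx ->
  \sum_(j < n) \sum_(l < n) (U *m delta_mx j l *m invmx U) *m M *m (U *m delta_mx j l *m invmx U) ^t* =
  (\tr M)%:M.
Proof.
move=> Uu; have Ui := unitarymx_unit Uu.
have e j l : (U *m delta_mx j l *m invmx U) *m M *m (U *m delta_mx j l *m invmx U) ^t* =
    U *m (delta_mx j l *m (invmx U *m M *m U) *m (delta_mx j l) ^t*) *m invmx U.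
  rewrite (invmx_unitary Uu) !adjmxM trmxCK.
  exact: mulmx_regroup.
under eq_bigr do (under eq_bigr do rewrite e; rewrite -mulmx_suml -mulmx_sumr).
rewrite -mulmx_suml -mulmx_sumr delta_sandwich_sum mul_mx_scalar -scalemxAl (mulmxV Ui) scalemx1.
by rewrite mxtrace_mulC mulmxA (mulmxV Ui) mul1mx.
Qed.

Lemma mxtrace_gram n (B : 'M[C]_n) : \tr (B ^t* *m B) = (hsnorm B ^+ 2)%:C.
Proof.
rewrite hsnorm_sqr exchange_big /= raddf_sum; apply: eq_bigr => j _.
rewrite mxE raddf_sum; apply: eq_bigr => i _.
by rewrite !mxE mulrC sqr_normcE.
Qed.

Lemma sandwich_perturb n (X E M : 'M[C]_n) (eta : R) : eta <= 1 ->
  opnorm (X - E) <= eta -> opnorm E <= 1 ->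
  opnorm (X *m M *m X ^t* - E *m M *m E ^t*) <= 3 * eta * opnorm M.
Proof.
move=> eta1 XE E1; have eta0 : 0 <= eta := le_trans (opnorm_ge0 _) XE.
have X2 : opnorm X <= 2.
  have -> : X = (X - E) + E by rewrite subrK.
  apply: le_trans (opnormD _ _) _; apply: le_trans (lerD XE E1) _.
  by rewrite -[2]/(1 + 1) lerD2r.
have -> : X *m M *m X ^t* - E *m M *m E ^t* =
    (X - E) *m M *m X ^t* + E *m M *m (X - E) ^t*.
  rewrite adjmxD adjmxN; move: (X ^t*) (E ^t*) => X' E'.
  by rewrite mulmxBl mulmxBl mulmxBr addrA subrK.
have h1 : opnorm ((X - E) *m M *m X ^t*) <= eta * opnorm M * 2.
  apply: le_trans (opnormM _ _) _; rewrite opnorm_adj.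
  apply: ler_pM; rewrite ?opnorm_ge0//.
  by apply: le_trans (opnormM _ _) _; apply: ler_wpM2r XE; exact: opnorm_ge0.
have h2 : opnorm (E *m M *m (X - E) ^t*) <= opnorm M * eta.
  apply: le_trans (opnormM _ _) _; rewrite opnorm_adj.
  apply: ler_pM; rewrite ?opnorm_ge0//.
  by apply: le_trans (opnormM _ _) _; rewrite -[leRHS]mul1r; apply: ler_wpM2r E1; exact: opnorm_ge0.
apply: le_trans (opnormD _ _) _; apply: le_trans (lerD h1 h2) _.
by move: (opnorm M) => r; have -> : 3 * eta * r = eta * r * 2 + r * eta by ring.
Qed.

Lemma opnorm_sum n (I : Type) (r : seq I) (F : I -> 'M[C]_n) :
  opnorm (\sum_(i <- r) F i) <= \sum_(i <- r) opnorm (F i).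
Proof.
elim/big_rec2: _ => [|i x y _ h]; first by rewrite opnorm0.
exact: le_trans (opnormD _ _) (lerD (lexx _) h).
Qed.

(* The matrices [X j l] behave like a system of matrix units: they average every
   positive matrix to an almost scalar one. *)
Definition averaging n m (X : 'I_n -> 'I_n -> 'M[C]_m) : Prop := forall B : 'M[C]_m,
  opnorm (\sum_j \sum_l X j l *m (B ^t* *m B) *m (X j l) ^t* -
    ((hsnorm B ^+ 2)%:C)%:M) <= hsnorm B ^+ 2 / 2.

Lemma averaging_size n m m' (X : 'I_n -> 'I_n -> 'M[C]_m) (X' : 'I_n -> 'I_n -> 'M[C]_m') :
  m = m' -> (forall j l, pad (X j l) = pad (X' j l)) -> averaging X -> averaging X'.
Proof.
move=> e; case: _ / e X' => X' h.
have -> : X' = X by apply/funext => j; apply/funext => l; apply: pad_inj; rewrite h.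
by [].
Qed.

Lemma averaging_near n (U : 'M[C]_n) : U \is unitarymx ->
  exists2 eta : R, 0 < eta & forall X : 'I_n -> 'I_n -> 'M[C]_n,
    (forall j l, opnorm (X j l - U *m delta_mx j l *m invmx U) <= eta) -> averaging X.
Proof.
move=> Uu; pose eta : R := (6 * (n%:R * n%:R + 1))^-1.
have n0 : 0 <= n%:R * n%:R :> R by rewrite mulr_ge0 ?ler0n.
have etaP : 0 < eta by rewrite /eta invr_gt0; lra.
have eta6 : eta * (6 * (n%:R * n%:R + 1)) = 1 by rewrite /eta mulVf//; apply/eqP; lra.
have eta1 : eta <= 1.
  by have := ler_wpM2l (ltW etaP) (_ : 1 <= 6 * (n%:R * n%:R + 1)); rewrite eta6 mulr1; apply; lra.
clearbody eta; exists eta => // X hX B; rewrite -mxtrace_gram -(unit_sandwich_sum _ Uu) -sumrB.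
apply: le_trans (opnorm_sum _ _) _.
have BB : opnorm (B ^t* *m B) <= hsnorm B ^+ 2.
  by rewrite opnorm_adjM; apply: lerXn2r; rewrite ?nnegrE ?opnorm_ge0 ?hsnorm_ge0 ?opnorm_le_hsnorm.
have term j l : opnorm (X j l *m (B ^t* *m B) *m (X j l) ^t* -
    U *m delta_mx j l *m invmx U *m (B ^t* *m B) *m (U *m delta_mx j l *m invmx U) ^t*) <=
    3 * eta * hsnorm B ^+ 2.
  apply: le_trans (sandwich_perturb _ eta1 (hX j l) _) _.
    rewrite (opnorm_conj _ Uu); apply: le_trans (opnorm_le_hsnorm _) _.
    have h : hsnorm (delta_mx j l : 'M[C]_n) ^+ 2 = 1.
      rewrite hsnorm_sqr (bigD1 j)//= (bigD1 l)//= !big1.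
      - by rewrite mxE !eqxx !addr0 normc1 expr1n.
      - by move=> i ij; rewrite big1// => k _; rewrite mxE (negPf ij) normc0 expr0n.
      by move=> k kl; rewrite mxE (negPf kl) andbF normc0 expr0n.
    by rewrite -(@ler_pXn2r _ 2)// ?nnegrE ?hsnorm_ge0// h expr1n.
  by apply: ler_wpM2l BB; rewrite mulr_ge0// ltW.
apply: (@le_trans _ _ (\sum_(j < n) \sum_(l < n) 3 * eta * hsnorm B ^+ 2)).
  apply: ler_sum => j _; rewrite -sumrB; apply: le_trans (opnorm_sum _ _) _.
  by apply: ler_sum => l _; exact: term.
rewrite !sumr_const !card_ord -[_ *+ n *+ n]mulr_natr -[_ *+ n]mulr_natr.
move: (hsnorm B ^+ 2) (sqr_ge0 (hsnorm B)) => b b0; clear term BB hX.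
have h : n%:R * n%:R * eta * 6 <= 1.
  have -> : n%:R * n%:R * eta * 6 = eta * (6 * (n%:R * n%:R + 1)) - 6 * eta by ring.
  rewrite eta6; by rewrite lerBlDr lerDl mulr_ge0// ltW.
have -> : 3 * eta * b * n%:R * n%:R = n%:R * n%:R * eta * 6 * (b / 2) by field.
by rewrite -[leRHS]mul1r; apply: ler_wpM2r h; rewrite divr_ge0.
Qed.

Lemma lowb_near n (Q : 'M[C]_n) (t : R) : opnorm (Q - (t%:C)%:M) <= t / 2 -> lowb (t / 2) Q.
Proof.
move=> h v; have -> : Q *m v = t%:C *: v + (Q - (t%:C)%:M) *m v.
  by rewrite mulmxBl mul_scalar_mx addrC subrK.
rewrite dotcDr dotcZr dotcc -rmorphM raddfD /=.
have := Re_dotc_le v (- ((Q - (t%:C)%:M) *m v)).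
have -> : dotc v (- ((Q - (t%:C)%:M) *m v)) = - dotc v ((Q - (t%:C)%:M) *m v).
  by rewrite -scaleN1r dotcZr mulN1r.
rewrite raddfN l2normN /= => h1.
have h2 : l2norm v * l2norm ((Q - (t%:C)%:M) *m v) <= t / 2 * l2norm v ^+ 2.
  apply: (@le_trans _ _ (l2norm v * (t / 2 * l2norm v))); last by rewrite mulrCA -expr2.
  apply: ler_wpM2l (l2norm_ge0 _) _ _ _.
  by apply: le_trans (l2norm_mulmx _ _) _; apply: ler_wpM2r h; exact: l2norm_ge0.
move: h1 h2; move: (complex.Re _) (l2norm v * _) (l2norm v ^+ 2) => p q r; lra.
Qed.

End ScalarWeights.

(** * Weights near an irreducible orbit *)

Section LocalWeights.
Variables (R : realType) (T : towerData R) (kappa : T).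
Hypothesis HS : is_solid kappa.
Let Hm := solid_mtower HS.
Let Hp := solid_proper HS.
Let HT := mtower_tower Hm.
Local Notation C := R[i].
Implicit Types (x y t s z : T) (f g u w m a : tfun T).

Lemma expanding_arith (r s t : R) : s <= 4^-1 * r -> 2 * r <= t + 2 * s -> 3 / 2 * r <= t.
Proof. lra. Qed.

Lemma normc2 : normc (2 : C) = 2.
Proof.
have -> : 2 = (2 : R)%:C :> C by rewrite rmorph_nat.
by rewrite normc_real ger0_norm.
Qed.

Lemma near_value f x n (e : R) : in_Cstar f -> deg x = n -> 0 < e ->
  \forall y \near x, deg y = n /\
    opnorm (mat n (pad (f y)) - mat n (pad (f x))) < e.
Proof.
move=> [cf _ _ _] dx e0; pose x' : layer T n := mk_layer dx.
have /cvg_opnormP/(_ e e0) := cf n x'.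
move=> [V [[O oO OV] x'V VE]].
have xO : O x by move: x'V; rewrite -OV.
have : nbhs x (O `&` layer T n).
  by apply: open_nbhs_nbhs; split; [exact: openI oO (open_layer Hm n)|].
apply: filterS => y [yO yn]; split=> //.
have := VE (mk_layer yn); rewrite -OV => /(_ yO).
by rewrite -[conform_mx 0 (f (\val (mk_layer yn)))]/(ev f (mk_layer yn))
  -[conform_mx 0 (f (\val x'))]/(ev f x') !evE.
Qed.

Variable B : tfun T -> Prop.
Hypothesis HB : closed_subalgebra kappa B.
Hypothesis Brich : forall f s, is_alg f -> f kappa = 0 -> exists2 b, B b & b s = f s.

Let Balg b : B b -> is_alg b := fun h => csub_alg Hm HB h.
Let BC b : B b -> in_Cstar b := fun h => let: And3 c _ _ := csub_C0 HB h in c.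

Lemma core_value y (X : 'M[C]_(deg y)) : core T y -> y <> kappa -> exists2 b, B b & b y = X.
Proof.
move=> yc yk; have [|b Bb h] := Brich y (alg_bumpP Hm X yc).
  apply: (alg_bump_core Hm _ yc (kappa_core HS)) => e.
  have d1 : deg y = 1%N by rewrite -(tequiv_deg HT e) (solid_point HS).
  by apply: yk; rewrite (tequiv_point HS d1 e).
by exists b => //; rewrite h (alg_bump_at Hm _ yc).
Qed.

(* Interpolation at the point [y (+) z]. *)
Lemma core_separate y z a : core T y -> tdisjoint y z -> y <> kappa -> is_alg a -> a kappa = 0 ->
  exists2 w, B w /\ w y = 0 & (a z)^t* *m w z = (a z)^t*.
Proof.
move=> yc yz yk aa ak.
pose g : tfun T := -1 *: alg_bump Hm (1%:M : 'M[C]_(deg y)) + alg_unit0 HS.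
have ga : is_alg g by apply: is_alg_linear => //; [exact: alg_bumpP|exact: alg_unit0P].
have gE x : g x = - alg_bump Hm (1%:M : 'M[C]_(deg y)) x + alg_unit0 HS x.
  by rewrite -[LHS]/(-1 *: alg_bump Hm (1%:M : 'M[C]_(deg y)) x + alg_unit0 HS x) scaleN1r.
have gk : g kappa = 0.
  rewrite gE alg_unit0_kappa addr0 (alg_bump_core Hm _ yc (kappa_core HS)) ?oppr0// => e.
  have d1 : deg y = 1%N by rewrite -(tequiv_deg HT e) (solid_point HS).
  by apply: yk; rewrite (tequiv_point HS d1 e).
have gy : g y = 0 by rewrite gE (alg_bump_at Hm _ yc) (alg_unit0_core HS yc yk) addNr.
have gz : g z = alg_unit0 HS z by rewrite gE (alg_bump_out Hm _ yc yz) oppr0 add0r.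
have [w Bw h] := Brich (oplus y z) ga gk.
have : pad (w (oplus y z)) = pad (g (oplus y z)) by rewrite h.
have [_ ws] := Balg Bw; have [_ gs] := ga; rewrite ws gs => e.
have [e1 e2] := udsum_inj (wf_pad _) (wf_pad _) (wf_pad _) (wf_pad _) e.
exists w; first by split=> //; rewrite (pad_inj e1) gy.
rewrite (pad_inj e2) gz.
apply: (@alg_unit0_mul R T kappa HS (tfun_adj a) z); first exact: is_alg_adj.
by rewrite /tfun_adj ak adjmx0.
Qed.

(** The power with exponent k + 1, as there is no unit to start from. *)
Fixpoint tfun_pow m k : tfun T := if k is k'.+1 then tfun_mul m (tfun_pow m k') else m.

Lemma tfun_powB m k : B m -> B (tfun_pow m k).
Proof. by move=> Bm; elim: k => //= k; exact: (csub_mul HB Bm). Qed.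

Lemma tfun_pow_le m k x (c : R) : 0 <= c <= 1 -> opnorm (m x) <= c ->
  opnorm (tfun_pow m k x) <= c ^+ k.
Proof.
move=> /andP[c0 c1] h; elim: k => [|k IH] /=; first by rewrite expr0 (le_trans h).
by apply: le_trans (opnormM _ _) _; rewrite exprS; apply: ler_pM; rewrite ?opnorm_ge0.
Qed.

Lemma tfun_pow_ge m k x (c : R) v : 1 <= c -> (forall v, c * l2norm v <= l2norm (m x *m v)) ->
  c ^+ k * l2norm v <= l2norm (tfun_pow m k x *m v).
Proof.
move=> c1 h; have c0 : 0 <= c := le_trans ler01 c1.
elim: k v => [|k IH] v /=.
  rewrite expr0 mul1r; apply: le_trans (h v); rewrite -[leLHS]mul1r.
  by apply: ler_wpM2r c1; exact: l2norm_ge0.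
rewrite /tfun_mul -mulmxA; apply: le_trans (h _); rewrite exprS -mulrA.
by apply: ler_wpM2l c0 _ _ _; exact: IH.
Qed.

Lemma opnorm_mat_sub1 k n (X : 'M[C]_k) : k = n ->
  opnorm (mat n (pad X) - 1%:M) = opnorm (X - 1%:M).
Proof. by move=> e; case: _ / e; rewrite matK. Qed.

Definition weight n (e : 'I_n -> 'I_n -> tfun T) b : tfun T := \sum_j \sum_l
  tfun_mul (tfun_mul (e j l) (tfun_mul (tfun_adj b) b)) (tfun_adj (e j l)).

Lemma weightE n (e : 'I_n -> 'I_n -> tfun T) b x : weight e b x =
  \sum_j \sum_l e j l x *m ((b x)^t* *m b x) *m (e j l x)^t*.
Proof. by rewrite /weight tfun_sumE; apply: eq_bigr => j _; rewrite tfun_sumE. Qed.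

Lemma weightB n (e : 'I_n -> 'I_n -> tfun T) b : (forall j l, B (e j l)) -> B b ->
  B (weight e b).
Proof.
move=> Be Bb; apply: (csub_sum HB) => j; apply: (csub_sum HB) => l.
apply: (csub_mul HB); last exact: (csub_adj HB).
by apply: (csub_mul HB) => //; apply: (csub_mul HB) => //; exact: (csub_adj HB).
Qed.

Lemma weight_lowb n (e : 'I_n -> 'I_n -> tfun T) b x : lowb 0 (weight e b x).
Proof.
rewrite weightE; apply: lowb_sum => j _; apply: lowb_sum => l _.
have -> : e j l x *m ((b x)^t* *m b x) *m (e j l x)^t* =
    (b x *m (e j l x)^t*)^t* *m (b x *m (e j l x)^t*).
  by rewrite adjmxM trmxCK !mulmxA.
exact: lowb_gram.
Qed.

Lemma weight_adj n (e : 'I_n -> 'I_n -> tfun T) b x : (weight e b x)^t* = weight e b x.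
Proof.
have sumA (I : finType) (F : I -> 'M[C]_(deg x)) : (\sum_i F i)^t* = \sum_i (F i)^t*.
  by rewrite raddf_sum raddf_sum.
rewrite weightE sumA; apply: eq_bigr => j _; rewrite sumA; apply: eq_bigr => l _.
by rewrite !adjmxM !trmxCK !mulmxA.
Qed.

Lemma weight_le n (e : 'I_n -> 'I_n -> tfun T) : (forall j l, B (e j l)) ->
  exists2 c : R, 0 <= c & forall b x (r : R), opnorm (b x) <= r ->
    opnorm (weight e b x) <= c * r ^+ 2.
Proof.
move=> Be; have bd (p : 'I_n * 'I_n) := csub_bounded HB (Be p.1 p.2).
have {}bd p : exists M : R, 0 < M /\ forall x, opnorm (e p.1 p.2 x) <= M.
  by have [M] := bd p; exists M.
have [M hM] := choice bd.
exists (\sum_j \sum_l M (j, l) ^+ 2).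
  by apply: sumr_ge0 => j _; apply: sumr_ge0 => l _; exact: sqr_ge0.
move=> b x r br; have r0 := le_trans (opnorm_ge0 _) br.
rewrite weightE mulr_suml; apply: le_trans (opnorm_sum _ _) _; apply: ler_sum => j _.
rewrite mulr_suml; apply: le_trans (opnorm_sum _ _) _; apply: ler_sum => l _.
have [M0 eM] := hM (j, l).
apply: le_trans (opnormM _ _) _; rewrite opnorm_adj expr2 mulrAC.
apply: ler_pM (eM x); rewrite ?opnorm_ge0//; apply: le_trans (opnormM _ _) _.
apply: ler_pM (eM x) _; rewrite ?opnorm_ge0// opnorm_adjM.
by apply: lerXn2r br; rewrite nnegrE ?opnorm_ge0.
Qed.

(* [q k] is a weight which grows near [y], is small away from the orbit of [y], and is
   almost scalar near this orbit. *)
Lemma local_weight y g (d : R) : core T y -> y <> kappa -> in_C0 kappa g -> 0 < d ->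
  exists b (q : nat -> tfun T) (O : set T) (c : R),
  [/\ B b, forall k, B (q k), forall k x, (q k x)^t* = q k x /\ lowb 0 (q k x), 0 <= c /\ nbhs y O &
    forall k x, (deg x <= deg y)%N -> exists t : R, [/\ 0 <= t, lowb (t / 2) (q k x),
      opnorm ((g x - b x) *m q k x) <= 2 * d * t + c * 4^-1 ^+ k &
      O x -> (9 / 4) ^+ k <= t]].
Proof.
move=> yc yk gc d0; set n := deg y; have [gC _ _] := gc.
have [b Bb by_] := core_value (g y) yc yk.
have [a Ba ay] := core_value (1%:M : 'M_(deg y)) yc yk.
have Bd (p : 'I_n * 'I_n) : exists u, B u /\ u y = delta_mx p.1 p.2.
  by have [u] := core_value (delta_mx p.1 p.2 : 'M[C]_n) yc yk; exists u.
have [e0 e0P] := choice Bd; pose e j l := e0 (j, l).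
have Be j l : B (e j l) by have [] := e0P (j, l).
have ey j l : e j l y = delta_mx j l by have [] := e0P (j, l).
have gbC : in_Cstar (-1 *: b + g) by apply: in_Cstar_linear => //; exact: BC.
have gbE x : (-1 *: b + g) x = g x - b x.
  by rewrite -[LHS]/(-1 *: b x + g x) scaleN1r addrC.
(* The good set: b approximates g there and the e j l average well. It is a neighborhood of the
   whole orbit of y, since at U.y the e j l are conjugated matrix units, which [averaging_near]
   allows. *)
pose G := [set x | [/\ deg x = n, averaging (fun j l => e j l x) & opnorm (g x - b x) < d]].
have VG (U : 'M[C]_n) : U \is unitarymx -> nbhs (act U y) G.
  move=> Uu; have [eta eta0 av] := averaging_near Uu.
  have dU : deg (act U y) = n by exact: (deg_actE HT erefl Uu).
  have n1 : \forall x \near act U y, forall j l, deg x = n /\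
      opnorm (mat n (pad (e j l x)) - mat n (pad (e j l (act U y)))) < eta.
    apply: filter_forall => j; apply: filter_forall => l.
    exact: near_value (BC (Be j l)) dU eta0.
  have n2 : nbhs (act U y) [set x | opnorm (g x - b x) < d].
    have : nbhs (act U y) [set x | opnorm ((-1 *: b + g) x) < d].
      have := opnorm_continuous Hm gbC (x := act U y) => /(_ [set r | r < d]); apply.
      apply: (open_nbhs_nbhs (conj (@open_lt R d) _)) => /=.
      rewrite (opnorm_tequiv Hm (in_Cstar_alg Hm gbC) (tequiv_intro erefl Uu)).
      by rewrite gbE by_ subrr opnorm0.
    by apply: filterS => x; rewrite /= gbE.
  apply: filterS2 n1 n2 => x h1 h2; have i0 := Ordinal (deg_gt0 y).
  have [dx _] := h1 i0 i0; split=> //.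
  apply: (averaging_size (X := fun j l => mat n (pad (e j l x)))) => //.
    by move=> j l; rewrite -dx; congr pad; rewrite matK.
  apply: av => j l; have [_ /ltW] := h1 j l.
  by rewrite (alg_actE (Balg (Be j l)) erefl Uu) mat_uconj matK ey.
pose V := interior G; have oV : open V by exact: open_interior.
have yV z : tequiv y z -> V z.
  by move=> [U [Uu <-]]; exact: VG.
(* Points of degree at most n outside the neighborhood. They are disjoint from y: a point of such
   degree lying above y would belong to its orbit. So [core_separate] provides the w vanishing at
   y. *)
pose K := [set x : T | (deg x <= n)%N] `&` ~` V.
have cK : compact K.
  by apply: compact_closedI; [exact: (layers_compact Hp)|exact: open_closedC].
have [m [s [c0 [mB sW mE ma mK]]]] : exists m (s : seq (tfun T)) (c : R), [/\ B m,
    (forall w, w \in s -> B w /\ w y = 0),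
    (forall x, m x + (c%:C *: \sum_(w <- s) (w x)^t* *m w x) *m m x = a x),
    (forall x, opnorm (m x) <= opnorm (a x)) & forall z, K z -> opnorm (m z) <= 4^-1].
  apply: (csub_bump Hm HB (W := fun w => B w /\ w y = 0)) => //; [by move=> w []| |by rewrite invr_gt0].
  move=> z [zn zV]; apply: core_separate => //; first by apply: contrapT => h; apply: zV;
    apply: yV; apply: (tsub_deg_eq HT); [exact: (core_tdisjointN HT)|apply/eqP;
    rewrite eqn_leq zn (tsub_deg HT)//; exact: (core_tdisjointN HT)].
  - exact: Balg.
  - by have [_ _] := csub_C0 HB Ba.
have my : m y = 1%:M.
  rewrite -ay -mE big_seq big1 ?scaler0 ?mul0mx ?addr0// => w /sW[_ ->].
  by rewrite mulmx0.
(* Doubling puts the threshold at 1: the norm is at most 1/2 on K, while vectors are stretched by at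
   least 3/2 where m is within 1/4 of the unit. Squaring in the weight gives the rates 4^-k and
   (9/4)^k. *)
pose m2 : tfun T := 2 *: m + 0.
have m2E x : m2 x = 2 *: m x by rewrite -[LHS]/(2 *: m x + 0) addr0.
have m2B : B m2 by apply: (csub_linear HB) => //; exact: (csub0 HB).
pose q k := weight e (tfun_pow m2 k).
have [c1 c10 qle] := weight_le Be.
have [M M0 gM] : exists2 M : R, 0 <= M & forall x, opnorm (g x - b x) <= M.
  have [_ _ _ [M hM]] := gbC; exists M; last by move=> x; rewrite -gbE; apply: hM; exists x.
  by apply: le_trans (opnorm_ge0 _) (hM _ (ex_intro2 _ _ y I erefl)).
exists b, q, (V `&` [set x | deg x = n /\ opnorm (m x - 1%:M) < 4^-1]), (M * c1); split=> //.
- by move=> k; apply: weightB => //; exact: tfun_powB.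
- by move=> k x; split; [exact: weight_adj|exact: weight_lowb].
- split; first exact: mulr_ge0.
  apply: filterI; first by apply: (open_nbhs_nbhs (conj oV _)); exact: (yV _ (tequiv_refl HT y)).
  have := near_value (BC mB) (erefl n) (_ : 0 < 4^-1 :> R) => /(_ ltac:(by rewrite invr_gt0)).
  by apply: filterS => x [dx]; rewrite my matK (opnorm_mat_sub1 _ dx).
move=> k x dx; have [xV|xV] := pselect (V x).
  have [dxn av gb] := interior_subset xV.
  (* On V the weight is within t / 2 of the scalar t by averaging; outside V the choice t = 0 leaves
     only the decaying term. *)
  exists (hsnorm (tfun_pow m2 k x) ^+ 2); split.
  - exact: sqr_ge0.
  - by apply: lowb_near; rewrite /q weightE; exact: av.
  - have hq : opnorm (q k x) <= 3 / 2 * hsnorm (tfun_pow m2 k x) ^+ 2.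
      have -> : q k x = (q k x - ((hsnorm (tfun_pow m2 k x) ^+ 2)%:C)%:M) +
          (hsnorm (tfun_pow m2 k x) ^+ 2)%:C *: 1%:M by rewrite scalemx1 subrK.
      apply: le_trans (opnormD _ _) _; rewrite opnormZ normc_real ger0_norm ?sqr_ge0//.
      have -> : 3 / 2 * hsnorm (tfun_pow m2 k x) ^+ 2 =
        hsnorm (tfun_pow m2 k x) ^+ 2 / 2 + hsnorm (tfun_pow m2 k x) ^+ 2 by field.
      apply: lerD; first by rewrite /q weightE; exact: av.
      by rewrite -[leRHS]mulr1; apply: ler_wpM2l (opnorm1 _ _); exact: sqr_ge0.
    apply: le_trans (opnormM _ _) _.
    apply: (@le_trans _ _ (d * (3 / 2 * hsnorm (tfun_pow m2 k x) ^+ 2))).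
      by apply: ler_pM hq; rewrite ?opnorm_ge0// ltW.
    rewrite -[leLHS]addr0; apply: lerD; last by rewrite !mulr_ge0// exprn_ge0// invr_ge0.
    rewrite mulrA; apply: ler_wpM2r (sqr_ge0 _) _ _ _.
    by rewrite mulrC; apply: ler_wpM2r (ltW d0) _ _ _; rewrite ler_pdivrMr// -natrM ler_nat.
  - move=> [_ [_ hm]].
    have ex v : 3 / 2 * l2norm v <= l2norm (m2 x *m v).
      have h1 : l2norm ((m x - 1%:M) *m v) <= 4^-1 * l2norm v.
        by apply: le_trans (l2norm_mulmx _ _) _; apply: ler_wpM2r (ltW hm); exact: l2norm_ge0.
      have h2 : 2 * l2norm v <= l2norm (m2 x *m v) + 2 * l2norm ((m x - 1%:M) *m v).
        have n2 (w : 'cV[C]_(deg x)) : l2norm (2 *: w) = 2 * l2norm w.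
          by rewrite l2normZ normc2.
        rewrite -n2 -n2 -(l2normN (2 *: (_ *m v))).
        have -> : 2 *: v = m2 x *m v + - (2 *: ((m x - 1%:M) *m v)).
          by rewrite m2E mulmxBl mul1mx scalerBr -scalemxAl opprB addrC subrK.
        exact: l2normD.
      by move: h1 h2; apply: expanding_arith.
    have i0 := Ordinal (deg_gt0 x); have := @tfun_pow_ge m2 k x (3 / 2) (delta_mx i0 0) _ ex.
    rewrite l2norm_delta mulr1 => /(_ ltac:(by rewrite ler_pdivlMr// mul1r ler_nat)) h3.
    have -> : 9 / 4 = (3 / 2) ^+ 2 :> R by field.
    rewrite -exprM mulnC exprM; apply: lerXn2r; rewrite ?nnegrE ?hsnorm_ge0//.
      by rewrite exprn_ge0// divr_ge0.
    apply: le_trans h3 _; apply: le_trans (l2norm_mulmx _ _) _; rewrite l2norm_delta mulr1.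
    exact: opnorm_le_hsnorm.
exists 0; split=> //.
- by rewrite mul0r; exact: weight_lowb.
- rewrite mulr0 add0r -mulrA; apply: le_trans (opnormM _ _) _.
  apply: ler_pM (gM x) _; rewrite ?opnorm_ge0//.
  have -> : 4^-1 = 2^-1 ^+ 2 :> R by field.
  rewrite -exprM mulnC exprM; apply: qle; apply: tfun_pow_le; first by rewrite invr_ge0 ler0n invf_le1 ?ler1n.
  rewrite m2E opnormZ normc2.
  have -> : 2^-1 = 2 * 4^-1 :> R by field.
  by apply: ler_wpM2l (mK x (conj dx xV)).
by move=> [].
Qed.

(* Truncations by resolvents *)
End LocalWeights.

Section Truncations.
Variable R : realType.
Local Notation C := R[i].
Variables (n : nat) (c : R).
Hypothesis c0 : 0 < c.
Implicit Types X Y M N : 'M[C]_n.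

Lemma gram_lowb X : lowb 0 (c%:C *: (X *m X^t*)).
Proof.
have -> : 0 = c * 0 :> R by rewrite mulr0.
apply: lowbZ; first exact: ltW.
by rewrite -{1}[X]trmxCK; exact: lowb_gram.
Qed.

(** By [bump_mx] with X* as the only weight, w = the norm of X* M satisfies c w ^ 2 <= w and bounds
    the square of the norm of M. *)
Lemma truncation_bound X M : M + c%:C *: (X *m X^t*) *m M = X -> opnorm M ^+ 2 <= c^-1.
Proof.
move=> h; have [|h1 h2] := @bump_mx R n unit [:: tt] (fun=> X^t*) X M c (ltW c0).
  by rewrite big_seq1 trmxCK.
have {h2} := h2 tt (mem_head _ _).
move: h1 (opnorm_ge0 (X^t* *m M)); move: (opnorm (X^t* *m M)) => w h1 w0 h2.
apply: le_trans h1 _; have [->|wn] := eqVneq w 0; first by rewrite invr_ge0 ltW.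
have w1 : 0 < w by rewrite lt0r wn.
by rewrite -[leRHS]mul1r ler_pdivlMr// mulrC -(ler_pM2r w1) mul1r -mulrA -expr2.
Qed.

(** The resolvent is pulled through X, so that the truncation of Y can be written with a right
    factor in [truncation_lip]. *)
Lemma truncation_sym X M : M + c%:C *: (X *m X^t*) *m M = X ->
  M + M *m (c%:C *: (X^t* *m X)) = X.
Proof.
move=> h; have Hu := lowb_unitmx (gram_lowb X).
have e1 : (1%:M + c%:C *: (X *m X^t*)) *m M = X by rewrite mulmxDl mul1mx.
rewrite -[M in M + _]mulmx1 -mulmxDr.
have e2 : (1%:M + c%:C *: (X *m X^t*)) *m (M *m (1%:M + c%:C *: (X^t* *m X))) =
    (1%:M + c%:C *: (X *m X^t*)) *m X.
  by rewrite mulmxA e1 mulmxDr mulmx1 mulmxDl mul1mx -scalemxAr -scalemxAl mulmxA.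
by have := congr1 (mulmx (invmx (1%:M + c%:C *: (X *m X^t*)))) e2; rewrite !(mulKmx Hu).
Qed.

Lemma opnorm_resolvent X : opnorm (invmx (1%:M + c%:C *: (X *m X^t*))) <= 1.
Proof.
have Hu := lowb_unitmx (gram_lowb X); set S := invmx _.
have h : S + c%:C *: (X *m X^t*) *m S = 1%:M.
  by rewrite -{1}[S]mul1mx -mulmxDl; exact: mulmxV Hu.
have := lowb_solve_le (lexx 0) (gram_lowb X) h; rewrite addr0 mul1r => h2.
exact: le_trans h2 (opnorm1 _ _).
Qed.

Lemma truncation_arith (m k x : R) : 0 <= m -> 0 <= k -> 0 <= x ->
  m ^+ 2 <= c^-1 -> k ^+ 2 <= c^-1 -> c * (m * x * k) <= x.
Proof.
move=> m0 k0 x0 hm hk; have -> : c * (m * x * k) = (c * (m * k)) * x by ring.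
have mk : m * k <= c^-1 by have := sqr_ge0 (m - k); nra.
rewrite -[leRHS]mul1r; apply: ler_wpM2r x0 _ _ _.
by rewrite -(@mulfV _ c) ?gt_eqF//; exact: ler_wpM2l (ltW c0) _ _ mk.
Qed.

Lemma opnorm_contract_sandwich X S V : opnorm S <= 1 -> opnorm V <= 1 ->
  opnorm (S *m X *m V) <= opnorm X.
Proof.
move=> S1 V1; apply: le_trans (opnormM _ _) _; rewrite -[leRHS]mulr1.
apply: (ler_pM (opnorm_ge0 _) (opnorm_ge0 _) _ V1).
apply: le_trans (opnormM _ _) _; rewrite -[leRHS]mul1r.
exact: (ler_wpM2r (opnorm_ge0 _) S1).
Qed.

(** A resolvent identity: M - N = G^-1 (X - Y) H^-1 + c M (Y - X)* N. Both resolvents are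
    contractions and c times the product of the norms of M and N is at most 1, hence the constant
    2. *)
Lemma truncation_lip X Y M N : M + c%:C *: (X *m X^t*) *m M = X ->
  N + c%:C *: (Y *m Y^t*) *m N = Y -> opnorm (M - N) <= 2 * opnorm (X - Y).
Proof.
move=> hM hN; have hN' := truncation_sym hN.
have bM := truncation_bound hM; have bN := truncation_bound hN.
have Xu := lowb_unitmx (gram_lowb X); have Yu := lowb_unitmx (gram_lowb (Y^t*)).
rewrite trmxCK in Yu; set G := 1%:M + c%:C *: (X *m X^t*) in Xu.
set H := 1%:M + c%:C *: (Y^t* *m Y) in Yu.
have GM : G *m M = X by rewrite /G mulmxDl mul1mx.
have NH : N *m H = Y by rewrite /H mulmxDr mulmx1.
have SX : invmx G *m X = M by rewrite -GM (mulKmx Xu).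
have YT : Y *m invmx H = N by rewrite -NH (mulmxK Yu).
have e : M - N = invmx G *m (X - Y) *m invmx H + c%:C *: (M *m (Y - X)^t* *m N).
  have e1 : G *m (M - N) *m H = (X - Y) + c%:C *: (X *m (Y - X)^t* *m Y).
    rewrite mulmxBr GM mulmxBl -(mulmxA G) NH /G /H mulmxDr mulmx1 mulmxDl mul1mx.
    rewrite -scalemxAr -scalemxAl adjmxD adjmxN mulmxBr mulmxBl scalerBr !mulmxA.
    by rewrite opprD addrACA.
  have -> : M - N = invmx G *m (G *m (M - N) *m H) *m invmx H.
    by rewrite -(mulmxA G) (mulKmx Xu) (mulmxK Yu).
  rewrite e1 mulmxDr mulmxDl; congr (_ + _).
  by rewrite -scalemxAr -scalemxAl !mulmxA SX -!(mulmxA _ _ (invmx H)) YT.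
have T1 : opnorm (invmx H) <= 1 by have := opnorm_resolvent (Y^t*); rewrite trmxCK.
have S1 : opnorm (invmx G) <= 1 := opnorm_resolvent X.
rewrite e; apply: le_trans (opnormD _ _) _; rewrite mulr_natl mulr2n; apply: lerD.
  exact: opnorm_contract_sandwich S1 T1.
rewrite opnormZ normc_real (gtr0_norm c0).
have h : opnorm (M *m (Y - X)^t* *m N) <= opnorm M * opnorm (X - Y) * opnorm N.
  apply: le_trans (opnormM _ _) _; apply: ler_wpM2r; first exact: opnorm_ge0.
  by apply: le_trans (opnormM _ _) _; rewrite opnorm_adj opnormBC.
apply: le_trans (ler_wpM2l (ltW c0) h) _.
by apply: truncation_arith bM bN; exact: opnorm_ge0.
Qed.

End Truncations.

Section StoneWeierstrass.
Variables (R : realType) (T : towerData R) (kappa : T).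
Hypothesis HS : is_solid kappa.
Let Hm := solid_mtower HS.
Let Hp := solid_proper HS.
Let HT := mtower_tower Hm.
Local Notation C := R[i].
Implicit Types (x y t s z : T) (f g u w m a : tfun T).
Variable B : tfun T -> Prop.
Hypothesis HB : closed_subalgebra kappa B.
Hypothesis Brich : forall f s, is_alg f -> f kappa = 0 -> exists2 b, B b & b s = f s.


Lemma lowb_sum_seq n (I : eqType) (r : seq I) (t : I -> R) (Q : I -> 'M[C]_n) :
  (forall j, j \in r -> lowb (t j / 2) (Q j)) ->
  lowb ((\sum_(j <- r) t j) / 2) (\sum_(j <- r) Q j).
Proof.
move=> h; rewrite mulr_suml big_seq [X in lowb _ X]big_seq; elim/big_rec2: _ => [|j G s jr IH].
  exact: lowb0.
exact: lowbD (h j jr) IH.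
Qed.

Lemma weighted_arith (z y t e d : R) : 0 <= t -> (1 + t / 2) * z <= y ->
  y <= 2 * e * (1 + t / 2) + (2 * d * t + e) -> 0 <= e -> 0 <= d -> z <= 3 * e + 4 * d.
Proof.
move=> t0 h1 h2 e0 d0; have t1 : 0 < 1 + t / 2 by lra.
rewrite -(ler_pM2l t1); apply: le_trans h1 _; apply: le_trans h2 _.
by have := mulr_ge0 t0 e0; nra.
Qed.

Lemma eighths_arith (e : R) : 0 < e -> 3 * (e / 8) + 4 * (e / 8) <= e.
Proof. lra. Qed.

(* Partial fractions: [d = P (1 + Q)^-1], where [Q] is a sum of weights and [P] the
   corresponding weighted sum of local approximations. *)
Lemma low_approx N f (e : R) : in_C0 kappa f -> 0 < e ->
  exists2 d, B d & forall x, (deg x <= N)%N -> opnorm (d x - f x) <= e.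
Proof.
elim: N f e => [|N IH] f e fc e0.
  by exists 0; [exact: (csub0 HB)|move=> x; rewrite leqNgt (deg_gt0 x)].
(* The final estimate adds 3 e1 and 4 e1. *)
pose e1 := e / 8; have e10 : 0 < e1 by rewrite divr_gt0.
have [b0 Bb0 b0f] := IH f e1 fc e10.
pose g : tfun T := -1 *: b0 + f.
have gE x : g x = f x - b0 x by rewrite -[LHS]/(-1 *: b0 x + f x) scaleN1r addrC.
have gc : in_C0 kappa g by apply: in_C0_linear fc; exact: (csub_C0 HB).
have [gC _ gk] := gc; have ga := in_Cstar_alg Hm gC.
have glow x : (deg x <= N)%N -> opnorm (g x) <= e1 by rewrite gE opnormBC; exact: b0f.
(* Where the remaining error g is not small in the new layer. These points are irreducible, since g
   is at most e1 on all parts of lower degree, and differ from kappa, where g vanishes. *)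
pose K := layer T N.+1 `&` [set x | 2 * e1 <= opnorm (g x)].
have cK : compact K.
  apply: compact_closedI; first exact: Hp.
  have := closed_comp (fun x _ => opnorm_continuous Hm gC (x := x)) (@closed_ge R (2 * e1)).
  by [].
have Kcore x : K x -> core T x.
  move=> [xN xg]; apply: contrapT => nc; move: xg; apply/negP; rewrite /= -ltNge.
  apply: (@le_lt_trans _ _ e1); last by rewrite mulr_natl mulr2n ltrDl.
  apply: (is_alg_opnorm_le Hm ga) => t tc tx; apply: glow; rewrite -ltnS -xN.
  rewrite ltn_neqAle (tsub_deg HT tx) andbT; apply/eqP => dtx; apply: nc.
  exact: core_tequiv HT _ _ (tsub_deg_eq HT tx dtx) tc.
have Kk x : K x -> x <> kappa.
  move=> [_ xg] xk; move: xg; rewrite xk /= gk opnorm0 leNgt; apply/negP; rewrite negbK.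
  by rewrite mulr_gt0.
have loc y : exists D : tfun T * (nat -> tfun T) * set T * R, K y ->
    let: (b, q, V, c) := D in
    [/\ B b, forall k, B (q k), forall k x, (q k x)^t* = q k x /\ lowb 0 (q k x), 0 <= c /\ nbhs y V &
    forall k x, (deg x <= deg y)%N -> exists t : R, [/\ 0 <= t, lowb (t / 2) (q k x),
      opnorm ((g x - b x) *m q k x) <= 2 * e1 * t + c * 4^-1 ^+ k &
      V x -> (9 / 4) ^+ k <= t]].
  have [Ky|nKy] := pselect (K y); last by exists (0, fun=> 0, set0, 0).
  have [b [q [O [c h]]]] := local_weight HS HB Brich (Kcore y Ky) (Kk y Ky) gc e10.
  by exists (b, q, O, c).
have [D hD] := choice loc.
pose b y := (D y).1.1.1; pose q y := (D y).1.1.2; pose O y := (D y).1.2; pose c y := (D y).2.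
have {}hD y : K y -> [/\ B (b y), forall k, B (q y k), forall k x, (q y k x)^t* = q y k x /\ lowb 0 (q y k x),
    0 <= c y /\ nbhs y (O y) &
    forall k x, (deg x <= deg y)%N -> exists t : R, [/\ 0 <= t, lowb (t / 2) (q y k x),
      opnorm ((g x - b y x) *m q y k x) <= 2 * e1 * t + c y * 4^-1 ^+ k &
      O y x -> (9 / 4) ^+ k <= t]].
  by move=> Ky; have := hD y Ky; rewrite /b /q /O /c; case: (D y) => [[[]]].
have [s sK sO] := @compact_finite_cover T T K K O cK
  (fun x Kx => ex_intro2 _ _ x Kx (let: And5 _ _ _ h _ := hD x Kx in proj2 h)).
have [_ _ _ [M0 gM0]] := gC.
have gM x : opnorm (g x) <= M0 by apply: gM0; exists x.
have M00 : 0 <= M0 := le_trans (opnorm_ge0 _) (gM kappa).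
pose cs := \sum_(y <- s) c y.
have cs0 : 0 <= cs by rewrite /cs big_seq; apply: sumr_ge0 => y /sK/hD[_ _ _ []].
(* One k serves both growth and decay: (4/9)^k dominates 4^-k, and its inverse is the lower bound of
   a weight near its center. *)
have [|k hk] := @geometric_small R (4 / 9) (M0 + cs) e1 _ e10; first by lra.
have hk1 : M0 <= e1 * (9 / 4) ^+ k.
  have p0 : 0 < (9 / 4) ^+ k :> R by rewrite exprn_gt0// divr_gt0.
  rewrite -ler_pdivrMr//; apply: le_trans hk.
  rewrite -exprVn invf_div mulrC; apply: ler_wpM2l; first by rewrite exprn_ge0// divr_ge0.
  by rewrite lerDl.
have hk2 : cs * 4^-1 ^+ k <= e1.
  apply: le_trans hk; rewrite mulrC; apply: ler_pM => //.
  - by rewrite exprn_ge0// invr_ge0.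
  - by apply: lerXn2r; rewrite ?nnegrE; lra.
  - by rewrite lerDr.
pose Q : tfun T := \sum_(y <- s) q y k.
pose P : tfun T := \sum_(y <- s) tfun_mul (b y) (q y k).
have QE x : Q x = \sum_(y <- s) q y k x by rewrite /Q tfun_sumE.
have PE x : P x = \sum_(y <- s) b y x *m q y k x by rewrite /P tfun_sumE.
have BQ : B Q.
  rewrite /Q big_seq; elim/big_ind: _ => [|u v Bu Bv|y /sK/hD[_]//]; first exact: (csub0 HB).
  by rewrite -[u]scale1r; exact: (csub_linear HB).
have BP : B P.
  rewrite /P big_seq; elim/big_ind: _ => [|u v Bu Bv|y /sK/hD[? h _ _ _]]; first exact: (csub0 HB).
    by rewrite -[u]scale1r; exact: (csub_linear HB).
  exact: (csub_mul HB).
have Qadj x : (Q x)^t* = Q x.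
  rewrite QE raddf_sum raddf_sum big_seq [RHS]big_seq; apply: eq_bigr => y /sK/hD[_ _ h _ _].
  by have [] := h k x.
have tx x : (deg x <= N.+1)%N -> exists t : T -> R, forall y, y \in s ->
    [/\ 0 <= t y, lowb (t y / 2) (q y k x),
      opnorm ((g x - b y x) *m q y k x) <= 2 * e1 * t y + c y * 4^-1 ^+ k &
      O y x -> (9 / 4) ^+ k <= t y].
  move=> dx; suff h y : exists r : R, y \in s -> [/\ 0 <= r, lowb (r / 2) (q y k x),
      opnorm ((g x - b y x) *m q y k x) <= 2 * e1 * r + c y * 4^-1 ^+ k &
      O y x -> (9 / 4) ^+ k <= r] by have [t ht] := choice h; exists t.
  have [ys|ys] := boolP (y \in s); last by exists 0.
  have Ky := sK y ys; have [_ _ _ _ h] := hD y Ky.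
  have [|t ht] := h k x; first by have [-> _] := Ky.
  by exists t.
(* Resolvents act on the left, so the equation is solved for the adjoint of P; the adjoint of the
   solution is P (1 + Q)^-1, as Q is self-adjoint. *)
have [|m Bm mE] := csub_resolvent HB (csub_adj HB BP) BQ.
  move=> x; rewrite QE big_seq; elim/big_ind: _ => [|G H hG hH|y /sK/hD[_ _ h _ _]].
  - exact: lowb0.
  - by rewrite -[0](addr0 (0 : R)); exact: lowbD.
  - by have [] := h k x.
exists (1 *: tfun_adj m + b0); first by apply: (csub_linear HB) => //; exact: (csub_adj HB).
move=> x dx; have [t ht] := tx x dx; pose tau := \sum_(y <- s) t y.
have tau0 : 0 <= tau by rewrite /tau big_seq; apply: sumr_ge0 => y /ht[].
pose W := g x - (m x)^t*.
(* The error W satisfies W (1 + Q) = g + sum of (g - b_y) q_y, where each summand is small relative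
   to its weight. *)
have WE : W + W *m Q x = g x + \sum_(y <- s) (g x - b y x) *m q y k x.
  have mE' : (m x)^t* + (m x)^t* *m Q x = P x.
    have := congr1 (fun M => M^t*) (mE x); rewrite adjmxD adjmxM Qadj => ->.
    exact: trmxCK.
  rewrite /W mulmxBl addrACA -opprD mE' PE QE mulmx_sumr -addrA -sumrB.
  by congr (_ + _); apply: eq_bigr => y _; rewrite mulmxBl.
have WQ : (1 + tau / 2) * opnorm W <= opnorm (g x + \sum_(y <- s) (g x - b y x) *m q y k x).
  apply: (lowb_solve_le_r _ _ (Qadj x) WE); first by rewrite divr_ge0.
  by rewrite QE; apply: lowb_sum_seq => y /ht[].
(* Either g is already below 2 e1 at x, or x lies near some center, whose weight exceeds (9/4)^k and
   absorbs the global bound of g. *)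
have gx : opnorm (g x) <= 2 * e1 * (1 + tau / 2).
  have tau2 : 2 * e1 <= 2 * e1 * (1 + tau / 2).
    rewrite -[leLHS]mulr1; apply: ler_wpM2l; first by rewrite mulr_ge0// ltW.
    by rewrite lerDl divr_ge0.
  have [Kx|nKx] := pselect (K x); last first.
    apply: le_trans tau2; move: dx; rewrite leq_eqVlt ltnS => /orP[/eqP dx|dx].
      by apply: ltW; rewrite ltNge; apply/negP => h; apply: nKx.
    by apply: le_trans (glow x dx) _; rewrite mulr_natl mulr2n lerDl ltW.
  have [y ys Oyx] := sO x Kx; have [_ _ _ /(_ Oyx) ty] := ht y ys.
  apply: le_trans (gM x) _; apply: le_trans hk1 _.
  have -> : 2 * e1 * (1 + tau / 2) = 2 * e1 + e1 * tau by field.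
  rewrite -[leLHS]add0r; apply: lerD; first by rewrite mulr_ge0// ltW.
  apply: (ler_wpM2l (ltW e10)); apply: le_trans ty _.
  rewrite /tau (big_rem y ys) /= lerDl big_seq; apply: sumr_ge0 => z /mem_rem zs.
  by have [] := ht z zs.
have Yx : opnorm (g x + \sum_(y <- s) (g x - b y x) *m q y k x) <=
    2 * e1 * (1 + tau / 2) + (2 * e1 * tau + e1).
  apply: le_trans (opnormD _ _) _; apply: lerD gx _; apply: le_trans (opnorm_sum _ _) _.
  apply: (@le_trans _ _ (\sum_(y <- s) (2 * e1 * t y + c y * 4^-1 ^+ k))).
    by rewrite big_seq [leRHS]big_seq; apply: ler_sum => y /ht[].
  by rewrite big_split /= -mulr_sumr -mulr_suml lerD2l.
have := weighted_arith tau0 WQ Yx (ltW e10) (ltW e10).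
have -> : (1 *: tfun_adj m + b0) x - f x = - W.
  rewrite -[LHS]/(1 *: (m x)^t* + b0 x - f x) scale1r /W gE opprB opprB.
  exact: esym (addrA _ _ _).
by rewrite opnormN => h; apply: le_trans h _; exact: eighths_arith.
Qed.

Lemma gram_tfunE (c : R) f x :
  (c%:C *: tfun_mul f (tfun_adj f) + 0) x = c%:C *: (f x *m (f x)^t*).
Proof. by rewrite -[LHS]/(c%:C *: (f x *m (f x)^t*) + 0) addr0. Qed.

Lemma csub_truncation (c : R) f B' : closed_subalgebra kappa B' -> 0 < c -> B' f ->
  exists2 F, B' F & forall x, F x + c%:C *: (f x *m (f x)^t*) *m F x = f x.
Proof.
move=> HB' c0 Bf.
have [||F BF FE] := @csub_resolvent R T kappa B' HB' f
  (c%:C *: tfun_mul f (tfun_adj f) + 0) Bf.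
- apply: (csub_linear HB') (csub0 HB').
  by apply: (csub_mul HB') => //; exact: (csub_adj HB').
- by move=> x; rewrite gram_tfunE; exact: gram_lowb.
by exists F => // x; have := FE x; rewrite gram_tfunE.
Qed.

Lemma compact_bounded_deg (K : set T) : compact K ->
  exists N, forall x, K x -> (deg x <= N)%N.
Proof.
move=> cK; have [|s _ sK] := @compact_finite_cover T nat K (fun=> True) (fun n => layer T n) cK.
  move=> x _; exists (deg x) => //; apply: open_nbhs_nbhs; split=> //; exact: open_layer.
exists (\max_(n <- s) n) => x /sK[n ns xn].
by rewrite (xn : deg x = n); exact: leq_bigmax_seq.
Qed.

(** F g is approximated by D g, where D truncates an approximant d of f valid in low degrees. Where
    g is not small the degrees are bounded and d is close to f; elsewhere D and F are bounded
    uniformly and g is small. *)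
Lemma truncation_mul (c : R) f F g : 0 < c -> in_C0 kappa f -> in_C0 kappa F ->
  (forall x, F x + c%:C *: (f x *m (f x)^t*) *m F x = f x) -> B g -> B (tfun_mul F g).
Proof.
move=> c0 fc Fc FE Bg; apply: (csub_closed HB) => e e0.
have [M M0 gM] := csub_bounded HB Bg.
(* A bound for every nonnegative number whose square is at most c^-1; it avoids a square root. *)
pose L := 1 + c^-1; have L1 : 0 < L by rewrite ltr_wpDr// invr_ge0 ltW.
have L2 X : 0 <= X -> X ^+ 2 <= c^-1 -> X <= L.
  have := invr_gt0 c; rewrite c0 /L; move: (c^-1) => r r0 X0 h; nra.
have [_ gv _] := csub_C0 HB Bg.
have [|K [cK Ksub gK]] := gv (e / (2 * L)); first by rewrite divr_gt0 ?mulr_gt0.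
have [N KN] := compact_bounded_deg cK.
have [|d Bd df] := low_approx N fc (_ : 0 < e / (2 * M)); first by rewrite divr_gt0 ?mulr_gt0.
have [D BD DE] := csub_truncation HB c0 Bd.
exists (tfun_mul D g); first exact: (csub_mul HB).
have [FC _ _] := Fc; have [DC _ _] := csub_C0 HB BD; have [gC _ _] := csub_C0 HB Bg.
pose G : tfun T := -1 *: tfun_mul F g + tfun_mul D g.
have GE x : G x = tfun_mul D g x - tfun_mul F g x.
  by rewrite -[LHS]/(-1 *: tfun_mul F g x + tfun_mul D g x) scaleN1r addrC.
have GC : in_Cstar G by apply: in_Cstar_linear; exact: in_Cstar_mul.
move=> x; rewrite -GE; apply: (is_alg_opnorm_le Hm (in_Cstar_alg Hm GC)) => t tc _.
rewrite GE /tfun_mul -mulmxBl; apply: le_trans (opnormM _ _) _.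
have [tK|tK] := pselect (K t).
  have h1 : opnorm (D t - F t) <= 2 * (e / (2 * M)).
    apply: le_trans (truncation_lip c0 (DE t) (FE t)) _.
    by apply: ler_wpM2l => //; exact: df _ (KN t tK).
  apply: le_trans (ler_pM (opnorm_ge0 _) (opnorm_ge0 _) h1 (gM t)) _.
  by have -> : 2 * (e / (2 * M)) * M = e by field; rewrite gt_eqF.
have h1 : opnorm (D t - F t) <= L + L.
  apply: le_trans (opnormD _ _) _; rewrite opnormN.
  apply: lerD; apply: L2; rewrite ?opnorm_ge0//.
    exact: truncation_bound c0 _ _ (DE t).
  exact: truncation_bound c0 _ _ (FE t).
have h2 := gK t (conj (subset_closure tc) tK).
apply: le_trans (ler_pM (opnorm_ge0 _) (opnorm_ge0 _) h1 h2) _.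
by have -> : (L + L) * (e / (2 * L)) = e by field; rewrite gt_eqF.
Qed.

Lemma csub_ideal f g : in_C0 kappa f -> B g -> B (tfun_mul f g).
Proof.
move=> fc Bg; apply: (csub_closed HB) => e e0.
have [M M0 gM] := csub_bounded HB Bg.
have [P P0 fP] := csub_bounded (in_C0_csub kappa) fc.
(* From f - F = c f f* F and the bound P on f and F, the error of F g is at most c P ^ 3 M = e. *)
pose c := e / (P ^+ 3 * M); have c0 : 0 < c by rewrite divr_gt0// mulr_gt0// exprn_gt0.
have [F Fc FE] := csub_truncation (in_C0_csub kappa) c0 fc.
exists (tfun_mul F g); first exact: truncation_mul c0 fc Fc FE Bg.
move=> x; rewrite opnormBC /tfun_mul -mulmxBl.
have -> : f x - F x = c%:C *: (f x *m (f x)^t*) *m F x by rewrite -{1}(FE x) addrC addKr.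
have Ff : opnorm (F x) <= opnorm (f x).
  have := lowb_solve_le (lexx 0) (gram_lowb c0 (f x)) (FE x).
  by rewrite addr0 mul1r.
apply: le_trans (opnormM _ _) _; apply: (@le_trans _ _ ((c * (P * P) * P) * M)).
  apply: (ler_pM (opnorm_ge0 _) (opnorm_ge0 _) _ (gM x)).
  apply: le_trans (opnormM _ _) _; apply: (ler_pM (opnorm_ge0 _) (opnorm_ge0 _)).
    rewrite opnormZ normc_real (gtr0_norm c0); apply: (ler_wpM2l (ltW c0)).
    apply: le_trans (opnormM _ _) _; rewrite opnorm_adj.
    exact: (ler_pM (opnorm_ge0 _) (opnorm_ge0 _) (fP x) (fP x)).
  exact: le_trans Ff (fP x).
by have -> : c * (P * P) * P * M = e by rewrite /c; field; rewrite !gt_eqF.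
Qed.

(** Once B is known to be an ideal, [ideal_approx] with right units taken from [Brich] puts f within
    e of B. *)
Lemma stone_weierstrass f : in_C0 kappa f -> B f.
Proof.
move=> fc; have [fC _ fk] := fc; apply: (csub_closed HB) => e e0.
have [|||m [mc me] Bm] := @ideal_approx R T kappa Hm B f e (csub_C0 HB) (csub0 HB)
  (csub_linear HB) _ _ fc _ e0.
- by move=> u w uc Bw; exact: csub_ideal.
- move=> u w Bu wc; rewrite -[tfun_mul u w]tfun_adjK tfun_mul_adj; apply: (csub_adj HB).
  by apply: csub_ideal; [exact: in_C0_adj|exact: (csub_adj HB)].
- move=> s; have [w Bw ws] := Brich s (alg_unit0P HS) (alg_unit0_kappa HS).
  exists w => //; rewrite ws; apply: (@alg_unit0_mul R T kappa HS (tfun_adj f) s).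
    exact: is_alg_adj (in_Cstar_alg Hm fC).
  by rewrite /tfun_adj fk adjmx0.
exists (f - m); first exact: Bm.
move=> x.
rewrite -[(f - m) x]/(f x - m x) addrAC subrr sub0r opnormN; exact: me.
Qed.

End StoneWeierstrass.

(** * The duality *)

Section Commutants.
Variable R : realType.
Local Notation C := R[i].

(** The quadratic form is purely imaginary; hence 1 + N is invertible. *)
Lemma lowb_skew n (N : 'M[C]_n) : N^t* = - N -> lowb 0 N.
Proof.
move=> h v; rewrite mul0r.
have : dotc v (N *m v) = - Num.conj (dotc v (N *m v)).
  by rewrite -dotc_conj dotc_adj h mulNmx -[- (N *m v)]scaleN1r dotcZr mulN1r opprK.
case: (dotc v _) => a b /eqP; rewrite eq_complex /= => /andP[/eqP e _].
by have -> : a = 0 by lra.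
Qed.

(* The Cayley transform [(1 - N) (1 + N)^-1]. *)
Lemma cayley_unitary n (N : 'M[C]_n) : N^t* = - N ->
  exists U, [/\ U \is unitarymx, (forall X, X *m N = N *m X -> X *m U = U *m X) &
    forall X, X *m U = U *m X -> X *m N = N *m X].
Proof.
move=> h; have Pu := lowb_unitmx (lowb_skew h).
have h' : (- N)^t* = - - N by rewrite adjmxN h.
have Mu := lowb_unitmx (lowb_skew h').
set P := 1%:M + N in Pu *; set M := 1%:M + - N in Mu.
have PMc : P *m M = M *m P.
  rewrite /P /M [LHS]mulmxDr [RHS]mulmxDr !mulmx1 mulmxN mulmxDl mulmxDl !mul1mx mulNmx.
  by rewrite opprD !addrA addrK subrK.
have Pt : P^t* = M by rewrite /P adjmxD adjmx1 h.
have Mt : M^t* = P by rewrite -Pt trmxCK.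
have commV (X Y : 'M[C]_n) : Y \in unitmx -> X *m Y = Y *m X -> X *m invmx Y = invmx Y *m X.
  move=> Yu XY; rewrite -[X *m invmx Y](mulKmx Yu) (mulmxA Y) -XY.
  by rewrite (mulmxK Yu).
pose U := M *m invmx P; exists U; split.
- apply: isometry_unitarymx; rewrite /U adjmxM Mt.
  have -> : (invmx P)^t* = invmx M.
    have e : (invmx P)^t* *m M = 1%:M by rewrite -Pt -adjmxM (mulmxV Pu) adjmx1.
    by rewrite -[LHS](mulmxK Mu) e mul1mx.
  by rewrite -mulmxA (mulmxA P) PMc -mulmxA (mulmxV Pu) mulmx1 (mulVmx Mu).
- move=> X XN; have XP : X *m P = P *m X by rewrite /P mulmxDr mulmxDl mulmx1 mul1mx XN.
  have XM : X *m M = M *m X by rewrite /M mulmxDr mulmxDl mulmx1 mul1mx mulmxN mulNmx XN.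
  by rewrite /U mulmxA XM -mulmxA (commV X P Pu XP) mulmxA.
move=> X XU.
(* The inverse of 1 + N is affine in the Cayley transform, so a matrix commuting with U commutes
   with it and therefore with N. *)
have VE : invmx P = 2^-1 *: (1%:M + U).
  have -> : 1%:M + U = (P + M) *m invmx P by rewrite mulmxDl (mulmxV Pu).
  have -> : P + M = 2%:M.
    by rewrite /P /M addrACA subrr addr0 -[RHS]scalemx1 scaler_nat.
  rewrite mul_scalar_mx scalerA mulVf ?scale1r//.
  by rewrite pnatr_eq0.
have XV : X *m invmx P = invmx P *m X.
  by rewrite VE -scalemxAr -scalemxAl mulmxDr mulmxDl mulmx1 mul1mx XU.
have iPu : invmx P \in unitmx by rewrite unitmx_inv.
have := commV X _ iPu XV; rewrite invmxK /P mulmxDr mulmxDl mulmx1 mul1mx.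
exact: addrI.
Qed.

Lemma skew_parts n (Z : 'M[C]_n) : exists N1 N2 : 'M[C]_n,
  [/\ N1 = Z - Z^t*, N2 = 'i%C *: (Z + Z^t*), N1^t* = - N1, N2^t* = - N2 &
  Z = 2^-1 *: (N1 - 'i%C *: N2)].
Proof.
exists (Z - Z^t*), ('i%C *: (Z + Z^t*)); split=> //.
- by rewrite adjmxD adjmxN trmxCK opprB.
- rewrite adjmxZ adjmxD trmxCK.
  have -> : Num.conj 'i%C = - 'i%C :> C by apply/eqP; rewrite eq_complex /= oppr0 !eqxx.
  by rewrite scaleNr (addrC Z).
rewrite scalerA.
have -> : 'i%C * 'i%C = -1 :> C by apply/eqP; rewrite eq_complex /=; apply/andP; split; apply/eqP; ring.
rewrite scaleN1r opprK addrACA (addrC (- _)) subrr addr0 -mulr2n -[Z *+ 2]scaler_nat scalerA mulVf ?scale1r//.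
by rewrite pnatr_eq0.
Qed.

End Commutants.

(** * Surjectivity of J *)

Section GelfandSurjective.
Variables (R : realType) (A : starAlgData R).
Hypotheses (HA : is_cstar_algebra A) (Hs : is_shrinking A).
Local Notation C := R[i].
Local Notation Z := (fdrep A).
Local Notation ZT := (fdrep_tower A).
Let Hm : is_mtower ZT := fdrep_is_mtower HA.
Implicit Types (p q t s : ZT) (a b : A).

Lemma alg_unitary_comm f s (U : 'M[C]_(deg s)) : is_alg f -> U \is unitarymx ->
  (forall a, U *m rep_fun (s : Z) a = rep_fun (s : Z) a *m U) -> f s *m U = U *m f s.
Proof.
move=> [fa _] Uu h; have e : act U s = s.
  by apply: (iffRL (stab_commutes erefl Uu)) => a; rewrite matK.
have := fa s U Uu; rewrite e => /pad_inj{1}->.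
by rewrite matK -mulmxA (mulVmx (unitarymx_unit Uu)) mulmx1.
Qed.

(** X is a combination of two skew-adjoint elements of the commutant of the representation. The
    Cayley transform replaces each by a unitary with the same commutant; this unitary stabilizes s,
    so equivariance of f applies. *)
Lemma alg_comm f s (X : 'M[C]_(deg s)) : is_alg f ->
  (forall a, X *m rep_fun (s : Z) a = rep_fun (s : Z) a *m X) -> f s *m X = X *m f s.
Proof.
move=> fa h; have skew N : N^t* = - N ->
    (forall a, N *m rep_fun (s : Z) a = rep_fun (s : Z) a *m N) -> f s *m N = N *m f s.
  move=> Nt Nc; have [U [Uu hU hV]] := cayley_unitary Nt.
  by apply: hV; apply: alg_unitary_comm fa Uu _ => a; rewrite (hU _ (esym (Nc a))).
have ht a : X^t* *m rep_fun (s : Z) a = rep_fun (s : Z) a *m X^t*.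
  have := congr1 (fun M => M^t*) (h (sa_adj a)); rewrite !adjmxM rep_adjE.
  by rewrite !trmxCK => ->.
have [N1 [N2 [e1 e2 n1 n2 ->]]] := skew_parts X.
have c1 : f s *m N1 = N1 *m f s.
  by apply: skew n1 _ => a; rewrite e1 mulmxBl mulmxBr h ht.
have c2 : f s *m N2 = N2 *m f s.
  by apply: skew n2 _ => a; rewrite e2 -scalemxAl -scalemxAr mulmxDl mulmxDr h ht.
by rewrite -scalemxAr -scalemxAl mulmxBr mulmxBl -scalemxAr -scalemxAl c1 c2.
Qed.

(* An intertwiner is an off-diagonal element of the commutant of [p (+) s]. *)
Lemma alg_intertwiner f p s (X : 'M[C]_(deg s, deg p)) : is_alg f -> isometric X ->
  intertwines (rep_fun (p : Z)) (rep_fun (s : Z)) X -> f s *m X = X *m f p.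
Proof.
move=> fa X1 hX; have hX' := intertwines_adj (rep_funP (p : Z)) (rep_funP (s : Z)) hX.
pose W : 'M[C]_(deg p + deg s) := block_mx 0 (X^t*) X 0.
have [_ fs] := fa; have h := fs p s.
have Wc a : W *m rep_fun (oplus p s : Z) a = rep_fun (oplus p s : Z) a *m W.
  rewrite rep_fun_mk /dsum_mx /W !mulmx_block !mulmx0 !mul0mx !addr0 !add0r.
  by rewrite hX hX'.
have := @alg_comm f (oplus p s) W fa Wc.
have -> : f (oplus p s) = dsum_mx (f p) (f s).
  by apply: (@pad_inj _ (deg p + deg s)); rewrite h pad_dsum.
rewrite /dsum_mx /W !mulmx_block !mulmx0 !mul0mx !addr0 !add0r.
by move=> /eq_block_mx[_ _ -> _].
Qed.

Lemma alg_zero_rep f p : is_alg f -> f (zero_rep A : ZT) = 0 ->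
  (forall a, rep_fun (p : Z) a = 0) -> f p = 0.
Proof.
move=> fa f0 pz; apply: (is_alg_eq0 Hm fa) => t tc /(tsub_intertwines HA)[X [X1 hX]].
have [->//|tn] := pselect (t = zero_rep A).
have [[a ha] _] := core_irreducible HA tc tn; case/eqP: ha.
by rewrite -[LHS]mul1mx -X1 -mulmxA -hX pz mul0mx mulmx0.
Qed.

Lemma gelfand_rich f s : is_alg f -> f (zero_rep A : ZT) = 0 ->
  exists a, gelfand a s = f s.
Proof.
move=> fa f0; have sr := rep_funP (s : Z).
pose S (X : 'M[C]_(deg s)) := exists a, X = rep_fun (s : Z) a.
have Ss : star_closed S.
  split.
  - by exists 0; rewrite (rep0 sr).
  - by move=> c X Y [a ->] [b ->]; exists (c *: a + b); rewrite rep_linearE.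
  - by move=> X Y [a ->] [b ->]; exists (sa_mul a b); rewrite rep_mulE.
  - by move=> X [a ->]; exists (sa_adj a); rewrite rep_adjE.
have [e [Se eh eS Sb]] := star_closed_unit Ss.
have [X XS|a ha] := Sb (f s).
  by apply: alg_comm fa _ => a; apply: XS; exists a.
exists a; rewrite /gelfand -ha; set E := 1%:M - e.
(* The range of E = 1 - e carries a zero representation, embedded isometrically in s; there f is
   determined by its value at the zero representation of degree one, which is 0. *)
suff fE : f s *m E = 0.
  by apply/esym/eqP; rewrite -subr_eq0 -[X in X - _]mulmx1 -mulmxBr fE.
have sE b : rep_fun (s : Z) b *m E = 0.
  have [|h _] := eS (rep_fun (s : Z) b); first by exists b.
  by rewrite /E mulmxBr mulmx1 h subrr.
have [k [V [V1 VE]]] := row_space_isometry E^T.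
have /submxP[D ED] : (E^T <= V^T)%MS by rewrite VE.
have /submxP[D' VD] : (V^T <= E^T)%MS by rewrite VE.
have {}ED : E = V *m D^T by rewrite -[E]trmxK ED trmx_mul trmxK.
have {}VD : V = E *m D'^T by rewrite -[V]trmxK VD trmx_mul trmxK.
have [k0|k0] := posnP k.
  by move: V D V1 VE ED D' VD; rewrite k0 => V D _ _ -> _ _; rewrite thinmx0 mul0mx mulmx0.
have zr : is_rep ((fun=> 0) : A -> 'M[C]_k).
  split=> [c b b'|b b'|b]; first by rewrite scaler0 addr0.
    by rewrite mulmx0.
  by rewrite adjmx0.
pose p : ZT := mk_fdrep k0 zr.
have pz b : rep_fun (p : Z) b = 0 by rewrite rep_fun_mk.
have hV : intertwines (rep_fun (p : Z)) (rep_fun (s : Z)) (V : 'M[C]_(deg s, deg p)).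
  by move=> b; rewrite pz mulmx0 VD mulmxA sE mul0mx.
have fV : f s *m V = V *m f p by exact: (@alg_intertwiner f p s V fa V1 hV).
by rewrite ED mulmxA fV (alg_zero_rep fa f0 pz) mulmx0 mul0mx.
Qed.

Lemma gelfand_opnorm a (c : R) : 0 <= c -> (forall p, opnorm (gelfand a p) <= c) -> nrm a <= c.
Proof. exact: rep_isometric HA (sh_separates Hs) a c. Qed.

Lemma gelfandB a b p : gelfand (a - b) p = gelfand a p - gelfand b p.
Proof. exact: repB (rep_funP (p : Z)). Qed.

(** Closedness combines two facts: the map is isometric, so uniform approximants come from a Cauchy
    sequence in A, and A is complete. *)
Lemma gelfand_closed : closed_subalgebra (zero_rep A : ZT) (fun f => exists a, f = gelfand a).
Proof.
split.
- by move=> u [a ->]; exact: gelfand_C0.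
- by exists 0; apply: functional_extensionality_dep => p; rewrite /gelfand (rep0 (rep_funP (p : Z))).
- move=> c u w [a ->] [b ->]; exists (c *: a + b); apply: functional_extensionality_dep => p.
  by rewrite /gelfand rep_linearE.
- move=> u w [a ->] [b ->]; exists (sa_mul a b); apply: functional_extensionality_dep => p.
  by rewrite /gelfand rep_mulE.
- move=> u [a ->]; exists (sa_adj a); apply: functional_extensionality_dep => p.
  by rewrite /gelfand rep_adjE.
move=> f hf.
have hn n : exists a, forall p, opnorm (gelfand a p - f p) <= n.+1%:R^-1.
  have [|u [a ->] h] := hf n.+1%:R^-1; first by rewrite invr_gt0.
  by exists a.
have [u hu] := choice hn.
have small (e : R) : 0 < e -> exists N, forall n, (N <= n)%N -> n.+1%:R^-1 <= e.
  move=> e0; exists (Num.bound e^-1) => n hn'.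
  rewrite -[leRHS]invrK lef_pV2 ?posrE ?invr_gt0//; apply: ltW.
  apply: lt_le_trans (archi_boundP _) _; first by rewrite invr_ge0 ltW.
  by rewrite ler_nat leqW.
have [e e0|l hl] := cauchy_converges HA (u := u).
  have [|N hN] := small (e / 2); first by rewrite divr_gt0.
  exists N => n Nn; apply: gelfand_opnorm; first exact: ltW.
  move=> p; rewrite gelfandB.
  have -> : gelfand (u n) p - gelfand (u N) p = (gelfand (u n) p - f p) - (gelfand (u N) p - f p).
    by rewrite opprB addrA subrK.
  apply: le_trans (opnormD _ _) _; rewrite opnormN [e]splitr.
  by apply: lerD; [exact: le_trans (hu n p) (hN n Nn)|exact: le_trans (hu N p) (hN N (leqnn N))].
exists l; apply: functional_extensionality_dep => p; apply/esym/eqP; rewrite -subr_eq0; apply/eqP.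
apply: opnorm_small => e e0; have e2 : 0 < e / 2 by rewrite divr_gt0.
have [N hN] := hl _ e2; have [M hM] := small _ e2; pose n := maxn N M.
have -> : gelfand l p - f p = (gelfand (u n) p - f p) - gelfand (u n - l) p.
  by rewrite gelfandB opprB [RHS]addrC addrA subrK.
apply: le_trans (opnormD _ _) _; rewrite opnormN [e]splitr; apply: lerD.
  exact: le_trans (hu n p) (hM n (leq_maxr N M)).
exact: le_trans (rep_contractive HA _ (rep_funP (p : Z))) (hN n (leq_maxl N M)).
Qed.

Lemma gelfand_surjective f : in_C0 (zero_rep A : ZT) f -> exists a, f = gelfand a.
Proof.
apply: (stone_weierstrass (fdrep_solid HA Hs) gelfand_closed) => g s ga g0.
by have [a <-] := gelfand_rich s ga g0; exists (gelfand a) => //; exists a.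
Qed.

Lemma gelfand_injective a b : (forall p, gelfand a p = gelfand b p) -> a = b.
Proof.
move=> h; apply: contrapT => /(sh_separates Hs)[p]; apply.
exact: h.
Qed.

Definition gelfand_map a : C0 (zero_rep A : ZT) := mkC0 (gelfand_C0 HA Hs a).

Lemma gelfand_mapE a p : C0val (gelfand_map a) p = rep_fun (p : Z) a.
Proof. by []. Qed.

Lemma gelfand_isomorphism : star_isomorphism gelfand_map.
Proof.
split.
- by move=> c a b; apply: C0_ext => p; rewrite gelfand_mapE rep_linearE.
- by move=> a b; apply: C0_ext => p; rewrite gelfand_mapE rep_mulE.
- by move=> a; apply: C0_ext => p; rewrite gelfand_mapE rep_adjE.
have inj : injective gelfand_map.
  move=> a b e; apply: gelfand_injective => p.
  exact: (congr1 (fun u => C0val u p) e).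
have surj u : exists a, gelfand_map a = u.
  have [a ha] := gelfand_surjective (C0funP u); exists a.
  by apply: C0_ext => p; rewrite ha.
have [J hJ] := choice surj.
by exists J => [a|u]; [apply: inj; exact: hJ|exact: hJ].
Qed.

End GelfandSurjective.

(** * The tower recovered from its function algebra *)

Section SolidDual.
Variables (R : realType) (T : towerData R) (kappa : T).
Hypothesis HS : is_solid kappa.
Let Hm := solid_mtower HS.
Let Hp := solid_proper HS.
Let HT := mtower_tower Hm.
Local Notation C := R[i].
Local Notation D := (C0 kappa).
Local Notation Z := (fdrep D).
Local Notation ZT := (fdrep_tower D).
Let HD : is_cstar_algebra D := C0_cstar_algebra kappa.
Implicit Types (x y s : T) (u v : D).

Lemma eval_repE x u : rep_fun (eval_rep kappa x) u = C0val u x.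
Proof. by []. Qed.

Lemma eval_rep_act x (U : 'M[C]_(deg x)) : U \is unitarymx ->
  eval_rep kappa (act U x) = act U (eval_rep kappa x : ZT).
Proof.
move=> Uu; apply: fdrep_eq => [|u].
  by rewrite rep_deg_conj; exact: (deg_actE HT erefl Uu).
rewrite (pad_conj_rep (p := eval_rep kappa x) _ erefl Uu) !eval_repE.
by have [h _] := C0val_alg HS u; exact: h.
Qed.

Lemma eval_rep_oplus x y :
  eval_rep kappa (oplus x y) = oplus (eval_rep kappa x : ZT) (eval_rep kappa y).
Proof.
apply: fdrep_eq => [|u]; first by rewrite rep_deg_sum; exact: (deg_oplus HT).
by rewrite pad_sum_rep !eval_repE; have [_ h] := C0val_alg HS u; exact: h.
Qed.

Lemma eval_rep_point : eval_rep kappa kappa = zero_rep D.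
Proof.
have dk := solid_point HS; apply: fdrep_eq => [//|u].
have [_ _ uk] := C0funP u.
by rewrite eval_repE uk rep_fun_mk !pad0.
Qed.

Lemma irreducible_eval_core s : irreducible_rep (eval_rep kappa s) -> core T s.
Proof.
move=> /(irreducible_core HD) sc [U [Uu [a [b e]]]].
apply: sc; exists U; split=> //; exists (eval_rep kappa a), (eval_rep kappa b).
by rewrite -eval_rep_act// e eval_rep_oplus.
Qed.

(** Irreducible representations are evaluations at core points. A compact set meets only finitely
    many degrees, so core points of large degree lie where u is small. *)
Lemma C0_shrinking : is_shrinking D.
Proof.
split=> [u v uv|p pI pd u].
  apply: contrapT => h; apply: uv; apply: C0_ext => x.
  by apply: contrapT => hx; apply: h; exists (eval_rep kappa x).
have [s hs] := choice (fun k => eval_rep_surj HS (p k)).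
have sc k : core T (s k) by apply: irreducible_eval_core; rewrite -hs.
apply: cvg_normP => e e0; have e2 : 0 < e / 2 by rewrite divr_gt0.
have [_ uv _] := C0funP u; have [K [cK Ksub uK]] := uv _ e2.
have [N KN] := compact_bounded_deg HS cK.
have /cvgnyPge/(_ N.+1) := pd; apply: filterS => k.
rewrite subr0 ger0_norm ?opnorm_ge0// hs eval_repE => dk.
apply: (@le_lt_trans _ _ (e / 2)); last by rewrite ltr_pdivrMr// ltr_pMr// ltr1n.
apply: uK; split; first exact: subset_closure.
by move=> /KN; rewrite leqNgt; apply/negP; rewrite negbK.
Qed.

Lemma eval_rep_continuous : continuous (eval_rep kappa : T -> Z).
Proof.
move=> x; apply: (@rep_cvgE R D (deg x)) => [//||u].
  by apply: open_nbhs_nbhs; split=> //; exact: (open_layer Hm (deg x)).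
have [uC _ _] := C0funP u.
apply/cvg_opnormP => e e0; have := near_value HS uC (erefl (deg x)) e0.
by apply: filterS => y [dy]; rewrite /rep_ev !eval_repE !mat_pad_conform.
Qed.

(** For continuity of the inverse: each layer is compact and the target is Hausdorff, so the image
    of the part of a layer outside an open set is closed, and layers are open in the target. *)
Lemma eval_rep_homeomorphism : homeomorphism (eval_rep kappa : T -> Z).
Proof.
split; first exact: eval_rep_continuous.
have [g hg] := choice (eval_rep_surj HS).
have gK : cancel g (eval_rep kappa) by move=> p; rewrite -hg.
have vK : cancel (eval_rep kappa) g by move=> x; apply: (eval_rep_inj HS); rewrite gK.
exists g; split=> // p.
move=> O; rewrite nbhsE => -[V [oV gV] VO].
pose K := layer T (rep_deg p) `&` ~` V.
have cK : compact K by apply: compact_closedI; [exact: Hp|exact: open_closedC].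
have clK : closed (eval_rep kappa @` K : set Z).
  apply: compact_closed; first exact: rep_hausdorff.
  apply: continuous_compact cK; apply: continuous_subspaceT; exact: eval_rep_continuous.
have np : (~` (eval_rep kappa @` K : set Z)) p.
  by move=> [x [_ nVx] e]; apply: nVx; rewrite -[x]vK e.
have nb : nbhs p ([set q : Z | rep_deg q = rep_deg p] `&` ~` (eval_rep kappa @` K : set Z)).
  apply: filterI; first exact: rep_deg_near.
  by apply: open_nbhs_nbhs; split=> //; exact: closed_openC.
apply: filterS nb => q [dq nq]; apply: VO; apply: contrapT => nV; apply: nq.
exists (g q); last exact: gK.
split=> //; rewrite -[layer _ _ _]/(deg (g q) = rep_deg p) -dq.
by rewrite -[in RHS](gK q).
Qed.

Lemma eval_rep_pointed_iso :
  pointed_iso kappa (zero_rep D : ZT) (eval_rep kappa : T -> ZT).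
Proof.
split=> //.
- exact: eval_rep_homeomorphism.
- exact: eval_rep_act.
- exact: eval_rep_oplus.
- exact: eval_rep_point.
Qed.

End SolidDual.

Theorem theorem6p5 (R : realType) :
  (forall A : starAlgData R, is_cstar_algebra A -> is_shrinking A ->
    is_solid (zero_rep A : fdrep_tower A) /\
    exists J : A -> C0 (zero_rep A : fdrep_tower A),
      (forall (a : A) (pi : fdrep_tower A), C0_eval pi (J a) = rep_fun pi a) /\
      star_isomorphism J)
  /\
  (forall (S : towerData R) (kappa : S), is_solid kappa ->
    [/\ is_cstar_algebra (C0 kappa),
        is_shrinking (C0 kappa),
        forall pi : fdrep (C0 kappa), exists! s : S, pi = eval_rep kappa s
      & pointed_iso kappa (zero_rep (C0 kappa) : fdrep_tower (C0 kappa))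
          (eval_rep kappa : S -> fdrep_tower (C0 kappa))]).
Proof.
split=> [A HA Hs|S kappa HS].
  split; first exact: fdrep_solid.
  by exists (gelfand_map HA Hs); split=> [a p|]; [|exact: gelfand_isomorphism].
split.
- exact: C0_cstar_algebra.
- exact: C0_shrinking.
- move=> p; have [s ps] := eval_rep_surj HS p; exists s; split=> // s' ps'.
  by apply: (eval_rep_inj HS); rewrite -ps.
- exact: eval_rep_pointed_iso.
Qed.
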